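(* Let $h>0$ and $\phi:\mathbb{R}\to[0,\infty)$, and write $\Phi(r)=\phi(r)+\phi(-r)$. Consider the limit equation $$U_t=U_0-\sum_{o \in \{-1,+1\}}\int_0^t \int_0^{\infty} U_{s-}\mathbf{1}\{z \leq \phi(oU_{s-})\}\mathbf{N}^o(ds,dz)+h\sum_{o\in \{-1,+1\}}o \int_0^t \mathbb{E}[\phi(oU_{s})]ds.$$ Consider the hypotheses (A) $\Phi(r)>0$ for all $r>0$; (B) for every $\lambda>0$, $\int_0^\infty \exp\big(-\lambda\int_0^s\Phi(r)dr\big)ds<\infty$; (C) $\phi(x)=f(x)+B$ for all $x\in\mathbb{R}$, where $B>0$ and $f$ is an odd $\mathcal{C}^1$ function with $f(0)=0$, $f(x)\le B$ and $f'(x)>0$ for all $x\in\mathbb{R}$, and $f'$ strictly decreasing on $[0,\infty)$. 1. Under (A), $\delta_0$ is an invariant probability measure of the limit equation. 2. Under (A) and (B), any invariant probability measure of the limit equation different from $\delta_0$ has support either in $\mathbb{R}^+$ or in $\mathbb{R}^-$. 3. Under (A) and (B), any invariant probability measure of the limit equation different from $\delta_0$ with support in $\mathbb{R}^+$ has the form $g(dx)=g_\gamma(x)dx$ with $$g_\gamma(x)=\exp\Big(-\frac{1}{\gamma h}\int_0^x\Phi(s)ds\Big)\Big/\int_0^\infty\exp\Big(-\frac{1}{\gamma h}\int_0^t\Phi(s)ds\Big)dt,\quad x\ge 0,$$ where $\gamma>0$ satisfies $\int_0^\infty(\phi(x)-\phi(-x))g_\gamma(dx)=\gamma$ and $\int_0^\infty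 g_\gamma(dx)=1$. 4. Under (A) and (B), $g(dx)=g(x)dx$ is an invariant probability measure of the limit equation with support in $\mathbb{R}^+$ if and only if $\tilde g(dx)=\tilde g(x)dx$, with $\tilde g(x)=g(-x)$, is an invariant probability measure of the limit equation with support in $\mathbb{R}^-$. 5. Under (C): if $h\le B/f'(0)$, then $\delta_0$ is the unique invariant probability measure of the limit equation; if $h>B/f'(0)$, the limit equation has three invariant probability measures: $\delta_0$, one supported in $\mathbb{R}^+$ and one supported in $\mathbb{R}^-$.
   Context: $\mathbf{N}^{+1},\mathbf{N}^{-1}$ are independent Poisson random measures on $\mathbb{R}^+\times\mathbb{R}^+$ with intensity $ds\,dz$, independent of $U_0$. A probability measure $g$ on $\mathbb{R}$ is an invariant probability measure of the limit equation if, when $U_0\sim g$, the solution satisfies $U_t\sim g$ for all $t\ge 0$ (so that in particular $\mathbb{E}[\phi(oU_t)]=\int\phi(ox)g(dx)$ for all $t$). $\delta_0$ is the Dirac mass at $0$. *)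

(* Defs.v *)
From HB Require Import structures.
From mathcomp Require Import all_boot all_order all_algebra.
From mathcomp Require Import all_classical all_reals all_analysis.
From mathcomp Require Import measurable_realfun.
Set Implicit Arguments. Unset Strict Implicit. Unset Printing Implicit Defensive.
Import Order.TTheory GRing.Theory Num.Theory.
Import numFieldNormedType.Exports.
Local Open Scope classical_set_scope.
Local Open Scope ring_scope.

Section defs.
Context {R : realType}.

Definition leb := (@lebesgue_measure R).
Definition leb2 := (leb \x leb)%E.

Definition quadrant : set (R * R) := `[0, +oo[ `*` `[0, +oo[.

(* Poisson pmf, correct also for rate 0 *)
Definition pois (r : R) (k : nat) : R := expR (- r) * r ^+ k / k`!%:R.

Definition Phi (phi : R -> R) (r : R) : R := phi r + phi (- r).

Definition Psi (phi : R -> R) (x : R) : \bar R :=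
  (\int[leb]_(r in `[0%R, x]) (Phi phi r)%:E)%E.

Definition hypA (phi : R -> R) : Prop := forall r, 0 < r -> 0 < Phi phi r.

Definition hypB (phi : R -> R) : Prop :=
  forall lam : R, 0 < lam ->
    (\int[leb]_(s in `[0%R, +oo[) expeR (- (lam%:E * Psi phi s)) < +oo)%E.

(* The joint law of (N^{+1}, N^{-1}, U_0): N^{+1}, N^{-1} are Poisson random
   measures on R+ x R+ with intensity ds dz, and N^{+1}, N^{-1}, U_0 are
   independent, U_0 having law g.  Expressed through the joint law of the
   counts on finite families of pairwise disjoint sets of finite intensity. *)
Definition PRM_indep {d} {T : measurableType d} (P : probability T R)
    (Np Nm : T -> {measure set (R * R) -> \bar R}) (U0 : T -> R)
    (g : set R -> \bar R) : Prop :=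
  (forall A, measurable A -> measurable_fun [set: T] (fun w => Np w A)) /\
  (forall A, measurable A -> measurable_fun [set: T] (fun w => Nm w A)) /\
  measurable_fun [set: T] U0 /\
  forall (n m : nat) (A : nat -> set (R * R)) (k : nat -> nat)
         (B : nat -> set (R * R)) (l : nat -> nat) (C : set R),
    (forall i, (i < n)%N ->
       [/\ measurable (A i), A i `<=` quadrant & (leb2 (A i) < +oo)%E]) ->
    (forall i j, (i < n)%N -> (j < n)%N -> i <> j -> A i `&` A j = set0) ->
    (forall i, (i < m)%N ->
       [/\ measurable (B i), B i `<=` quadrant & (leb2 (B i) < +oo)%E]) ->
    (forall i j, (i < m)%N -> (j < m)%N -> i <> j -> B i `&` B j = set0) ->
    measurable C ->
    P ((\bigcap_(i in `I_n) [set w | Np w (A i) = (k i)%:R%:E])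
       `&` (\bigcap_(i in `I_m) [set w | Nm w (B i) = (l i)%:R%:E])
       `&` (U0 @^-1` C))
    = (\prod_(i < n) (pois (fine (leb2 (A i))) (k i))%:E
       * \prod_(i < m) (pois (fine (leb2 (B i))) (l i))%:E * g C)%E.

Definition left_lim (u : R -> R) (s : R) : R := lim (u x @[x --> s^'-]).

Definition Nsel {T : Type} (Np Nm : T -> {measure set (R * R) -> \bar R})
  (o : R) (w : T) : {measure set (R * R) -> \bar R} :=
  if o == 1 then Np w else Nm w.

Definition drift {d} {T : measurableType d} (P : probability T R)
    (phi : R -> R) (U : R -> T -> R) (s : R) : R :=
  \sum_(o <- [:: -1; 1]) o * fine (\int[P]_w (phi (o * U s w))%:E)%E.

Definition solves {d} {T : measurableType d} (P : probability T R)
    (Np Nm : T -> {measure set (R * R) -> \bar R}) (U : R -> T -> R)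
    (h : R) (phi : R -> R) : Prop :=
  (forall t, measurable_fun [set: T] (U t)) /\
  (forall w t, 0 <= t -> (fun s => U s w) @ t^'+ --> U t w) /\
  (forall w t, 0 < t -> cvg ((fun s => U s w) @ t^'-)) /\
  (forall s o, 0 <= s -> (o = 1 \/ o = -1) ->
     P.-integrable setT (fun w => (phi (o * U s w))%:E)) /\
  (forall t, 0 <= t -> leb.-integrable `[0, t] (fun s => (drift P phi U s)%:E)) /\
  {ae P, forall w, forall t, 0 <= t ->
     (forall o, (o = 1 \/ o = -1) ->
        (Nsel Np Nm o w).-integrable (`]0%R, t] `*` `[0%R, +oo[)
          (fun p => (left_lim (fun s => U s w) p.1 *
             ((p.2 <= phi (o * left_lim (fun s => U s w) p.1))%R : bool)%:R)%:E)) /\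
     ((U t w)%:E =
       (U 0 w)%:E
       - \sum_(o <- [:: (-1)%R; 1%R] : seq R)
           \int[Nsel Np Nm o w]_(p in `]0%R, t] `*` `[0%R, +oo[)
              (left_lim (fun s => U s w) p.1 *
               ((p.2 <= phi (o * left_lim (fun s => U s w) p.1))%R : bool)%:R)%:E
       + h%:E * \int[leb]_(s in `[0%R, t]) (drift P phi U s)%:E)%E}.

Definition is_invariant (h : R) (phi : R -> R) (g : set R -> \bar R) : Prop :=
  exists (d : measure_display) (T : measurableType d) (P : probability T R)
         (Np Nm : T -> {measure set (R * R) -> \bar R}) (U : R -> T -> R),
    [/\ PRM_indep P Np Nm (U 0) g, solves P Np Nm U h phi &
        forall t, 0 <= t -> forall A, measurable A -> P (U t @^-1` A) = g A].

Definition eqm (g1 g2 : set R -> \bar R) : Prop :=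
  forall A, measurable A -> g1 A = g2 A.

Definition delta0 : set R -> \bar R := \d_(0 : R).

Definition supp_pos (g : set R -> \bar R) : Prop := g `]-oo, 0%R[%classic = 0%E.
Definition supp_neg (g : set R -> \bar R) : Prop := g `]0%R, +oo[%classic = 0%E.

Definition Zgam (h : R) (phi : R -> R) (gam : R) : \bar R :=
  (\int[leb]_(t in `[0%R, +oo[) expeR (- (Psi phi t * ((gam * h)^-1)%:E)))%E.

Definition ggam (h : R) (phi : R -> R) (gam : R) (x : R) : \bar R :=
  (if (0 <= x)%R then
     expeR (- (Psi phi x * ((gam * h)^-1)%:E)) * ((fine (Zgam h phi gam))^-1)%:E
   else 0)%E.

End defs.

(* Main.v *)
Require Import Defs.
From HB Require Import structures.
From mathcomp Require Import all_boot all_order all_algebra.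
From mathcomp Require Import all_classical all_reals all_analysis.
From mathcomp Require Import measurable_realfun.
From mathcomp Require Import ring lra.
Import Order.TTheory GRing.Theory Num.Theory.
Import numFieldNormedType.Exports.
Local Open Scope classical_set_scope.
Local Open Scope ring_scope.


(* Between jumps an invariant law is transported with the constant speed
   c = h E[phi(U) - phi(-U)], and paths are killed to 0 at rate Phi; a particle
   is at y > 0 at a large time t exactly when it was reset to 0 at time t - y/c
   and survived.  If c = 0 nothing leaves 0, so the law is a Dirac mass; if
   c > 0 the shift identity for times without a zero of the path forces
   the density g_gamma with c = h gamma, and c < 0 follows by reflection.
   Under (C), Phi is the constant 2B, so a nonzero invariant law on the positive
   half-line is exponential of some mean m solving E[f(m Y)] = (B/h) m with Y
   standard exponential; by strict concavity of f this has exactly one positive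
   root when h f'(0) > B and none otherwise.  Conversely the exponential law is
   invariant: the path driven by two Poisson measures is the limit of a
   discretised chain in which each step kills with the current rate, and the
   tails of the chain are computed from the independence of Poisson counts on
   disjoint strips.  The driving measures are built from uniform points, by a
   Poisson number of points in each unit square. *)

(** The Poisson hypothesis speaks of counts in fixed disjoint sets, whereas the region that kills a
    particle depends on its random position. The bridge is the law of the event that a random
    section [xsection S (V w)] holds no point: it is proved for sections taking countably many
    values and extended by monotone classes. The extension works because counts are integers, hence
    eventually constant along monotone sequences. In the general statements [phi] is only measurable
    and nonnegative, so integrated rates may be infinite and nothing bounds the number of resets in
    a bounded time. Survival probabilities are therefore extended exponentials, the comparison with
    the candidate density is cross-multiplied so as never to divide by a density that may vanish,
    and the absence of mass at 0 for a nonzero speed is obtained by counting zeros of the path on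
    finer and finer time grids. Under (C) the rate is bounded, paths are built event by event, and
    the approximating chain overestimates the rates so that it stays below the path. *)

Lemma measurable_pickle2 {d} {X : measurableType d} (i j : X -> nat) :
  measurable_fun setT i -> measurable_fun setT j ->
  measurable_fun setT (fun x => pickle (i x, j x)).
Proof.
move=> mi mj _ k mk; rewrite setTI.
have -> : (fun x => pickle (i x, j x)) @^-1` k =
    \bigcup_a \bigcup_b ((i @^-1` [set a] `&` j @^-1` [set b]) `&`
      [set _ | k (pickle (a, b))]).
  apply/seteqP; split => [x /= kx|x [a _ [b _ [[/= <- <-]]]] //].
  by exists (i x) => //; exists (j x).
apply: bigcupT_measurable => a; apply: bigcupT_measurable => b.
apply: measurableI; last first.
  have [h|h] := pselect (k (pickle (a, b))).
    by rewrite (_ : [set _ | _] = setT)//; apply/seteqP; split.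
  by rewrite (_ : [set _ | _] = set0)//; apply/seteqP; split.
by apply: measurableI; rewrite -[X in measurable X]setTI; [exact: mi|exact: mj].
Qed.

(** * Product sets with countably many sections, and the monotone class they generate *)

Section step_sets.
Context {d1 d2} {X : measurableType d1} {Y : measurableType d2}.

(** The section over a state is one of countably many fixed sets. An event about the section at a
    random state thus splits into countably many events about fixed sets, each covered by the
    Poisson hypothesis. *)
Definition step_set (i : X -> nat) (D : nat -> set Y) : set (X * Y) :=
  [set p | D (i p.1) p.2].

Definition step_sets : set (set (X * Y)) :=
  [set S | exists2 i, measurable_fun setT i &
     exists2 D, (forall k, measurable (D k)) & S = step_set i D].

Lemma measurable_step_sets : step_sets `<=` measurable.
Proof.
move=> _ [i mi [D mD ->]].
rewrite (_ : step_set i D = \bigcup_k ((i @^-1` [set k]) `*` D k)).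
  apply: bigcupT_measurable => k; apply: measurableX => //.
  by rewrite -[X in measurable X]setTI; exact: mi.
by apply/seteqP; split => -[x y] /=; [exists (i x)|move=> [k _ [/= <-]]].
Qed.

(** Two labels are merged by coding the pair, which makes any sectionwise operation a function of
    one label. Codes that decode to no pair never occur as labels and receive the empty set. *)
Lemma step_sets_op (op : set (X * Y) -> set (X * Y) -> set (X * Y))
    (opY : set Y -> set Y -> set Y) :
  (forall A B, measurable A -> measurable B -> measurable (opY A B)) ->
  (forall S S' p, op S S' p =
     opY [set y | S (p.1, y)] [set y | S' (p.1, y)] p.2) ->
  forall S S', step_sets S -> step_sets S' -> step_sets (op S S').
Proof.
move=> mop opE S S' [i mi [D mD ->]] [i' mi' [D' mD' ->]].
exists (fun x => pickle (i x, i' x)); first exact: measurable_pickle2.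
exists (fun k => if unpickle k is Some ab then opY (D ab.1) (D' ab.2) else set0).
  by move=> k; case: unpickle => // -[a b]; exact: mop.
by apply/funext => p; rewrite opE /step_set /= pickleK.
Qed.

Lemma step_setsX (A : set X) (B : set Y) :
  measurable A -> measurable B -> step_sets (A `*` B).
Proof.
move=> mA mB; exists (fun x => if x \in A then 1%N else 0%N).
  apply: measurable_fun_ifT => //; apply: (measurable_fun_bool true).
  rewrite setTI (_ : _ @^-1` _ = A)//.
  by apply/seteqP; split => x /= => [/set_mem//|/mem_set ->].
exists (fun k => if k is 1%N then B else set0); first by case=> [|[]].
apply/seteqP; split => -[x y] /=; rewrite /step_set/=.
  by move=> [Ax By]; rewrite (mem_set Ax).
by case: ifPn => [/set_mem|].
Qed.

Lemma step_sets_ring : setring step_sets.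
Proof.
split.
- rewrite (_ : set0 = setT `*` set0); last by rewrite setX0.
  exact: step_setsX.
- by apply: (step_sets_op setU setU) => //; [exact: measurableU|move=> S S' [x y]].
- by apply: (step_sets_op setD setD) => //; [exact: measurableD|move=> S S' [x y]].
Qed.

(* A halving of the monotone class theorem: the generating ring consists of the
   sets whose section over [x] depends on [x] through a countable label. *)
Lemma monotone_step_sets (Q : set (set (X * Y))) :
  monotone Q -> step_sets `<=` Q -> measurable `<=` Q.
Proof.
move=> mQ sQ; apply: subset_trans (monotone_setring_sub_g_sigma_ring mQ step_sets_ring sQ).
rewrite measurable_prod_measurableType; apply: smallest_sub.
  have [r0 rD rU] := smallest_sigma_ring step_sets.
  split => // A sA; apply: rD => //; apply: sub_g_sigma_ring.
  by rewrite -setXTT; exact: step_setsX.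
by move=> _ [A mA [B mB <-]]; apply: sub_g_sigma_ring; exact: step_setsX.
Qed.

End step_sets.

(** * Integer-valued measures on the plane *)

Section counting.
Context {R : realType}.
Implicit Types (m : {measure set (R * R) -> \bar R}) (Q B : set (R * R)).

Definition isnat (x : \bar R) : Prop := exists k : nat, x = k%:R%:E.

Definition counting_on (m : set (R * R) -> \bar R) B :=
  forall Q, measurable Q -> Q `<=` B -> isnat (m Q).

(** Integers closer than 1 coincide, so a convergent integer sequence is eventually constant. This
    turns convergence of counts into equality for large indices, the form in which points are
    excluded later. *)
Lemma isnat_cvg (u : nat -> \bar R) (l : \bar R) :
  (forall n, isnat (u n)) -> l \is a fin_num -> u @ \oo --> l ->
  isnat l /\ \forall n \near \oo, u n = l.
Proof.
move=> un lfin ul.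
have {}ul : (fine \o u) n @[n --> \oo] --> fine l.
  by apply: fine_cvg; rewrite fineK.
(* Radius one half: two terms within it of the limit differ by less than 1. *)
have [N _ hN] : \forall n \near \oo, `|fine l - fine (u n)| < 2^-1.
  by move/cvgrPdist_lt : ul; apply; rewrite invr_gt0.
have [k uN] := un N.
have uE n : (N <= n)%N -> u n = k%:R%:E.
  move=> Nn; have [j unE] := un n; rewrite unE; congr (_%:R%:E).
  have := hN _ Nn; have := hN _ (leqnn N); rewrite /= unE uN /=.
  move=> h1 h2.
  have : `|j%:R - k%:R : R| < 1.
    rewrite (_ : j%:R - k%:R = (fine l - k%:R) - (fine l - j%:R)); last by ring.
    by rewrite (le_lt_trans (ler_normB _ _))// [ltRHS](splitr 1) div1r ltrD.
  have [jk|jk] := leqP j k.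
    rewrite distrC ger0_norm ?subr_ge0 ?ler_nat// -natrB// (ltr_nat _ _ 1).
    by rewrite ltnS leqn0 subn_eq0 => kj; apply/eqP; rewrite eqn_leq jk kj.
  rewrite ger0_norm ?subr_ge0 ?ler_nat 1?ltnW// -natrB 1?ltnW// (ltr_nat _ _ 1).
  by rewrite ltnS leqn0 subn_eq0 leqNgt jk.
have lE : l = k%:R%:E.
  rewrite -(fineK lfin); congr EFin.
  suff : (fine \o u) n @[n --> \oo] --> (k%:R : R) by move/(cvg_unique _ ul); exact.
  apply: cvg_near_cst; exists N => // n /= Nn; by rewrite uE.
by split; [exists k|exists N => // n /= /uE ->].
Qed.


Definition sqbox (M : R) : set (R * R) := `[0, M] `*` `[0, M].

Lemma measurable_sqbox M : measurable (sqbox M).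
Proof. exact: measurableX. Qed.

(** Dynkin argument. Sets whose trace on [B] has integer mass form a lambda-system: masses are
    finite, so proper differences stay integer, and increasing limits are handled by [isnat_cvg].
    The generating pi-system is that of lower-left quadrants, with the whole plane added. *)
Lemma counting_on_pi m B :
  measurable B -> isnat (m B) ->
  (forall x y, isnat (m (B `&` `]-oo, x] `*` `]-oo, y]))) ->
  counting_on m B.
Proof.
move=> mB [b mBb] hm.
have mBfin Q : measurable Q -> m (B `&` Q) \is a fin_num.
  move=> mQ; rewrite ge0_fin_numE//.
  apply: (@le_lt_trans _ _ (m B)); last by rewrite mBb ltry.
  by rewrite le_measure ?inE//; exact: measurableI.
pose G := [set A : set (R * R) | exists x y, A = `]-oo, x] `*` `]-oo, y]] `|` [set setT].
have GI : setI_closed G.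
  move=> _ _ [[x [y ->]]|->] [[x' [y' ->]]|->]; rewrite ?setIT ?setTI.
  - left; exists (Num.min x x'), (Num.min y y'); rewrite -setXI; congr (_ `*` _).
    + by apply/seteqP; split => z /=; rewrite !in_itv/= le_min => /andP.
    + by apply/seteqP; split => z /=; rewrite !in_itv/= le_min => /andP.
  - by left; exists x, y.
  - by left; exists x', y'.
  - by right.
(* Quadrants give half-planes by countable unions, half-planes give cylinders over Borel sets, and
   two cylinders intersect in a measurable rectangle. *)
have mG : measurable `<=` <<s G >>.
  have sG : sigma_algebra setT <<s G >> by exact: smallest_sigma_algebra.
  have GC A : <<s G >> A -> <<s G >> (~` A).
    by case: sG => _ h _ /h; rewrite setTD.
  have GU (F : (set (R * R))^nat) : (forall n, <<s G >> (F n)) -> <<s G >> (\bigcup_n F n).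
    by case: sG => _ _ h hF; exact: h.
  have GI' A A' : <<s G >> A -> <<s G >> A' -> <<s G >> (A `&` A').
    move=> /GC GA /GC GA'; rewrite -[_ `&` _]setCK setCI -bigcup2E; apply: GC.
    by apply: GU => -[|[|n]]//=; exact: sigma_algebra0.
  have Gl x : <<s G >> (`]-oo, x] `*` setT).
    rewrite (_ : _ `*` _ = \bigcup_(n in [set: nat]) (`]-oo, x] `*` `]-oo, n%:R])).
      by apply: GU => n; apply: sub_sigma_algebra; left; exists x, n%:R.
    apply/seteqP; split => -[p q] /=; last by move=> [n _ [/= ? _]].
    move=> [px _]; exists (Num.truncn `|q|).+1 => //=; split => //=.
    by rewrite in_itv/= (le_trans (ler_norm _))// ltW// truncnS_gt.
  have Gr y : <<s G >> (setT `*` `]-oo, y]).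
    rewrite (_ : _ `*` _ = \bigcup_(n in [set: nat]) (`]-oo, n%:R] `*` `]-oo, y])).
      by apply: GU => n; apply: sub_sigma_algebra; left; exists n%:R, y.
    apply/seteqP; split => -[p q] /=; last by move=> [n _ [/= _ ?]].
    move=> [_ px]; exists (Num.truncn `|p|).+1 => //=; split => //=.
    by rewrite in_itv/= (le_trans (ler_norm _))// ltW// truncnS_gt.
  have mR : measurable = <<s @RGenOInfty.G R >> := @RGenOInfty.measurableE R.
  have GA (A : set R) : measurable A -> <<s G >> (A `*` setT).
    rewrite mR => /(_ [set A | <<s G >> (A `*` setT)]); apply; split.
      split => /=.
      - by rewrite set0X; exact: sigma_algebra0.
      - move=> C /GC; rewrite (_ : ~` _ = (setT `\` C) `*` setT)//.
        by apply/seteqP; split => -[p q] /=; tauto.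
      - by move=> F hF; rewrite setX_bigcupl; exact: GU.
    move=> _ [x ->] /=; rewrite -setCitvl.
    have := GC _ (Gl x); rewrite (_ : ~` _ = (~` `]-oo, x]) `*` setT)//.
    by apply/seteqP; split => -[p q] /=; tauto.
  have GB (A : set R) : measurable A -> <<s G >> (setT `*` A).
    rewrite mR => /(_ [set A | <<s G >> (setT `*` A)]); apply; split.
      split => /=.
      - by rewrite setX0; exact: sigma_algebra0.
      - move=> C /GC; rewrite (_ : ~` _ = setT `*` (setT `\` C))//.
        by apply/seteqP; split => -[p q] /=; tauto.
      - by move=> F hF; rewrite setX_bigcupr; exact: GU.
    move=> _ [x ->] /=; rewrite -setCitvl.
    have := GC _ (Gr x); rewrite (_ : ~` _ = setT `*` (~` `]-oo, x]))//.
    by apply/seteqP; split => -[p q] /=; tauto.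
  rewrite measurable_prod_measurableType; apply: smallest_sub => //.
  move=> _ [A mA [A' mA' <-]]; rewrite -[X in <<s G>> X](_ : (A `*` setT) `&` (setT `*` A') = _).
    by apply: GI'; [exact: GA|exact: GB].
  by rewrite -setXI setIT setTI.
move=> Q mQ QB; rewrite -(setIidr QB).
suff: <<s G >> `<=` [set Q | measurable Q /\ isnat (m (B `&` Q))].
  by move=> /(_ _ (mG _ mQ)) [].
apply: lambda_system_subset => //.
- split => //.
  + by split => //; rewrite setIT; exists b.
  + move=> A A' A'A [mA [k Ak]] [mA' [k' Ak']]; split; first exact: measurableD.
    rewrite setIDA measureD//=; last 2 first.
    * exact: measurableI.
    * by rewrite -ge0_fin_numE// mBfin.
    have -> : B `&` A `&` A' = B `&` A' by rewrite -setIA (setIidr A'A).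
    have k'k : (k' <= k)%N.
      rewrite -(ler_nat R) -lee_fin -Ak -Ak' le_measure ?inE//.
      * exact: measurableI.
      * exact: measurableI.
      * exact: setIS.
    by exists (k - k')%N; rewrite Ak Ak' -EFinB natrB.
  + move=> F ndF FH.
    have mF n : measurable (F n) := (FH n).1.
    have mU : measurable (\bigcup_i F i) by exact: bigcupT_measurable.
    split => //.
    apply: (isnat_cvg (fun n => m (B `&` F n)) _ _ (mBfin _ mU) _).1.
      by move=> n; have [] := FH n.
    rewrite setI_bigcupr; apply: nondecreasing_cvg_mu.
    * by move=> n; exact: measurableI.
    * by rewrite -setI_bigcupr; exact: measurableI.
    * by move=> p q pq; apply/subsetPset; apply: setIS; apply/subsetPset; exact: ndF.
- move=> _ [[x [y ->]]|->]; split => //; first exact: measurableX.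
  by rewrite setIT; exists b.
Qed.

(** Only countably many counts can be made integer almost surely at once, hence the dyadic corners.
    Every rectangle based at the origin is a decreasing intersection of dyadic ones. *)
Lemma counting_on_dyadic m (M : nat) :
  (forall n i j, isnat (m (`[0, i%:R / 2 ^+ n] `*` `[0, j%:R / 2 ^+ n]))) ->
  counting_on m (sqbox M%:R).
Proof.
move=> hd.
have hr (x y : R) : isnat (m (`[0, x] `*` `[0, y])).
  have [x0|x0] := ltP x 0.
    by rewrite set_itv_ge ?set0X ?measure0 ?bnd_simp -?ltNge//; exists 0%N.
  have [y0|y0] := ltP y 0.
    by rewrite (@set_itv_ge _ _ (BLeft 0) (BRight y)) ?setX0 ?measure0 ?bnd_simp -?ltNge//; exists 0%N.
  (* Dyadic approximation from above; the successor makes it strictly larger than [z], by at most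
     [2 ^- n], and nonincreasing in [n]. *)
  pose a (z : R) n := (Num.truncn (z * 2 ^+ n)).+1%:R / 2 ^+ n : R.
  have ag (z : R) n : 0 <= z -> z < a z n.
    move=> z0; rewrite ltr_pdivlMr ?exprn_gt0//.
    by have /andP[] := truncn_itv (mulr_ge0 z0 (exprn_ge0 n (ler0n R 2))).
  have au (z : R) n : 0 <= z -> a z n <= z + 2 ^- n.
    move=> z0; rewrite /a -natr1 mulrDl mul1r lerD2r ler_pdivrMr ?exprn_gt0//.
    by have /andP[] := truncn_itv (mulr_ge0 z0 (exprn_ge0 n (ler0n R 2))).
  have aS (z : R) n : 0 <= z -> a z n.+1 <= a z n.
    move=> z0; rewrite {1}/a ler_pdivrMr ?exprn_gt0//.
    rewrite [leRHS](_ : _ = (Num.truncn (z * 2 ^+ n)).+1%:R * 2); last first.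
      by rewrite /a exprS mulrCA divfK ?expf_neq0// mulrC.
   
    rewrite -natrM ler_nat truncn_lt_nat ?mulr_ge0// ?exprn_ge0//.
    by rewrite exprS mulrCA natrM mulrC ltr_pM2r// truncnS_gt.
  have an (z : R) : 0 <= z -> nonincreasing_seq (a z).
    by move=> z0; apply/nonincreasing_seqP => n; exact: aS.
  have acap (z : R) : 0 <= z -> \bigcap_n `[0, a z n]%classic = `[0, z]%classic.
    move=> z0; apply/seteqP; split => p /=; last first.
      by rewrite in_itv/= => /andP[p0 pz] n _ /=; rewrite in_itv/= p0 (le_trans pz)// ltW// ag.
    move=> h; have := h O I; rewrite /= !in_itv/= => /andP[p0 _]; rewrite p0/=.
    apply/ler_addgt0Pr => e e0.
    have [n _ /(_ n (leqnn n)) ne] := near_infty_natSinv_expn_lt (PosNum e0).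
    have := h n I; rewrite /= in_itv/= => /andP[_ /le_trans]; apply.
    rewrite (le_trans (au _ _ z0))// lerD2l ltW//.
    by move: ne; rewrite div1r.
  have mF n : measurable (`[0, a x n]%classic `*` `[0, a y n]%classic) by exact: measurableX.
  have capE : \bigcap_n (`[0, a x n]%classic `*` `[0, a y n]%classic) = `[0, x]%classic `*` `[0, y]%classic.
    rewrite -acap// -(acap y)//; apply/seteqP; split => -[p q] /= h.
      by split => n _; have [] := h n I.
    by move=> n _; split; [exact: h.1|exact: h.2].
  have F0 : (m (`[0%R, a x 0%N] `*` `[0%R, a y 0%N]) < +oo)%E.
    by have [k ->] := hd 0%N (Num.truncn (x * 2 ^+ 0)).+1 (Num.truncn (y * 2 ^+ 0)).+1; rewrite ltry.
  rewrite -capE.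
  have cv : (fun n => m (`[0, a x n] `*` `[0, a y n])) @ \oo --> m (\bigcap_n (`[0, a x n] `*` `[0, a y n])).
    apply: nonincreasing_cvg_mu => //.
      by rewrite capE; exact: measurableX.
    move=> p q pq; apply/subsetPset => -[r s] /=; rewrite !in_itv/= => -[/andP[-> rp] /andP[-> sp]].
    by rewrite (le_trans rp) ?(le_trans sp)//; exact: an.
  apply: (isnat_cvg _ _ _ _ cv).1.
    by move=> n; exact: hd.
  rewrite ge0_fin_numE// (le_lt_trans _ F0)//.
  by rewrite le_measure ?inE// capE //; [exact: measurableX|move=> -[p q]; rewrite -capE => /(_ O I)].
have E (x y z t : R) : `[0, x]%classic `*` `[0, y]%classic `&` `]-oo, z]%classic `*` `]-oo, t]%classic =
    `[0, Num.min x z] `*` `[0, Num.min y t] :> set (R * R).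
  apply/seteqP; split=> -[p q] /=; rewrite !in_itv/= !le_min.
    by move=> [[/andP[-> ->] /andP[-> ->]] [-> ->]].
  by move=> [/and3P[-> -> ->] /and3P[-> -> ->]].
apply: counting_on_pi; [exact: measurable_sqbox|exact: hr|].
by move=> x y; rewrite E; exact: hr.
Qed.

End counting.

(** * Limits of integrals and of probabilities of events *)

Lemma cvg_integral_bounded {d} {T : measurableType d} {R : realType}
    (mu : {finite_measure set T -> \bar R}) (D : set T)
    (f_ : nat -> T -> R) (f : T -> R) (c : R) :
  measurable D ->
  (forall n, measurable_fun D (fun w => (f_ n w)%:E)) ->
  measurable_fun D (fun w => (f w)%:E) ->
  (forall w, D w -> f_ n w @[n --> \oo] --> f w) ->
  (forall n w, D w -> `|f_ n w| <= c) ->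
  (\int[mu]_(w in D) (f_ n w)%:E)%E @[n --> \oo] --> (\int[mu]_(w in D) (f w)%:E)%E.
Proof.
move=> mD mf_ mf cf bf.
have [] := @dominated_convergence _ T R mu D mD (fun n w => (f_ n w)%:E)
  (fun w => (f w)%:E) (cst c%:E) mf_ mf _ _ _ => //.
- by apply: aeW => w Dw; apply: cvg_EFin; [exact: nearW|exact: cf].
- exact: finite_measure_integrable_cst.
- by apply: aeW => w n Dw; rewrite lee_fin bf.
Qed.

Lemma probability_setI1 {d} {T : measurableType d} {R : realType}
    (P : probability T R) (X G : set T) :
  measurable X -> measurable G -> P G = 1%E -> P (X `&` G) = P X.
Proof.
move=> mX mG PG; have PG0 : P (~` G) = 0%E by rewrite probability_setC// PG subee.
rewrite [RHS](measureDI P mX mG) [X in (X + _)%E](_ : _ = 0%E) ?add0e//.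
apply/eqP; rewrite eq_le measure_ge0 andbT -PG0 le_measure ?inE//.
- exact: measurableD.
- exact: measurableC.
Qed.

(** Dominated convergence of indicators. It serves for void events, for counts in finitely many
    boxes and for the tails of the approximating chain, where events agree eventually at almost
    every point. *)
Lemma cvg_measure_near {d} {T : measurableType d} {R : realType}
    (mu : {finite_measure set T -> \bar R}) (F : nat -> set T) (E : set T) :
  (forall n, measurable (F n)) -> measurable E ->
  {ae mu, forall w, \forall n \near \oo, F n w <-> E w} ->
  mu (F n) @[n --> \oo] --> mu E.
Proof.
move=> mF mE FE.
have := @dominated_convergence _ T R mu setT measurableT
  (fun n w => (\1_(F n) w)%:E) (fun w => (\1_E w)%:E) (cst 1%E).
move=> /(_ _ _ _ _ _)[].
- by move=> n; apply/measurable_EFinP; exact: measurable_indic.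
- by apply/measurable_EFinP; exact: measurable_indic.
- apply: filterS FE => w wFE _; apply: cvg_near_cst.
  apply: filterS wFE => n FnE; rewrite !indicE; congr (_%:R%:E).
  by congr nat_of_bool; apply/idP/idP; rewrite !inE FnE.
- exact: finite_measure_integrable_cst.
- by apply: aeW => w n _ /=; rewrite indicE lee_fin; case: (_ \in _); rewrite ?normr1 ?normr0.
move=> _ _; rewrite integral_indic// setIT.
by under eq_fun do rewrite integral_indic// setIT.
Qed.

Lemma mule_shuffle {R : realType} (a b c e p : \bar R) :
  (a * b * (c * e) * p = a * c * (b * e * p))%E.
Proof. by rewrite [(a * b * _)%E]muleACA -(muleA (a * c)%E). Qed.

Lemma pois_0 {R : realType} (r : R) : pois r 0 = expR (- r).
Proof. by rewrite /pois expr0 fact0 mulr1 divr1. Qed.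

Lemma leb2X {R : realType} (A B : set R) : measurable A -> measurable B ->
  leb2 (A `*` B) = (leb A * leb B)%E.
Proof. by move=> mA mB; rewrite /leb2 product_measure1E. Qed.

Lemma leb2_box_lty {R : realType} (a b c e : R) :
  (leb2 (`]a, b]%classic `*` `[c, e]%classic) < +oo)%E.
Proof.
rewrite leb2X// /leb !lebesgue_measure_itv/=.
by case: ifPn => _; case: ifPn => _; rewrite ?mule0 ?mul0e// -!EFinB -EFinM ltry.
Qed.

(** * Planar Lebesgue measure and monotone sequences of sections *)

Section leb2R.
Context {R : realType}.

(** The same set function as [leb2], redeclared as a measure on [R * R] so that results about
    bundled measures on that type apply to it. *)
Definition leb2R : set (R * R) -> \bar R := leb2.

Let leb2R0 : leb2R set0 = 0%E. Proof. exact: measure0. Qed.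

Let leb2R_ge0 A : (0 <= leb2R A)%E. Proof. exact: measure_ge0. Qed.

Let leb2R_sigma_additive : semi_sigma_additive leb2R.
Proof. exact: (@measure_semi_sigma_additive _ _ _ leb2). Qed.

HB.instance Definition _ := isMeasure.Build _ (R * R)%type R leb2R
  leb2R0 leb2R_ge0 leb2R_sigma_additive.

End leb2R.

Section mono.
Context {R : realType}.
Implicit Types (B : set (R * R)) (S : set (R * (R * R))) (x : R).

Lemma xsection_monotone_cvg (m : {measure set (R * R) -> \bar R}) B
    (S : nat -> set (R * (R * R))) (S' : set (R * (R * R))) x :
  measurable B -> (m B < +oo)%E -> (forall n, measurable (S n)) ->
  (nondecreasing_seq S /\ S' = \bigcup_n S n) \/
  (nonincreasing_seq S /\ S' = \bigcap_n S n) ->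
  m (xsection (S n) x `&` B) @[n --> \oo] --> m (xsection S' x `&` B).
Proof.
move=> mB mBoo mS hS.
have mI n : measurable (xsection (S n) x `&` B).
  by apply: measurableI => //; exact: measurable_xsection.
case: hS => -[mono ->].
- have -> : xsection (\bigcup_n S n) x `&` B = \bigcup_n (xsection (S n) x `&` B).
    apply/seteqP; split => y.
      by move=> [/xsectionP[n _ Sn] By]; exists n => //; split => //; exact/xsectionP.
    by move=> [n _ [/xsectionP Sn By]]; split => //; apply/xsectionP; exists n.
  apply: nondecreasing_cvg_mu => //; first exact: bigcupT_measurable.
  move=> p q pq; apply/subsetPset => y [/xsectionP Sy By]; split => //.
  by apply/xsectionP; move: Sy; apply: (subsetPset _ _ (mono _ _ pq)).
- have -> : xsection (\bigcap_n S n) x `&` B = \bigcap_n (xsection (S n) x `&` B).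
    apply/seteqP; split => y.
      by move=> [/xsectionP h By] n _; split => //; apply/xsectionP; exact: h.
    by move=> h; split; [apply/xsectionP => n _; have [/xsectionP] := h n I|exact: (h O I).2].
  apply: nonincreasing_cvg_mu => //.
  + by rewrite (le_lt_trans _ mBoo)// le_measure ?inE//; exact: subIsetr.
  + exact: bigcapT_measurable.
  + move=> p q pq; apply/subsetPset => y [/xsectionP Sy By]; split => //.
    by apply/xsectionP; move: Sy; apply: (subsetPset _ _ (mono _ _ pq)).
Qed.

(** Continuity of the measure gives convergence of the counts inside [B]; integrality upgrades it to
    equality from some index on. *)
Lemma counting_on_monotone (m : {measure set (R * R) -> \bar R}) B
    (S : nat -> set (R * (R * R))) (S' : set (R * (R * R))) x :
  measurable B -> counting_on m B -> (forall n, measurable (S n)) ->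
  (nondecreasing_seq S /\ S' = \bigcup_n S n) \/
  (nonincreasing_seq S /\ S' = \bigcap_n S n) ->
  \forall n \near \oo, m (xsection (S n) x `&` B) = m (xsection S' x `&` B).
Proof.
move=> mB cB mS hS.
have mI n : measurable (xsection (S n) x `&` B).
  by apply: measurableI => //; exact: measurable_xsection.
have mS' : measurable S'.
  by case: hS => -[_ ->]; [exact: bigcupT_measurable|exact: bigcapT_measurable].
have mI' : measurable (xsection S' x `&` B).
  by apply: measurableI => //; exact: measurable_xsection.
have cv := xsection_monotone_cvg m B S S' x mB _ mS hS.
apply: (isnat_cvg (fun n => m (xsection (S n) x `&` B)) _ _ _ _).2.
- by move=> n; apply: cB => //; exact: subIsetr.
- by have [k ->] := cB _ mI' (@subIsetr _ _ _).
- by apply: cv; have [k ->] := cB _ mB (@subset_refl _ _); rewrite ltry.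
Qed.

Lemma leb2_monotone B (S : nat -> set (R * (R * R))) (S' : set (R * (R * R))) x :
  measurable B -> (leb2 B < +oo)%E -> (forall n, measurable (S n)) ->
  (nondecreasing_seq S /\ S' = \bigcup_n S n) \/
  (nonincreasing_seq S /\ S' = \bigcap_n S n) ->
  fine (leb2 (xsection (S n) x `&` B)) @[n --> \oo] --> fine (leb2 (xsection S' x `&` B)).
Proof.
move=> mB leb2B mS hS; apply: fine_cvg; rewrite fineK.
  by have := xsection_monotone_cvg leb2R B S S' x mB leb2B mS hS.
rewrite ge0_fin_numE// (le_lt_trans _ leb2B)// le_measure ?inE//.
  apply: measurableI => //; apply: measurable_xsection.
  by case: hS => -[_ ->]; [exact: bigcupT_measurable|exact: bigcapT_measurable].
Qed.
End mono.

(** * Void probabilities of regions that depend on a random state *)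

Section prm.
Context {d : measure_display} {T : measurableType d} {R : realType}.
Variables (P : probability T R) (Np Nm : T -> {measure set (R * R) -> \bar R}).
Implicit Types (N : T -> {measure set (R * R) -> \bar R}) (s : R) (V : T -> R)
  (A B : nat -> set (R * R)) (k l : nat -> nat) (S : set (R * (R * R))).

(** The sets lie strictly after time [s], so a box in the strip ending at time [s] can be appended
    to the family without overlap. *)
Definition finfam s n A :=
  (forall i, (i < n)%N -> [/\ measurable (A i),
     A i `<=` `]s, +oo[ `*` `[0, +oo[ & (leb2 (A i) < +oo)%E]) /\
  (forall i j, (i < n)%N -> (j < n)%N -> i <> j -> A i `&` A j = set0).

Definition counts N n A k : set T :=
  \bigcap_(i in `I_n) [set w | N w (A i) = (k i)%:R%:E].

Definition pfam n A k : \bar R :=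
  (\prod_(i < n) (pois (fine (leb2 (A i))) (k i))%:E)%E.

(** The Markov property in the form that propagates: the points after time [s] keep their Poisson
    law and are independent of the current state [V]. *)
Definition indep_after s V :=
  [/\ (forall D, measurable D -> measurable_fun [set: T] (fun w => Np w D)),
      (forall D, measurable D -> measurable_fun [set: T] (fun w => Nm w D)),
      measurable_fun [set: T] V &
      forall n m A k B l C, finfam s n A -> finfam s m B -> measurable C ->
        P (counts Np n A k `&` counts Nm m B l `&` V @^-1` C) =
        (pfam n A k * pfam m B l * P (V @^-1` C))%E].

Definition extend {X : Type} n (A : nat -> X) (D : X) : nat -> X :=
  fun i => if (i < n)%N then A i else D.

Lemma counts_extend N n A k D j :
  counts N n.+1 (extend n A D) (extend n k j) =
  counts N n A k `&` [set w | N w D = j%:R%:E].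
Proof.
apply/seteqP; split => w.
  move=> h; split => [i /= ni|].
    by have := h i (ltnW ni); rewrite /= /extend ni.
  by have := h n (leqnn n); rewrite /= /extend ltnn.
move=> [h hD] i /=; rewrite ltnS leq_eqVlt => /orP[/eqP ->|ni].
  by rewrite /extend ltnn.
by rewrite /extend ni; exact: h.
Qed.

Lemma pfam_extend n A k D j :
  pfam n.+1 (extend n A D) (extend n k j) =
  (pfam n A k * (pois (fine (leb2 D)) j)%:E)%E.
Proof.
rewrite /pfam big_ord_recr /= /extend ltnn; congr (_ * _)%E.
by apply: eq_bigr => i _; rewrite ltn_ord.
Qed.

Lemma pfamE n A k :
  pfam n A k = (\prod_(i < n) pois (fine (leb2 (A i))) (k i))%:E.
Proof. by rewrite /pfam prodEFin. Qed.

Lemma measurable_counts N n A k :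
  (forall D, measurable D -> measurable_fun [set: T] (fun w => N w D)) ->
  (forall i, (i < n)%N -> measurable (A i)) -> measurable (counts N n A k).
Proof.
move=> mN mA; apply: fin_bigcap_measurable => [|i /= /mA mAi]; first exact: finite_II.
by have := mN _ mAi measurableT _ (emeasurable_set1 (k i)%:R%:E); rewrite setTI.
Qed.

Lemma finfam_extend s s' (M : R) n A (D : set (R * R)) : s <= s' -> finfam s' n A -> measurable D ->
  D `<=` `]s, s'] `*` `[0, M] -> finfam s n.+1 (extend n A D).
Proof.
move=> ss' [hA tA] mD DB.
have sub i : (i < n)%N -> A i `<=` `]s', +oo[ `*` `[0, +oo[ by move=> /hA[].
split.
  move=> i _; rewrite /extend; case: ifPn => [ni|_].
    have [? Ai ?] := hA _ ni; split => //.
    apply: subset_trans Ai _ => -[p q] /=; rewrite !in_itv/= !andbT => -[? ?].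
    by split => //; exact: le_lt_trans ss' _.
  split => //.
    apply: subset_trans DB _ => -[p q] /=.
    by rewrite !in_itv/= !andbT => -[/andP[? ?] /andP[? ?]].
  apply: (@le_lt_trans _ _ (leb2 (`]s, s'] `*` `[0%R, M]))).
    by rewrite le_measure ?inE//; exact: measurableX.
  exact: leb2_box_lty.
have AD i : (i < n)%N -> A i `&` D = set0.
  move=> ni; apply/seteqP; split => // -[p q] [/(sub _ ni)/= + /DB/=].
  by rewrite !in_itv/= !andbT => -[+ _] [/andP[_ +] _] => /lt_le_trans /[apply]; rewrite ltxx.
move=> i j; rewrite !ltnS (leq_eqVlt i) (leq_eqVlt j).
move=> /orP[/eqP->|ni] /orP[/eqP->|nj] ij.
- by [].
- by rewrite /extend ltnn nj setIC AD.
- by rewrite /extend ltnn ni AD.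
- by rewrite /extend ni nj; exact: tA.
Qed.

Variables (s s' M : R) (V : T -> R).
Hypothesis indepV : indep_after s V.
Hypothesis ss' : s <= s'.
Let Bx : set (R * R) := `]s, s'] `*` `[0, M].
Variable (G : set T).
Hypotheses (mG : measurable G) (PG : P G = 1%E)
  (Gcount : forall w, G w -> counting_on (Np w) Bx /\ counting_on (Nm w) Bx).

Let mBx : measurable Bx. Proof. exact: measurableX. Qed.

Let Bxfin : (leb2 Bx < +oo)%E.
Proof. exact: leb2_box_lty. Qed.

(** The region inspected is the section at the random state, cut to the box [Bx]. Intersecting with
    the almost sure event [G], where counts in the box are integers, makes these events stabilise at
    every point along monotone sequences of regions. *)
Definition void_set S S' : set T := G `&`
  [set w | Np w (xsection S (V w) `&` Bx) = 0%E] `&`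
  [set w | Nm w (xsection S' (V w) `&` Bx) = 0%E].

(** The conditional void probability given the state: both areas enter through the Poisson weight of
    count 0. *)
Definition void_rate S S' x : R :=
  expR (- fine (leb2 (xsection S x `&` Bx)) - fine (leb2 (xsection S' x `&` Bx))).

(** The families [A] and [B] after [s'] are carried along so that the law of the void event also
    records its independence from the future; without them the chain could not be continued. *)
Definition void_law S S' : Prop :=
  [/\ measurable (void_set S S'),
   measurable_fun setT (fun w => (void_rate S S' (V w))%:E) &
   forall n m A k B l C, finfam s' n A -> finfam s' m B -> measurable C ->
     P (counts Np n A k `&` counts Nm m B l `&` V @^-1` C `&` void_set S S') =
     (pfam n A k * pfam m B l * \int[P]_(w in V @^-1` C) (void_rate S S' (V w))%:E)%E].

(** On [G] the counts stabilise, so the void events agree eventually at every point, while the areas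
    converge by continuity of measure. Both sides of the law then pass to the limit by dominated
    convergence. *)
Lemma void_law_monotone (S S' : nat -> set (R * (R * R))) S_ S'_ :
  (forall n, measurable (S n)) -> (forall n, measurable (S' n)) ->
  (nondecreasing_seq S /\ S_ = \bigcup_n S n) \/
  (nonincreasing_seq S /\ S_ = \bigcap_n S n) ->
  (nondecreasing_seq S' /\ S'_ = \bigcup_n S' n) \/
  (nonincreasing_seq S' /\ S'_ = \bigcap_n S' n) ->
  (forall n, void_law (S n) (S' n)) -> void_law S_ S'_.
Proof.
move=> mS mS' hS hS' hV.
have mS_ : measurable S_.
  by case: hS => -[_ ->]; [exact: bigcupT_measurable|exact: bigcapT_measurable].
have mS'_ : measurable S'_.
  by case: hS' => -[_ ->]; [exact: bigcupT_measurable|exact: bigcapT_measurable].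
have vE w : \forall n \near \oo, void_set (S n) (S' n) w <-> void_set S_ S'_ w.
  have [Gw|Gw] := pselect (G w); last by near=> n; split=> -[[]].
  have [Gp Gm] := Gcount _ Gw.
  have := counting_on_monotone _ _ _ _ (V w) mBx Gp mS hS.
  have := counting_on_monotone _ _ _ _ (V w) mBx Gm mS' hS'.
  by apply: filterS2 => n /= e' e; rewrite /void_set/= e e'.
have rE x : void_rate (S n) (S' n) x @[n --> \oo] --> void_rate S_ S'_ x.
  apply: (cvg_comp _ expR _ (@continuous_expR R _)).
  apply: cvgB; first by apply: cvgN; exact: leb2_monotone.
  exact: leb2_monotone.
have mv n : measurable (void_set (S n) (S' n)) by have [] := hV n.
have mv_ : measurable (void_set S_ S'_).
  (* The limit event is the lower limit of the approximating ones, hence measurable. *)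
  rewrite (_ : void_set S_ S'_ =
      \bigcup_n \bigcap_(m in [set m | (n <= m)%N]) void_set (S m) (S' m)).
    apply: bigcupT_measurable => n; apply: bigcap_measurable => //.
    by exists n => /=.
  apply/seteqP; split => w.
    by move=> vw; have [n _ h] := vE w; exists n => // m nm; apply/h.
  move=> [n _ h]; have [m _ h'] := vE w.
  by apply/(h' _ (leq_maxr n m)); apply: h => /=; exact: leq_maxl.
have mr n : measurable_fun setT (fun w => (void_rate (S n) (S' n) (V w))%:E).
  by have [] := hV n.
have mr_ : measurable_fun setT (fun w => (void_rate S_ S'_ (V w))%:E).
  apply: (emeasurable_fun_cvg (fun n w => (void_rate (S n) (S' n) (V w))%:E)) => //.
  by move=> w _; apply: cvg_EFin; [exact: nearW|exact: rE].
split => // n m A k B l C fA fB mC.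
have mX : measurable (counts Np n A k `&` counts Nm m B l `&` V @^-1` C).
  have [mp mm mV _] := indepV.
  apply: measurableI; last by rewrite -[X in measurable X]setTI; exact: mV.
  by apply: measurableI; apply: measurable_counts => // i; [case: fA|case: fB] => + _ => /[apply] -[].
have mVC : measurable (V @^-1` C).
  by rewrite -[X in measurable X]setTI; have [_ _ mV _] := indepV; exact: mV.
set X := _ `&` V @^-1` C in mX *.
have cl : P (X `&` void_set (S n) (S' n)) @[n --> \oo] --> P (X `&` void_set S_ S'_).
  apply: cvg_measure_near => //.
  - by move=> j; exact: measurableI.
  - exact: measurableI.
  - apply: aeW => w; apply: filterS (vE w) => j vj.
    by split=> -[Xw /vj].
have cr : (pfam n A k * pfam m B l * \int[P]_(w in V @^-1` C) (void_rate (S j) (S' j) (V w))%:E)%E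
    @[j --> \oo] --> (pfam n A k * pfam m B l * \int[P]_(w in V @^-1` C) (void_rate S_ S'_ (V w))%:E)%E.
  apply: cvgeZl; first by rewrite fin_numM// /pfam prode_fin_num.
  apply: (cvg_integral_bounded P _ (fun j w => void_rate (S j) (S' j) (V w)) _ 1 mVC).
  - by move=> j; exact: (measurable_funTS (mr j)).
  - exact: (measurable_funTS mr_).
  - by move=> w _; exact: rE.
  - move=> j w _; rewrite ger0_norm ?expR_ge0// -expR0 ler_expR.
    by rewrite -opprD oppr_le0 addr_ge0// fine_ge0.
suff E : (fun j => P (X `&` void_set (S j) (S' j))) =
    (fun j => pfam n A k * pfam m B l * \int[P]_(w in V @^-1` C) (void_rate (S j) (S' j) (V w))%:E)%E.
  by rewrite E in cl; exact: (cvg_unique _ cl cr).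
by apply/funext => j; have [_ _ ->] := hV j.
Unshelve. all: by end_near. Qed.

(** With both labels fixed the two regions are fixed sets, so the void event is a zero count on one
    more set in each family and the hypothesis on [V] applies. Summing over the label classes of the
    state gives the integral. *)
Lemma void_law_step S S' : step_sets S -> step_sets S' -> void_law S S'.
Proof.
move=> [i1 mi1 [D1 mD1 ->]] [i2 mi2 [D2 mD2 ->]].
have [mp mm mV hV] := indepV.
pose i x := pickle (i1 x, i2 x).
have mi : measurable_fun setT i by exact: measurable_pickle2.
pose D j := if (unpickle j : option (nat * nat)) is Some ab then D1 (ab.1 : nat) else set0.
pose D' j := if (unpickle j : option (nat * nat)) is Some ab then D2 (ab.2 : nat) else set0.
have mD j : measurable (D j `&` Bx).
  by apply: measurableI => //; rewrite /D; case: unpickle => //= -[].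
have mD' j : measurable (D' j `&` Bx).
  by apply: measurableI => //; rewrite /D'; case: unpickle => //= -[].
have sE x : xsection (step_set i1 D1) x = D (i x).
  by rewrite /D /i pickleK; apply/seteqP; split=> y /=; [move/xsectionP|move=> ?; exact/xsectionP].
have sE' x : xsection (step_set i2 D2) x = D' (i x).
  by rewrite /D' /i pickleK; apply/seteqP; split=> y /=; [move/xsectionP|move=> ?; exact/xsectionP].
have mN0 N (E : set (R * R)) : (forall E, measurable E -> measurable_fun setT (fun w => N w E)) ->
    measurable E -> measurable [set w | N w E = 0%E].
  by move=> mN mE; have := mN _ mE measurableT _ (emeasurable_set1 0%E); rewrite setTI.
have mVi j : measurable (V @^-1` (i @^-1` [set j])).
  rewrite -[X in measurable X]setTI; apply: mV => //.
  by rewrite -[X in measurable X]setTI; exact: mi.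
have vE : void_set (step_set i1 D1) (step_set i2 D2) =
    G `&` \bigcup_j (V @^-1` (i @^-1` [set j]) `&`
      ([set w | Np w (D j `&` Bx) = 0%E] `&` [set w | Nm w (D' j `&` Bx) = 0%E])).
  apply/seteqP; split => w.
    move=> [[Gw]] /=; rewrite sE sE' => h h'; split => //.
    by exists (i (V w)).
  by move=> [Gw [j _ [/= ij [h h']]]]; rewrite /void_set /= sE sE' ij.
have rE w : void_rate (step_set i1 D1) (step_set i2 D2) (V w) =
    (fun j => expR (- fine (leb2 (D j `&` Bx)) - fine (leb2 (D' j `&` Bx)))) (i (V w)).
  by rewrite /void_rate sE sE'.
have mr : measurable_fun setT (fun w => (void_rate (step_set i1 D1) (step_set i2 D2) (V w))%:E).
  apply/measurable_EFinP; rewrite (_ : (fun _ => _) =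
    (fun j => expR (- fine (leb2 (D j `&` Bx)) - fine (leb2 (D' j `&` Bx)))) \o (i \o V)).
    by apply: measurableT_comp => //; exact: measurableT_comp.
  by apply/funext => w /=; rewrite rE.
have mU : measurable (\bigcup_j (V @^-1` (i @^-1` [set j]) `&`
      ([set w | Np w (D j `&` Bx) = 0%E] `&` [set w | Nm w (D' j `&` Bx) = 0%E]))).
  by apply: bigcupT_measurable => j; apply: measurableI => //; apply: measurableI; exact: mN0.
split => //; first by rewrite vE; exact: measurableI.
move=> n m A k B l C fA fB mC.
set F := counts Np n A k `&` counts Nm m B l.
have mF : measurable F.
  by apply: measurableI; apply: measurable_counts => // j; [case: fA|case: fB] => + _ => /[apply] -[].
have mVC : measurable (V @^-1` C) by rewrite -[X in measurable X]setTI; exact: mV.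
rewrite vE (setIC G) setIA -[LHS](_ : P (F `&` V @^-1` C `&` (\bigcup_j (V @^-1` (i @^-1` [set j]) `&`
      ([set w | Np w (D j `&` Bx) = 0%E] `&` [set w | Nm w (D' j `&` Bx) = 0%E])))) = _); last first.
  rewrite [RHS]probability_setI1//.
    by apply: measurableI => //; exact: measurableI.
set W := fun j => _ `&` _.
have mW j : measurable (W j).
  by apply: measurableI => //; apply: measurableI; exact: mN0.
rewrite setI_bigcupr measure_semi_bigcup; last 3 first.
- by move=> j; apply: (measurableI _ _ _ (mW j)); exact: measurableI.
- apply/trivIsetP => j1 j2 _ _ /eqP j12; apply/seteqP; split => // w.
  by move=> [[_ [/= e1 _]] [_ [/= e2 _]]]; apply: j12; rewrite -e1 -e2.
- by rewrite -setI_bigcupr; apply: (measurableI _ _ _ mU); exact: measurableI.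
have mVCj j : measurable (V @^-1` (C `&` i @^-1` [set j])).
  by rewrite preimage_setI; exact: measurableI.
have PW j : P (F `&` V @^-1` C `&` W j) =
    (pfam n A k * pfam m B l * \int[P]_(w in V @^-1` (C `&` i @^-1` [set j])) (void_rate (step_set i1 D1) (step_set i2 D2) (V w))%:E)%E.
  rewrite (_ : _ `&` W j =
      counts Np n.+1 (extend n A (D j `&` Bx)) (extend n k 0%N) `&`
      counts Nm m.+1 (extend m B (D' j `&` Bx)) (extend m l 0%N) `&`
      V @^-1` (C `&` i @^-1` [set j])); last first.
    rewrite !counts_extend; apply/seteqP; split => w.
      by move=> [[[Fp Fm] VC] [ij [p0 m0]]].
    by move=> [[[Fp p0] [Fm m0]] [VC ij]].
  rewrite hV; last 3 first.
  - by apply: (finfam_extend s s' M) => //; exact: subIsetr.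
  - by apply: (finfam_extend s s' M) => //; exact: subIsetr.
  - apply: measurableI => //.
    by rewrite -[X in measurable X]setTI; exact: mi.
  rewrite !pfam_extend !pois_0.
  rewrite (eq_integral (cst (expR (- fine (leb2 (D j `&` Bx)) - fine (leb2 (D' j `&` Bx))))%:E)); last first.
    by move=> w; rewrite inE /= => -[_ /= ij]; rewrite rE ij.
  rewrite integral_cst// expRD EFinM.
  exact: mule_shuffle.
rewrite (eq_eseriesr (fun j _ => PW j)).
rewrite !pfamE -EFinM nneseriesZl; last by move=> j _; apply: integral_ge0 => w _; rewrite lee_fin expR_ge0.
congr (_ * _)%E.
have VCE : V @^-1` C = \bigcup_j V @^-1` (C `&` i @^-1` [set j]).
  apply/seteqP; split => w; first by move=> Cw; exists (i (V w)).
  by move=> [j _ []].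
rewrite [in RHS]VCE ge0_integral_bigcup//.
- exact: measurable_funTS.
- by move=> w _; rewrite lee_fin expR_ge0.
- apply/trivIsetP => j1 j2 _ _ /eqP j12; apply/seteqP; split => // w.
  by move=> [[_ /= e1] [_ /= e2]]; apply: j12; rewrite -e1 -e2.
Qed.


(** The monotone class theorem is applied to one region at a time; the other region is kept as a
    constant sequence, which is a nondecreasing sequence with itself as union. *)
Lemma void_lawT S S' : measurable S -> measurable S' -> void_law S S'.
Proof.
move=> mS mS'.
have h S0 : step_sets S0 -> void_law S0 S'.
  move=> sS0; suff: measurable `<=` [set S' | measurable S' /\ void_law S0 S'].
    by move=> /(_ _ mS')[].
  apply: monotone_step_sets.
    split=> F mF hF /=; split.
    - by apply: bigcupT_measurable => n; exact: (hF n).1.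
    - apply: (void_law_monotone (fun=> S0) F) => //.
      + by move=> n; exact: measurable_step_sets.
      + by move=> n; exact: (hF n).1.
      + by left; split=> //; rewrite bigcup_const//; exists 0%N.
      + by left.
      + by move=> n; exact: (hF n).2.
    - by apply: bigcapT_measurable => n; exact: (hF n).1.
    - apply: (void_law_monotone (fun=> S0) F) => //.
      + by move=> n; exact: measurable_step_sets.
      + by move=> n; exact: (hF n).1.
      + by left; split=> //; rewrite bigcup_const//; exists 0%N.
      + by right.
      + by move=> n; exact: (hF n).2.
  move=> S1 sS1; split; first exact: measurable_step_sets.
  exact: void_law_step.
suff: measurable `<=` [set S | measurable S /\ void_law S S'].
  by move=> /(_ _ mS)[].
apply: monotone_step_sets.
  split=> F mF hF /=; split.
  - by apply: bigcupT_measurable => n; exact: (hF n).1.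
  - apply: (void_law_monotone F (fun=> S')) => //.
    + by move=> n; exact: (hF n).1.
    + by left.
    + by left; split=> //; rewrite bigcup_const//; exists 0%N.
    + by move=> n; exact: (hF n).2.
  - by apply: bigcapT_measurable => n; exact: (hF n).1.
  - apply: (void_law_monotone F (fun=> S')) => //.
    + by move=> n; exact: (hF n).1.
    + by right.
    + by left; split=> //; rewrite bigcup_const//; exists 0%N.
    + by move=> n; exact: (hF n).2.
by move=> S1 sS1; split; [exact: measurable_step_sets|exact: h].
Qed.

End prm.

(** * Almost sure regularity of the Poisson measures *)

Section prm_ae.
Context {d : measure_display} {T : measurableType d} {R : realType}.
Variables (P : probability T R) (Np Nm : T -> {measure set (R * R) -> \bar R})
  (U0 : T -> R) (g : set R -> \bar R).
Hypothesis prm : PRM_indep P Np Nm U0 g.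

Let mNp : forall D, measurable D -> measurable_fun [set: T] (fun w => Np w D).
Proof. by case: prm. Qed.

Let mNm : forall D, measurable D -> measurable_fun [set: T] (fun w => Nm w D).
Proof. by case: prm => _ []. Qed.

Let mU0 : measurable_fun [set: T] U0.
Proof. by case: prm => _ [_ []]. Qed.

Lemma counts0 (N : T -> {measure set (R * R) -> \bar R}) A k : counts N 0 A k = setT.
Proof. by apply/seteqP; split. Qed.

Lemma counts1 (N : T -> {measure set (R * R) -> \bar R}) A k :
  counts N 1 A k = [set w | N w (A 0%N) = (k 0%N)%:R%:E].
Proof.
apply/seteqP; split => w; first exact.
by move=> h i /=; rewrite ltnS leqn0 => /eqP ->.
Qed.

Lemma PRM_indep_law C : measurable C -> P (U0 @^-1` C) = g C.
Proof.
move=> mC; have [_ [_ [_ h]]] := prm.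
have := h 0%N 0%N (fun=> set0) (fun=> 0%N) (fun=> set0) (fun=> 0%N) C.
rewrite -/(counts Np 0 (fun=> set0) (fun=> 0%N)) -/(counts Nm 0 (fun=> set0) (fun=> 0%N)).
rewrite !counts0 !setTI !big_ord0 !mul1e; exact.
Qed.

Lemma PRM_indep_after : indep_after P Np Nm 0 U0.
Proof.
split => // n m A k B l C [fA tA] [fB tB] mC.
have [_ [_ [_ h]]] := prm.
have sub : `]0, +oo[%classic `*` `[0, +oo[%classic `<=` @quadrant R.
  by move=> -[p q]; rewrite /quadrant/= !in_itv/= !andbT => -[/ltW ? ?].
have qA i : (i < n)%N -> [/\ measurable (A i), A i `<=` quadrant & (leb2 (A i) < +oo)%E].
  by move=> /fA[? ? ?]; split => //; exact: subset_trans sub.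
have qB i : (i < m)%N -> [/\ measurable (B i), B i `<=` quadrant & (leb2 (B i) < +oo)%E].
  by move=> /fB[? ? ?]; split => //; exact: subset_trans sub.
by have := h n m A k B l C qA tA qB tB mC; rewrite -(PRM_indep_law C mC).
Qed.

Definition cell (A : set (R * R)) := [/\ measurable A, A `<=` quadrant & (leb2 A < +oo)%E].

Let gT : g setT = 1%E.
Proof. by rewrite -PRM_indep_law// preimage_setT probability_setT. Qed.

Lemma PRM_pair A k B l : cell A -> cell B ->
  P ([set w | Np w A = k%:R%:E] `&` [set w | Nm w B = l%:R%:E]) =
  ((pois (fine (leb2 A)) k)%:E * (pois (fine (leb2 B)) l)%:E)%E.
Proof.
move=> hA hB; have [_ [_ [_ h]]] := prm.
have := h 1%N 1%N (fun=> A) (fun=> k) (fun=> B) (fun=> l) setT.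
rewrite -/(counts Np 1 (fun=> A) (fun=> k)) -/(counts Nm 1 (fun=> B) (fun=> l)).
rewrite !counts1 preimage_setT setIT !big_ord1 gT mule1; apply => //.
- by move=> i j; rewrite !ltnS !leqn0 => /eqP -> /eqP ->.
- by move=> i j; rewrite !ltnS !leqn0 => /eqP -> /eqP ->.
Qed.

Lemma PRM_plus A k : cell A -> P [set w | Np w A = k%:R%:E] = (pois (fine (leb2 A)) k)%:E.
Proof.
move=> hA; have [_ [_ [_ h]]] := prm.
have := h 1%N 0%N (fun=> A) (fun=> k) (fun=> set0) (fun=> 0%N) setT.
rewrite -/(counts Np 1 (fun=> A) (fun=> k)) -/(counts Nm 0 (fun=> set0) (fun=> 0%N)).
rewrite counts1 counts0 preimage_setT !setIT big_ord1 big_ord0 gT !mule1; apply => //.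
by move=> i j; rewrite !ltnS !leqn0 => /eqP -> /eqP ->.
Qed.

Lemma PRM_minus A k : cell A -> P [set w | Nm w A = k%:R%:E] = (pois (fine (leb2 A)) k)%:E.
Proof.
move=> hA; have [_ [_ [_ h]]] := prm.
have := h 0%N 1%N (fun=> set0) (fun=> 0%N) (fun=> A) (fun=> k) setT.
rewrite -/(counts Np 0 (fun=> set0) (fun=> 0%N)) -/(counts Nm 1 (fun=> A) (fun=> k)).
rewrite counts1 counts0 preimage_setT setTI !setIT big_ord1 big_ord0 gT !mule1 mul1e; apply => //.
by move=> i j; rewrite !ltnS !leqn0 => /eqP -> /eqP ->.
Qed.

Lemma pois_ge0 (r : R) k : 0 <= r -> 0 <= pois r k.
Proof. by move=> r0; rewrite /pois divr_ge0// mulr_ge0 ?expR_ge0// exprn_ge0. Qed.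

Lemma pois_sum (r : R) : 0 < r -> (\sum_(k <oo) (pois r k)%:E = 1)%E.
Proof.
move=> r0; rewrite (eq_eseriesr (g := fun k => (expR (- r))%:E * (exp_coeff r k)%:E))%E; last first.
  by move=> k _; rewrite -EFinM /exp_coeff /= /pois mulrA.
rewrite nneseriesZl; last by move=> k _; rewrite lee_fin exp_coeff_ge0// ltW.
rewrite (_ : \sum_(k <oo) _ = (expR r)%:E)%E; last first.
  rewrite /expR -EFin_lim; last exact: is_cvg_series_exp_coeff.
  by apply: congr_lim; apply/funext => n /=; rewrite /series /= sumEFin.
by rewrite -EFinM -expRD addNr expR0.
Qed.

Let isnat1 (N : T -> {measure set (R * R) -> \bar R}) A :
  (forall D, measurable D -> measurable_fun [set: T] (fun w => N w D)) ->
  (forall k, P [set w | N w A = k%:R%:E] = (pois (fine (leb2 A)) k)%:E) ->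
  cell A ->
  measurable [set w | isnat (N w A)] /\ P [set w | isnat (N w A)] = 1%E.
Proof.
move=> mN hN [mA _ _].
have mNk k : measurable [set w | N w A = k%:R%:E].
  by have := mN _ mA measurableT _ (emeasurable_set1 k%:R%:E); rewrite setTI.
have E : [set w | isnat (N w A)] = \bigcup_k [set w | N w A = k%:R%:E].
  by apply/seteqP; split => w [k]; [exists k|move=> _ h; exists k].
have mU : measurable (\bigcup_k [set w | N w A = k%:R%:E]) by exact: bigcupT_measurable.
rewrite E; split => //.
(* The Poisson weights are summed for a positive rate; at rate 0 the count 0 alone has probability
   1. *)
have [r0|r0] := ltP 0 (fine (leb2 A)).
  rewrite measure_semi_bigcup//.
    by rewrite -[RHS](pois_sum _ r0); apply: eq_eseriesr => k _; exact: hN.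
  apply/trivIsetP => i j _ _ /eqP ij; apply/seteqP; split => // w /= [-> [] /eqP].
  by rewrite eqr_nat => /eqP.
apply/eqP; rewrite eq_le probability_le1//=.
have A0 : fine (leb2 A) = 0 by apply/eqP; rewrite eq_le r0 fine_ge0.
have <- : P [set w | N w A = 0%:R%:E] = 1%E by rewrite hN A0 pois_0 oppr0 expR0.
by rewrite le_measure ?inE// => w h; exists 0%N.
Qed.

(** No simultaneous points below level [M], neither within one measure nor across the two. This is
    what bounds by one the number of resets at a given time. *)
Definition simple_upto (M : R) (w : T) := forall r, 0 < r -> r <= M ->
  (Np w ([set r] `*` `[0%R, M]) + Nm w ([set r] `*` `[0%R, M]) <= 1)%E.

Let grid (M : R) n i : set (R * R) :=
  `]i%:R * (M / n.+1%:R), i.+1%:R * (M / n.+1%:R)]%classic `*` `[0, M]%classic.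

Let few A : set T := ([set w | Np w A = 0%:R%:E] `&` [set w | Nm w A = 0%:R%:E]) `|`
  (([set w | Np w A = 1%:R%:E] `&` [set w | Nm w A = 0%:R%:E]) `|`
   ([set w | Np w A = 0%:R%:E] `&` [set w | Nm w A = 1%:R%:E])).

Let mNk (N : T -> {measure set (R * R) -> \bar R}) A (k : nat) : measurable A ->
  (forall D, measurable D -> measurable_fun [set: T] (fun w => N w D)) ->
  measurable [set w | N w A = k%:R%:E].
Proof.
by move=> mA mN; have := mN _ mA measurableT _ (emeasurable_set1 k%:R%:E); rewrite setTI.
Qed.

Let mfew A : measurable A -> measurable (few A).
Proof.
move=> mA; apply: measurableU; last apply: measurableU.
- by apply: measurableI; exact: mNk.
- by apply: measurableI; exact: mNk.
- by apply: measurableI; exact: mNk.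
Qed.

(** For area [r] the probability of at most one point is [expR (- 2 * r) * (1 + 2 * r)]. Since
    [expR (- 2 * r)] is at least [1 - 2 * r], the complement is at most [4 * r ^+ 2]. *)
Let Pfew A : cell A -> (P (~` few A) <= (4 * fine (leb2 A) ^+ 2)%:E)%E.
Proof.
move=> hA; have [mA _ _] := hA; rewrite probability_setC; last exact: mfew.
have mI i j : measurable ([set w | Np w A = i%:R%:E] `&` [set w | Nm w A = j%:R%:E]).
  by apply: measurableI; exact: mNk.
have P3 : P (few A) = ((pois (fine (leb2 A)) 0)%:E * (pois (fine (leb2 A)) 0)%:E +
   ((pois (fine (leb2 A)) 1)%:E * (pois (fine (leb2 A)) 0)%:E +
    (pois (fine (leb2 A)) 0)%:E * (pois (fine (leb2 A)) 1)%:E))%E.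
  rewrite /few measureU//; last 2 first.
  - by apply: measurableU; exact: mI.
  - apply/seteqP; split => // w /= [[-> ->]] [[]|[]] /eqP; rewrite ?eqe ?eqr_nat//.
    by move=> _ [] /eqP; rewrite eqr_nat.
  rewrite measureU//; last first.
    by apply/seteqP; split => // w /= [[-> ->]] [] [] /eqP; rewrite eqr_nat.
  by congr (_ + (_ + _))%E; exact: PRM_pair.
rewrite P3 -!EFinM -!EFinD lee_fin pois_0 /pois expr1 factS fact0 divr1.
set r := fine _; have r0 : 0 <= r by exact: fine_ge0.
have e1 : 1 - r <= expR (- r) by exact: expR_ge1Dx.
have e0 : 0 < expR (- r) by exact: expR_gt0.
rewrite lerBlDr.
rewrite (_ : _ + _ = 4 * r ^+ 2 + (expR (- r) * expR (- r)) * (1 + 2 * r)); last by ring.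
have : expR (- r) * expR (- r) >= 1 - 2 * r.
  rewrite -expRD (_ : - r + - r = - (2 * r)); last by ring.
  exact: expR_ge1Dx.
move=> h; rewrite -lerBlDl (@le_trans _ _ ((1 - 2 * r) * (1 + 2 * r)))//; first by lra.
by rewrite ler_wpM2r//; lra.
Qed.

(** Integrality holds on countably many dyadic rectangles at once. For simultaneous points, cut the
    square of side [M] into [n.+1] strips of area [M ^+ 2 / n.+1]: some strip holds two points with
    probability at most [4 * M ^+ 4 / n.+1], so almost surely some grid has at most one point in
    each strip. *)
Lemma PRM_ae : exists G : set T, [/\ measurable G, P G = 1%E &
  forall w, G w -> [/\ (forall M : nat, counting_on (Np w) (sqbox M%:R)),
    (forall M : nat, counting_on (Nm w) (sqbox M%:R)) &
    (forall M : nat, simple_upto M%:R w)]].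
Proof.
pose dy n i j : set (R * R) := `[0, i%:R / 2 ^+ n]%classic `*` `[0, j%:R / 2 ^+ n]%classic.
have cdy n i j : cell (dy n i j).
  split; first exact: measurableX.
    by move=> -[p q]; rewrite /quadrant/dy/= !in_itv/= !andbT => -[/andP[-> _] /andP[-> _]].
  rewrite leb2X// /leb !lebesgue_measure_itv/=.
  by case: ifPn => _; case: ifPn => _; rewrite ?mule0 ?mul0e// -!EFinB -EFinM ltry.
pose E t := [set w | isnat (Np w (dy t.1.1 t.1.2 t.2))] `&` [set w | isnat (Nm w (dy t.1.1 t.1.2 t.2))].
have mE t : measurable (E t) /\ P (E t) = 1%E.
  have [m1 p1] := isnat1 Np _ mNp (fun k => PRM_plus _ k (cdy t.1.1 t.1.2 t.2)) (cdy t.1.1 t.1.2 t.2).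
  have [m2 p2] := isnat1 Nm _ mNm (fun k => PRM_minus _ k (cdy t.1.1 t.1.2 t.2)) (cdy t.1.1 t.1.2 t.2).
  split; first exact: measurableI.
  by rewrite probability_setI1.
pose B M n := \bigcup_(i in `I_(n.+1)) ~` few (grid M%:R n i).
have mgrid M n i : measurable (grid M n i) by exact: measurableX.
have mB M n : measurable (B M n).
  by apply: fin_bigcup_measurable => // i _; apply: measurableC; exact: mfew.
have gridC (M n i : nat) : cell (grid M%:R n i) /\ fine (leb2 (grid M%:R n i)) = M%:R ^+ 2 / n.+1%:R.
  have M0 : 0 <= M%:R / n.+1%:R :> R by rewrite divr_ge0.
  have lE : leb2 (grid M%:R n i) = (M%:R ^+ 2 / n.+1%:R)%:E.
    rewrite leb2X// /leb !lebesgue_measure_itv/= !lte_fin.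
    case: M M0 => [|M] M0; first by rewrite !mul0r !mulr0 ltxx mul0e expr0n mul0r.
    rewrite ltr_pM2r ?divr_gt0// ltr_nat ltnSn ltr0n -!EFinB -EFinM -mulrBl -natrB// subSnn.
    by rewrite mul1r subr0 expr2 mulrAC.
  split; last by rewrite lE.
  split => //; last by rewrite lE ltry.
  move=> -[p q]; rewrite /quadrant/grid/= !in_itv/= !andbT => -[/andP[+ _] /andP[-> _]].
  by move=> /ltW /(le_trans _) -> //; rewrite mulr_ge0.
have PB (M n : nat) : (P (B M n) <= (4 * M%:R ^+ 4 / n.+1%:R)%:E)%E.
  have := @Boole_inequality _ _ _ P (fun i => ~` few (grid M%:R n i)) n.+1.
  move=> /(_ (fun i _ => measurableC (mfew _ (mgrid _ _ _)))) h.
  rewrite /B bigcup_mkord; apply: (le_trans h).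
  apply: (@le_trans _ _ (\sum_(i < n.+1) (4 * (M%:R ^+ 2 / n.+1%:R) ^+ 2)%:E)%E).
    apply: lee_sum => i _; have [c e] := gridC M n i.
    by rewrite -e; exact: Pfew.
  rewrite sumEFin lee_fin sumr_const card_ord -mulr_natl.
  rewrite le_eqVlt; apply/orP; left; apply/eqP; field.
  by rewrite addrC natr1 pnatr_eq0.
(* The event that every grid is bad; its probability is below that of each single grid, and these
   tend to 0. *)
pose Z M := \bigcap_n B M n.
have mZ M : measurable (Z M) by exact: bigcapT_measurable.
have PZ M : P (Z M) = 0%E.
  apply/eqP; rewrite eq_le measure_ge0 andbT; apply/lee_addgt0Pr => e e0; rewrite add0e.
  pose n := Num.truncn (4 * M%:R ^+ 4 / e : R).
  apply: (@le_trans _ _ (P (B M n))); first by rewrite le_measure ?inE// => w; exact.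
  apply: (le_trans (PB M n)); rewrite lee_fin ler_pdivrMr// [leRHS]mulrC -ler_pdivrMr//.
  by rewrite ltW// truncnS_gt.
pose G := (\bigcap_t E t) `&` ~` \bigcup_M Z M.
have mcapE : measurable (\bigcap_t E t).
  have -> : \bigcap_t E t = ~` \bigcup_t ~` E t by rewrite setC_bigcup; apply: eq_bigcapr => t _; rewrite setCK.
  apply: measurableC; apply: countable_bigcupT_measurable => // t; apply: measurableC.
  exact: (mE t).1.
have mG : measurable G.
  by apply: measurableI => //; apply: measurableC; exact: bigcupT_measurable.
have PnG : P (~` G) = 0%E.
  apply/negligibleP; first exact: measurableC.
  rewrite /G setCI setCK; apply: negligibleU; last first.
    by apply: negligible_bigcup => M; apply/negligibleP; [exact: mZ|exact: PZ].
  have -> : (~` (\bigcap_t E t)) = \bigcup_k (if unpickle k is Some t then ~` E t else set0).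
    rewrite setC_bigcap; apply/seteqP; split => w.
      by move=> [t _ nt]; exists (pickle t) => //=; rewrite pickleK.
    by move=> [k _]; case: unpickle => // t nt; exists t.
  apply: negligible_bigcup => k; case: unpickle => [t|]; last exact: negligible_set0.
  have [m1 p1] := mE t; apply/negligibleP; first exact: measurableC.
  by have := probability_setC P m1; rewrite p1 subee.
exists G; split => //.
  by rewrite -(setCK G) probability_setC ?PnG ?sube0//; exact: measurableC.
move=> w [Ew Zw]; split.
- by move=> M; apply: counting_on_dyadic => n i j; have [] := Ew (n, i, j) I.
- by move=> M; apply: counting_on_dyadic => n i j; have [] := Ew (n, i, j) I.
- move=> M r r0 rM.
  have M0 : (0 < M)%N by rewrite -(ltr_nat R) (lt_le_trans r0).
  have : ~ Z M w by move=> ZMw; apply: Zw; exists M.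
  move/existsNP => [n] /not_implyP [_ Bw].
  have [i iN ri] : exists2 i, (i < n.+1)%N & i%:R * (M%:R / n.+1%:R) < r <= i.+1%:R * (M%:R / n.+1%:R).
    pose q := r / (M%:R / n.+1%:R).
    have q0 : 0 < q by rewrite !divr_gt0// ltr0n.
    have qE : r = q * (M%:R / n.+1%:R).
      by rewrite /q divfK// gt_eqF// divr_gt0// ltr0n.
    have qn : q <= n.+1%:R by rewrite /q ler_pdivrMr ?divr_gt0 ?ltr0n// mulrC divfK ?pnatr_eq0.
    have hM : 0 < M%:R / n.+1%:R :> R by rewrite divr_gt0 ?ltr0n.
    pose t := Num.truncn q; have /andP[t1 t2] := truncn_itv (ltW q0).
    (* The strips are open on the left. A grid time therefore belongs to the strip that ends there,
       whose index is the predecessor of the truncation. *)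
    have [qt|qt] := eqVneq q t%:R.
      exists t.-1.
        move: (qn); rewrite qt ler_nat; have: (0 < t)%N by rewrite -(ltr_nat R) -qt.
        by case: (t) => //= t'.
      have t0 : (0 < t)%N by rewrite -(ltr_nat R) -qt.
      by rewrite qE qt prednK// lexx andbT ltr_pM2r// ltr_nat ltn_predL.
    exists t; last by rewrite qE ltr_pM2r// ler_pM2r// (ltW t2) andbT lt_neqAle eq_sym qt.
    by rewrite -(ltr_nat R) (lt_le_trans _ qn)// lt_neqAle eq_sym qt.
  have fw : few (grid M%:R n i) w.
    by apply: contrapT => nf; apply: Bw; exists i.
  apply: (@le_trans _ _ (Np w (grid M%:R n i) + Nm w (grid M%:R n i))%E).
    apply: leeD; apply: le_measure; rewrite ?inE//; try exact: measurableX.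
    + by move=> -[p q] /= [-> ?]; split => //=; rewrite in_itv.
    + by move=> -[p q] /= [-> ?]; split => //=; rewrite in_itv.
  by case: fw => [[/= -> ->]|[[/= -> ->]|[/= -> ->]]]; rewrite -EFinD lee_fin ?addr0 ?add0r.
Qed.

End prm_ae.

(** * Pathwise study of the equation with constant drift *)

Section integral_tools.
Context {d : measure_display} {X : measurableType d} {R : realType}.
Variable m : {measure set X -> \bar R}.

Lemma cvg_integral_sets (D : set X) (f : X -> \bar R) (A : nat -> set X) (A' : set X) :
  measurable D -> m.-integrable D f ->
  (forall n, measurable (A n)) -> measurable A' ->
  (forall n, A n `<=` D) -> A' `<=` D ->
  (forall x, \forall n \near \oo, A n x <-> A' x) ->
  (\int[m]_(x in A n) f x)%E @[n --> \oo] --> (\int[m]_(x in A') f x)%E.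
Proof.
move=> mD intf mA mA' AD A'D cA.
have mf := measurable_int m intf.
have E B : measurable B -> B `<=` D -> (\int[m]_(x in B) f x = \int[m]_(x in D) (f \_ B) x)%E.
  by move=> mB BD; rewrite -integral_mkcondr setIidr.
rewrite E//; under eq_fun do rewrite E//.
have mfB B : measurable B -> measurable_fun D (f \_ B).
  move=> mB; apply/(measurable_restrict f mB mD).
  by apply: measurable_funS mf => //; exact: subIsetr.
have [] := @dominated_convergence _ X R m D mD (fun n => f \_ (A n)) (f \_ A') (abse \o f)
  (fun n => mfB _ (mA n)) (mfB _ mA') _ _ _ => //.
- apply: aeW => x Dx; apply: cvg_near_cst; apply: filterS (cA x) => n An.
  by rewrite /patch; case: ifPn => [/set_mem/An/mem_set ->//|/negP nA]; case: ifPn => // /set_mem/An/mem_set.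
- exact: integrable_abse.
- by apply: aeW => x n Dx; rewrite /patch /=; case: ifPn => // _; rewrite abse0.
Qed.

End integral_tools.

Lemma divS_le {R : realType} (x : R) (n : nat) : 0 <= x -> x / n.+1%:R <= x.
Proof. by move=> x0; rewrite ler_pdivrMr// ler_peMr// ler1n. Qed.

(** Each occurrence after the first raises the potential [a] by at least 1. The induction compares
    the number of occurrences with the potential at the last one. *)
Lemma count_separated {R : realType} (b : nat -> bool) (a : nat -> R) (n : nat) :
  (forall i, 0 <= a i) -> (forall i j, (i <= j)%N -> a i <= a j) ->
  (forall i j, (i < j)%N -> b i -> b j -> a i + 1 <= a j) ->
  (\sum_(i < n) b i)%:R <= 1 + a n :> R.
Proof.
move=> a0 am sep.
have key : (\sum_(i < n) b i = 0)%N \/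
    exists i, [/\ (i < n)%N, b i & (\sum_(i < n) b i)%:R <= 1 + a i :> R].
  elim: n => [|n IH]; first by left; rewrite big_ord0.
  rewrite big_ord_recr /=; have [bn|bn] := boolP (b n); last first.
    by rewrite addn0; case: IH => [->|[i [ni bi h]]]; [left|right; exists i; split => //; exact: ltnW].
  right; exists n; split => //; case: IH => [->|[i [ni bi h]]]; first by rewrite add0n lerDl.
  by rewrite natrD [leRHS]addrC lerD// (le_trans h)// addrC sep.
case: key => [->|[i [ni _ h]]]; first by rewrite addr_ge0.
by rewrite (le_trans h)// lerD2l am// ltnW.
Qed.

Section path.
Context {R : realType}.
Variables (Np Nm : {measure set (R * R) -> \bar R}) (u : R -> R) (c : R) (phi : R -> R).
Hypotheses (cNp : forall M : nat, counting_on Np (sqbox M%:R))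
           (cNm : forall M : nat, counting_on Nm (sqbox M%:R)).
Hypothesis simpleN : forall (M : nat) (r : R), 0 < r -> r <= M%:R ->
  (Np ([set r] `*` `[0%R, M%:R]) + Nm ([set r] `*` `[0%R, M%:R]) <= 1)%E.
Hypotheses (rc : forall t : R, 0 <= t -> u @ t^'+ --> u t)
           (ll : forall t : R, 0 < t -> cvg (u @ t^'-)).

Definition jump (o : R) (p : R * R) : \bar R :=
  (left_lim u p.1 * ((p.2 <= phi (o * left_lim u p.1))%R : bool)%:R)%:E.

Definition strip (a b : R) : set (R * R) := `]a, b]%classic `*` `[0, +oo[%classic.

Hypotheses (intp : forall t : R, 0 <= t -> Np.-integrable (strip 0 t) (jump 1))
           (intm : forall t : R, 0 <= t -> Nm.-integrable (strip 0 t) (jump (-1))).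

Definition J (A : set (R * R)) : \bar R :=
  (\int[Np]_(p in A) jump 1 p + \int[Nm]_(p in A) jump (-1) p)%E.

(** The total variation of the jumps carried by [A]. Unlike [J] it is monotone in the region, and
    its smallness excludes jumps from states away from 0. *)
Definition absJ (A : set (R * R)) : \bar R :=
  (\int[Np]_(p in A) `|jump 1 p| + \int[Nm]_(p in A) `|jump (-1) p|)%E.

Hypothesis eqn : forall t : R, 0 <= t -> ((u t)%:E = (u 0)%:E - J (strip 0 t) + (c * t)%:E)%E.

Let mstrip a b : measurable (strip a b). Proof. exact: measurableX. Qed.

Let intpS (A : set (R * R)) (t : R) : 0 <= t -> measurable A -> A `<=` strip 0 t -> Np.-integrable A (jump 1).
Proof. by move=> t0 mA At; apply: integrableS (intp _ t0). Qed.

Let intmS (A : set (R * R)) (t : R) : 0 <= t -> measurable A -> A `<=` strip 0 t -> Nm.-integrable A (jump (-1)).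
Proof. by move=> t0 mA At; apply: integrableS (intm _ t0). Qed.

Let strip_sub (a b : R) : 0 <= a -> strip a b `<=` strip 0 b.
Proof.
move=> a0 -[p q] [/=]; rewrite !in_itv/= => /andP[ap pb] q0.
by rewrite /strip/= !in_itv/= pb (le_lt_trans a0 ap).
Qed.

Lemma J_fin (A : set (R * R)) (t : R) : 0 <= t -> measurable A -> A `<=` strip 0 t -> J A \is a fin_num.
Proof.
move=> t0 mA At; rewrite fin_numD.
by rewrite !integrable_fin_num//; [exact: intmS At|exact: intpS At].
Qed.

Lemma J_setU (A B : set (R * R)) (t : R) : 0 <= t -> measurable A -> measurable B -> A `<=` strip 0 t ->
  B `<=` strip 0 t -> [disjoint A & B] -> J (A `|` B) = (J A + J B)%E.
Proof.
move=> t0 mA mB At Bt AB.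
have ABt : A `|` B `<=` strip 0 t by rewrite subUset.
rewrite /J !integral_setU//.
- by rewrite addeACA.
- by apply: (measurable_int Nm (intmS _ _ t0 _ ABt)); exact: measurableU.
- by apply: (measurable_int Np (intpS _ _ t0 _ ABt)); exact: measurableU.
Qed.

Lemma incr (s t : R) : 0 <= s -> s <= t -> ((u t)%:E = (u s)%:E - J (strip s t) + (c * (t - s))%:E)%E.
Proof.
move=> s0 st; have t0 := le_trans s0 st.
have E : strip 0 t = strip 0 s `|` strip s t.
  rewrite /strip [in LHS](@itv_bndbnd_setU _ _ (BRight 0) (BRight s)) ?bnd_simp//.
  by apply/seteqP; split => -[p q] /=; tauto.
have Fs : strip 0 s `<=` strip 0 t by rewrite E; exact: subsetUl.
have Ft : strip s t `<=` strip 0 t by exact: strip_sub.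
have := eqn _ t0; rewrite E (J_setU _ _ _ t0)//; last first.
  apply/disj_setPS => -[p q] [[/= + _] [/= + _]]; rewrite !in_itv/= => /andP[_ ps] /andP[/lt_le_trans/(_ ps)].
  by rewrite ltxx.
have := eqn _ s0.
have := J_fin _ _ t0 (mstrip _ _) Fs; have := J_fin _ _ t0 (mstrip _ _) Ft.
case: (J (strip s t)) => // j2 _; case: (J (strip 0 s)) => // j1 _.
rewrite -[(j1%:E + _)%E]EFinD -!EFinB -!EFinD => -[us] -[ut]; congr EFin; rewrite ut us; ring.
Qed.

Lemma absJ_cvg (t : R) (A : nat -> set (R * R)) (A' : set (R * R)) : 0 <= t ->
  (forall n, measurable (A n)) -> measurable A' ->
  (forall n, A n `<=` strip 0 t) -> A' `<=` strip 0 t ->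
  (forall x, \forall n \near \oo, A n x <-> A' x) ->
  absJ (A n) @[n --> \oo] --> absJ A' /\ J (A n) @[n --> \oo] --> J A'.
Proof.
move=> t0 mA mA' At A't cA; split; apply: cvgeD.
- by apply: ge0_adde_def; rewrite inE integral_ge0.
- exact: (cvg_integral_sets Np (strip 0 t) _ _ _ (mstrip _ _) (integrable_abse (intp _ t0))).
- exact: (cvg_integral_sets Nm (strip 0 t) _ _ _ (mstrip _ _) (integrable_abse (intm _ t0))).
- by apply: fin_num_adde_defr; apply: integrable_fin_num => //; exact: intpS A't.
- exact: (cvg_integral_sets Np (strip 0 t) _ _ _ (mstrip _ _) (intp _ t0)).
- exact: (cvg_integral_sets Nm (strip 0 t) _ _ _ (mstrip _ _) (intm _ t0)).
Qed.

(** On each square the mass is an integer below 1, hence 0; the squares exhaust the strip. *)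
Lemma count_lt1 (m : {measure set (R * R) -> \bar R}) (Q : set (R * R)) (t : R) :
  (forall M : nat, counting_on m (sqbox M%:R)) ->
  measurable Q -> Q `<=` strip 0 t -> (m Q < 1)%E -> m Q = 0%E.
Proof.
move=> cm mQ Qt mQ1.
have h (M : nat) : m (Q `&` sqbox M%:R) = 0%E.
  have mI : measurable (Q `&` sqbox M%:R) by apply: measurableI => //; exact: measurable_sqbox.
  have [k kE] := cm M _ mI (@subIsetr _ _ _).
  have : (m (Q `&` sqbox M%:R) < 1)%E.
    by apply: le_lt_trans mQ1; rewrite le_measure ?inE.
  by rewrite kE lte_fin (ltr_nat _ _ 1) ltnS leqn0 => /eqP ->.
apply/negligibleP => //.
rewrite (_ : Q = \bigcup_(M in [set: nat]) (Q `&` sqbox M%:R)); last first.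
  rewrite -setI_bigcupr setIidl// => -[p q] /Qt[/=]; rewrite !in_itv/= andbT => /andP[p0 _] q0.
  exists (Num.truncn (Num.max p q)).+1 => //; split; rewrite /= in_itv/= ?q0 ?(ltW p0)/=.
    by rewrite (@le_trans _ _ (Num.max p q)) ?le_max ?lexx// ltW// truncnS_gt.
  by rewrite (@le_trans _ _ (Num.max p q)) ?le_max ?lexx ?orbT// ltW// truncnS_gt.
apply: negligible_bigcup => M; apply/negligibleP => //.
  by apply: measurableI => //; exact: measurable_sqbox.
exact: h.
Qed.

(* The indicator of an accepted atom is integer valued, so a set on which the
   state stays away from [0] and the total jump is small contains no atom. *)
Lemma no_jump (A : set (R * R)) (t e : R) : 0 <= t -> 0 < e -> measurable A -> A `<=` strip 0 t ->
  (forall p, A p -> e <= `|left_lim u p.1|) -> (absJ A < e%:E)%E ->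
  forall B, measurable B -> B `<=` A -> J B = 0%E.
Proof.
move=> t0 e0 mA At eA hA B mB BA.
have one (m : {measure set (R * R) -> \bar R}) o :
    (forall M : nat, counting_on m (sqbox M%:R)) -> m.-integrable (strip 0 t) (jump o) ->
    (\int[m]_(p in A) `|jump o p| < e%:E)%E -> (\int[m]_(p in B) jump o p = 0)%E.
  move=> cm im hm.
  have mf : measurable_fun A (jump o) by apply: (measurable_funS _ At (measurable_int m im)).
  pose Q := A `&` [set p | jump o p != 0%E].
  have mQ : measurable Q by exact: emeasurable_neq.
  have Q0 : m Q = 0%E.
    apply: (count_lt1 m Q t) => //; first by move=> p [/At].
    rewrite -(@lte_pmul2l _ e%:E)// mule1; apply: le_lt_trans hm.
    rewrite -integral_cst//.
    apply: (@le_trans _ _ (\int[m]_(p in Q) `|jump o p|)%E).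
      apply: ge0_le_integral => //.
      - by move=> p _; rewrite lee_fin ltW.
      - by apply: measurable_funS (measurableT_comp (@abse_measurable _ _) mf) => // p [].
      - move=> p [/eA ep]; rewrite /jump /=; case: (_ <= _) => /=; rewrite ?mulr1 ?mulr0 ?eqxx//.
    apply: ge0_subset_integral => //; last by move=> p [].
    exact: measurableT_comp.
  rewrite -(integral0 m B); apply: ae_eq_integral => //.
  - exact: measurable_funS mf.
  - exists Q; split => // p /= /not_implyP[Bp jp]; split; first exact: BA.
    by apply/eqP => j0; apply: jp.
have le1 : (\int[Np]_(p in A) `|jump 1 p| < e%:E)%E.
  by apply: le_lt_trans hA; rewrite /absJ leeDl// integral_ge0.
have le2 : (\int[Nm]_(p in A) `|jump (-1) p| < e%:E)%E.
  by apply: le_lt_trans hA; rewrite /absJ leeDr// integral_ge0.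
by rewrite /J (one Np 1)// ?(one Nm (-1)) ?adde0//; [exact: intm|exact: intp].
Qed.


Lemma linear_on A (t e s s' : R) : 0 <= t -> 0 < e -> measurable A -> A `<=` strip 0 t ->
  (forall p, A p -> e <= `|left_lim u p.1|) -> (absJ A < e%:E)%E ->
  0 <= s -> s <= s' -> strip s s' `<=` A -> u s' = u s + c * (s' - s).
Proof.
move=> t0 e0 mA At eA hA s0 ss' sA; have := incr _ _ s0 ss'.
by rewrite (no_jump A t e)// sube0 -EFinD => -[].
Qed.

Lemma left_lim_near (a b x e : R) (l : R) : a < x -> x <= b ->
  (forall y : R, a < y -> y < b -> `|l - u y| <= e) -> 0 < x -> `|l - left_lim u x| <= e.
Proof.
move=> ax xb h x0.
have cu : (fun y => `|l - u y|) @ x^'- --> `|l - left_lim u x|.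
  by apply: cvg_norm; apply: cvgB; [exact: cvg_cst|exact: ll].
apply: (ler_cvg_to cu (cvg_cst e)); near=> y; apply: h.
  near: y; exact: nbhs_left_gt.
apply: lt_le_trans xb; near: y; exact: nbhs_left_lt.
Unshelve. all: by end_near. Qed.

(** Just after [r] the left limits stay at distance at least half of [|u r|] from 0, while the
    variation of the jumps over a shrinking strip tends to 0. Once it falls below that distance, no
    jump is left and only the drift acts. *)
Lemma right_linear (r : R) : 0 <= r -> u r != 0 ->
  exists2 n : R, 0 < n & forall s : R, r <= s -> s < r + n -> u s = u r + c * (s - r).
Proof.
move=> r0 ur0.
pose e := `|u r| / 2; have e0 : 0 < e by rewrite divr_gt0// normr_gt0.
have [dl dl0 hd] : exists2 dl : R, 0 < dl & forall s : R, r < s -> s < r + dl -> `|u r - u s| <= e.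
  have /cvgrPdist_le /(_ _ e0) := rc _ r0.
  rewrite near_withinE => -[dl /= dl0 hd]; exists dl => // s rs sd.
  by apply: hd => //=; rewrite distrC gtr0_norm ?subr_gt0// ltrBlDl.
pose A (n : nat) := strip r (r + dl / 2 / n.+1%:R).
have t0 : 0 <= r + dl / 2 by rewrite addr_ge0// divr_ge0// ltW.
have An n : A n `<=` strip 0 (r + dl / 2).
  apply: subset_trans (strip_sub _ _ r0) _ => -[p q] [/=]; rewrite !in_itv/= => /andP[p0 pr] ?.
  rewrite /strip/= !in_itv/= p0/=; split => //; apply: (le_trans pr).
  by rewrite lerD2l divS_le// divr_ge0// ltW.
have cvA : forall x, \forall n \near \oo, A n x <-> set0 x.
  move=> -[p q]; have [pr|pr] := leP p r.
    near=> n; split => //; rewrite /A /strip/= !in_itv/= => -[/andP[rp _] _].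
    by move: rp; rewrite ltNge pr.
  near=> n; split => //; rewrite /A /strip/= !in_itv/= => -[/andP[_ +] _].
  rewrite leNgt => /negP; apply; rewrite -ltrBrDl ltr_pdivrMr// [ltRHS]mulrC -ltr_pdivrMr ?subr_gt0//.
  rewrite (lt_le_trans (truncnS_gt _))// ler_nat ltnS; near: n; exact: nbhs_infty_ge.
have [cA _] := absJ_cvg _ A set0 t0 (fun n => mstrip _ _) measurable0 An (@sub0set _ _) cvA.
have absJ0 : absJ set0 = 0%E by rewrite /absJ !integral_set0 adde0.
rewrite absJ0 in cA.
have [n _ hn] : \forall n \near \oo, (absJ (A n) < e%:E)%E.
  apply: (cA [set x | (x < e%:E)%E]); apply: open_nbhs_nbhs; split; last by rewrite /= lte_fin.
  exact: open_ereal_lt_ereal.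
exists (dl / 2 / n.+1%:R); first by rewrite divr_gt0// divr_gt0.
move=> s rs sn.
apply: (linear_on (A n) (r + dl / 2) e) => //.
- exact: mstrip.
- move=> p [/=]; rewrite in_itv/= => /andP[rp pn] _.
  have pd : p.1 < r + dl.
    apply: (le_lt_trans pn); rewrite ltrD2l.
    rewrite (le_lt_trans (divS_le _ _ _)) ?divr_ge0 ?(ltW dl0)//.
    by rewrite ltr_pdivrMr// ltr_pMr// ltr1n.
  have := left_lim_near r (r + dl) p.1 e (u r) rp (ltW pd) hd (le_lt_trans r0 rp).
  move=> h; have : `|u r| - `|u r - left_lim u p.1| <= `|left_lim u p.1|.
    by rewrite lerBlDr (le_trans _ (ler_normD _ _))// addrC subrK.
  apply: le_trans; rewrite lerBrDl (le_trans (lerD h (lexx _)))//.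
  by rewrite -splitr.
- exact: (hn n (leqnn n)).
- move=> p [/=]; rewrite !in_itv/= => /andP[rp ps] p0; rewrite /A /strip/= !in_itv/= rp/=.
  by split => //; apply: (le_trans ps); exact: ltW.
Unshelve. all: by end_near. Qed.

(** The mirror argument, from a nonzero left limit. The strips exclude [r] itself, so a reset at [r]
    is allowed, and they are truncated at time 0. *)
Lemma left_linear (r : R) : 0 < r -> left_lim u r != 0 ->
  exists2 n : R, 0 < n & forall s : R, 0 <= s -> r - n < s -> s < r -> u s = left_lim u r - c * (r - s).
Proof.
move=> r0 ur0; set v := left_lim u r.
pose e := `|v| / 2; have e0 : 0 < e by rewrite divr_gt0// normr_gt0.
have [dl dl0 hd] : exists2 dl : R, 0 < dl & forall s : R, r - dl < s -> s < r -> `|v - u s| <= e.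
  have /cvgrPdist_le /(_ _ e0) : u @ r^'- --> v by exact: ll.
  rewrite near_withinE => -[dl /= dl0 hd]; exists dl => // s rs sd.
  by apply: hd => //=; rewrite gtr0_norm ?subr_gt0// ltrBlDr -ltrBlDl.
pose a (n : nat) := Num.max 0 (r - dl / n.+1%:R).
pose A (n : nat) : set (R * R) := `]a n, r[%classic `*` `[0, +oo[%classic.
have mA n : measurable (A n) by exact: measurableX.
have An n : A n `<=` strip 0 r.
  move=> -[p q] [/=]; rewrite !in_itv/= /a gt_max => /andP[/andP[p0 _] pr] ?.
  by rewrite /strip/= !in_itv/= p0 ltW.
have cvA : forall x, \forall n \near \oo, A n x <-> set0 x.
  move=> -[p q]; have [pr|pr] := leP r p.
    near=> n; split => //; rewrite /A /= !in_itv/= => -[/andP[_ rp] _].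
    by move: rp; rewrite ltNge pr.
  near=> n; split => //; rewrite /A/= !in_itv/= /a gt_max => -[/andP[/andP[_ +] _] _].
  rewrite ltNge => /negP; apply; rewrite lerBrDr -lerBrDl ler_pdivrMr// [leRHS]mulrC -ler_pdivrMr ?subr_gt0//.
  rewrite (le_trans (ltW (truncnS_gt _)))// ler_nat ltnS; near: n; exact: nbhs_infty_ge.
have [cA _] := absJ_cvg _ A set0 (ltW r0) mA measurable0 An (@sub0set _ _) cvA.
have absJ0 : absJ set0 = 0%E by rewrite /absJ !integral_set0 adde0.
rewrite absJ0 in cA.
have [n _ hn] : \forall n \near \oo, (absJ (A n) < e%:E)%E.
  apply: (cA [set x | (x < e%:E)%E]); apply: open_nbhs_nbhs; split; last by rewrite /= lte_fin.
  exact: open_ereal_lt_ereal.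
exists (dl / n.+1%:R); first by rewrite divr_gt0.
have lin (s s' : R) : 0 <= s -> r - dl / n.+1%:R < s -> s <= s' -> s' < r -> u s' = u s + c * (s' - s).
  move=> s0 rs ss' s'r; apply: (linear_on (A n) r e) => //.
  - exact: ltW.
  - move=> p [/=]; rewrite in_itv/= /a gt_max => /andP[/andP[p0 rp] pr] _.
    have pd : r - dl < p.1.
      by apply: le_lt_trans rp; rewrite lerB// divS_le// ltW.
    have := left_lim_near (r - dl) r p.1 e v pd (ltW pr) hd p0.
    move=> h; have : `|v| - `|v - left_lim u p.1| <= `|left_lim u p.1|.
      by rewrite lerBlDr (le_trans _ (ler_normD _ _))// addrC subrK.
    apply: le_trans; rewrite lerBrDl (le_trans (lerD h (lexx _)))//.
    by rewrite -splitr.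
  - exact: (hn n (leqnn n)).
  - move=> p [/=]; rewrite !in_itv/= => /andP[sp ps] q0; rewrite /A /= !in_itv/= /a gt_max.
    by rewrite (le_lt_trans s0 sp) (lt_trans rs sp) (le_lt_trans ps s'r).
move=> s s0 rs sr.
have c1 : u @ r^'- --> v by exact: ll.
have c2 : u @ r^'- --> u s + c * (r - s).
  have : (fun s' => u s + c * (s' - s)) @ r^'- --> u s + c * (r - s).
    apply: cvgD; first exact: cvg_cst.
    apply: cvgM; first exact: cvg_cst.
    by apply: cvgB; [exact: cvg_at_left_filter|exact: cvg_cst].
  apply: cvg_trans; apply: near_eq_cvg; near=> y.
  apply/esym/lin => //; first by apply/ltW; near: y; exact: nbhs_left_gt.
by rewrite (cvg_unique _ c1 c2) // addrK.
Unshelve. all: by end_near. Qed.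

(** Strips shrinking to the line over [r] isolate the jump at that time. On this line the integrand
    is the left limit times the indicator of an accepted point, so the jump is the left limit times
    the number of accepted points, at most one by simplicity: the path either continues or is reset
    to 0. *)
Lemma jump_at (r : R) : 0 < r -> exists2 k : nat, (k <= 1)%N &
  u r = left_lim u r * (1 - k%:R) /\
  (Np ([set r] `*` `[0%R, phi (left_lim u r)]) +
   Nm ([set r] `*` `[0%R, phi (- left_lim u r)]))%E = k%:R%:E.
Proof.
move=> r0; set v := left_lim u r.
pose a (n : nat) := r - r / n.+1%:R.
have a0 n : 0 <= a n by rewrite subr_ge0 divS_le// ltW.
have ar n : a n < r by rewrite ltrBlDr ltrDl divr_gt0.
pose Dr : set (R * R) := [set r] `*` `[0%R, +oo[.
have mDr : measurable Dr by exact: measurableX.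
have DrS : Dr `<=` strip 0 r.
  by move=> -[p q] [/= -> q0]; split => //=; rewrite in_itv/= r0 lexx.
have cvA : forall x, \forall n \near \oo, strip (a n) r x <-> Dr x.
  move=> -[p q]; have [<-|pr] := eqVneq r p.
    near=> n; rewrite /strip /Dr/= in_itv/= ar lexx.
    by split=> -[].
  near=> n; split; last by move=> [/= pr']; rewrite pr' eqxx in pr.
  move=> [/= + _]; rewrite in_itv/= => /andP[+ pr'].
  have {}pr' : p < r by rewrite lt_neqAle eq_sym pr.
  rewrite ltNge => /negP[]; rewrite lerBrDr -lerBrDl ler_pdivrMr// [leRHS]mulrC -ler_pdivrMr ?subr_gt0//.
  rewrite (le_trans (ltW (truncnS_gt _)))// ler_nat ltnS; near: n; exact: nbhs_infty_ge.
have [_ cJ] := absJ_cvg _ (fun n => strip (a n) r) Dr (ltW r0) (fun n => mstrip _ _) mDr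
  (fun n => strip_sub _ _ (a0 n)) DrS cvA.
have ca : a n @[n --> \oo] --> r.
  rewrite -[X in _ --> X]subr0; apply: cvgB; first exact: cvg_cst.
  rewrite -(mulr0 r); apply: cvgM; first exact: cvg_cst.
  by have := @cvg_harmonic R.
have cua : u (a n) @[n --> \oo] --> v.
  have /cvg_at_leftP h : u @ r^'- --> v by exact: ll.
  by apply: h; split.
have JD : J Dr = (v - u r)%:E.
  apply: (cvg_unique (@ereal_hausdorff R) cJ).
  have -> : (fun n => J (strip (a n) r)) = (fun n => (u (a n) - u r + c * (r - a n))%:E).
    apply/funext => n; have := incr _ _ (a0 n) (ltW (ar n)).
    have := J_fin _ _ (ltW r0) (mstrip (a n) r) (strip_sub _ _ (a0 n)).
    by case: (J _) => // j _; rewrite -EFinB -EFinD => -[->]; congr EFin; ring.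
  apply: cvg_EFin; first exact: nearW.
  rewrite -[X in _ --> X]addr0; apply: cvgD; first by apply: cvgB => //; exact: cvg_cst.
  rewrite -(mulr0 c); apply: cvgM; first exact: cvg_cst.
  by rewrite -(subrr r); apply: cvgB => //; exact: cvg_cst.
have atom (m : {measure set (R * R) -> \bar R}) o : (forall M : nat, counting_on m (sqbox M%:R)) ->
    exists2 k : nat, m ([set r] `*` `[0%R, phi (o * v)]) = k%:R%:E &
      (\int[m]_(p in Dr) jump o p = (v * k%:R)%:E)%E.
  move=> cm; set Q := [set r] `*` _.
  have mQ : measurable Q by exact: measurableX.
  have [k kE] : isnat (m Q).
    pose M := (Num.truncn (Num.max r (phi (o * v)))).+1.
    apply: (cm M) => // -[p q] [/= ->]; rewrite !in_itv/= => /andP[q0 qv].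
    rewrite /sqbox/= !in_itv/= q0 (ltW r0)/=; split.
      by rewrite (@le_trans _ _ (Num.max r (phi (o * v)))) ?le_max ?lexx// ltW// truncnS_gt.
    by rewrite (le_trans qv)// (@le_trans _ _ (Num.max r (phi (o * v)))) ?le_max ?lexx ?orbT// ltW// truncnS_gt.
  exists k => //.
  have QD : Dr `&` Q = Q.
    by apply/setIidPr => -[p q] [/= ->]; rewrite !in_itv/= => /andP[q0 _]; rewrite /Dr/= in_itv/= q0.
  transitivity (\int[m]_(p in Dr) ((cst v%:E) \_ Q) p)%E.
    apply: eq_integral => -[p q]; rewrite inE => -[/= -> q0]; rewrite /jump /= -/v /patch.
    have -> : ((r, q) \in Q) = (q <= phi (o * v)).
      apply/idP/idP; first by rewrite inE => -[/= _]; rewrite in_itv/= => /andP[].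
      by move=> qv; rewrite inE; split => //=; rewrite in_itv/= qv andbT; move: q0; rewrite in_itv/= andbT.
    by case: ifPn; rewrite ?mulr1 ?mulr0.
  by rewrite -integral_mkcondr QD integral_cst// kE EFinM.
have [kp kpE Ip] := atom Np 1 cNp.
have [km kmE Im] := atom Nm (-1) cNm.
have JE : J Dr = (v * (kp + km)%:R)%:E by rewrite /J Ip Im -EFinD natrD mulrDr.
rewrite mul1r in kpE; rewrite mulN1r in kmE.
exists (kp + km)%N.
  pose M := (Num.truncn (Num.max r (Num.max (phi v) (phi (- v))))).+1.
  have MP : Num.max r (Num.max (phi v) (phi (- v))) <= M%:R by rewrite ltW// truncnS_gt.
  move: MP; rewrite !ge_max => /and3P[rM vM vM'].
  have := simpleN M r r0 rM; rewrite -(ler_nat R) -lee_fin; apply: le_trans.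
  rewrite natrD EFinD -kpE -kmE; apply: leeD; apply: le_measure; rewrite ?inE; try exact: measurableX.
  - by move=> -[p q] [/= ->]; rewrite !in_itv/= => /andP[-> qv]; split => //; exact: le_trans vM.
  - by move=> -[p q] [/= ->]; rewrite !in_itv/= => /andP[-> qv]; split => //; exact: le_trans vM'.
split; last by rewrite kpE kmE -EFinD natrD.
by have := JD; rewrite JE => -[e]; rewrite mulrBr mulr1 e opprB addrC subrK.
Unshelve. all: by end_near.
Qed.

(** The region below the rate curve of the measure [o] along the free trajectory started at [x]. The
    particle survives to time [t] on this trajectory when the region holds no point. *)
Definition under (o x t : R) : set (R * R) :=
  [set p | [/\ 0 < p.1, p.1 <= t, 0 <= p.2 & p.2 <= phi (o * (x + c * p.1))]].

(** Go back to the infimum of the times from which the path agrees with the line through [u t]. The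
    line does not vanish there, so no reset takes place, the left limit is nonzero and [left_linear]
    prolongs the agreement further left unless time 0 is reached. *)
Lemma backward (t : R) : 0 <= t -> (forall s : R, 0 <= s -> s <= t -> u t - c * (t - s) != 0) ->
  forall s : R, 0 <= s -> s <= t -> u s = u t - c * (t - s).
Proof.
move=> t0 nz; pose l (s : R) := u t - c * (t - s).
pose E := [set r : R | 0 <= r <= t /\ forall s : R, r <= s -> s <= t -> u s = l s].
have Et : E t.
  split; first by rewrite t0 lexx.
  move=> s ts st; have -> : s = t by apply/eqP; rewrite eq_le ts st.
  by rewrite /l subrr mulr0 subr0.
have lE : has_inf E by split; [exists t|exists 0 => r [/andP[]]].
have r0 : 0 <= inf E by apply: lb_le_inf => [|r [/andP[]]//]; exists t.
have rt : inf E <= t by apply: ge_inf => //; exact: lE.2.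
have right (s : R) : inf E < s -> s <= t -> u s = l s.
  move=> rs st; have rs0 : 0 < s - inf E by rewrite subr_gt0.
  have [r [_ hr] rlt] := inf_adherent rs0 lE.
  by apply: hr => //; apply: ltW; move: rlt; rewrite addrC subrK.
have at_r : u (inf E) = l (inf E).
  have [->|rt'] := eqVneq (inf E) t; first by rewrite /l subrr mulr0 subr0.
  have {}rt' : inf E < t by rewrite lt_neqAle rt' rt.
  have c1 : u @ (inf E)^'+ --> u (inf E) by exact: rc.
  have c2 : u @ (inf E)^'+ --> l (inf E).
    have : l @ (inf E)^'+ --> l (inf E).
      apply: cvgB; first exact: cvg_cst.
      apply: cvgM; first exact: cvg_cst.
      by apply: cvgB; [exact: cvg_cst|exact: cvg_at_right_filter].
    apply: cvg_trans; apply: near_eq_cvg; near=> y.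
    apply/esym/right; first by near: y; exact: nbhs_right_gt.
    by near: y; exact: nbhs_right_le.
  exact: (cvg_unique _ c1 c2).
suff rE0 : inf E = 0.
  move=> s s0 st; have [sE|sE] := eqVneq (inf E) s; first by rewrite -sE at_r.
  by apply: right => //; rewrite lt_neqAle sE rE0.
apply/eqP; rewrite eq_le r0 andbT leNgt; apply/negP => rpos.
have lr0 : l (inf E) != 0 by exact: nz.
have [k k1 [uk _]] := jump_at _ rpos.
(* A reset would give the value 0, which the line avoids. *)
have k0 : k = 0%N.
  case: k k1 uk => // -[|//] _; rewrite subrr mulr0 => uk.
  by move: lr0; rewrite -at_r uk eqxx.
have lim_r : left_lim u (inf E) = l (inf E) by rewrite -at_r uk k0 subr0 mulr1.
have [n n0 hn] : exists2 n : R, 0 < n & forall s : R, 0 <= s -> inf E - n < s -> s < inf E ->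
    u s = left_lim u (inf E) - c * (inf E - s) by apply: left_linear => //; rewrite lim_r.
pose s1 := Num.max 0 (inf E - n / 2).
have n20 : 0 < n / 2 by rewrite divr_gt0.
have s1r : s1 < inf E by rewrite /s1 gt_max rpos ltrBlDr ltrDl.
suff : E s1 by move=> /(ge_inf lE.2); rewrite leNgt s1r.
split; first by rewrite /s1 le_max lexx/= ge_max t0/= lerBlDr (le_trans rt)// lerDl ltW.
move=> s ss st; have [rs|sr|<-//] := ltgtP (inf E) s; first exact: right.
have s0 : 0 <= s by apply: le_trans ss; rewrite /s1 le_max lexx.
rewrite hn// ?lim_r /l; first by ring.
apply: lt_le_trans ss; rewrite /s1 lt_max; apply/orP; right.
by rewrite ltrD2l ltrN2 ltr_pdivrMr// ltr_pMr// ltr1n.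
Unshelve. all: by end_near. Qed.

(** Continuation to the right up to the supremum of the times of agreement. A reset at the supremum
    would need a point on the line over it below the rate at the left limit, and such a point lies
    in one of the two empty regions. *)
Lemma forward (t : R) : 0 <= t -> (forall s : R, 0 <= s -> s <= t -> u 0 + c * s != 0) ->
  Np (under 1 (u 0) t) = 0%E -> Nm (under (-1) (u 0) t) = 0%E ->
  (forall o : R, o = 1 \/ o = -1 -> measurable (under o (u 0) t)) ->
  forall s : R, 0 <= s -> s <= t -> u s = u 0 + c * s.
Proof.
move=> t0 nz Np0 Nm0 mun; pose l (s : R) := u 0 + c * s.
pose E := [set r : R | 0 <= r <= t /\ forall s : R, 0 <= s -> s <= r -> u s = l s].
have E0 : E 0.
  split; first by rewrite t0 lexx.
  move=> s ts st; have -> : s = 0 by apply/eqP; rewrite eq_le ts st.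
  by rewrite /l mulr0 addr0.
have lE : has_sup E by split; [exists 0|exists t => r [/andP[]]].
have r0 : 0 <= sup E by apply: ub_le_sup => //; exact: lE.2.
have rt : sup E <= t by apply: ge_sup; [exists 0|move=> r [/andP[]]].
have left (s : R) : 0 <= s -> s < sup E -> u s = l s.
  move=> s0 sr; have rs0 : 0 < sup E - s by rewrite subr_gt0.
  have [r [_ hr] rlt] := sup_adherent rs0 lE.
  by apply: hr => //; apply: ltW; move: rlt; rewrite opprB addrC subrK.
have at_r : u (sup E) = l (sup E).
  have [->|r0'] := eqVneq (sup E) 0; first by rewrite /l mulr0 addr0.
  have {}r0' : 0 < sup E by rewrite lt_neqAle eq_sym r0' r0.
  have lim_r : left_lim u (sup E) = l (sup E).
    have c1 : u @ (sup E)^'- --> left_lim u (sup E) by exact: ll.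
    have c2 : u @ (sup E)^'- --> l (sup E).
      have : l @ (sup E)^'- --> l (sup E).
        apply: cvgD; first exact: cvg_cst.
        by apply: cvgM; [exact: cvg_cst|exact: cvg_at_left_filter].
      apply: cvg_trans; apply: near_eq_cvg; near=> y.
      apply/esym/left; last by near: y; exact: nbhs_left_lt.
      by apply/ltW; near: y; exact: nbhs_left_gt.
    exact: (cvg_unique _ c1 c2).
  have [k k1 [uk kE]] := jump_at _ r0'.
  suff k0 : k = 0%N by rewrite uk k0 subr0 mulr1 lim_r.
  apply/eqP; rewrite -leqn0 -(ler_nat R) -lee_fin -kE lim_r.
  rewrite [leRHS](_ : _ = Np (under 1 (u 0) t) + Nm (under (-1) (u 0) t))%E; last by rewrite Np0 Nm0 adde0.
  apply: leeD; apply: le_measure; rewrite ?inE; try exact: measurableX; try by apply: mun; tauto.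
  - by move=> -[p q] [/= ->]; rewrite in_itv/= => /andP[q0 qv]; split; rewrite ?mul1r.
  - by move=> -[p q] [/= ->]; rewrite in_itv/= => /andP[q0 qv]; split; rewrite ?mulN1r.
suff rE0 : sup E = t.
  move=> s s0 st; have [sE|sE] := eqVneq s (sup E); first by rewrite sE at_r.
  by apply: left => //; rewrite lt_neqAle sE rE0.
apply/eqP; rewrite eq_le rt/= leNgt; apply/negP => rlt.
have lr0 : u (sup E) != 0 by rewrite at_r nz.
have [n n0 hn] := right_linear _ r0 lr0.
pose s1 := Num.min t (sup E + n / 2).
have n20 : 0 < n / 2 by rewrite divr_gt0.
have s1r : sup E < s1 by rewrite /s1 lt_min rlt ltrDl.
suff : E s1 by move=> /(ub_le_sup lE.2); rewrite leNgt s1r.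
split; first by rewrite (ltW (le_lt_trans r0 s1r)) /s1 ge_min lexx.
move=> s s0 ss; have [sr|rs|->//] := ltgtP s (sup E); first exact: left.
rewrite hn ?(ltW rs)// ?at_r /l; first by ring.
apply: (le_lt_trans ss); rewrite /s1 gt_min; apply/orP; right.
by rewrite ltrD2l ltr_pdivrMr// ltr_pMr// ltr1n.
Unshelve. all: by end_near. Qed.

(** A linear path absorbs no net jump. Since it keeps a constant sign all its jumps have the same
    sign, so their variation vanishes too, and the accepted region, where the jump is nonzero, is
    null. *)
Lemma linear_void (t : R) : 0 <= t -> (forall s : R, 0 <= s -> s <= t -> u 0 + c * s != 0) ->
  (forall o : R, o = 1 \/ o = -1 -> measurable (under o (u 0) t)) ->
  (forall s : R, 0 <= s -> s <= t -> u s = u 0 + c * s) ->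
  Np (under 1 (u 0) t) = 0%E /\ Nm (under (-1) (u 0) t) = 0%E.
Proof.
move=> t0 nz mun lin; pose l (s : R) := u 0 + c * s.
have lim_r (r : R) : 0 < r -> r <= t -> left_lim u r = l r.
  move=> r0 rt; have c1 : u @ r^'- --> left_lim u r by exact: ll.
  have c2 : u @ r^'- --> l r.
    have : l @ r^'- --> l r.
      apply: cvgD; first exact: cvg_cst.
      by apply: cvgM; [exact: cvg_cst|exact: cvg_at_left_filter].
    apply: cvg_trans; apply: near_eq_cvg; near=> y.
    apply/esym/lin; first by apply/ltW; near: y; exact: nbhs_left_gt.
    by apply: le_trans rt; apply/ltW; near: y; exact: nbhs_left_lt.
  exact: (cvg_unique _ c1 c2).
(* An affine function without zeros on the interval has a constant sign: a change of sign would
   place its root [- u 0 / c] in the interval. *)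
have [sg sg1 lsg] : exists2 sg : R, sg != 0 & forall r : R, 0 <= r -> r <= t -> l r = sg * `|l r|.
  have ends (r : R) : 0 <= r -> r <= t -> 0 < u 0 * l r.
    move=> r0' rt; rewrite ltNge; apply/negP => h.
    have u00 : u 0 != 0 by have := nz 0; rewrite mulr0 addr0; apply.
    have c0 : c != 0.
      apply: contraTneq h => c0; rewrite /l c0 mul0r addr0 -ltNge -expr2.
      by rewrite lt_neqAle eq_sym expf_eq0/= u00 sqr_ge0.
    have key : u 0 ^+ 2 + u 0 * c * r <= 0 by move: h; rewrite /l; lra.
    have u2 : 0 < u 0 ^+ 2 by rewrite lt_neqAle eq_sym expf_eq0/= u00 sqr_ge0.
    have uc : u 0 * c < 0.
      rewrite ltNge; apply/negP => uc; have := mulr_ge0 uc r0'; lra.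
    pose s := - u 0 / c.
    have sE : s = u 0 ^+ 2 / (- (u 0 * c)) by rewrite /s; field; rewrite c0 u00.
    have s0 : 0 <= s by rewrite sE divr_ge0// ?ltW// oppr_gt0.
    have st : s <= t.
      apply: le_trans rt; rewrite sE ler_pdivrMr ?oppr_gt0//; lra.
    by have := nz s s0 st; rewrite /s mulrCA divff// mulr1 subrr eqxx.
  have [up|un|u00] := ltgtP 0 (u 0).
  - exists 1; first exact: oner_neq0.
    by move=> r r0 rt; rewrite mul1r gtr0_norm//; have := ends r r0 rt; rewrite pmulr_rgt0.
  - exists (-1); first by rewrite oppr_eq0 oner_neq0.
    by move=> r r0 rt; rewrite mulN1r ltr0_norm ?opprK//; have := ends r r0 rt; rewrite nmulr_rgt0.
  - by have := nz 0 (lexx _) t0; rewrite mulr0 addr0 -u00 eqxx.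
have J0 : J (strip 0 t) = 0%E.
  have := eqn _ t0; rewrite lin//.
  have := J_fin _ _ t0 (mstrip _ _) (@subset_refl _ _).
  by case: (J _) => // j _; rewrite -EFinB -EFinD => -[h]; congr EFin; lra.
have jE o p : strip 0 t p -> jump o p = (sg%:E * `|jump o p|)%E.
  move=> [/=]; rewrite !in_itv/= => /andP[p0 pt] _.
  rewrite /jump lim_r// -EFinM; congr EFin; rewrite normrM mulrA -lsg ?normr_nat//; exact: ltW.
have absJ0 : absJ (strip 0 t) = 0%E.
  have : (sg%:E * absJ (strip 0 t))%E = 0%E.
    rewrite -J0 /absJ /J ge0_muleDr ?integral_ge0//.
    rewrite -(integralZl (mstrip 0 t) (integrable_abse (intp _ t0))).
    rewrite -(integralZl (mstrip 0 t) (integrable_abse (intm _ t0))).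
    by congr (_ + _)%E; apply: eq_integral => z; rewrite inE => /jE <-.
  by move=> /eqP; rewrite mule_eq0 eqe (negPf sg1)/= => /eqP.
have one (m : {measure set (R * R) -> \bar R}) o : o = 1 \/ o = -1 -> m.-integrable (strip 0 t) (jump o) ->
   (\int[m]_(p in strip 0 t) `|jump o p|)%E = 0%E -> m (under o (u 0) t) = 0%E.
  move=> ho im /(ae_eq_integral_abs m (mstrip 0 t) (measurable_int m im)) [Q [mQ Q0 sQ]].
  apply/eqP; rewrite eq_le measure_ge0 andbT -Q0 le_measure ?inE//; first exact: mun.
  move=> -[p q] [/= p0 pt q0 qv]; apply: sQ => /= h.
  have /h : strip 0 t (p, q) by split; rewrite /= in_itv/= ?p0 ?pt// q0.
  rewrite /jump /= lim_r// qv mulr1 => -[] /eqP.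
  by apply/negP/nz => //; exact: ltW.
move: absJ0 => /eqP; rewrite /absJ padde_eq0 ?integral_ge0// => /andP[/eqP e1 /eqP e2].
by split; apply: one; rewrite ?e1 ?e2//; try tauto; [exact: intp|exact: intm].
Unshelve. all: by end_near. Qed.


(** Points are split at height [M]: finitely many lie below in bounded time, and the variation of
    the jumps due to those above tends to 0 as [M] grows. *)
Definition low (M t : R) : set (R * R) := `]0, t]%classic `*` `[0, M]%classic.
Definition high (M t : R) : set (R * R) := `]0, t]%classic `*` `]M, +oo[%classic.

Let low_fin (m : {measure set (R * R) -> \bar R}) (M t : R) :
  (forall M : nat, counting_on m (sqbox M%:R)) -> forall A, measurable A -> A `<=` low M t -> isnat (m A).
Proof.
move=> cm A mA AL; pose Q := (Num.truncn (Num.max t M)).+1.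
apply: (cm Q) => //; apply: subset_trans AL _ => -[p q] [/=].
rewrite !in_itv/= => /andP[p0 pt] /andP[q0 qM]; rewrite /sqbox/= !in_itv/= q0 (ltW p0)/=.
have : Num.max t M <= Q%:R by rewrite ltW// truncnS_gt.
by rewrite ge_max => /andP[tQ MQ]; split; [exact: le_trans tQ|exact: le_trans MQ].
Qed.

Let mlow (M t : R) : measurable (low M t). Proof. exact: measurableX. Qed.

Let mhigh (M t : R) : measurable (high M t). Proof. exact: measurableX. Qed.

Let high_sub (M t : R) : 0 <= M -> high M t `<=` strip 0 t.
Proof.
move=> M0 -[p q] [/= pt]; rewrite !in_itv/= !andbT => qM; split => //=.
by rewrite in_itv/= andbT (le_trans M0)// ltW.
Qed.

Let absJ_fin (A : set (R * R)) (t : R) : 0 <= t -> measurable A -> A `<=` strip 0 t -> absJ A \is a fin_num.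
Proof.
move=> t0 mA At; rewrite fin_numD.
rewrite !integrable_fin_num//; apply: integrable_abse; [exact: intmS At|exact: intpS At].
Qed.

Let mabs (m : {measure set (R * R) -> \bar R}) (o t : R) (A : set (R * R)) : 0 <= t ->
  m.-integrable (strip 0 t) (jump o) -> measurable A -> A `<=` strip 0 t ->
  measurable_fun A (fun p => `|jump o p|%E).
Proof.
move=> t0 im mA At; apply: measurableT_comp => //.
by apply: measurable_funS At (measurable_int m im).
Qed.

(** Between two zeros the drift [c * (t - s)] must be compensated by jumps. Either a low point
    occurs, raising the count by 1, or high points alone compensate, and their variation grows by at
    least [|c| * (t - s)]. *)
Lemma zeros_gap (M s t : R) : 0 <= M -> 0 <= s -> s <= t -> u s = 0 -> u t = 0 ->
  (fine (Np (low M s) + Nm (low M s)) + 1 <= fine (Np (low M t) + Nm (low M t))) \/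
  (fine (Np (low M s) + Nm (low M s)) <= fine (Np (low M t) + Nm (low M t)) /\
   fine (absJ (high M s)) + `|c| * (t - s) <= fine (absJ (high M t))).
Proof.
move=> M0 s0 st us ut; have t0 := le_trans s0 st.
pose dL : set (R * R) := `]s, t]%classic `*` `[0, M]%classic.
pose dH : set (R * R) := `]s, t]%classic `*` `]M, +oo[%classic.
have mdL : measurable dL by exact: measurableX.
have mdH : measurable dH by exact: measurableX.
have itE : `]0, t]%classic = `]0, s]%classic `|` `]s, t]%classic.
  by rewrite (@itv_bndbnd_setU _ _ (BRight 0) (BRight s)) ?bnd_simp.
have LE : low M t = low M s `|` dL.
  by rewrite /low /dL itE; apply/seteqP; split => -[p q] /=; tauto.
have HE : high M t = high M s `|` dH.
  by rewrite /high /dH itE; apply/seteqP; split => -[p q] /=; tauto.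
have dis (X Y : set R) : (`]0, s]%classic `*` X) `&` (`]s, t]%classic `*` Y) = set0.
  apply/seteqP; split => // -[p q] [[/= + _] [/= + _]].
  by rewrite !in_itv/= => /andP[_ ps] /andP[/lt_le_trans/(_ ps)]; rewrite ltxx.
have NLE (m : {measure set (R * R) -> \bar R}) : m (low M t) = (m (low M s) + m dL)%E.
  by rewrite LE measureU//; exact: dis.
have dLt : dL `<=` low M t by rewrite LE; exact: subsetUr.
have Lst : low M s `<=` low M t by rewrite LE; exact: subsetUl.
have [kp kpE] := low_fin Np M t cNp _ (mlow M s) Lst.
have [km kmE] := low_fin Nm M t cNm _ (mlow M s) Lst.
have [jp jpE] := low_fin Np M t cNp _ mdL dLt.
have [jm jmE] := low_fin Nm M t cNm _ mdL dLt.
rewrite !NLE kpE kmE jpE jmE -!EFinD/=.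
have [|] := posnP (jp + jm); last first.
  rewrite -(ler_nat R) natrD => h; left; lra.
move=> /eqP; rewrite addn_eq0 => /andP[/eqP jp0 /eqP jm0]; rewrite jp0 jm0 !addr0.
right; split => //.
have dHs : dH `<=` strip 0 t.
  by apply: subset_trans (high_sub M t M0); rewrite HE; exact: subsetUr.
have Hs : high M s `<=` strip 0 t.
  by apply: subset_trans (high_sub M t M0); rewrite HE; exact: subsetUl.
have dLs : dL `<=` strip 0 t.
  apply: subset_trans dLt _ => -[p q] [/= pt]; rewrite in_itv/= => /andP[q0 _].
  by split => //=; rewrite in_itv/= q0.
have one (m : {measure set (R * R) -> \bar R}) o : m.-integrable (strip 0 t) (jump o) ->
    m dL = 0%E ->
    (\int[m]_(p in strip s t) jump o p = \int[m]_(p in dH) jump o p)%E.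
  move=> im mL0.
  have -> : strip s t = dL `|` dH.
    rewrite /strip /dL /dH; apply/seteqP; split => -[p q] /=; rewrite !in_itv/= !andbT.
      by move=> [pq q0]; have [qM|qM] := leP q M; [left|right]; rewrite ?q0.
    by move=> [[pq /andP[q0 _]]|[pq qM]]; split => //; rewrite (le_trans M0)// ltW.
  rewrite integral_setU//.
  - rewrite (null_set_integral mdL _ mL0) ?add0e//.
    by apply: measurable_funS (measurable_int m im).
  - by apply: measurable_funS (measurable_int m im); rewrite ?subUset//.
  - apply/disj_setPS => -[p q] [[/= _]]; rewrite in_itv/= => /andP[_ qM] [/= _].
    by rewrite in_itv/= andbT ltNge qM.
have JH : J dH = (c * (t - s))%:E.
  have := incr _ _ s0 st; rewrite us ut /J (one Np) ?(one Nm) ?jpE ?jmE ?jp0 ?jm0//; [|exact: intm|exact: intp].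
  have := J_fin _ _ t0 mdH dHs; rewrite /J.
  by case: (_ + _)%E => // j _; rewrite -EFinB -EFinD => -[h]; congr EFin; lra.
have leJ : ((`|c| * (t - s))%:E <= absJ dH)%E.
  rewrite -(ger0_norm (x := t - s)) ?subr_ge0// -normrM -abse_EFin -JH.
  apply: (le_trans (lee_abs_add _ _)); apply: leeD; apply: le_abse_integral => //.
  - exact: (measurable_int Np (intpS _ _ t0 mdH dHs)).
  - exact: (measurable_int Nm (intmS _ _ t0 mdH dHs)).
have AE : absJ (high M t) = (absJ (high M s) + absJ dH)%E.
  rewrite /absJ HE !ge0_integral_setU//.
  - by rewrite addeACA.
  - by apply: (mabs Nm (-1) t) => //; [exact: intm|exact: measurableU|rewrite subUset].
  - by apply/disj_setPS; rewrite dis.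
  - by apply: (mabs Np 1 t) => //; [exact: intp|exact: measurableU|rewrite subUset].
  - by apply/disj_setPS; rewrite dis.
have f1 := absJ_fin _ t t0 (mhigh M s) Hs; have f2 := absJ_fin _ t t0 mdH dHs.
by rewrite AE (fineD f1 f2) lerD2l -lee_fin fineK.
Qed.

(** The potential is the number of low points plus the high variation scaled by [n.+1 / |c|]. Two
    grid times differ by at least [1 / n.+1], so either alternative of [zeros_gap] raises it by at
    least 1. *)
Lemma zeros_bound (M : R) (n : nat) : c != 0 -> 0 <= M ->
  (\sum_(i < n.+1) (u (i%:R / n.+1%:R) == 0)%R)%:R <=
  1 + (fine (Np (low M 1) + Nm (low M 1)) + n.+1%:R / `|c| * fine (absJ (high M 1))) :> R.
Proof.
move=> c0 M0; have c0' : 0 < `|c| by rewrite normr_gt0.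
pose q (i : nat) : R := i%:R / n.+1%:R.
pose a (i : nat) : R := fine (Np (low M (q i)) + Nm (low M (q i))) + n.+1%:R / `|c| * fine (absJ (high M (q i))).
have -> : fine (Np (low M 1) + Nm (low M 1)) + n.+1%:R / `|c| * fine (absJ (high M 1)) = a n.+1.
  by rewrite /a /q divff.
have q0 i : 0 <= q i by rewrite divr_ge0.
have qle i j : (i <= j)%N -> q i <= q j by move=> ij; rewrite ler_pM2r ?invr_gt0// ler_nat.
have sublow i j : (i <= j)%N -> low M (q i) `<=` low M (q j).
  move=> ij -[x y] [/=]; rewrite !in_itv/= => /andP[x0 xi] y0; split => //=.
  by rewrite in_itv/= x0 (le_trans xi)// qle.
have subhigh i j : (i <= j)%N -> high M (q i) `<=` high M (q j).
  move=> ij -[x y] [/=]; rewrite !in_itv/= => /andP[x0 xi] y0; split => //=.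
    by rewrite in_itv/= x0 (le_trans xi)// qle.
have lfin i : (Np (low M (q i)) + Nm (low M (q i)))%E \is a fin_num.
  have [k1 ->] := low_fin Np M (q i) cNp _ (mlow M (q i)) (@subset_refl _ _).
  by have [k2 ->] := low_fin Nm M (q i) cNm _ (mlow M (q i)) (@subset_refl _ _).
have hfin i : absJ (high M (q i)) \is a fin_num by apply: (absJ_fin _ (q i)) => //; exact: high_sub.
have monol i j : (i <= j)%N -> fine (Np (low M (q i)) + Nm (low M (q i))) <= fine (Np (low M (q j)) + Nm (low M (q j))).
  move=> ij; rewrite fine_le//; apply: leeD; apply: le_measure; rewrite ?inE//; exact: sublow.
have monoh i j : (i <= j)%N -> fine (absJ (high M (q i))) <= fine (absJ (high M (q j))).
  move=> ij; rewrite fine_le//; apply: leeD; apply: ge0_subset_integral => //; try exact: subhigh.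
    by apply: (mabs Np 1 (q j)) => //; [exact: intp|exact: high_sub].
  by apply: (mabs Nm (-1) (q j)) => //; [exact: intm|exact: high_sub].
have nc : 0 < n.+1%:R / `|c| by rewrite divr_gt0.
apply: (count_separated (fun i => u (q i) == 0)).
- move=> i; rewrite addr_ge0// ?fine_ge0 ?adde_ge0// mulr_ge0// ?(ltW nc)// fine_ge0//.
  by rewrite adde_ge0// integral_ge0.
- by move=> i j ij; rewrite lerD ?monol// ler_pM2l// monoh.
- move=> i j ij /eqP ui /eqP uj.
  have [h|[h1 h2]] := zeros_gap M _ _ M0 (q0 i) (qle _ _ (ltnW ij)) ui uj.
    by rewrite /a addrAC lerD// ler_pM2l// monoh// ltnW.
  rewrite /a -addrA lerD//.
  apply: (@le_trans _ _ (n.+1%:R / `|c| * (fine (absJ (high M (q i))) + `|c| * (q j - q i)))); last by rewrite ler_pM2l.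
  rewrite mulrDr lerD2l mulrA divfK ?gt_eqF// mulrBr /q !(mulrC n.+1%:R) !divfK ?pnatr_eq0//.
  by rewrite lerBrDl natr1 ler_nat.
Qed.

(** Choose [M] so that the high variation is at most [e / 2 * |c|]; this bounds its share of the
    frequency by [e / 2]. The number of low points is then a fixed constant, negligible after
    division by [n.+1]. *)
Lemma zeros_cvg : c != 0 ->
  (\sum_(i < n.+1) (u (i%:R / n.+1%:R) == 0)%R)%:R / n.+1%:R @[n --> \oo] --> (0 : R).
Proof.
move=> c0; have c0' : 0 < `|c| by rewrite normr_gt0.
apply/cvgrPdist_le => e e0.
have cvA : forall x, \forall n \near \oo, high n%:R 1 x <-> set0 x.
  move=> -[p q]; near=> n; split => // -[/= _]; rewrite in_itv/= andbT ltNge => /negP[].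
  rewrite (@le_trans _ _ (Num.truncn (Num.max q 0)).+1%:R)//.
    by rewrite (@le_trans _ _ (Num.max q 0)) ?le_max ?lexx// ltW// truncnS_gt.
  by rewrite ler_nat; near: n; exact: nbhs_infty_ge.
have [cA _] := absJ_cvg _ (fun n => high n%:R 1) set0 ler01 (fun n => mhigh _ _) measurable0
   (fun n => high_sub _ _ (ler0n _ n)) (@sub0set _ _) cvA.
have absJ0 : absJ set0 = 0%E by rewrite /absJ !integral_set0 adde0.
rewrite absJ0 in cA.
have ec : 0 < e / 2 * `|c| by rewrite mulr_gt0// divr_gt0.
have [M _ hM] : \forall n \near \oo, (absJ (high n%:R 1) < (e / 2 * `|c|)%:E)%E.
  apply: (cA [set x | (x < (e / 2 * `|c|)%:E)%E]); apply: open_nbhs_nbhs; split; last by rewrite /= lte_fin.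
  exact: open_ereal_lt_ereal.
have {}hM : fine (absJ (high M%:R 1)) <= e / 2 * `|c|.
  have hf := absJ_fin (high M%:R 1) 1 ler01 (mhigh _ _) (high_sub _ _ (ler0n _ M)).
  by rewrite -lee_fin fineK// ltW//; exact: (hM M (leqnn M)).
pose K : R := fine (Np (low M%:R 1) + Nm (low M%:R 1)).
have K0 : 0 <= K by rewrite fine_ge0// adde_ge0.
near=> n; rewrite sub0r normrN ger0_norm ?divr_ge0//.
rewrite ler_pdivrMr//; apply: (le_trans (zeros_bound M%:R n c0 (ler0n _ M))).
rewrite -/K addrA (_ : e * n.+1%:R = e / 2 * n.+1%:R + e / 2 * n.+1%:R); last by rewrite -mulrDl -splitr.
apply: lerD.
  rewrite -ler_pdivrMl ?divr_gt0//.
  apply: (@le_trans _ _ n%:R); last by rewrite ler_nat.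
  rewrite (@le_trans _ _ (Num.truncn ((e / 2)^-1 * (1 + K))).+1%:R)//.
    by rewrite ltW// truncnS_gt.
  by rewrite ler_nat; near: n; exact: nbhs_infty_ge.
rewrite mulrAC ler_pdivrMr// mulrC mulrAC ler_wpM2r//.
Unshelve. all: by end_near. Qed.

End path.

(** * Lebesgue measure on the line, and transfer of integrals *)

Section lebR.
Context {R : realType}.

(** The same set function as [leb], redeclared as a sigma-finite measure on [R] itself so that it
    can be paired with measures on that type in Tonelli arguments. *)
Definition lebR : set R -> \bar R := leb.

Let lebR0 : lebR set0 = 0%E. Proof. exact: measure0. Qed.

Let lebR_ge0 A : (0 <= lebR A)%E. Proof. exact: measure_ge0. Qed.

Let lebR_sigma_additive : semi_sigma_additive lebR.
Proof. exact: (@measure_semi_sigma_additive _ _ _ (@leb R)). Qed.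

HB.instance Definition _ := isMeasure.Build _ R R lebR
  lebR0 lebR_ge0 lebR_sigma_additive.

Let lebR_sigma_finite : sigma_finite setT lebR.
Proof.
exists (fun n : nat => `]- n%:R, n%:R]%classic).
  by rewrite -(bigcup_itvT false false).
move=> n; split => //.
by rewrite /lebR /leb lebesgue_measure_itv/=; case: ifPn => // _; rewrite -EFinB ltry.
Qed.

HB.instance Definition _ := Measure_isSigmaFinite.Build _ R R lebR lebR_sigma_finite.

Lemma ge0_integral_lebR (D : set R) (f : R -> \bar R) : measurable D -> measurable_fun D f ->
  (forall x, D x -> (0 <= f x)%E) -> (\int[leb]_(x in D) f x = \int[lebR]_(x in D) f x)%E.
Proof.
move=> mD mf f0.
have mid : measurable_fun [set: measurableTypeR R] (id : measurableTypeR R -> R) by move=> _ Y mY; rewrite setTI.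
have := @ge0_integral_pushforward _ _ _ _ R _ mid leb D f mD mf.
move=> /(_ _) <-; last by move=> x; rewrite inE; exact: f0.
by apply: eq_measure_integral => A mA _.
Qed.

(** The scaled image measure agrees with Lebesgue measure on half-open intervals, and uniqueness
    does the rest. *)
Lemma lebR_affine (x c : R) (A : set R) : 0 < c -> measurable A ->
  lebR ((fun s => x + c * s) @^-1` A) = ((c^-1)%:E * lebR A)%E.
Proof.
move=> c0 mA; pose f (s : R) := x + c * s.
have mf : measurable_fun [set: R] (f : R -> measurableTypeR R).
  by apply: measurable_funD => //; exact: measurable_funM.
pose m : {measure set (measurableTypeR R) -> \bar R} :=
  mscale (NngNum (ltW c0)) (measure_function_pushforward__canonical__measure_function_Measure lebR mf).
have key (X : set R) : measurable X -> leb X = m X.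
  move=> mX; apply: (lebesgue_measure_unique (mu := m)) => // _ [[a b]] _ <-.
  transitivity (c%:E * leb (f @^-1` `]a, b]%classic))%E; last by [].
  have -> : f @^-1` `]a, b]%classic = `](a - x) / c, (b - x) / c]%classic.
    by apply/seteqP; split => s; rewrite /= !in_itv/= /f ltr_pdivrMr// ler_pdivlMr// ltrBlDl lerBrDl (mulrC s).
  rewrite /lebR /leb !lebesgue_measure_itv/= !lte_fin ltr_pM2r ?invr_gt0// ltrD2r.
  case: ifPn => _; last by rewrite mule0.
  by rewrite -!EFinB -EFinM; congr EFin; field; rewrite gt_eqF.
rewrite [in RHS]/lebR key// /m /mscale/= /pushforward muleA -EFinM mulVf ?gt_eqF// mul1e.
by [].
Qed.

End lebR.

Import HBNNSimple.

(** Image and density in one step: the identity on indicators extends to simple functions and then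
    by monotone convergence. Finiteness of [k] lets multiplication by [k x] pass through the
    limit. *)
Lemma ge0_integral_transfer {d1 d2} {X : measurableType d1} {Y : measurableType d2} {R : realType}
    (mu : {measure set X -> \bar R}) (nu : {measure set Y -> \bar R}) (th : X -> Y) (k : X -> \bar R) :
  measurable_fun setT th -> measurable_fun setT k -> (forall x, (0 <= k x)%E) -> (forall x, k x \is a fin_num) ->
  (forall B, measurable B -> nu B = (\int[mu]_x (k x * (\1_B (th x))%:E))%E) ->
  forall f : Y -> \bar R, measurable_fun setT f -> (forall y, (0 <= f y)%E) ->
    (\int[nu]_y f y = \int[mu]_x (k x * f (th x)))%E.
Proof.
move=> mth mk k0 kf H f mf f0.
have simple (s : {nnsfun Y >-> R}) : (\int[nu]_y (s y)%:E = \int[mu]_x (k x * (s (th x))%:E))%E.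
  rewrite integralT_nnsfun sintegralE.
  transitivity (\sum_(r \in range s) \int[mu]_x (k x * (r * \1_(s @^-1` [set r]) (th x))%:E))%E.
    apply: eq_fsbigr => r; rewrite inE => -[y _ yr].
    have r0 : 0 <= r by rewrite -yr.
    rewrite H// -ge0_integralZl//.
    - by apply: eq_integral => x _; rewrite EFinM muleCA.
    - apply: emeasurable_funM => //; apply/measurable_EFinP; apply: measurableT_comp => //.
    - by move=> x _; rewrite mule_ge0.
  rewrite -ge0_integral_fsum//.
  - apply: eq_integral => x _; rewrite [in RHS]fimfunE -fsumEFin// ge0_mule_fsumr// => r.
    by rewrite nnfun_muleindic_ge0.
  - move=> r; apply: emeasurable_funM => //; apply/measurable_EFinP; apply: measurable_funM => //.
    by apply: measurableT_comp.
  - by move=> r x _; rewrite mule_ge0// nnfun_muleindic_ge0.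
pose s := nnsfun_approx measurableT mf.
have sy y : (s n y)%:E @[n --> \oo] --> f y by exact: cvg_nnsfun_approx.
have nds y : {homo (fun n => s n y) : m n / (m <= n)%N >-> m <= n}.
  by move=> m n mn; exact/lefP/nd_nnsfun_approx.
have mks n : measurable_fun setT (fun x => k x * (s n (th x))%:E)%E.
  by apply: emeasurable_funM => //; apply/measurable_EFinP; apply: measurableT_comp.
transitivity (limn (fun n => \int[nu]_y (s n y)%:E)%E).
  rewrite -monotone_convergence//.
  - by apply: eq_integral => y _; apply/esym/cvg_lim.
  - by move=> n; exact/measurable_EFinP.
  - by move=> n y _; rewrite lee_fin.
  - by move=> y _ m n mn; rewrite lee_fin nds.
transitivity (limn (fun n => \int[mu]_x (k x * (s n (th x))%:E))%E).
  by congr (limn _); apply/funext => n.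
rewrite -monotone_convergence//.
- apply: eq_integral => x _; apply/cvg_lim => //.
  exact: cvgeZl.
- by move=> n x _; rewrite mule_ge0// lee_fin.
- by move=> x _ m n mn; rewrite lee_wpmul2l// lee_fin nds.
Qed.

Section expeR_tools.
Context {R : realType}.

Lemma measurable_expeR : measurable_fun [set: \bar R] (@expeR R).
Proof.
rewrite (_ : @expeR R = (fun x => maxe 0 (er_map expR x))%E); last first.
  apply/funext => -[x| |] /=; first by rewrite maxEle lee_fin expR_ge0.
    by rewrite max_r ?leey.
  by rewrite max_l ?leNye.
apply: measurable_maxe => //.
by have := @measurable_er_map _ R R _ (@measurable_expR R).
Qed.

(** The limit may be infinite: an infinite integrated rate means survival with probability 0. *)
Lemma cvg_expeRN (a : nat -> R) (x : \bar R) : (-oo < x)%E ->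
  (a n)%:E @[n --> \oo] --> x -> (expR (- a n))%:E @[n --> \oo] --> expeR (- x).
Proof.
case: x => [x| |//] _ cx.
  rewrite /=; apply: cvg_EFin; first exact: nearW.
  apply: (cvg_comp _ expR _ (@continuous_expR R _)).
  by apply: cvgN; have /fine_cvgP[] := cx.
rewrite /=; apply: cvg_EFin; first exact: nearW.
apply/cvgrPdist_le => e e0.
have /cvgeryP/cvgryPge /(_ (- ln e)) : (a n)%:E @[n --> \oo] --> +oo%E by [].
apply: filterS => n; rewrite sub0r normrN ger0_norm ?expR_ge0// => h.
by rewrite -[leRHS]lnK ?posrE// ler_expR lerNl.
Qed.

End expeR_tools.

Lemma negrr1 (R : realType) : (-1 == 1 :> R) = false.
Proof. by apply/negbTE; rewrite lt_eqF// (lt_trans _ (@ltr01 R))// oppr_lt0. Qed.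

(** * The shift identity, and absence of mass at zero *)

Section invariant_law.
Context {d : measure_display} {T : measurableType d} {R : realType}.
Variables (P : probability T R) (Np Nm : T -> {measure set (R * R) -> \bar R})
  (U : R -> T -> R) (h : R) (phi : R -> R) (g : set R -> \bar R).
Hypotheses (phi_ge0 : forall x, 0 <= phi x) (mphi : measurable_fun setT phi).
Hypothesis prm : PRM_indep P Np Nm (U 0) g.
Hypothesis sol : solves P Np Nm U h phi.
Hypothesis inv : forall t : R, 0 <= t -> forall A, measurable A -> P (U t @^-1` A) = g A.

Let mU (t : R) : measurable_fun [set: T] (U t). Proof. by case: sol. Qed.

Lemma stationary_integral (s : R) (f : R -> \bar R) : 0 <= s -> measurable_fun setT f -> (forall x, (0 <= f x)%E) ->
  (\int[P]_w f (U s w) = \int[P]_w f (U 0 w))%E.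
Proof.
move=> s0 mf f0.
have E (r : R) := @ge0_integral_pushforward _ _ T R R (U r) (mU r) P setT f measurableT mf (fun x _ => f0 x).
have := E s; have := E 0; rewrite !preimage_setT => <- <-.
by apply: eq_measure_integral => A mA _; rewrite /= /pushforward !inv.
Qed.

(** Stationarity freezes the mean field term, so each path solves an equation with the constant
    speed [c]. *)
Lemma stationary_drift (s : R) : 0 <= s -> drift P phi U s = drift P phi U 0.
Proof.
move=> s0; rewrite /drift; apply: eq_bigr => o _; congr (o * fine _).
apply: (stationary_integral s (fun x => (phi (o * x))%:E)) => //.
- apply/measurable_EFinP; apply: measurableT_comp => //; exact: measurable_funM.
- by move=> x; rewrite lee_fin.
Qed.

Let c := h * drift P phi U 0.

Lemma ae_path : exists G : set T, [/\ measurable G, P G = 1%E & forall w, G w ->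
  [/\ forall M : nat, counting_on (Np w) (sqbox M%:R),
      forall M : nat, counting_on (Nm w) (sqbox M%:R) &
      forall (M : nat) (r : R), 0 < r -> r <= M%:R ->
        (Np w ([set r] `*` `[0%R, M%:R]) + Nm w ([set r] `*` `[0%R, M%:R]) <= 1)%E] /\
  [/\ forall t : R, 0 <= t -> (Np w).-integrable (strip 0 t) (jump (fun s => U s w) phi 1),
      forall t : R, 0 <= t -> (Nm w).-integrable (strip 0 t) (jump (fun s => U s w) phi (-1)) &
      forall t : R, 0 <= t -> (U t w)%:E =
        ((U 0 w)%:E - J (Np w) (Nm w) (fun s => U s w) phi (strip 0 t) + (c * t)%:E)%E]].
Proof.
have [G [mG PG hG]] := PRM_ae P Np Nm (U 0) g prm.
have [_ [_ [_ [_ [_ [N [mN PN hN]]]]]]] := sol.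
exists (G `&` ~` N); split.
- by apply: measurableI => //; exact: measurableC.
- rewrite setIC probability_setI1//; last exact: measurableC.
  by rewrite probability_setC// PN sube0.
move=> w [/hG [g1 g2 g3] Nw].
have {Nw} sw := contrapT (fun H => Nw (hN w H)).
split => //; split.
- move=> t t0; have [/(_ 1 (or_introl erefl)) + _] := sw t t0.
  by rewrite /Nsel eqxx.
- move=> t t0; have [/(_ (-1) (or_intror erefl)) + _] := sw t t0.
  by rewrite /Nsel negrr1.
- move=> t t0; have [_ ->] := sw t t0.
  congr (_ - _ + _)%E.
    by rewrite !big_cons big_nil /Nsel eqxx negrr1 adde0 addeC.
  rewrite (eq_integral (cst (drift P phi U 0)%:E)); last first.
    by move=> s; rewrite inE/= in_itv/= => /andP[s0 _]; rewrite stationary_drift.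
  rewrite integral_cst//= /leb lebesgue_measure_itv/= lte_fin.
  have [t0'|] := ltP 0 t; first by rewrite -EFinB subr0 -!EFinM mulrA.
  by move=> t0'; have -> : t = 0 by [apply/eqP; rewrite eq_le t0' t0]; rewrite !mule0 mulr0.
Qed.

(** The killing rate integrated along the free trajectory from [x]. It is an extended real, since
    [phi] need not be locally integrable. *)
Definition rate (c x t : R) : \bar R := (\int[lebR]_(s in `]0%R, t]) (Phi phi (x + c * s))%:E)%E.

Let Sec (o t : R) : set (R * (R * R)) := [set q | under c phi o q.1 t q.2].

Let mSec o t : measurable (Sec o t).
Proof.
have m1 : measurable_fun setT (fun q : R * (R * R) => q.1) by exact: measurable_fst.
have m21 : measurable_fun setT (fun q : R * (R * R) => q.2.1).
  by apply: (measurableT_comp (@measurable_fst _ _ R R)); exact: measurable_snd.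
have m22 : measurable_fun setT (fun q : R * (R * R) => q.2.2).
  by apply: (measurableT_comp (@measurable_snd _ _ R R)); exact: measurable_snd.
have mF : measurable_fun setT (fun q : R * (R * R) => phi (o * (q.1 + c * q.2.1))).
  apply: (measurableT_comp mphi); apply: measurable_funM => //.
  by apply: measurable_funD => //; exact: measurable_funM.
rewrite (_ : Sec o t = ((setT `&` [set q | 0 <= q.2.2]) `&` (setT `&` [set q | q.2.2 <= phi (o * (q.1 + c * q.2.1))])) `&`
   (setT `&` (fun q : R * (R * R) => q.2.1) @^-1` `]0, t]%classic)).
  apply: measurableI; last exact: m21.
  by apply: measurableI; apply: measurable_fun_le.
apply/seteqP; split=> -[x [p q]] /=; rewrite /Sec/under/= in_itv/=; first by move=> [-> -> -> ->].
by move=> [[[_ ?] [_ ?]] [_ /andP[? ?]]].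
Qed.

Let xSec o t x : xsection (Sec o t) x = under c phi o x t.
Proof. by apply/seteqP; split => p; [move/xsectionP|move=> ?; exact/xsectionP]. Qed.

Let mun o x t : measurable (under c phi o x t).
Proof. by rewrite -xSec; exact: measurable_xsection. Qed.

Let leb2_under1 o x t : leb2 (under c phi o x t) = (\int[lebR]_(s in `]0%R, t]) (phi (o * (x + c * s)))%:E)%E.
Proof.
have mF : measurable_fun setT (fun s : R => (phi (o * (x + c * s)))%:E).
  apply/measurable_EFinP; apply: (measurableT_comp mphi); apply: measurable_funM => //.
  by apply: measurable_funD => //; exact: measurable_funM.
rewrite -ge0_integral_lebR//; last 2 first.
- exact: measurable_funTS.
- by move=> s _; rewrite lee_fin.
rewrite [RHS]integral_mkcond; apply: eq_integral => s _ /=; rewrite /patch.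
case: ifPn => [|]; last first.
  move=> /negP sN; rewrite (_ : xsection _ s = set0); first exact: measure0.
  apply/seteqP; split => // q /xsectionP [/= s0 st _ _]; apply: sN.
  by rewrite inE/= in_itv/= s0.
rewrite inE/= in_itv/= => /andP[s0 st].
rewrite (_ : xsection _ s = `[0, phi (o * (x + c * s))]%classic).
  rewrite /leb lebesgue_measure_itv/= lte_fin; case: ltP => [_|]; first by rewrite -EFinB subr0.
  by move=> p0; congr EFin; apply/eqP; rewrite eq_le p0 phi_ge0.
apply/seteqP; split => q /=; rewrite in_itv/=; first by move=> /xsectionP [/= _ _ -> ->].
by move=> /andP[q0 qv]; apply/xsectionP.
Qed.

Lemma leb2_under x t : (leb2 (under c phi 1 x t) + leb2 (under c phi (-1) x t) = rate c x t)%E.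
Proof.
have mF o : measurable_fun setT (fun s : R => (phi (o * (x + c * s)))%:E).
  apply/measurable_EFinP; apply: (measurableT_comp mphi); apply: measurable_funM => //.
  by apply: measurable_funD => //; exact: measurable_funM.
rewrite !leb2_under1 -ge0_integralD//; last 4 first.
- by move=> s _; rewrite lee_fin.
- exact: measurable_funTS.
- by move=> s _; rewrite lee_fin.
- exact: measurable_funTS.
by apply: eq_integral => s _; rewrite /Phi mul1r mulN1r EFinD.
Qed.

(** Up to a null set, being at time [t] in the translate of [A] is the same event as starting in [A]
    with no point under the two rate curves: [backward] and [linear_void] give one inclusion,
    [forward] the other. The probability of the latter comes from [void_lawT]. *)
Lemma shift_law (A : set R) (t : R) : 0 <= t -> measurable A ->
  (forall x s : R, A x -> 0 <= s -> s <= t -> x + c * s != 0) ->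
  P (U t @^-1` [set y | A (y - c * t)]) = (\int[P]_(w in U 0 @^-1` A) expeR (- rate c (U 0 w) t))%E.
Proof.
move=> t0 mA nz; have [G [mG PG hG]] := ae_path.
have rcU w (s : R) : 0 <= s -> (fun s => U s w) @ s^'+ --> U s w by case: sol => _ [+ _]; exact.
have llU w (s : R) : 0 < s -> cvg ((fun s => U s w) @ s^'-) by case: sol => _ [_ [+ _]]; exact.
pose B M : set (R * R) := `]0, t] `*` `[0, M%:R].
pose Q := Num.truncn t.
have cB w (M : nat) : G w -> counting_on (Np w) (B M) /\ counting_on (Nm w) (B M).
  move=> /hG [[cp cm _] _].
  have BQ : B M `<=` sqbox (maxn M Q.+1)%:R.
    move=> -[p q] [/=]; rewrite !in_itv/= => /andP[p0 pt] /andP[q0 qM].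
    rewrite /sqbox/= !in_itv/= q0 (ltW p0)/=; split.
      rewrite (le_trans pt)// (@le_trans _ _ Q.+1%:R)//; first by rewrite ltW// truncnS_gt.
      by rewrite ler_nat leq_maxr.
    by rewrite (le_trans qM)// ler_nat leq_maxl.
  by split=> D mD DB; [apply: (cp (maxn M Q.+1))|apply: (cm (maxn M Q.+1))] => //; apply: subset_trans BQ.
pose V M := void_set Np Nm 0 t M%:R (U 0) G (Sec 1 t) (Sec (-1) t).
have vl (M : nat) := void_lawT P Np Nm 0 t M%:R (U 0) (PRM_indep_after P Np Nm (U 0) g prm) t0 G mG PG (fun w => cB w M) _ _ (mSec 1 t) (mSec (-1) t).
have mVA : measurable (U 0 @^-1` A) by rewrite -[X in measurable X]setTI; exact: mU.
pose E := G `&` U 0 @^-1` A `&` [set w | Np w (under c phi 1 (U 0 w) t) = 0%E] `&`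
   [set w | Nm w (under c phi (-1) (U 0 w) t) = 0%E].
have path : G `&` U t @^-1` [set y | A (y - c * t)] = E.
  apply/seteqP; split => w.
    move=> [Gw /= At]; have [[cp cm sm] [ip im eq]] := hG w Gw.
    have lin := backward _ _ _ c phi cp cm sm (rcU w) (llU w) ip im eq t t0.
    have {}lin : forall s : R, 0 <= s -> s <= t -> U s w = U t w - c * (t - s).
      apply: lin => s s0 st.
      by have := nz _ _ At s0 st; congr (_ != _); ring.
    have u0 : U 0 w = U t w - c * t by rewrite (lin 0) ?subr0.
    have [|||e1 e2] := linear_void _ _ _ c phi (llU w) ip im eq t t0.
    - by move=> s s0 st; rewrite u0; exact: nz.
    - by move=> o _; exact: mun.
    - by move=> s s0 st; rewrite lin// u0; ring.
    by split => //; split => //; split => //=; rewrite u0.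
  move=> [[[Gw Aw] /= e1] /= e2]; split => //=; have [[cp cm sm] [ip im eq]] := hG w Gw.
  rewrite (forward _ _ _ c phi cp cm sm (rcU w) (llU w) ip im eq t t0) ?addrK//.
  by move=> s s0 st; exact: nz.
have mB M : measurable (B M) by exact: measurableX.
have underB (m : {measure set (R * R) -> \bar R}) o x :
    m (under c phi o x t `&` B M) @[M --> \oo] --> m (under c phi o x t).
  have uE : under c phi o x t = \bigcup_M (under c phi o x t `&` B M).
    rewrite -setI_bigcupr setIidl// => -[p q] [/= p0 pt q0 _].
    exists (Num.truncn q).+1 => //; split; rewrite /= in_itv/= ?p0 ?q0//=.
    by rewrite ltW// truncnS_gt.
  rewrite [X in _ --> m X]uE; apply: nondecreasing_cvg_mu.
  - by move=> M; exact: measurableI.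
  - by rewrite -uE.
  - move=> M M' MM'; apply/subsetPset; apply: setIS => -[p q] [/= pt]; rewrite !in_itv/= => /andP[q0 qM].
    by split => //=; rewrite in_itv/= q0 (le_trans qM)// ler_nat.
(* Void probabilities are available in boxes only; the regions under the curves are exhausted by
   boxes of growing height [M]. *)
have EV : E = \bigcap_M (U 0 @^-1` A `&` V M).
  have z (m : {measure set (R * R) -> \bar R}) o x : m (under c phi o x t) = 0%E <->
      forall M : nat, m (under c phi o x t `&` B M) = 0%E.
    split.
      move=> m0 M; apply/eqP; rewrite eq_le measure_ge0 andbT -m0 le_measure ?inE//.
      exact: measurableI.
    move=> m0; apply: (cvg_unique (@ereal_hausdorff R) (underB m o x)).
    by apply: cvg_near_cst; apply: nearW.
  apply/seteqP; split => w.
    move=> [[[Gw Aw] /z e1] /z e2] M _; split => //; split; first split => //=.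
      by rewrite xSec; exact: e1.
    by rewrite /= xSec; exact: e2.
  move=> hw; have [Aw [[Gw _] _]] := hw 0%N I; split; first split => //=.
    by apply/z => M; have [_ [[_ /=]]] := hw M I; rewrite xSec.
  by apply/z => M; have [_ [_ /=]] := hw M I; rewrite xSec.
have mV M : measurable (V M) by have [] := vl M.
have mAt : measurable [set y | A (y - c * t)].
  have mf : measurable_fun setT (fun y : R => y - c * t) by exact: measurable_funB.
  by have := mf measurableT _ mA; rewrite setTI.
have mUt : measurable (U t @^-1` [set y | A (y - c * t)]).
  by rewrite -[X in measurable X]setTI; exact: mU.
rewrite -(probability_setI1 P _ G)// setIC path EV.
have PV (M : nat) : P (U 0 @^-1` A `&` V M) =
    (\int[P]_(w in U 0 @^-1` A) (void_rate 0 t M%:R (Sec 1 t) (Sec (-1) t) (U 0 w))%:E)%E.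
  have [_ _ /(_ 0%N 0%N (fun=> set0) (fun=> 0%N) (fun=> set0) (fun=> 0%N) A)] := vl M.
  rewrite !counts0 !setTI /pfam !big_ord0 !mul1e => -> //.
have c1 : P (U 0 @^-1` A `&` V M) @[M --> \oo] --> P (\bigcap_M (U 0 @^-1` A `&` V M)).
  apply: nonincreasing_cvg_mu => //.
  - by rewrite (le_lt_trans (probability_le1 P _)) ?ltry//; exact: measurableI.
  - by move=> M; exact: measurableI.
  - by apply: bigcapT_measurable => M; exact: measurableI.
  - move=> M M' MM'; apply/subsetPset; apply: setIS => w [[Gw /= e1] /= e2].
    have BM : B M `<=` B M'.
      move=> -[p q] [/= pt]; rewrite !in_itv/= => /andP[q0 qM].
      by split => //=; rewrite in_itv/= q0 (le_trans qM)// ler_nat.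
    have le0 (m : {measure set (R * R) -> \bar R}) S : measurable S -> m (S `&` B M') = 0%E -> m (S `&` B M) = 0%E.
      move=> mS m0; apply/eqP; rewrite eq_le measure_ge0 andbT -m0 le_measure ?inE//.
      - exact: measurableI.
      - exact: measurableI.
      - exact: setIS.
    split; first split => //=.
      by apply: le0 e1; exact: measurable_xsection.
    by apply: le0 e2; exact: measurable_xsection.
have c2 : P (U 0 @^-1` A `&` V M) @[M --> \oo] --> (\int[P]_(w in U 0 @^-1` A) expeR (- rate c (U 0 w) t))%E.
  under eq_fun do rewrite PV.
  have mr (M : nat) : measurable_fun (U 0 @^-1` A) (fun w => (void_rate 0 t M%:R (Sec 1 t) (Sec (-1) t) (U 0 w))%:E).
    by have [_ mr _] := vl M; exact: (measurable_funTS mr).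
  have cr w : (void_rate 0 t M%:R (Sec 1 t) (Sec (-1) t) (U 0 w))%:E @[M --> \oo] --> expeR (- rate c (U 0 w) t).
    pose a (M : nat) := fine (leb2R (under c phi 1 (U 0 w) t `&` B M)) + fine (leb2R (under c phi (-1) (U 0 w) t `&` B M)).
    have -> : (fun M : nat => (void_rate 0 t M%:R (Sec 1 t) (Sec (-1) t) (U 0 w))%:E) = (fun M => (expR (- a M))%:E).
      by apply/funext => M; rewrite /void_rate !xSec /a opprD.
    apply: cvg_expeRN; first by rewrite (lt_le_trans ltNy0)// integral_ge0// => s _; rewrite lee_fin addr_ge0.
    have fin o M : leb2R (under c phi o (U 0 w) t `&` B M) \is a fin_num.
      rewrite ge0_fin_numE// (@le_lt_trans _ _ (leb2R (B M)))//; last exact: leb2_box_lty.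
      rewrite le_measure ?inE//; exact: measurableI.
    have -> : (fun M => (a M)%:E) = (fun M => leb2R (under c phi 1 (U 0 w) t `&` B M) + leb2R (under c phi (-1) (U 0 w) t `&` B M))%E.
      by apply/funext => M; rewrite /a EFinD !fineK.
    rewrite -leb2_under; apply: cvgeD.
    - by apply: ge0_adde_def; rewrite inE measure_ge0.
    - exact: (underB leb2R).
    - exact: (underB leb2R).
  have ml : measurable_fun (U 0 @^-1` A) (fun w => expeR (- rate c (U 0 w) t)).
    by apply: (emeasurable_fun_cvg (fun (M : nat) w => (void_rate 0 t M%:R (Sec 1 t) (Sec (-1) t) (U 0 w))%:E)) => // w _; exact: cr.
  have [] := @dominated_convergence _ T R P (U 0 @^-1` A) mVA _ _ (cst 1%E) mr ml _ _ _ => //.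
  - by apply: aeW => w _; exact: cr.
  - exact: finite_measure_integrable_cst.
  - apply: aeW => w M _ /=; rewrite lee_fin ger0_norm ?expR_ge0// -expR0 ler_expR.
    by rewrite -opprD oppr_le0 addr_ge0// fine_ge0.
exact: (cvg_unique (@ereal_hausdorff R) c1 c2).
Qed.

(** By stationarity the expected fraction of grid times at which the path vanishes is [g [set 0]]
    for every grid, while along almost every path this fraction tends to 0. *)
Lemma no_atom0 : c != 0 -> g [set 0] = 0%E.
Proof.
move=> c0; have [G [mG PG hG]] := ae_path.
pose Z (n i : nat) : set T := U (i%:R / n.+1%:R) @^-1` [set 0].
have mZ n i : measurable (Z n i) by rewrite -[X in measurable X]setTI; exact: mU.
pose f (n : nat) w : R := (\sum_(i < n.+1) (U (i%:R / n.+1%:R) w == 0)%R)%:R / n.+1%:R.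
have fE n w : (f n w)%:E = (\sum_(i < n.+1) (n.+1%:R^-1)%:E * (\1_(Z n i) w)%:E)%E.
  rewrite /f natr_sum mulr_suml -sumEFin; apply: eq_bigr => i _.
  rewrite EFinM muleC indicE; congr (_ * (_%:R)%:E)%E.
  by congr nat_of_bool; apply/eqP/idP; rewrite inE.
have mf n : measurable_fun setT (fun w => (f n w)%:E).
  under eq_fun do rewrite fE.
  apply: emeasurable_sum => i; apply: measurable_funeM; apply/measurable_EFinP.
  exact: measurable_indic.
have If n : (\int[P]_w (f n w)%:E = g [set 0%R])%E.
  under eq_integral do rewrite fE.
  rewrite ge0_integral_sum//.
  - rewrite (eq_bigr (fun=> (n.+1%:R^-1)%:E * g [set 0%R])%E); last first.
      move=> i _; rewrite ge0_integralZl//.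
      + rewrite integral_indic// setIT; congr (_ * _)%E.
        by apply: inv => //; rewrite divr_ge0.
      + by apply/measurable_EFinP; exact: measurable_indic.
    have gf : g [set (0 : R)] \is a fin_num.
      rewrite -(inv 0 (lexx _))//; apply: fin_num_measure.
      by rewrite -[X in measurable X]setTI; exact: mU.
    rewrite -(fineK gf) -EFinM sumEFin sumr_const card_ord -[X in X%:E = _]mulr_natl mulrA divff ?mul1r//.
  - move=> i; apply: measurable_funeM; apply/measurable_EFinP.
    exact: measurable_indic.
have cf w : G w -> f n w @[n --> \oo] --> (0 : R).
  move=> Gw; have [[cp cm sm] [ip im eq]] := hG w Gw.
  by apply: (zeros_cvg (Np w) (Nm w) (fun s => U s w) c phi) => //.
have nG : P (~` G) = 0%E by rewrite probability_setC// PG subee.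
have [] := @dominated_convergence _ T R P setT measurableT (fun n w => (f n w)%:E) (cst 0%E) (cst 1%E) mf _ _ _ _ => //.
- exists (~` G); split => //; first exact: measurableC.
  move=> w /= nc Gw; apply: nc => _; apply: cvg_EFin; first exact: nearW.
  exact: cf.
- exact: finite_measure_integrable_cst.
- apply: aeW => w n _ /=; rewrite lee_fin ger0_norm ?divr_ge0// ler_pdivrMr// mul1r ler_nat.
  by rewrite -[leqRHS]card_ord -sum1_card leq_sum// => i _; exact: leq_b1.
rewrite integral0 => _ _; under eq_fun do rewrite If.
by move=> /(cvg_unique (@ereal_hausdorff R) (cvg_cst _)).
Qed.

End invariant_law.

(** * Densities, tails and affine changes of variable *)

Section density_measure.
Context {d : measure_display} {X : measurableType d} {R : realType}.
Variables (mu : {measure set X -> \bar R}) (f : X -> \bar R).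
Hypotheses (mf : measurable_fun setT f) (f0 : forall x, (0 <= f x)%E).

Let dens (A : set X) : \bar R := (\int[mu]_(x in A) f x)%E.

Let dens0 : dens set0 = 0%E. Proof. by rewrite /dens integral_set0. Qed.

Let dens_ge0 A : (0 <= dens A)%E. Proof. by rewrite /dens integral_ge0. Qed.

Let dens_sigma_additive : semi_sigma_additive dens.
Proof.
move=> F mF tF mUF; rewrite /dens ge0_integral_bigcup//; last exact: measurable_funTS.
apply: (is_cvg_ereal_nneg_natsum_cond (P := predT)) => n _ _.
by rewrite integral_ge0.
Qed.

Definition density_measure : {measure set X -> \bar R} :=
  HB.pack dens (isMeasure.Build _ X R dens dens0 dens_ge0 dens_sigma_additive).

Lemma density_measureE A : density_measure A = (\int[mu]_(x in A) f x)%E.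
Proof. by []. Qed.

End density_measure.

Lemma measure_tail_unique {R : realType} (m1 m2 : {measure set R -> \bar R}) :
  (m1 setT < +oo)%E ->
  (forall b : R, m1 `]b, +oo[%classic = m2 `]b, +oo[%classic) ->
  forall A, measurable A -> m1 A = m2 A.
Proof.
move=> m1f m12 A mA.
apply: (measure_unique (@RGenOInfty.G R) (fun n : nat => `](- n%:R)%R, +oo[%classic)) => //.
- exact: RGenOInfty.measurableE.
- move=> _ _ [x ->] [y ->]; exists (Num.max x y).
  by apply/seteqP; split => z /=; rewrite !in_itv/= !andbT gt_max => /andP.
- by move=> i; exists (- i%:R).
- apply/seteqP; split => // x _; exists (Num.truncn `|x|).+1 => //=; rewrite in_itv/= andbT.
  by rewrite ltrNl (le_lt_trans (ler_norm _))// normrN truncnS_gt.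
- by move=> _ [x ->].
- by move=> k; rewrite (le_lt_trans _ m1f)// le_measure ?inE.
Qed.

Section affine_integral.
Context {R : realType}.

Lemma lebR_itv (i : interval R) :
  lebR [set` i] = (if (i.1 < i.2)%E then ((i.2 : \bar R) - i.1)%E else 0%E).
Proof. exact: lebesgue_measure_itv. Qed.

Lemma lebR_set1 (a : R) : lebR [set a] = 0%E.
Proof. exact: lebesgue_measure_set1. Qed.

Lemma lebR_opp (x : R) (A : set R) : measurable A -> lebR ((fun s => x - s) @^-1` A) = lebR A.
Proof.
move=> mA.
have mf : measurable_fun [set: R] (fun s : R => x + 1 * s).
  by apply: measurable_funD => //; exact: measurable_funM.
have mB : measurable ((fun s => x + 1 * s) @^-1` A) by rewrite -[X in measurable X]setTI; exact: mf.
have := lebR_affine x 1 A ltr01 mA; rewrite invr1 mul1e => <-.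
rewrite -[RHS](lebesgue_measureN mB) /pushforward; congr (lebR _).
by apply/seteqP; split => s /=; rewrite mulrN mul1r.
Qed.

Lemma ge0_integral_affine (x c : R) (f : R -> \bar R) : 0 < c -> measurable_fun setT f -> (forall y, (0 <= f y)%E) ->
  (\int[lebR]_s f (x + c * s)%R = (c^-1)%:E * \int[lebR]_y f y)%E.
Proof.
move=> c0 mf f0; have ci0 : 0 <= c^-1 by rewrite invr_ge0 ltW.
have mth : measurable_fun [set: R] (fun s : R => x + c * s).
  by apply: measurable_funD => //; exact: measurable_funM.
have := @ge0_integral_mscale _ _ _ (@lebR R) setT measurableT (NngNum ci0) f.
move=> /(_ mf (fun x _ => f0 x))/= <-; apply/esym.
have := ge0_integral_transfer lebR (mscale (NngNum ci0) lebR) (fun s => x + c * s) (cst 1%E) mth _ _ _ _ f mf f0.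
move=> -> //.
  by apply: eq_integral => s _ /=; rewrite mul1e.
move=> B mB; transitivity ((c^-1)%:E * lebR B)%E => //; rewrite -(lebR_affine x)//.
have mBp : measurable ((fun s => x + c * s) @^-1` B) by rewrite -[X in measurable X]setTI; exact: mth.
transitivity (\int[lebR]_s (\1_((fun s => x + c * s) @^-1` B) s)%:E)%E.
  by rewrite integral_indic// setIT.
by apply: eq_integral => s _; rewrite mul1e !indicE; congr (_%:R%:E); apply/idP/idP; rewrite !inE.
Qed.

Lemma ge0_integral_reflect (x : R) (f : R -> \bar R) : measurable_fun setT f -> (forall y, (0 <= f y)%E) ->
  (\int[lebR]_s f (x - s)%R = \int[lebR]_y f y)%E.
Proof.
move=> mf f0.
have mth : measurable_fun [set: R] (fun s : R => x - s) by exact: measurable_funB.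
have := ge0_integral_transfer lebR lebR (fun s => x - s) (cst 1%E) mth _ _ _ _ f mf f0.
move=> -> //.
  by apply: eq_integral => s _ /=; rewrite mul1e.
move=> B mB; transitivity (lebR ((fun s => x - s) @^-1` B)); first by rewrite lebR_opp.
have mBp : measurable ((fun s => x - s) @^-1` B) by rewrite -[X in measurable X]setTI; exact: mth.
transitivity (\int[lebR]_s (\1_((fun s => x - s) @^-1` B) s)%:E)%E.
  by rewrite integral_indic// setIT.
by apply: eq_integral => s _; rewrite mul1e !indicE; congr (_%:R%:E); apply/idP/idP; rewrite !inE.
Qed.

End affine_integral.

Lemma ge0_oppeD {R : realType} (x y : \bar R) : (0 <= x)%E -> (0 <= y)%E -> (- (x + y) = - x - y)%E.
Proof. by case: x y => [x| |] [y| |] // _ _; rewrite fin_num_oppeD. Qed.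

(** * Laws that satisfy the shift identity *)

Section stationary_density.
Context {R : realType}.
Variables (g : probability R R) (phi : R -> R) (c : R).
Hypotheses (phi_ge0 : forall x, 0 <= phi x) (mphi : measurable_fun setT phi).
Hypothesis shift : forall (A : set R) (t : R), 0 <= t -> measurable A ->
  (forall x s : R, A x -> 0 <= s -> s <= t -> x + c * s != 0) ->
  g [set y | A (y - c * t)] = (\int[g]_(x in A) expeR (- rate phi c x t))%E.

Lemma measurable_Phi : measurable_fun setT (Phi phi).
Proof.
apply: measurable_funD => //; apply: (measurableT_comp mphi).
exact: oppr_measurable.
Qed.

Lemma measurable_EPhi : measurable_fun setT (fun r => (Phi phi r)%:E).
Proof. by apply/measurable_EFinP; exact: measurable_Phi. Qed.

Lemma Phi_ge0 x : 0 <= Phi phi x. Proof. by rewrite addr_ge0. Qed.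

Lemma rate_ge0 a x t : (0 <= rate phi a x t)%E.
Proof. by rewrite integral_ge0// => s _; rewrite lee_fin Phi_ge0. Qed.

Lemma measurable_rate a t : measurable_fun setT (fun x => rate phi a x t).
Proof.
have mF : measurable_fun setT (fun p : R * R => (Phi phi (p.1 + a * p.2) * \1_(`]0, t]%classic) p.2)%:E).
  apply/measurable_EFinP; apply: measurable_funM.
    apply: (measurableT_comp measurable_Phi); apply: measurable_funD; first exact: measurable_fst.
    by apply: measurable_funM => //; exact: measurable_snd.
  by apply: measurableT_comp => //; exact: measurable_snd.
have := measurable_fun_fubini_tonelli_F (m2 := @lebR R) _ mF.
move=> /(_ _) h; apply: (eq_measurable_fun _ _ (h _)).
- move=> x _; rewrite /fubini_F /rate [RHS]integral_mkcond; apply: eq_integral => s _ /=.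
  by rewrite /patch indicE; case: (_ \in _); rewrite ?mulr1 ?mulr0.
- by move=> p; rewrite lee_fin mulr_ge0 ?Phi_ge0.
Qed.

Lemma expeRN_fin (x : \bar R) : (0 <= x)%E -> expeR (- x) \is a fin_num /\ (expeR (- x) <= 1)%E.
Proof.
by case: x => [r| |] //= r0; split => //; rewrite -expR0 lee_fin ler_expR oppr_le0 -lee_fin.
Qed.

(** The shift identity indexed by the displacement [tau] instead of the time [tau / c], and extended
    from sets to functions. Starting points are positive, so for [c > 0] the trajectory never meets
    0. *)
Lemma shift_pos (tau : R) (f : R -> \bar R) : 0 < c -> 0 <= tau -> measurable_fun setT f -> (forall x, (0 <= f x)%E) ->
  (\int[g]_y ((\1_(`]tau, +oo[%classic) y)%:E * f y) =
   \int[g]_x ((\1_(`]0%R, +oo[%classic) x)%:E * expeR (- rate phi c x (tau / c)) * f (x + tau)%R))%E.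
Proof.
move=> c0 tau0 mf f0.
have mk : measurable_fun setT (fun x : R => (\1_(`]0%R, +oo[%classic) x)%:E * expeR (- rate phi c x (tau / c)))%E.
  apply: emeasurable_funM; first exact/measurable_EFinP/measurable_indic.
  apply: (measurableT_comp measurable_expeR); apply: measurableT_comp => //.
  exact: measurable_rate.
have k0 x : (0 <= (\1_(`]0%R, +oo[%classic) x)%:E * expeR (- rate phi c x (tau / c)))%E.
  by rewrite mule_ge0// expeR_ge0.
have kf x : ((\1_(`]0%R, +oo[%classic) x)%:E * expeR (- rate phi c x (tau / c)))%E \is a fin_num.
  by rewrite fin_numM// (expeRN_fin _ (rate_ge0 _ _ _)).1.
have mth : measurable_fun setT (fun x : R => x + tau) by exact: measurable_funD.
pose nu : {measure set R -> \bar R} := mrestr g (measurable_itv `]tau, +oo[).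
have nuE (B : set R) : nu B = g (B `&` `]tau, +oo[%classic) by [].
transitivity (\int[nu]_y f y)%E.
  apply/esym; apply: (ge0_integral_transfer g nu id (fun y => (\1_(`]tau, +oo[%classic) y)%:E)) => //.
  - exact/measurable_EFinP/measurable_indic.
  - move=> B mB; rewrite nuE -integral_indic//.
    rewrite integral_mkcond; apply: eq_integral => x _; rewrite /patch !indicE.
    by case: (x \in `]tau, +oo[%classic); rewrite ?mul1e ?mul0e.
apply: (ge0_integral_transfer g nu (fun x => x + tau)) => // B mB.
pose A := `]0, +oo[%classic `&` (fun x => x + tau) @^-1` B.
have mA : measurable A by apply: measurableI => //; rewrite -[X in measurable X]setTI; exact: mth.
have := shift A (tau / c); rewrite [c * _]mulrC divfK ?gt_eqF// => /(_ _ mA).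
have -> : [set y | A (y - tau)] = B `&` `]tau, +oo[%classic.
  apply/seteqP; split => y; rewrite /A/= !in_itv/= !andbT subr_gt0 subrK; first by move=> [].
  by move=> [].
move=> h; rewrite nuE h; last 2 first.
- by rewrite divr_ge0// ltW.
- move=> x s [/= + _] s0 _; rewrite in_itv/= andbT => x0.
  by rewrite gt_eqF// ltr_pwDl// mulr_ge0// ltW.
rewrite [LHS]integral_mkcond; apply: eq_integral => x _; rewrite /patch /A in_setI !indicE.
rewrite [x \in _ @^-1` B](_ : _ = ((x + tau) \in B)); last by apply/idP/idP; rewrite !inE.
by case: (x \in _) => /=; case: (_ \in B); rewrite /= ?mul0e ?mul1e ?mule1 ?mule0.
Qed.

(** With [c > 0] a particle that is negative at time [n] has not been reset before, so it started
    below [- c * n]. The mass there tends to 0. *)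
Lemma no_mass_neg : 0 < c -> g `]-oo, 0%R[%classic = 0%E.
Proof.
move=> c0.
pose A (n : nat) : set R := `]-oo, (- c * n%:R)%R[%classic.
have gA n : (g `]-oo, 0%R[%classic <= g (A n))%E.
  have mA : measurable (A n) by exact: measurable_itv.
  have := shift (A n) n%:R; rewrite (_ : [set y | _] = `]-oo, 0%R[%classic); last first.
    by apply/seteqP; split => y; rewrite /A/= !in_itv/= mulNr ltrBlDr addNr.
  move=> -> //; last first.
    move=> x s; rewrite /A/= in_itv/= => xn s0 sn; rewrite lt_eqF//.
    rewrite -(ltrD2r (- (c * s))) addrK sub0r (lt_le_trans xn)// mulNr lerN2.
    by rewrite ler_pM2l.
  apply: (@le_trans _ _ (\int[g]_(x in A n) cst 1%E x)%E); last by rewrite integral_cst// mul1e.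
  apply: ge0_le_integral => //.
  - by move=> x _; exact: expeR_ge0.
  - apply: measurable_funTS; apply: (measurableT_comp measurable_expeR); apply: measurableT_comp => //.
    exact: measurable_rate.
  - by move=> x _; have [] := expeRN_fin _ (rate_ge0 c x n%:R).
have cA : g (A n) @[n --> \oo] --> g (\bigcap_n A n).
  apply: nonincreasing_cvg_mu => //.
  - by rewrite (le_lt_trans (probability_le1 g _)) ?ltry//; exact: measurable_itv.
  - by move=> n; exact: measurable_itv.
  - by apply: bigcapT_measurable => n; exact: measurable_itv.
  - move=> n m nm; apply/subsetPset => x; rewrite /A/= !in_itv/= => /lt_le_trans; apply.
    by rewrite !mulNr lerN2 ler_pM2l// ler_nat.
have A0 : \bigcap_n A n = set0.
  apply/seteqP; split => // x Ax; have := Ax (Num.truncn (- x / c)).+1 I.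
  rewrite /A/= in_itv/= mulNr ltrNr mulrC -ltr_pdivlMr// => /lt_trans /(_ (truncnS_gt _)).
  by rewrite ltxx.
rewrite A0 measure0 in cA.
apply/eqP; rewrite eq_le measure_ge0 andbT; apply: (cvge_to_ge cA).
by apply: nearW.
Qed.

Lemma PsiE x : Psi phi x = (\int[lebR]_(r in `]0%R, x]) (Phi phi r)%:E)%E.
Proof.
have mF : measurable_fun setT (fun r => (Phi phi r)%:E) by exact: measurable_EPhi.
rewrite /Psi /leb -integral_itv_obnd_cbnd; last exact: measurable_funTS.
rewrite -/leb ge0_integral_lebR//; first exact: measurable_funTS.
by move=> r _; rewrite lee_fin Phi_ge0.
Qed.

Lemma Psi_ge0 x : (0 <= Psi phi x)%E.
Proof. by rewrite integral_ge0// => s _; rewrite lee_fin Phi_ge0. Qed.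

Lemma measurable_Psi : measurable_fun setT (Psi phi).
Proof.
pose S := [set p : R * R | 0 < p.2 <= p.1].
have mS : measurable S.
  rewrite (_ : S = (setT `&` snd @^-1` `]0, +oo[%classic) `&` (setT `&` [set p : R * R | p.2 <= p.1])).
    apply: measurableI; last by apply: measurable_fun_le; [|exact: measurable_snd|exact: measurable_fst].
    exact: measurable_snd.
  apply/seteqP; split => p; rewrite /S/= in_itv/= andbT; first by move=> /andP[].
  by move=> [[_ ->] [_ ->]].
have mF : measurable_fun setT (fun p : R * R => (Phi phi p.2 * \1_S p)%:E).
  apply/measurable_EFinP; apply: measurable_funM; last exact: measurable_indic.
  by apply: (measurableT_comp measurable_Phi); exact: measurable_snd.
have := measurable_fun_fubini_tonelli_F (m2 := @lebR R) _ mF.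
move=> /(_ _) h; apply: (eq_measurable_fun _ _ (h _)).
- move=> x _; rewrite /fubini_F PsiE [RHS]integral_mkcond; apply: eq_integral => s _ /=.
  rewrite /patch indicE (_ : ((x, s) \in S) = (s \in `]0, x]%classic)); last first.
    by apply/idP/idP; rewrite !inE /S/= ?in_itv.
  by case: (s \in _); rewrite ?mulr1 ?mulr0.
- by move=> p; rewrite lee_fin mulr_ge0 ?Phi_ge0.
Qed.

Lemma Psi_rate (x t : R) : 0 < c -> 0 <= x -> 0 <= t ->
  (Psi phi x * (c^-1)%:E + rate phi c x t = Psi phi (x + c * t)%R * (c^-1)%:E)%E.
Proof.
move=> c0 x0 t0.
have mF : measurable_fun setT (fun r => (Phi phi r)%:E) by exact: measurable_EPhi.
have xy : x <= x + c * t by rewrite lerDl mulr_ge0// ltW.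
have -> : rate phi c x t = ((c^-1)%:E * \int[lebR]_(r in `]x, (x + c * t)%R]) (Phi phi r)%:E)%E.
  rewrite integral_mkcond -(ge0_integral_affine x c)//; last 2 first.
  - by apply/(measurable_restrictT _ _).1 => //; exact: measurable_funTS.
  - by move=> y; rewrite /patch; case: ifPn => // _; rewrite lee_fin Phi_ge0.
  rewrite /rate integral_mkcond; apply: eq_integral => s _; rewrite /patch.
  rewrite (_ : (s \in `]0, t]%classic) = (x + c * s \in `]x, (x + c * t)]%classic))//.
  by apply/idP/idP; rewrite !inE/= !in_itv/= ltrDl lerD2l pmulr_rgt0// ler_pM2l.
rewrite !PsiE [in RHS](@itv_bndbnd_setU _ _ (BRight 0) (BRight x)) ?bnd_simp//.
rewrite ge0_integral_setU//.
- have i0 a b : (0 <= \int[lebR]_(r in `]a, b]) (Phi phi r)%:E)%E.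
    by rewrite integral_ge0// => s _; rewrite lee_fin Phi_ge0.
  by rewrite [RHS]muleC (ge0_muleDr _ (i0 _ _) (i0 _ _)) [X in (X + _)%E]muleC.
- exact: measurable_funTS.
- by move=> s _; rewrite lee_fin Phi_ge0.
- by apply/disj_setPS => y [/=]; rewrite !in_itv/= => /andP[_ yx] /andP[+ _]; rewrite ltNge yx.
Qed.

(** The unnormalised candidate density. By [q_shift] it is transported with exactly the survival
    factor of the shift identity. *)
Let q (x : R) : \bar R := expeR (- (Psi phi x * (c^-1)%:E)).

Lemma q_shift (x tau : R) : 0 < c -> 0 <= x -> 0 <= tau ->
  (q x * expeR (- rate phi c x (tau / c)) = q (x + tau)%R)%E.
Proof.
move=> c0 x0 tau0; have t0 : 0 <= tau / c by rewrite divr_ge0// ltW.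
have := Psi_rate x (tau / c) c0 x0 t0; rewrite [c * _]mulrC divfK ?gt_eqF// /q => <-.
rewrite -expeRD; congr expeR; rewrite (ge0_oppeD _ _ _ (rate_ge0 _ _ _))//.
by rewrite mule_ge0 ?Psi_ge0// lee_fin invr_ge0 ltW.
Qed.

Lemma q_ge0 x : (0 <= q x)%E. Proof. exact: expeR_ge0. Qed.

Lemma measurable_q : measurable_fun setT q.
Proof.
apply: (measurableT_comp measurable_expeR); apply: measurableT_comp => //.
by apply: emeasurable_funM => //; exact: measurable_Psi.
Qed.

Definition weight (B : set R) : \bar R := (\int[lebR]_(x in B) q x)%E.

(** For a displacement [tau] the shift identity sends [x] in [A] to [x + tau] in [B] with a survival
    factor that turns [q x] into [q (x + tau)]. Hence the [g]-integrals of [F1] and [F2] agree for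
    each [tau], and Tonelli over [tau] gives the two products. This form replaces a division by [q],
    which may vanish. *)
Lemma weight_balance (b : R) (A B : set R) : 0 < c -> 0 < b -> measurable A -> measurable B ->
  A `<=` `]0, b]%classic -> B `<=` `]b, +oo[%classic -> (g A * weight B = g B * weight A)%E.
Proof.
move=> c0 b0 mA mB Ab bB.
pose F1 (p : R * R) : \bar R := ((\1_A p.1)%:E * ((\1_B (p.1 + p.2)%R)%:E * q (p.1 + p.2)%R))%E.
pose F2 (p : R * R) : \bar R := ((\1_B p.1)%:E * ((\1_A (p.1 - p.2)%R)%:E * q (p.1 - p.2)%R))%E.
have F10 p : (0 <= F1 p)%E by rewrite mule_ge0// mule_ge0// q_ge0.
have F20 p : (0 <= F2 p)%E by rewrite mule_ge0// mule_ge0// q_ge0.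
have mplus : measurable_fun setT (fun p : R * R => p.1 + p.2).
  by apply: measurable_funD; [exact: measurable_fst|exact: measurable_snd].
have mminus : measurable_fun setT (fun p : R * R => p.1 - p.2).
  by apply: measurable_funB; [exact: measurable_fst|exact: measurable_snd].
have mind (D : set R) (u : R * R -> R) : measurable D -> measurable_fun setT u ->
    measurable_fun setT (fun p => (\1_D (u p))%:E : \bar R).
  by move=> mD mu; apply/measurable_EFinP; apply: measurableT_comp; [exact: measurable_indic|exact: mu].
have mF1 : measurable_fun setT F1.
  apply: emeasurable_funM; first by apply: mind => //; exact: measurable_fst.
  by apply: emeasurable_funM; [exact: mind|exact: measurableT_comp measurable_q mplus].
have mF2 : measurable_fun setT F2.
  apply: emeasurable_funM; first by apply: mind => //; exact: measurable_fst.
  by apply: emeasurable_funM; [exact: mind|exact: measurableT_comp measurable_q mminus].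
have mBq : measurable_fun setT (fun y => (\1_B y)%:E * q y)%E.
  by apply: emeasurable_funM; [apply/measurable_EFinP/measurable_indic|exact: measurable_q].
have mAq : measurable_fun setT (fun y => (\1_A y)%:E * q y)%E.
  by apply: emeasurable_funM; [apply/measurable_EFinP/measurable_indic|exact: measurable_q].
have wE (D : set R) : (weight D = \int[lebR]_x ((\1_D x)%:E * q x))%E.
  rewrite /weight integral_mkcond; apply: eq_integral => x _; rewrite /patch indicE.
  by case: (x \in D); rewrite ?mul1e ?mul0e.
have inner (D : set R) : measurable D -> forall x, (\int[lebR]_y ((\1_D (x + y)%R)%:E * q (x + y)%R) = weight D)%E.
  move=> mD x; have mDq : measurable_fun setT (fun y => (\1_D y)%:E * q y)%E.
    by apply: emeasurable_funM; [apply/measurable_EFinP/measurable_indic|exact: measurable_q].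
  rewrite wE; have := ge0_integral_affine x 1 (fun y => (\1_D y)%:E * q y)%E ltr01 mDq.
  rewrite invr1 mul1e => <-; first by apply: eq_integral => y _; rewrite mul1r.
  by move=> y; rewrite mule_ge0// q_ge0.
have inner' (D : set R) : measurable D -> forall x, (\int[lebR]_y ((\1_D (x - y)%R)%:E * q (x - y)%R) = weight D)%E.
  move=> mD x; have mDq : measurable_fun setT (fun y => (\1_D y)%:E * q y)%E.
    by apply: emeasurable_funM; [apply/measurable_EFinP/measurable_indic|exact: measurable_q].
  rewrite wE; apply: (ge0_integral_reflect x (fun y => (\1_D y)%:E * q y)%E mDq).
  by move=> y; rewrite mule_ge0// q_ge0.
have w0 D : (0 <= weight D)%E by rewrite integral_ge0// => x _; exact: q_ge0.
have outer (D : set R) (k : \bar R) : measurable D -> (0 <= k)%E -> (\int[g]_x ((\1_D x)%:E * k) = g D * k)%E.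
  move=> mD k0; under eq_integral do rewrite muleC.
  rewrite ge0_integralZl//; first by rewrite integral_indic// setIT muleC.
  by apply/measurable_EFinP/measurable_indic.
have L : (\int[g]_x \int[lebR]_y F1 (x, y) = g A * weight B)%E.
  rewrite -outer//; apply: eq_integral => x _; rewrite /F1/= ge0_integralZl//.
  - by rewrite inner.
  - apply: emeasurable_funM.
      apply/measurable_EFinP; apply: measurableT_comp; first exact: measurable_indic.
      exact: measurable_funD.
    by apply: (measurableT_comp measurable_q); exact: measurable_funD.
  - by move=> y _; rewrite mule_ge0// q_ge0.
have L' : (\int[g]_x \int[lebR]_y F2 (x, y) = g B * weight A)%E.
  rewrite -outer//; apply: eq_integral => x _; rewrite /F2/= ge0_integralZl//.
  - by rewrite inner'.
  - apply: emeasurable_funM.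
      apply/measurable_EFinP; apply: measurableT_comp; first exact: measurable_indic.
      exact: measurable_funB.
    by apply: (measurableT_comp measurable_q); exact: measurable_funB.
  - by move=> y _; rewrite mule_ge0// q_ge0.
have M tau : (\int[g]_x F1 (x, tau) = \int[g]_x F2 (x, tau))%E.
  (* Backward displacements contribute nothing because [A] lies to the left of [b] and [B] to the
     right; the shift identity only goes forward. *)
  have [tau0|tau0] := leP 0 tau; last first.
    rewrite !integral0_eq// => x _; rewrite /F1 /F2 /= !indicE.
      case: (boolP (x \in B)) => [|_]; last by rewrite mul0e.
      rewrite inE => /bB; rewrite /= in_itv/= andbT => bx.
      case: (boolP (_ \in A)) => [|_]; last by rewrite mul0e mule0.
      rewrite inE => /Ab; rewrite /= in_itv/= => /andP[_ xb].
      have : x < x - tau by rewrite ltrDl oppr_gt0.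
      by move=> /lt_le_trans/(_ xb)/(lt_trans bx); rewrite ltxx.
    case: (boolP (x \in A)) => [|_]; last by rewrite mul0e.
    rewrite inE => /Ab; rewrite /= in_itv/= => /andP[_ xb].
    case: (boolP (_ \in B)) => [|_]; last by rewrite mul0e mule0.
    rewrite inE => /bB; rewrite /= in_itv/= andbT => bx.
    have : x + tau < x by rewrite gtrDl.
    by move=> /lt_le_trans/(_ xb)/(lt_trans bx); rewrite ltxx.
  have mt : measurable_fun setT (fun y : R => y - tau) by exact: measurable_funB.
  have mF2t : measurable_fun setT (fun y => F2 (y, tau)).
    apply: emeasurable_funM; first by apply/measurable_EFinP/measurable_indic.
    apply: emeasurable_funM; last exact: (measurableT_comp measurable_q mt).
    apply/measurable_EFinP; apply: (measurableT_comp _ mt); exact: measurable_indic.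
  transitivity (\int[g]_y ((\1_(`]tau, +oo[%classic) y)%:E * F2 (y, tau)))%E; last first.
    apply: eq_integral => y _; rewrite indicE; case: (boolP (y \in `]tau, +oo[%classic)) => [|/negP yt].
      by rewrite mul1e.
    rewrite mul0e /F2/= [\1_A _]indicE; case: (boolP (_ \in A)) => [|_]; last by rewrite mul0e mule0.
    rewrite inE => /Ab; rewrite /= in_itv/= subr_gt0 => /andP[ty _]; exfalso; apply: yt.
    by rewrite inE/= in_itv/= ty.
  rewrite shift_pos//; apply: eq_integral => x _; rewrite /F1 /F2/= addrK !indicE.
  case: (boolP (x \in A)) => [|_]; last by rewrite !mul0e !mule0.
  rewrite inE => /Ab; rewrite /= in_itv/= => /andP[x0 _].
  have xin : x \in `]0, +oo[%classic by rewrite inE/= in_itv/= x0.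
  rewrite xin !mul1e -(q_shift x tau)//; last exact: ltW.
  by rewrite [RHS]muleC muleA.
have T1 := fubini_tonelli (m1 := g) (m2 := lebR) F1 mF1 F10.
have T2 := fubini_tonelli (m1 := g) (m2 := lebR) F2 mF2 F20.
transitivity (\int[g]_x \int[lebR]_y F1 (x, y))%E; first exact: (esym L).
transitivity (\int[g]_x \int[lebR]_y F2 (x, y))%E; last exact: L'.
apply: (etrans T1); apply: (etrans _ (esym T2)).
by apply: eq_integral => tau _; exact: M.
Qed.

Lemma Psi_shift y : 0 <= y ->
  (Psi phi y = \int[lebR]_tau ((\1_(`[0%R, +oo[%classic) tau)%:E * ((\1_(`]0%R, +oo[%classic) (y - tau)%R)%:E * (Phi phi (y - tau))%:E)))%E.
Proof.
move=> y0; rewrite PsiE.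
pose f (r : R) : \bar R := (\1_(`]0%R, y]%classic) r * Phi phi r)%:E.
have mf : measurable_fun setT f.
  by apply/measurable_EFinP; apply: measurable_funM; [exact: measurable_indic|exact: measurable_Phi].
have f0 r : (0 <= f r)%E by rewrite lee_fin mulr_ge0 ?Phi_ge0.
transitivity (\int[lebR]_r f r)%E.
  rewrite integral_mkcond; apply: eq_integral => r _; rewrite /patch /f indicE.
  by case: (r \in _); rewrite ?mul1r ?mul0r.
rewrite -(ge0_integral_reflect y)//; apply: eq_integral => tau _.
rewrite /f -!EFinM; congr EFin; rewrite mulrA; congr (_ * _); rewrite !indicE -natrM mulnb.
congr (_%:R); congr nat_of_bool; apply/idP/andP.
  by rewrite !inE/= !in_itv/= !andbT => /andP[h1 h2]; split; rewrite // -(lerD2l y) addr0; lra.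
by rewrite !inE/= !in_itv/= !andbT => -[h1 h2]; lra.
Qed.

(** [Psi] might be infinite at every positive point. Applying the shift identity to [Phi] for each
    displacement in the interval from 0 to [K] and integrating bounds the integral of [Psi] over
    that interval by [K] times the mean of [Phi], so [Psi] is finite at some point. *)
Lemma Psi_finite (K : R) : 0 < c -> 0 < K -> (\int[g]_x (Phi phi x)%:E < +oo)%E ->
  (0 < g `]0%R, K]%classic)%E -> exists2 y : R, 0 < y & (Psi phi y < +oo)%E.
Proof.
move=> c0 K0 Phifin gK.
pose G (p : R * R) : \bar R := ((\1_(`]0%R, K]%classic) p.1)%:E *
  ((\1_(`[0%R, +oo[%classic) p.2)%:E * ((\1_(`]0%R, +oo[%classic) (p.1 - p.2)%R)%:E * (Phi phi (p.1 - p.2))%:E)))%E.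
have mminus : measurable_fun setT (fun p : R * R => p.1 - p.2).
  by apply: measurable_funB; [exact: measurable_fst|exact: measurable_snd].
have mind (D : set R) (u : R * R -> R) : measurable D -> measurable_fun setT u ->
    measurable_fun setT (fun p => (\1_D (u p))%:E : \bar R).
  by move=> mD mu; apply/measurable_EFinP; apply: measurableT_comp; [exact: measurable_indic|exact: mu].
have G0 p : (0 <= G p)%E by rewrite !mule_ge0// lee_fin Phi_ge0.
have mG : measurable_fun setT G.
  apply: emeasurable_funM; first by apply: mind => //; exact: measurable_fst.
  apply: emeasurable_funM; first by apply: mind => //; exact: measurable_snd.
  apply: emeasurable_funM; first exact: mind.
  exact: (measurableT_comp measurable_EPhi mminus).
have L : (\int[g]_y \int[lebR]_tau G (y, tau) = \int[g]_(y in `]0%R, K]) Psi phi y)%E.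
  rewrite [RHS]integral_mkcond; apply: eq_integral => y _; rewrite /patch /G/= indicE.
  case: ifPn => [|_]; last by rewrite integral0_eq// => tau _; rewrite mul0e.
  rewrite inE/= in_itv/= => /andP[y0 _]; rewrite Psi_shift ?(ltW y0)//.
  by apply: eq_integral => tau _; rewrite mul1e.
have M (tau : R) : (\int[g]_y G (y, tau) <= (\1_(`[0%R, K]%classic) tau)%:E * \int[g]_x (Phi phi x)%:E)%E.
  have [tauK|tauK] := boolP (tau \in `[0%R, K]%classic); last first.
    rewrite indicE (negPf tauK) mul0e integral0_eq// => y _; rewrite /G/= !indicE.
    have [yK|] := boolP (y \in `]0%R, K]%classic); last by rewrite mul0e.
    have [tau0|] := boolP (tau \in `[0%R, +oo[%classic); last by rewrite mul0e mule0.
    have [yt|] := boolP (_ \in `]0%R, +oo[%classic); last by rewrite mul0e !mule0.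
    move: yK tau0 yt tauK; rewrite !inE/= !in_itv/= !andbT => /andP[h1 h2] h3 h4 /negP[].
    by rewrite inE/= in_itv/= h3; lra.
  rewrite indicE tauK mul1e.
  have tau0 : 0 <= tau by move: tauK; rewrite inE/= in_itv/= => /andP[].
  have mt : measurable_fun setT (fun y : R => y - tau) by exact: measurable_funB.
  pose f (y : R) : \bar R := ((\1_(`]0%R, +oo[%classic) (y - tau)%R)%:E * (Phi phi (y - tau))%:E)%E.
  have mf : measurable_fun setT f.
    apply: emeasurable_funM; last exact: (measurableT_comp measurable_EPhi mt).
    by apply/measurable_EFinP; apply: (measurableT_comp _ mt); exact: measurable_indic.
  have f0 y : (0 <= f y)%E by rewrite mule_ge0// lee_fin Phi_ge0.
  have mf' : measurable_fun setT (fun y => (\1_(`]tau, +oo[%classic) y)%:E * f y)%E.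
    by apply: emeasurable_funM => //; apply/measurable_EFinP; exact: measurable_indic.
  apply: (@le_trans _ _ (\int[g]_y ((\1_(`]tau, +oo[%classic) y)%:E * f y))%E).
    apply: ge0_le_integral => //.
    - exact: (measurableT_comp mG (measurable_pair2 tau)).
    - move=> y _; rewrite /G/= !indicE /f.
      have [yt|yt] := boolP (y \in `]tau, +oo[%classic).
        rewrite mul1e; case: (_ \in _) => /=; last by rewrite mul0e f0.
        by case: (_ \in _) => /=; rewrite ?mul1e ?mul0e ?f0.
      rewrite [leRHS]mul0e (_ : (y - tau \in `]0%R, +oo[%classic) = false) ?mul0e ?mule0//.
      by apply/negbTE; apply: contra yt; rewrite !inE/= !in_itv/= !andbT subr_gt0.
  rewrite shift_pos//; apply: ge0_le_integral => //.
  - by move=> x _; rewrite mule_ge0// mule_ge0// expeR_ge0.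
  - apply: emeasurable_funM.
      apply: emeasurable_funM; first by apply/measurable_EFinP; exact: measurable_indic.
      apply: (measurableT_comp measurable_expeR); apply: measurableT_comp => //.
      exact: measurable_rate.
    by apply: (measurableT_comp mf); exact: measurable_funD.
  - exact: measurable_EPhi.
  - move=> x _; rewrite /f addrK indicE; case: (_ \in _) => /=; last by rewrite !mul0e lee_fin Phi_ge0.
    rewrite !mul1e -[leRHS]mul1e lee_wpmul2r ?lee_fin ?Phi_ge0//.
    by have [] := expeRN_fin _ (rate_ge0 c x (tau / c)).
have fin : (\int[g]_(y in `]0%R, K]) Psi phi y < +oo)%E.
  rewrite -L (fubini_tonelli (m1 := g) (m2 := lebR) G mG G0).
  apply: (@le_lt_trans _ _ (\int[lebR]_tau ((\1_(`[0%R, K]%classic) tau)%:E * \int[g]_x (Phi phi x)%:E))%E).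
    apply: ge0_le_integral => //.
    - by move=> tau _; rewrite integral_ge0.
    - exact: (measurable_fun_fubini_tonelli_G (m1 := g) G mG G0).
    - apply: emeasurable_funM => //; apply/measurable_EFinP; exact: measurable_indic.
  have I0 : (0 <= \int[g]_x (Phi phi x)%:E)%E by rewrite integral_ge0// => x _; rewrite lee_fin Phi_ge0.
  under eq_integral do rewrite muleC.
  rewrite ge0_integralZl//; last by apply/measurable_EFinP; exact: measurable_indic.
  have -> : (\int[lebR]_tau (\1_(`[0%R, K]%classic) tau)%:E = lebR `[0%R, K]%classic)%E.
    by rewrite integral_indic// setIT.
  rewrite lebR_itv/= lte_fin K0 -EFinB.
  have If : (\int[g]_x (Phi phi x)%:E)%E \is a fin_num by rewrite ge0_fin_numE.
  by rewrite -(fineK If) -EFinM ltry.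
apply: contrapT => /forall2NP nfin.
have Psi_oo y : 0 < y -> Psi phi y = +oo%E.
  by move=> y0; have [//|/negP] := nfin y; rewrite -leNgt leye_eq => /eqP.
move: fin; rewrite (eq_integral (cst +oo%E)); last first.
  by move=> y; rewrite inE/= in_itv/= => /andP[y0 _]; exact: Psi_oo.
by rewrite integral_cst// gt0_mulye// ltxx.
Qed.

Lemma Psi_le x y : x <= y -> (Psi phi x <= Psi phi y)%E.
Proof.
move=> xy; rewrite !PsiE; apply: ge0_subset_integral => //.
- exact: measurable_funTS measurable_EPhi.
- by move=> r _; rewrite lee_fin Phi_ge0.
- by move=> r /=; rewrite !in_itv/= => /andP[-> /le_trans]; apply.
Qed.

(** At speed 0 and time 1 the identity says that integrating [expR (- Phi)] over the complement of 0
    loses no mass. There [Phi], which is even, is positive, so the complement is null. *)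
Lemma zero_drift_law : c = 0 -> hypA phi -> g [set 0] = 1%E.
Proof.
move=> c0 hA; pose A : set R := ~` [set 0].
have mA : measurable A by apply: measurableC.
have PhiA x : A x -> 0 < Phi phi x.
  move=> x0; have [xp|xn|e] := ltgtP 0 x; [exact: hA| |by case: x0; rewrite /= -e].
  by rewrite /Phi addrC -{2}[x]opprK; apply: hA; rewrite oppr_gt0.
have rE x : rate phi c x 1 = (Phi phi x)%:E.
  rewrite /rate c0 (eq_integral (cst (Phi phi x)%:E)); last by move=> s _; rewrite mul0r addr0.
  have l1 : lebR `](0 : R), 1]%classic = 1%E by rewrite lebR_itv/= lte_fin ltr01 -EFinB subr0.
  by rewrite integral_cst//= -[RHS]mule1 -l1.
have gA : g A = (\int[g]_(x in A) (expR (- Phi phi x))%:E)%E.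
  have := shift A 1 ler01 mA; rewrite (_ : [set y | _] = A); last first.
    by apply/seteqP; split => y; rewrite /A/= c0 mul0r subr0.
  move=> ->; last by move=> x s /= /eqP x0 _ _; rewrite c0 mul0r addr0.
  by apply: eq_integral => x _; rewrite rE.
have mexp : measurable_fun setT (fun x => (expR (- Phi phi x))%:E).
  apply/measurable_EFinP; apply: (measurableT_comp (@measurable_expR R)).
  exact: (measurableT_comp (@oppr_measurable R setT) measurable_Phi).
have iexp : g.-integrable A (fun x => (expR (- Phi phi x))%:E).
  apply: (le_integrable mA (measurable_funTS mexp)); last exact: (finite_measure_integrable_cst g 1 mA).
  move=> x _ /=; rewrite lee_fin normr1 ger0_norm ?expR_ge0// -expR0 ler_expR oppr_le0 Phi_ge0//.
have dif : (\int[g]_(x in A) (1 - (expR (- Phi phi x))%:E) = 0)%E.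
  rewrite (integralB mA (finite_measure_integrable_cst g 1 mA) iexp) -gA.
  have -> : (\int[g]_(x in A) (1%R : R)%:E = g A)%E by rewrite (integral_cst g mA) mul1e.
  by rewrite subee// fin_num_measure.
have f0 x : (0 <= 1 - (expR (- Phi phi x))%:E)%E.
  by rewrite -EFinB lee_fin subr_ge0 -expR0 ler_expR oppr_le0 Phi_ge0.
have mf : measurable_fun A (fun x => 1 - (expR (- Phi phi x))%:E)%E.
  by apply: measurable_funTS; apply: emeasurable_funB.
have : (\int[g]_(x in A) `|1 - (expR (- Phi phi x))%:E| = 0)%E.
  by rewrite -[RHS]dif; apply: eq_integral => x _; rewrite gee0_abs.
move/(ae_eq_integral_abs g mA mf) => [N [mN N0 sN]].
have gA0 : g A = 0%E.
  apply/eqP; rewrite eq_le measure_ge0 andbT -N0 le_measure ?inE//.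
  move=> x Ax; apply: sN => /= /(_ Ax) /eqP; rewrite -EFinB eqe subr_eq0 => /eqP e.
  have : expR (- Phi phi x) < 1 by rewrite -expR0 ltr_expR oppr_lt0 PhiA.
  by rewrite -e ltxx.
rewrite -[X in g X]setCK -/A probability_setC// gA0 sube0//.
Qed.

Let Z := weight `]0%R, +oo[%classic.

Hypotheses (c0 : 0 < c) (g0 : g [set 0] = 0%E)
  (intPhi : (\int[g]_x (Phi phi x)%:E < +oo)%E) (Zfin : (Z < +oo)%E).

Lemma mass_pos : g `]0%R, +oo[%classic = 1%E.
Proof.
have E : (~` `]0%R, +oo[%classic : set R) = `]-oo, 0%R[%classic `|` [set 0].
  apply/seteqP; split => x /=; rewrite !in_itv/= andbT.
    by move=> /negP; rewrite -leNgt le_eqVlt => /orP[/eqP->|]; [right|left].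
  by move=> [x0|->]; apply/negP; rewrite -leNgt // ltW.
have D : `]-oo, 0%R[%classic `&` [set 0] = set0 :> set R.
  by apply/seteqP; split => // x [/= x0 x1]; move: x0; rewrite x1 in_itv/= ltxx.
have : g (~` `]0%R, +oo[%classic) = 0%E.
  transitivity (g `]-oo, 0%R[%classic + g [set 0%R])%E; last by rewrite no_mass_neg// g0 adde0.
  by rewrite E measureU.
by rewrite -[X in _ -> g X = _]setCK => h; rewrite probability_setC ?h ?sube0//; exact: measurableC.
Qed.

Let wsplit (b : R) : 0 < b -> Z = (weight `]0%R, b]%classic + weight `]b, +oo[%classic)%E.
Proof.
move=> b0; rewrite /Z /weight (@itv_bndbnd_setU _ _ (BRight 0) (BRight b)) ?bnd_simp ?ltW//.
rewrite ge0_integral_setU//.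
- exact: measurable_funTS measurable_q.
- by move=> x _; exact: q_ge0.
- by apply/disj_setPS => y [/=]; rewrite !in_itv/= => /andP[_ yx]; rewrite andbT ltNge yx.
Qed.

Let gsplit (b : R) : 0 < b -> (g `]0%R, b]%classic + g `]b, +oo[%classic = 1)%E.
Proof.
move=> b0; rewrite -mass_pos [in RHS](@itv_bndbnd_setU _ _ (BRight 0) (BRight b)) ?bnd_simp ?ltW//.
rewrite measureU//; apply/seteqP; split => // y [/=]; rewrite !in_itv/= => /andP[_ yx].
by rewrite andbT ltNge yx.
Qed.

(** Below a point [y] with [Psi phi y] finite, [q] is at least [q y > 0]. [Psi_finite] supplies such
    a point, from a bounded interval charged by [g]. *)
Lemma weight_total_gt0 : (0 < Z)%E.
Proof.
have [K K0 gK] : exists2 K : R, 0 < K & (0 < g `]0%R, K]%classic)%E.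
  apply: contrapT => /forall2NP H.
  have gn n : g `]0, n.+1%:R]%classic = 0%E.
    have [//|/negP] := H n.+1%:R; rewrite -leNgt => h.
    by apply/eqP; rewrite eq_le h measure_ge0.
  have : g (\bigcup_n `]0, n.+1%:R]%classic) = 0%E.
    apply/negligibleP; first exact: bigcupT_measurable.
    by apply: negligible_bigcup => n; apply/negligibleP; [exact: measurable_itv|exact: gn].
  rewrite (_ : \bigcup_n _ = `]0%R, +oo[%classic); first by rewrite mass_pos => /eqP; rewrite onee_eq0.
  apply/seteqP; split => x /=; first by move=> [n _ /=]; rewrite !in_itv/= andbT => /andP[].
  rewrite in_itv/= andbT => x0; exists (Num.truncn x) => //=; rewrite in_itv/= x0.
  by rewrite ltW// truncnS_gt.
have [y y0 Psiy] := Psi_finite K c0 K0 intPhi gK.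
have h1 : (0 < q y * y%:E)%E.
  rewrite mule_gt0// expeR_gt0//.
  by move: Psiy (Psi_ge0 y); case: (Psi phi y) => [r| |] //= _ _; rewrite ltNyr.
apply: (lt_le_trans h1).
rewrite /Z /weight (@itv_bndbnd_setU _ _ (BRight 0) (BRight y)) ?bnd_simp ?(ltW y0)//.
apply: (@le_trans _ _ (weight `]0%R, y]%classic)); last first.
  apply: ge0_subset_integral => //; first exact: measurableU.
  - exact: measurable_funTS measurable_q.
  - by move=> x _; exact: q_ge0.
apply: (@le_trans _ _ (\int[lebR]_(x in `]0%R, y]) cst (q y) x)%E).
  have ly : lebR `]0%R, y]%classic = y%:E by rewrite lebR_itv/= lte_fin y0 -EFinB subr0.
  by rewrite integral_cst//= -ly.
apply: ge0_le_integral => //.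
- by move=> x _; exact: q_ge0.
- exact: measurable_funTS measurable_q.
- move=> x /=; rewrite in_itv/= => /andP[_ xy]; rewrite lee_expeR leeN2.
  by rewrite lee_wpmul2r ?Psi_le// lee_fin invr_ge0 ltW.
Qed.

(** The balance between the parts below and above [b], together with the total mass 1 and the total
    weight [Z], is a linear system that determines the tail of [g] at [b]. *)
Lemma stationary_law (A : set R) : measurable A ->
  g A = (\int[lebR]_(x in A `&` `[0%R, +oo[) (q x * ((fine Z)^-1)%:E))%E.
Proof.
move=> mA; have Z0 := weight_total_gt0.
have Zf : Z \is a fin_num by rewrite ge0_fin_numE// ltW.
have fZ0 : 0 < fine Z by rewrite fine_gt0// Z0.
pose k (x : R) : \bar R := (((\1_(`[0%R, +oo[%classic) x)%:E * q x) * ((fine Z)^-1)%:E)%E.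
have mk : measurable_fun setT k.
  apply: emeasurable_funM => //; apply: emeasurable_funM; last exact: measurable_q.
  by apply/measurable_EFinP; exact: measurable_indic.
have k0 x : (0 <= k x)%E by rewrite mule_ge0 ?lee_fin ?invr_ge0 ?(ltW fZ0)// mule_ge0// q_ge0.
transitivity (density_measure lebR k mk k0 A); last first.
  rewrite density_measureE integral_mkcondr; apply: eq_integral => x _.
  by rewrite /patch /k indicE; case: (x \in _); rewrite ?mul1e ?mul0e.
have kW (b : R) : 0 <= b -> (\int[lebR]_(x in `]b, +oo[) k x = weight `]b, +oo[%classic * ((fine Z)^-1)%:E)%E.
  move=> b0; rewrite /weight -ge0_integralZr//; last 3 first.
  - exact: measurable_funTS measurable_q.
  - by move=> x _; exact: q_ge0.
  - by rewrite lee_fin invr_ge0 ltW.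
  apply: eq_integral => x; rewrite inE/= in_itv/= andbT => bx; rewrite /k indicE.
  have xin : x \in `[0, +oo[%classic by rewrite inE/= in_itv/= andbT (le_trans b0)// ltW.
  by rewrite xin mul1e.
have ZV : (Z * ((fine Z)^-1)%:E = 1)%E.
  by rewrite -(fineK Zf) -EFinM divff// gt_eqF.
have gT : (g setT < +oo)%E by rewrite probability_setT ltry.
apply: (measure_tail_unique g (density_measure lebR k mk k0) gT) => //.
move=> b; rewrite density_measureE.
(* Below 0 the density is extended by 0, so the part of the half-line up to 0 reduces to the point
   0, which is Lebesgue null. *)
have [b0|b0] := ltP b 0.
  transitivity (1%E : \bar R).
    apply/eqP; rewrite eq_le probability_le1//= -mass_pos le_measure ?inE//.
    by move=> x /=; rewrite !in_itv/= !andbT; exact: lt_trans.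
  rewrite -ZV /Z -kW// -[LHS]/(\int[lebR]_(x in `]0%R, +oo[) k x)%E.
  have E : `]b, +oo[%classic = `]b, 0]%classic `|` `]0, +oo[%classic.
    by rewrite (@itv_bndbnd_setU _ _ (BRight b) (BRight 0)) ?bnd_simp ?ltW.
  rewrite E ge0_integral_setU//; last 2 first.
  - exact: measurable_funTS mk.
  - by apply/disj_setPS => y [/=]; rewrite !in_itv/= => /andP[_ yx]; rewrite andbT ltNge yx.
  rewrite [X in (X + _)%E](_ : _ = 0%E) ?add0e//.
  have N0 : lebR [set (0 : R)] = 0%E by exact: lebR_set1.
  have m1 : measurable_fun [set (0 : R)] k by exact: measurable_funTS mk.
  rewrite -(null_set_integral (measurable_set1 _) m1 N0).
  rewrite [LHS]integral_mkcond [RHS]integral_mkcond; apply: eq_integral => x _; rewrite /patch.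
  have [->|x0] := eqVneq x 0.
    have -> : 0 \in `]b, 0%R]%classic by rewrite inE/= in_itv/= b0 lexx.
    by have -> : 0 \in [set 0%R : R] by rewrite inE.
  have -> : (x \in [set (0 : R)]) = false by apply/negbTE; apply: contra x0; rewrite inE => ->.
  case: ifPn => //; rewrite inE/= in_itv/= => /andP[_ xle]; rewrite /k indicE.
  have -> : (x \in `[0%R, +oo[%classic) = false; last by rewrite !mul0e.
  apply/negbTE; apply: contra x0; rewrite inE/= in_itv/= andbT => xge.
  by apply/eqP/le_anti; rewrite xle xge.
rewrite kW//; move: b0; rewrite le_eqVlt => /orP[/eqP <-|b0].
  exact: (etrans mass_pos (esym ZV)).
have bal := weight_balance b `]0%R, b]%classic `]b, +oo[%classic c0 b0 (measurable_itv _) (measurable_itv _)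
   (@subset_refl _ _) (@subset_refl _ _).
have := wsplit b b0; have := gsplit b b0.
have w1 : weight `]0%R, b]%classic \is a fin_num.
  rewrite ge0_fin_numE ?integral_ge0// => [|x _]; last exact: q_ge0.
  by apply: le_lt_trans Zfin; rewrite (wsplit b b0) leeDl// integral_ge0// => x _; exact: q_ge0.
have w2 : weight `]b, +oo[%classic \is a fin_num.
  rewrite ge0_fin_numE ?integral_ge0// => [|x _]; last exact: q_ge0.
  by apply: le_lt_trans Zfin; rewrite (wsplit b b0) leeDr// integral_ge0// => x _; exact: q_ge0.
have g1 : g `]0%R, b]%classic \is a fin_num by exact: fin_num_measure.
have g2 : g `]b, +oo[%classic \is a fin_num by exact: fin_num_measure.
move: bal; rewrite -(fineK w1) -(fineK w2) -(fineK g1) -(fineK g2) -(fineK Zf) -!EFinD -!EFinM.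
move=> [bal] [gs] [ws]; rewrite -[LHS](fineK g2)/=; congr EFin; apply: (mulIf (lt0r_neq0 fZ0)); rewrite divfK ?lt0r_neq0// ws.
nra.
Qed.

End stationary_density.

(** * Two independent uniform variables from the binary digits of one *)

Lemma uniform_exists {R : realType} :
  exists mu : probability R R, forall A, measurable A -> mu A = lebR (A `&` `[0%R, 1%R[).
Proof.
have m01 : measurable (`[0%R, 1%R[%classic : set R) by [].
pose mu := measure_function_mrestr__canonical__measure_function_Measure lebR m01.
have mu1 : mu setT = 1%E.
  by rewrite /mu/= /mrestr setTI lebR_itv/= lte_fin ltr01 -EFinB subr0.
pose g : probability R R := HB.pack (Measure.sort mu) (Measure_isProbability.Build _ _ _ mu mu1).
by exists g.
Qed.

Section uniform_split.
Context {R : realType}.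
Variable mu : probability R R.
Hypothesis muE : forall A, measurable A -> mu A = lebR (A `&` `[0%R, 1%R[).

(** On the unit interval [bit] is the first binary digit and [doubling] drops it. The digits at even
    positions make up [even_bits], those at odd positions [odd_bits]. *)
Definition bit (x : R) : R := if x < 2^-1 then 0 else 1.
Definition doubling (x : R) : R := if x < 2^-1 then 2 * x else - 1 + 2 * x.

Fixpoint even_bits_upto (n : nat) (x : R) : R :=
  if n is m.+1 then (bit x + even_bits_upto m (doubling (doubling x))) / 2 else 0.

Definition even_bits (x : R) : R := lim (even_bits_upto n x @[n --> \oo]).
Definition odd_bits (x : R) : R := even_bits (doubling x).

Let bit01 x : 0 <= bit x <= 1.
Proof. by rewrite /bit; case: ifP; rewrite !lexx !ler01. Qed.

Let A01 n x : 0 <= even_bits_upto n x <= 1.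
Proof.
elim: n x => [|n IH] x /=; first by rewrite lexx ler01.
have := bit01 x; have := IH (doubling (doubling x)).
move=> /andP[a0 a1] /andP[b0 b1]; apply/andP; split; lra.
Qed.

Let Ahomo x : {homo even_bits_upto^~ x : n m / (n <= m)%N >-> n <= m}.
Proof.
apply: homo_leq => // [n y m|n]; first exact: le_trans.
elim: n x => [|n IH] x; first by have /andP[] := A01 1 x.
by rewrite [in leRHS]/= [in leLHS]/= ler_pM2r// lerD2l; exact: IH.
Qed.

Let Acvg x : even_bits_upto n x @[n --> \oo] --> even_bits x.
Proof.
apply/cvg_ex; eexists; apply: nondecreasing_cvgn; first exact: Ahomo.
by exists 1 => _ [n _ <-]; have /andP[] := A01 n x.
Qed.

(** Dropping the first digit exchanges the two subsequences. This self-similarity is all that is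
    used of the digits afterwards. *)
Lemma even_bitsE x : even_bits x = (bit x + odd_bits (doubling x)) / 2.
Proof.
have e1 : even_bits_upto n.+1 x @[n --> \oo] --> even_bits x.
  by have := Acvg x; rewrite -(cvg_shiftS (even_bits_upto^~ x)).
have e2 : even_bits_upto n.+1 x @[n --> \oo] --> (bit x + odd_bits (doubling x)) / 2.
  by apply: cvgM; [apply: cvgD; [exact: cvg_cst|exact: Acvg]|exact: cvg_cst].
by rewrite -(cvg_lim (@Rhausdorff R) e1) (cvg_lim (@Rhausdorff R) e2).
Qed.

Lemma even_bits01 x : 0 <= even_bits x <= 1.
Proof.
apply/andP; split.
  by apply: (limr_ge (cvgP _ (Acvg x))); apply: nearW => n; have /andP[] := A01 n x.
by apply: (limr_le (cvgP _ (Acvg x))); apply: nearW => n; have /andP[] := A01 n x.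
Qed.

Lemma odd_bits01 x : 0 <= odd_bits x <= 1. Proof. exact: even_bits01. Qed.

Lemma measurable_doubling : measurable_fun setT doubling.
Proof.
apply: measurable_fun_ifT => //; first by apply: measurable_fun_ltr.
by apply: measurable_funD => //; exact: measurable_funM.
Qed.

Lemma measurable_even_bits : measurable_fun setT even_bits.
Proof.
apply: (measurable_fun_cvg (h := even_bits_upto)) => // n; elim: n => [|n IH] /=.
  exact: measurable_cst.
apply: measurable_funM => //; apply: measurable_funD.
  by apply: measurable_fun_ifT => //; apply: measurable_fun_ltr.
apply: (measurableT_comp IH); exact: measurableT_comp measurable_doubling measurable_doubling.
Qed.

Lemma measurable_odd_bits : measurable_fun setT odd_bits.
Proof. exact: measurableT_comp measurable_even_bits measurable_doubling. Qed.

Let mhalf (c : bool) : measurable [set x : R | (x < 2^-1) = c].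
Proof.
case: c.
  rewrite (_ : [set x | _] = `]-oo, 2^-1[%classic)//; apply/seteqP; split => x /=; rewrite in_itv//=.
rewrite (_ : [set x | _] = `[2^-1, +oo[%classic)//; apply/seteqP; split => x /=; rewrite in_itv//= andbT leNgt.
  by move=> ->.
by move/negbTE.
Qed.

Let half (S : set R) (a : R) : measurable S -> (a = 0) \/ (a = - 1) ->
  mu ((fun x => a + 2 * x) @^-1` S `&` [set x | (x < 2^-1) = (a == 0)]) = (2^-1%:E * mu S)%E.
Proof.
move=> mS ha; have mt : measurable_fun [set: R] (fun x => a + 2 * x).
  by apply: measurable_funD => //; exact: measurable_funM.
have mpre : measurable ((fun x => a + 2 * x) @^-1` S) by rewrite -[X in measurable X]setTI; exact: mt.
have mh := mhalf (a == 0).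
have mS1 : measurable (S `&` `[0%R, 1%R[) by exact: measurableI.
rewrite muE; last exact: measurableI.
rewrite muE// -(lebR_affine a 2 _ _ mS1)//; congr (lebR _).
apply/seteqP; split => x /=; rewrite !in_itv/=.
  move=> [[Sx xh] /andP[x0 x1]]; split => //.
  by case: ha => ha; move: xh; rewrite ha ?eqxx ?oppr_eq0 ?oner_eq0 => /idP xh; apply/andP; split; lra.
move=> [Sx /andP[x0 x1]]; split; [split => //|].
  case: ha => ha; move: x0 x1; rewrite ha ?eqxx ?oppr_eq0 ?oner_eq0 => x0 x1.
    by apply/idP; lra.
  by apply/negbTE; rewrite -leNgt; lra.
by case: ha => ha; move: x0 x1; rewrite ha => x0 x1; apply/andP; split; lra.
Qed.

Let mu_halves (E S0 S1 : set R) : measurable S0 -> measurable S1 ->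
  (forall x, x < 2^-1 -> E x <-> S0 (0 + 2 * x)) -> (forall x, 2^-1 <= x -> E x <-> S1 (- 1 + 2 * x)) ->
  mu E = (2^-1%:E * mu S0 + 2^-1%:E * mu S1)%E.
Proof.
move=> mS0 mS1 h0 h1.
have e1 : (-1 == 0 :> R) = false by rewrite oppr_eq0 oner_eq0.
rewrite -(half S0 0 mS0)//; last by left.
rewrite -(half S1 (-1) mS1)//; last by right.
have mpre (S : set R) a : measurable S -> measurable ((fun x => a + 2 * x) @^-1` S).
  move=> mS; rewrite -[X in measurable X]setTI; apply: (_ : measurable_fun setT _) => //.
  by apply: measurable_funD => //; exact: measurable_funM.
rewrite -measureU.
- congr (mu _); apply/seteqP; split => x /=.
    by have [xh|xh] := ltP x 2^-1 => Ex; [left|right]; rewrite ?eqxx ?e1; split => //; [exact/h0|exact/h1].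
  by rewrite eqxx e1 => -[[Sx xh]|[Sx xh]]; [apply/h0|apply/h1] => //; rewrite leNgt xh.
- by apply: measurableI; [exact: mpre|exact: mhalf].
- by apply: measurableI; [exact: mpre|exact: mhalf].
- by apply/seteqP; split => x //=; rewrite eqxx e1 => -[[_ ->] []].
Qed.

Let k (u : R) : R := fine (mu `]u, +oo[%classic).

Let kE u : mu `]u, +oo[%classic = (k u)%:E.
Proof. by rewrite /k fineK// fin_num_measure. Qed.

Let J (u v : R) : R := fine (mu (even_bits @^-1` `]u, +oo[%classic `&` odd_bits @^-1` `]v, +oo[%classic)).

Let mA u : measurable (even_bits @^-1` `]u, +oo[%classic).
Proof. rewrite -[X in measurable X]setTI; exact: measurable_even_bits. Qed.

Let mB u : measurable (odd_bits @^-1` `]u, +oo[%classic).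
Proof. rewrite -[X in measurable X]setTI; exact: measurable_odd_bits. Qed.

Let JE u v : mu (even_bits @^-1` `]u, +oo[%classic `&` odd_bits @^-1` `]v, +oo[%classic) = (J u v)%:E.
Proof. by rewrite /J fineK// fin_num_measure//; exact: measurableI. Qed.

(** Conditioning on the first digit: each half of the interval is a copy of the whole scaled by 1/2,
    and the arguments are swapped because the two subsequences exchange roles. *)
Let Jrec u v : J u v = (J v (2 * u) + J v (- 1 + 2 * u)) / 2.
Proof.
apply: EFin_inj; rewrite -JE (mu_halves _ (even_bits @^-1` `]v, +oo[%classic `&` odd_bits @^-1` `](2 * u), +oo[%classic)
  (even_bits @^-1` `]v, +oo[%classic `&` odd_bits @^-1` `](- 1 + 2 * u), +oo[%classic)).
- by rewrite !JE -!EFinM -EFinD; congr (_%:E); ring.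
- exact: measurableI.
- exact: measurableI.
- move=> x xh; rewrite /= !in_itv/= !andbT even_bitsE /odd_bits /bit /doubling xh !add0r.
  by rewrite ltr_pdivlMr// mulrC; split=> -[].
- move=> x; rewrite leNgt => /negbTE xh; rewrite /= !in_itv/= !andbT even_bitsE /odd_bits /bit /doubling xh.
  by rewrite ltr_pdivlMr// [u * 2]mulrC -ltrBlDl [2 * u - 1]addrC; split=> -[].
Qed.

Let krec u : k u = (k (2 * u) + k (- 1 + 2 * u)) / 2.
Proof.
apply: EFin_inj; rewrite -kE (mu_halves _ `](2 * u), +oo[%classic `](- 1 + 2 * u), +oo[%classic)//.
- by rewrite !kE -!EFinM -EFinD; congr (_%:E); ring.
- by move=> x _; rewrite /= !in_itv/= !andbT add0r ltr_pM2l.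
- by move=> x _; rewrite /= !in_itv/= !andbT ltrD2l ltr_pM2l.
Qed.

Let k0 u : u < 0 -> k u = 1.
Proof.
move=> u0; apply: EFin_inj; rewrite -kE muE// (_ : _ `&` _ = `[(0 : R), 1[%classic).
  by rewrite lebR_itv/= lte_fin ltr01 -EFinB subr0.
apply/seteqP; split => x /=; rewrite !in_itv/= ?andbT; first by case.
by move=> /andP[x0 x1]; split; [exact: lt_le_trans x0|exact/andP].
Qed.

Let k1 u : 1 <= u -> k u = 0.
Proof.
move=> u1; apply: EFin_inj; rewrite -kE muE// (_ : _ `&` _ = set0) ?measure0//.
by apply/seteqP; split => x //=; rewrite !in_itv/= andbT => -[xu /andP[_ x1]]; lra.
Qed.

Let Jr0 u v : v < 0 -> J u v = J u (-1).
Proof.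
move=> v0; rewrite /J; congr (fine (mu (_ `&` _))); apply/seteqP; split => x /= _;
  by rewrite in_itv/= andbT; have /andP[h _] := odd_bits01 x; lra.
Qed.

Let Jr1 u v : 1 <= v -> J u v = 0.
Proof.
move=> v1; rewrite /J (_ : _ `&` _ = set0) ?measure0//; apply/seteqP; split => x //= -[_].
by rewrite in_itv/= andbT; have /andP[_ h] := odd_bits01 x; lra.
Qed.

Let Jl u : J (-1) u = J u (-1).
Proof.
by rewrite Jrec (Jr0 _ (2 * -1)) ?(Jr0 _ (-1 + 2 * -1)); lra.
Qed.

Let J11 u : u < 0 -> J u (-1) = 1.
Proof.
move=> u0; apply: EFin_inj; rewrite -JE -(probability_setT mu); congr (mu _); apply/seteqP; split => x // _ /=.
rewrite !in_itv/= !andbT; have /andP[h _] := odd_bits01 x; have /andP[h' _] := even_bits01 x.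
by split; lra.
Qed.

Let small (x : R) : (forall n, `|x| <= 2^-1 ^+ n) -> x = 0.
Proof.
move=> h; apply/eqP; rewrite -normr_le0.
have c : ((2^-1 : R) ^+ n) @[n --> \oo] --> 0 by apply: cvg_expr; rewrite gtr0_norm ?invr_gt0// invf_lt1// ltr1n.
rewrite -(cvg_lim (@Rhausdorff R) c); apply: (limr_ge (cvgP _ c)); exact: nearW.
Qed.

Let k01 u : 0 <= k u <= 1.
Proof. by rewrite -!lee_fin -kE measure_ge0 probability_le1. Qed.

Let J01 u v : 0 <= J u v <= 1.
Proof. by rewrite -!lee_fin -JE measure_ge0 probability_le1//; exact: measurableI. Qed.

Let marginal u : J u (-1) = k u.
Proof.
suff h n : forall u, `|J u (-1) - k u| <= 2^-1 ^+ n by apply/eqP; rewrite -subr_eq0; apply/eqP/small => n; exact: h.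
elim: n => [|n IH] {}u.
  by rewrite expr0 ler_norml; have := k01 u; have := J01 u (-1); move=> /andP[? ?] /andP[? ?]; apply/andP; split; lra.
rewrite Jrec krec exprS !Jl.
have E (a b c d : R) : (a + b) / 2 - (c + d) / 2 = 2^-1 * ((a - c) + (b - d)) by field.
rewrite E normrM gtr0_norm ?invr_gt0// ler_pM2l ?invr_gt0//.
have [h|h] := leP 1 (2 * u).
  by rewrite -Jl Jr1// k1// subrr add0r; exact: IH.
by rewrite (J11 (-1 + 2 * u)) ?(k0 (-1 + 2 * u)) ?subrr ?addr0; [exact: IH|lra|lra].
Qed.

(** The joint tail and the product of tails obey the same recursion. Whether [2 * u] reaches 1 or
    not, one of the two branches cancels exactly, so the discrepancy is halved at each step and is
    below every [2^-1 ^+ n]. *)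
Let joint u v : J u v = k u * k v.
Proof.
suff h n : forall u v, `|J u v - k u * k v| <= 2^-1 ^+ n.
  by apply/eqP; rewrite -subr_eq0; apply/eqP/small => n; exact: h.
elim: n => [|n IH] {}u {}v.
  rewrite expr0 ler_norml; have := k01 u; have := k01 v; have := J01 u v.
  by move=> /andP[? ?] /andP[? ?] /andP[? ?]; apply/andP; split; nra.
rewrite Jrec krec exprS.
have E (a b c d : R) : (a + b) / 2 - (c + d) / 2 * k v = 2^-1 * ((a - k v * c) + (b - k v * d)) by field.
rewrite E normrM gtr0_norm ?invr_gt0// ler_pM2l ?invr_gt0//.
have [h|h] := leP 1 (2 * u).
  by rewrite Jr1// (k1 (2 * u))// mulr0 subrr add0r; exact: IH.
rewrite (Jr0 _ (-1 + 2 * u)); last by lra.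
by rewrite marginal (k0 (-1 + 2 * u)) ?mulr1 ?subrr ?addr0; [exact: IH|lra].
Qed.

(** Independence of the tails extends to Borel sets one coordinate at a time: with the other
    coordinate fixed, both sides are finite measures with equal tails. *)
Lemma split_rectangle (S S' : set R) : measurable S -> measurable S' ->
  mu (even_bits @^-1` S `&` odd_bits @^-1` S') = (mu S * mu S')%E.
Proof.
move=> mS mS'.
have pA (X : set R) : measurable X -> measurable (even_bits @^-1` X).
  by move=> mX; rewrite -[X in measurable X]setTI; exact: measurable_even_bits.
have pB (X : set R) : measurable X -> measurable (odd_bits @^-1` X).
  by move=> mX; rewrite -[X in measurable X]setTI; exact: measurable_odd_bits.
have step v X : measurable X -> mu (even_bits @^-1` X `&` odd_bits @^-1` `]v, +oo[%classic) = ((k v)%:E * mu X)%E.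
  move=> mX; have kv : 0 <= k v by case/andP: (k01 v).
  pose m1 := measure_function_pushforward__canonical__measure_function_Measure (measure_function_mrestr__canonical__measure_function_Measure mu (mB v)) measurable_even_bits.
  pose m2 := measure_function_mscale__canonical__measure_function_Measure (NngNum kv) mu.
  have := measure_tail_unique m1 m2 => H.
  have /H : (m1 setT < +oo)%E.
    apply: (@le_lt_trans _ _ 1%E); last exact: ltry.
    by apply: probability_le1; apply: measurableI; [exact: pA|exact: mB].
  apply => // b; rewrite /m1/m2/= /pushforward/mrestr/mscale/= -/(mu _) JE joint kE -EFinM mulrC//.
pose m1 := measure_function_pushforward__canonical__measure_function_Measure (measure_function_mrestr__canonical__measure_function_Measure mu (pA _ mS)) measurable_odd_bits.
have muS : 0 <= fine (mu S) by rewrite fine_ge0.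
have muSE : (fine (mu S))%:E = mu S by rewrite fineK// fin_num_measure.
pose m2 := measure_function_mscale__canonical__measure_function_Measure (NngNum muS) mu.
have H := measure_tail_unique m1 m2.
have m1fin : (m1 setT < +oo)%E.
  apply: (@le_lt_trans _ _ 1%E); last exact: ltry.
  by apply: probability_le1; apply: measurableI; [exact: pB|exact: (pA _ mS)].
have E X : measurable X -> m1 X = m2 X.
  apply: (H m1fin) => b.
  by rewrite /m1/m2/= /pushforward/mrestr/mscale/= setIC step// kE muSE muleC.
have := E S' mS'; rewrite /m1/m2/= /pushforward/mrestr/mscale/= setIC => ->.
by rewrite muSE.
Qed.

Lemma measurable_split : measurable_fun setT (fun x => (even_bits x, odd_bits x)).
Proof.
exact: (measurable_fun_pair measurable_even_bits measurable_odd_bits).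
Qed.

Lemma integral_split (f : R * R -> \bar R) : measurable_fun setT f -> (forall p, (0 <= f p)%E) ->
  (\int[mu]_x f (even_bits x, odd_bits x) = \int[(mu \x mu)%E]_p f p)%E.
Proof.
move=> mf f0.
have := @ge0_integral_pushforward _ _ R (R * R)%type R _ measurable_split mu setT f measurableT mf (fun x _ => f0 x).
rewrite preimage_setT => <-; apply: eq_measure_integral => [|? D mD _].
  exact: measurable_split.
apply/esym; apply: product_measure_unique => // B C mB' mC.
exact: split_rectangle.
Qed.

End uniform_split.

(** * Generating functions determine counting laws *)

Section power_series.
Context {R : realType}.

Lemma eseries_single (u : nat -> \bar R) k : (forall j, j <> k -> u j = 0%E) -> (\sum_(j <oo) u j = u k)%E.
Proof.
move=> h; apply: lim_near_cst => //; exists k.+1 => //= n kn.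
rewrite big_mkord (bigD1 (Ordinal kn))//= big1 ?adde0// => j /eqP jk; apply: h => e.
by apply: jk; apply: val_inj.
Qed.

Let shift_sum (a : nat -> R) (s : R) : (forall k, 0 <= a k) -> 0 <= s ->
  (\sum_(k <oo) (a k * s ^+ k)%:E = (a 0)%:E + s%:E * \sum_(k <oo) (a k.+1 * s ^+ k)%:E)%E.
Proof.
move=> a0 s0; have p k : (0 <= (a k * s ^+ k)%:E)%E by rewrite lee_fin mulr_ge0// exprn_ge0.
rewrite nneseries_recl//= expr0 mulr1; congr (_ + _)%E.
rewrite -(nneseries_addn 1%N p)//=.
rewrite -nneseriesZl; last by move=> k _; rewrite lee_fin mulr_ge0// exprn_ge0.
by apply: eq_eseriesr => k _; rewrite addn1 -EFinM exprS mulrCA.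
Qed.

Let sum_le (a : nat -> R) (s : R) : (forall k, 0 <= a k) -> 0 <= s <= 1 ->
  (\sum_(k <oo) (a k * s ^+ k)%:E <= \sum_(k <oo) (a k)%:E)%E.
Proof.
move=> a0 /andP[s0 s1]; apply: lee_nneseries => k *; rewrite lee_fin.
  by rewrite mulr_ge0// exprn_ge0.
by rewrite ler_piMr// exprn_ile1.
Qed.

Let sumE (a : nat -> R) : (forall k, 0 <= a k) ->
  (\sum_(k <oo) (a k)%:E = (a 0)%:E + \sum_(k <oo) (a k.+1)%:E)%E.
Proof.
move=> a0; have := shift_sum a 1 a0 ler01; rewrite mul1e.
have e (c : nat -> R) : (\sum_(k <oo) (c k * 1 ^+ k)%:E = \sum_(k <oo) (c k)%:E)%E.
  by apply: eq_eseriesr => k _; rewrite expr1n mulr1.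
by rewrite (e a) (e (fun k => a k.+1)).
Qed.

Let tail_fin (a : nat -> R) : (forall k, 0 <= a k) ->
  (\sum_(k <oo) (a k)%:E < +oo)%E -> (\sum_(k <oo) (a k.+1)%:E < +oo)%E.
Proof. by move=> a0 fa; apply: le_lt_trans fa; rewrite (sumE a)// leeDr// lee_fin. Qed.

(** All terms but the first of the series of [e] are at most [s * M]. The choice
    [s <= eps / (M + 1)] makes them smaller than [eps], with a denominator that stays positive when
    [M] is 0. *)
Let head_le (c e : nat -> R) : (forall k, 0 <= c k) -> (forall k, 0 <= e k) ->
  (\sum_(k <oo) (e k)%:E < +oo)%E ->
  (forall s, 0 < s <= 1 -> (\sum_(k <oo) (c k * s ^+ k)%:E = \sum_(k <oo) (e k * s ^+ k)%:E)%E) ->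
  c 0 <= e 0.
Proof.
move=> c0 e0 fe ce; pose M := fine (\sum_(k <oo) (e k.+1)%:E)%E.
have tail0 : (0 <= \sum_(k <oo) (e k.+1)%:E)%E by apply: nneseries_ge0 => i *; rewrite lee_fin.
have tailf : (\sum_(k <oo) (e k.+1)%:E)%E \is a fin_num by rewrite ge0_fin_numE//; exact: tail_fin.
have M0 : 0 <= M by rewrite fine_ge0.
apply/ler_addgt0Pr => eps eps0.
pose s := Num.min 1 (eps / (M + 1)).
have M1 : 0 < M + 1 by lra.
have s0 : 0 < s by rewrite lt_min ltr01 divr_gt0.
have s1 : s <= 1 by rewrite ge_min lexx.
have sM : s * M <= eps.
  have : s <= eps / (M + 1) by rewrite ge_min lexx orbT.
  by rewrite ler_pdivlMr// mulrDr mulr1; lra.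
rewrite -lee_fin EFinD; have := ce s; rewrite s0 s1 => /(_ isT).
rewrite (shift_sum c s c0 (ltW s0)) (shift_sum e s e0 (ltW s0)) => E.
apply: (@le_trans _ _ ((e 0)%:E + s%:E * \sum_(k <oo) (e k.+1 * s ^+ k)%:E)%E).
  rewrite -E leeDl// mule_ge0 ?lee_fin ?(ltW s0)// nneseries_ge0// => i *.
  by rewrite lee_fin mulr_ge0// exprn_ge0// ltW.
rewrite leeD2l//; apply: (@le_trans _ _ (s * M)%:E); last by rewrite lee_fin.
by rewrite EFinM lee_pmul2l// /M fineK//; apply: (sum_le (fun k => e k.+1)); rewrite ?(ltW s0).
Qed.

(** Equality of the heads comes from small [s]; removing them and dividing by [s] gives the same
    hypothesis for the shifted sequences. *)
Lemma power_series_unique (a b : nat -> R) :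
  (forall k, 0 <= a k) -> (forall k, 0 <= b k) ->
  (\sum_(k <oo) (a k)%:E < +oo)%E -> (\sum_(k <oo) (b k)%:E < +oo)%E ->
  (forall s, 0 < s <= 1 -> (\sum_(k <oo) (a k * s ^+ k)%:E = \sum_(k <oo) (b k * s ^+ k)%:E)%E) ->
  forall k, a k = b k.
Proof.
move=> a0 b0 fa fb h k.
have E0 (c e : nat -> R) : (forall k, 0 <= c k) -> (forall k, 0 <= e k) ->
    (\sum_(k <oo) (c k)%:E < +oo)%E -> (\sum_(k <oo) (e k)%:E < +oo)%E ->
    (forall s, 0 < s <= 1 -> (\sum_(k <oo) (c k * s ^+ k)%:E = \sum_(k <oo) (e k * s ^+ k)%:E)%E) -> c 0 = e 0.
  by move=> c0 e0 fc fe ce; apply/eqP; rewrite eq_le !head_le// => s s01; rewrite ce.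
elim: k a b a0 b0 fa fb h => [|k IH] a b a0 b0 fa fb h; first exact: E0.
apply: (IH (fun k => a k.+1) (fun k => b k.+1)) => //; [exact: tail_fin|exact: tail_fin|].
move=> s /andP[s0 s1]; have := h s; rewrite s0 s1 => /(_ isT).
rewrite (shift_sum a s a0 (ltW s0)) (shift_sum b s b0 (ltW s0)) (E0 a b a0 b0 fa fb h) => H.
have {H} : (s%:E * \sum_(k <oo) (a k.+1 * s ^+ k)%:E = s%:E * \sum_(k <oo) (b k.+1 * s ^+ k)%:E)%E.
  by move: H => /(congr1 (fun x => (- b 0)%:E + x)%E); rewrite !addeA -EFinD addNr !add0e.
move=> /(congr1 (fun x => s^-1%:E * x)%E).
by rewrite !muleA -!EFinM mulVf ?gt_eqF// !mul1e.
Qed.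

Lemma pois1_pgf (m : R) : 0 <= m -> (\sum_(k <oo) (pois 1 k * m ^+ k)%:E = (expR (m - 1))%:E)%E.
Proof.
move=> m0; rewrite (eq_eseriesr (g := fun k => (expR (- 1))%:E * (exp_coeff m k)%:E))%E; last first.
  by move=> k _; rewrite -EFinM /exp_coeff /= /pois expr1n mulr1 mulrAC mulrA.
rewrite nneseriesZl; last by move=> k _; rewrite lee_fin exp_coeff_ge0.
rewrite (_ : \sum_(k <oo) _ = (expR m)%:E)%E; last first.
  rewrite /expR -EFin_lim; last exact: is_cvg_series_exp_coeff.
  by apply/congr_lim/funext => n /=; rewrite sumEFin.
by rewrite -EFinM -expRD addrC.
Qed.

End power_series.

Section generating_functions.
Context {d} {T : measurableType d} {R : realType} (P : probability T R).

Lemma measurable_nat_eq (K : T -> nat) (k : nat) : measurable_fun setT K -> measurable (K @^-1` [set k]).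
Proof. by move=> mK; rewrite -[X in measurable X]setTI; exact: mK. Qed.

Lemma measurable_fun_nat_of (K : T -> nat) : (forall k, measurable (K @^-1` [set k])) -> measurable_fun setT K.
Proof.
move=> h _ Y _; rewrite setTI (_ : K @^-1` Y = \bigcup_k (K @^-1` [set k] `&` [set _ | Y k])); last first.
  by apply/seteqP; split => x /=; [exists (K x)|move=> [k _ [/= <-]]].
apply: bigcupT_measurable => k; apply: measurableI => //.
have [yk|yk] := pselect (Y k); first by rewrite (_ : [set _ | _] = setT)//; apply/seteqP; split.
by rewrite (_ : [set _ | _] = set0)//; apply/seteqP; split.
Qed.

Lemma measurable_fun_select {d'} {Y : measurableType d'} (K : T -> nat) (F : nat -> T -> Y) :
  measurable_fun setT K -> (forall k, measurable_fun setT (F k)) -> measurable_fun setT (fun w => F (K w) w).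
Proof.
move=> mK mF _ Z mZ; rewrite setTI.
rewrite (_ : _ @^-1` Z = \bigcup_k (K @^-1` [set k] `&` F k @^-1` Z)); last first.
  by apply/seteqP; split => x /=; [exists (K x)|move=> [k _ [/= <-]]].
apply: bigcupT_measurable => k; apply: measurableI; first exact: measurable_nat_eq.
by rewrite -[X in measurable X]setTI; exact: mF.
Qed.

Lemma measurable_addn (f g : T -> nat) : measurable_fun setT f -> measurable_fun setT g ->
  measurable_fun setT (fun w => (f w + g w)%N).
Proof.
move=> mf mg.
have := measurable_fun_select (fun w => pickle (f w, g w))
  (fun k _ => if @unpickle (nat * nat)%type k is Some ab then (ab.1 + ab.2)%N else 0%N) (measurable_pickle2 f g mf mg).
move=> /(_ (fun k => measurable_cst _)).
by rewrite (_ : (fun w => _) = (fun w => (f w + g w)%N))//; apply/funext => w; rewrite pickleK.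
Qed.

Lemma select_sum (K : T -> nat) (F : nat -> R) w : (\sum_(k <oo) ((K w == k)%:R * F k)%:E = (F (K w))%:E)%E.
Proof.
rewrite (eseries_single _ (K w)); first by rewrite eqxx mul1r.
by move=> j /eqP; rewrite eq_sym => /negbTE ->; rewrite mul0r.
Qed.

Let mind (K : T -> nat) k : measurable_fun setT K -> measurable_fun setT (fun w => (K w == k)%:R : R).
Proof.
move=> mK; rewrite (_ : (fun w => _) = \1_(K @^-1` [set k])).
  by apply: measurable_indic; exact: measurable_nat_eq.
apply/funext => w; rewrite indicE; congr (_ %:R); congr nat_of_bool.
by apply/idP/idP => [/eqP e|]; [rewrite inE|rewrite inE => /eqP].
Qed.

Definition measurable_nat_indic := mind.

(** The bounded weight [Y] stands for the factors of the other counts, so that one count of a joint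
    law can be converted from its generating function to its probabilities. Both are coefficients of
    the same power series in [s]. *)
Lemma pgf_pmf (Y : T -> R) (K : T -> nat) (c r : R) :
  measurable_fun setT Y -> (forall w, 0 <= Y w <= 1) -> measurable_fun setT K -> 0 <= c -> 0 <= r ->
  (forall s, 0 <= s <= 1 -> (\int[P]_w (Y w * s ^+ K w)%:E = (c * expR (r * (s - 1)))%:E)%E) ->
  forall k, (\int[P]_w (Y w * (K w == k)%:R)%:E = (c * pois r k)%:E)%E.
Proof.
move=> mY Y01 mK c0 r0 h k.
have Y0 w : 0 <= Y w by case/andP: (Y01 w).
have mI j : measurable_fun setT (fun w => (Y w * (K w == j)%:R)%:E).
  by apply/measurable_EFinP; apply: measurable_funM => //; exact: mind.
pose a j := fine (\int[P]_w (Y w * (K w == j)%:R)%:E)%E.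
have I0 j : (0 <= \int[P]_w (Y w * (K w == j)%:R)%:E)%E.
  by apply: integral_ge0 => w _; rewrite lee_fin mulr_ge0.
have aE j : (\int[P]_w (Y w * (K w == j)%:R)%:E = (a j)%:E)%E.
  rewrite /a fineK// ge0_fin_numE//; apply: (@le_lt_trans _ _ (\int[P]_w (cst 1 w))%E).
    apply: ge0_le_integral => //; first by move=> w _; rewrite lee_fin mulr_ge0.
    move=> w _; rewrite lee_fin; case: (K w == j); rewrite ?mulr1 ?mulr0 ?ler01//.
    by case/andP: (Y01 w).
  by rewrite (integral_cst P measurableT) mul1e; exact: le_lt_trans (probability_le1 P measurableT) (ltry 1).
have S s : 0 < s <= 1 -> (\sum_(j <oo) (a j * s ^+ j)%:E = (c * expR (r * (s - 1)))%:E)%E.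
  move=> /andP[s0 s1]; rewrite -h ?(ltW s0)//.
  have -> : (\int[P]_w (Y w * s ^+ K w)%:E = \int[P]_w \sum_(j <oo) ((Y w * (K w == j)%:R)%:E * (s ^+ j)%:E))%E.
    apply: eq_integral => w _; rewrite -(select_sum K (fun j => Y w * s ^+ j)); apply: eq_eseriesr => j _.
    by rewrite -EFinM; congr (_%:E); ring.
  rewrite integral_nneseries//.
  - apply: eq_eseriesr => j _; rewrite ge0_integralZr//.
    + by rewrite aE -EFinM.
    + by move=> w _; rewrite lee_fin mulr_ge0.
    + by rewrite lee_fin exprn_ge0// ltW.
  - by move=> j; exact: emeasurable_funM.
  - by move=> j w _; rewrite mule_ge0// lee_fin ?mulr_ge0// exprn_ge0// ltW.
have Sb s : 0 < s <= 1 -> (\sum_(j <oo) ((c * pois r j) * s ^+ j)%:E = (c * expR (r * (s - 1)))%:E)%E.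
  move=> /andP[s0 s1].
  have rs : r * (s - 1) = - r + r * s by ring.
  rewrite rs expRD mulrA EFinM.
  rewrite -[(expR (r * s))%:E]mul1e.
  have -> : (1 * (expR (r * s))%:E = \sum_(k <oo) (exp_coeff (r * s) k)%:E :> \bar R)%E.
    rewrite mul1e /expR -EFin_lim; last exact: is_cvg_series_exp_coeff.
    by apply/congr_lim/funext => n /=; rewrite sumEFin.
  rewrite -nneseriesZl; last by move=> j _; rewrite lee_fin exp_coeff_ge0// mulr_ge0// ltW.
  apply: eq_eseriesr => j _; rewrite -EFinM /exp_coeff /= /pois exprMn; congr (_%:E); ring.
rewrite aE; congr (_%:E); apply: (power_series_unique a (fun j => c * pois r j)).
- by move=> j; rewrite fine_ge0.
- by move=> j; rewrite mulr_ge0 ?pois_ge0.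
- by have := S 1; rewrite ltr01 lexx => /(_ isT); under eq_eseriesr do rewrite expr1n mulr1; move=> ->; rewrite ltry.
- by have := Sb 1; rewrite ltr01 lexx => /(_ isT); under eq_eseriesr do rewrite expr1n mulr1; move=> ->; rewrite ltry.
- by move=> s s01; rewrite S// Sb.
Qed.

(** Coordinates are converted one by one: after [m] steps the first [m] factors are indicators of
    counts and the others are still powers of the [s i]. *)
Lemma joint_pgf_pmf n (C : nat -> T -> nat) (r : nat -> R) (k : nat -> nat) :
  (forall i, measurable_fun setT (C i)) -> (forall i, 0 <= r i) ->
  (forall s : nat -> R, (forall i, 0 <= s i <= 1) ->
    (\int[P]_w (\prod_(i < n) s i ^+ C i w)%:E = (\prod_(i < n) expR (r i * (s i - 1)))%:E)%E) ->
  (\int[P]_w (\prod_(i < n) (C i w == k i)%:R)%:E = (\prod_(i < n) pois (r i) (k i))%:E)%E.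
Proof.
move=> mC r0 h.
pose f m (s : nat -> R) i w : R := if (i < m)%N then (C i w == k i)%:R else s i ^+ C i w.
pose e m (s : nat -> R) i : R := if (i < m)%N then pois (r i) (k i) else expR (r i * (s i - 1)).
suff H m : (m <= n)%N -> forall s : nat -> R, (forall i, 0 <= s i <= 1) ->
    (\int[P]_w (\prod_(i < n) f m s i w)%:E = (\prod_(i < n) e m s i)%:E)%E.
  have /= := H n (leqnn n) (fun=> 0); rewrite lexx ler01 => /(_ (fun=> isT)).
  rewrite (eq_integral (fun w => (\prod_(i < n) (C i w == k i)%:R)%:E)); last first.
    by move=> w _; congr (_%:E); apply: eq_bigr => i _; rewrite /f ltn_ord.
  by move=> ->; congr (_%:E); apply: eq_bigr => i _; rewrite /e ltn_ord.
elim: m => [_|m IH mn] s s01.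
  by rewrite -h.
pose om := Ordinal mn.
pose Y w : R := \prod_(i < n | i != om) f m.+1 s i w.
have f01 i w : 0 <= f m.+1 s i w <= 1.
  rewrite /f; case: ifP => _; first by case: (_ == _); rewrite ?lexx ?ler01.
  by have /andP[a b] := s01 i; rewrite exprn_ge0//= exprn_ile1.
have mf i : measurable_fun setT (f m.+1 s i).
  rewrite /f; case: (i < m.+1)%N; first exact: mind.
  apply: (measurable_fun_select (C i) (fun j _ => s i ^+ j)) => // j; exact: measurable_cst.
pose c := \prod_(i < n | i != om) e m.+1 s i.
have ne (i : 'I_n) : i != om -> i <> m :> nat.
  by move=> /eqP im e'; apply: im; apply: val_inj.
have lt (i : 'I_n) : i != om -> (i < m.+1)%N = (i < m)%N.
  by move=> /ne /eqP /negbTE im; rewrite [LHS]ltnS leq_eqVlt im.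
have fE (s' : nat -> R) (i : 'I_n) w : (forall j, j <> m -> s' j = s j) -> i != om -> f m s' i w = f m.+1 s i w.
  by move=> hs im; rewrite /f lt// hs//; exact: ne.
have eE (s' : nat -> R) (i : 'I_n) : (forall j, j <> m -> s' j = s j) -> i != om -> e m s' i = e m.+1 s i.
  by move=> hs im; rewrite /e lt// hs//; exact: ne.
rewrite (bigD1 om)//= {1}/e ltnSn mulrC -/c.
rewrite (eq_integral (fun w => (Y w * (C m w == k m)%:R)%:E)); last first.
  by move=> w _; rewrite (bigD1 om)//= {1}/f ltnSn mulrC.
apply: pgf_pmf => //.
- rewrite (_ : Y = fun w => \prod_(i < n) (if i != om then f m.+1 s i w else 1)); last first.
    by apply/funext => w; rewrite /Y big_mkcond.
  by apply: measurable_prod => i _; case: (i != om); [exact: mf|exact: measurable_cst].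
- by move=> w; rewrite prodr_ge0 ?prodr_ile1// => i _; case/andP: (f01 i w).
- apply: prodr_ge0 => i _; rewrite /e; case: ifP => _; rewrite ?expR_ge0// pois_ge0//.
- move=> t t01; pose s' j := if j == m then t else s j.
  have hs j : j <> m -> s' j = s j by rewrite /s' => /eqP /negbTE ->.
  have := IH (ltnW mn) s'; rewrite (bigD1 om)//= {1}/e ltnn /s' eqxx -/s' mulrC.
  rewrite (eq_bigr (fun i : 'I_n => e m.+1 s i)); last by move=> i im; exact: eE.
  rewrite -/c => <-; last by move=> j; rewrite /s'; case: ifP.
  apply: eq_integral => w _; rewrite (bigD1 om)//= {1}/f ltnn /s' eqxx -/s' mulrC; congr (_ * _)%:E.
  by apply: eq_bigr => i im; rewrite fE.
Qed.

End generating_functions.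

(** * Independent uniform seeds and Poisson many points in a unit square *)

Section uniform_seeds.
Context {R : realType}.
Variable mu : probability R R.
Hypothesis muE : forall A, measurable A -> mu A = lebR (A `&` `[0%R, 1%R[).

Lemma split_mean (f g : R -> R) (a b : R) : measurable_fun setT f -> measurable_fun setT g ->
  (forall x, 0 <= f x) -> (forall x, 0 <= g x) ->
  (\int[mu]_x (f x)%:E = a%:E)%E -> (\int[mu]_x (g x)%:E = b%:E)%E ->
  (\int[mu]_x (g (even_bits x) * f (odd_bits x))%:E = (b * a)%:E)%E.
Proof.
move=> mf mg f0 g0 fa gb.
pose F (p : R * R) : \bar R := (g p.1 * f p.2)%:E.
have mF : measurable_fun setT F.
  by apply/measurable_EFinP; apply: measurable_funM; [exact: (measurableT_comp mg)|exact: (measurableT_comp mf)].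
have F0 p : (0 <= F p)%E by rewrite lee_fin mulr_ge0.
rewrite (integral_split mu muE F mF F0) (fubini_tonelli1 (m1 := mu) (m2 := mu) F mF F0).
rewrite (eq_integral (fun x => ((g x)%:E * a%:E)%E)); last first.
  move=> x _; rewrite /fubini_F /F/= -fa -ge0_integralZl//; last 3 first.
  - exact/measurable_EFinP.
  - by move=> y _; rewrite lee_fin.
  - by rewrite lee_fin.
have a0 : (0 <= a%:E)%E by rewrite -fa integral_ge0// => x _; rewrite lee_fin.
rewrite ge0_integralZr//; last by move=> x _; rewrite lee_fin.
  by rewrite gb -EFinM.
exact/measurable_EFinP.
Qed.

(** The odd digits are taken as output and the even digits are split again. Each seed is thereby
    independent of all that is extracted later. *)
Definition seed (n : nat) (x : R) : R := odd_bits (iter n even_bits x).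

Lemma measurable_seed n : measurable_fun setT (seed n).
Proof.
apply: (measurableT_comp measurable_odd_bits); elim: n => [|n IH]; first exact: measurable_id.
exact: (measurableT_comp measurable_even_bits IH).
Qed.

Lemma seeds_mean n (f : nat -> R -> R) (e : nat -> R) :
  (forall k, measurable_fun setT (f k)) -> (forall k x, 0 <= f k x) ->
  (forall k, (\int[mu]_x (f k x)%:E = (e k)%:E)%E) ->
  (\int[mu]_x (\prod_(k < n) f k (seed k x))%:E = (\prod_(k < n) e k)%:E)%E.
Proof.
elim: n f e => [|n IH] f e mf f0 fe.
  rewrite big_ord0 (eq_integral (cst 1%E)); last by move=> x _; rewrite big_ord0.
  by rewrite (integral_cst mu measurableT) mul1e; exact: (probability_setT mu).
rewrite big_ord_recl mulrC.
rewrite -(split_mean (f 0) (fun x => \prod_(k < n) f k.+1 (seed k x)) (e 0) (\prod_(k < n) e k.+1))//.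
- apply: eq_integral => x _; rewrite big_ord_recl mulrC; congr (_ * _)%:E.
  by apply: eq_bigr => k _; rewrite /seed/= -iterSr.
- apply: measurable_prod => k _; exact: (measurableT_comp (mf _) (measurable_seed _)).
- by move=> x; rewrite prodr_ge0.
- exact: (IH (fun k => f k.+1) (fun k => e k.+1)).
Qed.

Definition pois_cdf (k : nat) : R := \sum_(j < k) pois 1 j.

Lemma pois_cdf_cvg : pois_cdf k @[k --> \oo] --> (1 : R).
Proof.
have h : (\sum_(0 <= j < n) (pois (1 : R) j)%:E)%E @[n --> \oo] --> 1%E.
  by rewrite -(pois_sum 1 ltr01); apply: is_cvg_nneseries => j *; rewrite lee_fin pois_ge0.
have -> : pois_cdf = fine \o (fun n => (\sum_(0 <= j < n) (pois (1 : R) j)%:E)%E).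
  by apply/funext => n; rewrite /pois_cdf /= sumEFin big_mkord.
exact: fine_cvg h.
Qed.

Let cdf_le : {homo pois_cdf : m n / (m <= n)%N >-> m <= n}.
Proof.
apply: homo_leq => // [n y m|n]; first exact: le_trans.
by rewrite /pois_cdf big_ord_recr/= lerDl pois_ge0.
Qed.

Let cdf_le1 n : pois_cdf n <= 1.
Proof.
have := nondecreasing_cvgn_le cdf_le (cvgP _ pois_cdf_cvg) n.
by rewrite (cvg_lim (@Rhausdorff R) pois_cdf_cvg).
Qed.

Let cdf_ge0 n : 0 <= pois_cdf n.
Proof. by have := cdf_le 0%N n (leq0n _); rewrite {1}/pois_cdf big_ord0. Qed.

(** The quantile transform of the Poisson law of mean 1. Outside the unit interval no [k] fits and
    the default 0 is returned; this enlarges the fibre of 0 by a null set of the uniform law. *)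
Definition pois_quantile (v : R) : nat := xget 0%N [set k | pois_cdf k <= v < pois_cdf k.+1].

Let quantile_uniq v j k : pois_cdf j <= v < pois_cdf j.+1 -> pois_cdf k <= v < pois_cdf k.+1 -> j = k.
Proof.
move=> /andP[a b] /andP[c e]; apply/eqP; rewrite eqn_leq; apply/andP; split; rewrite leqNgt; apply/negP => h.
  have := cdf_le _ _ h; lra.
have := cdf_le _ _ h; lra.
Qed.

Lemma pois_quantileE (k : nat) : pois_quantile @^-1` [set k] =
  `[pois_cdf k, pois_cdf k.+1[%classic `|` (if k == 0%N then ~` `[(0:R), 1[%classic else set0).
Proof.
apply/seteqP; split => v /=.
  rewrite /pois_quantile => vk; have [/andP[v0 v1]|v01] := boolP (0 <= v < 1); last first.
    right; rewrite -vk; case: xgetP => [j _ /= /andP[jv vj]|_].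
      exfalso; move/negP: v01; apply; apply/andP; split; [exact: le_trans (cdf_ge0 _) jv|exact: lt_le_trans vj (cdf_le1 _)].
    by rewrite eqxx /= in_itv/=; exact/negP.
  left; rewrite in_itv/=; move: vk; case: xgetP => [j -> /= jv <- //|no _].
  have [n _ hn] : \forall n \near \oo, v < pois_cdf n by exact: cvgr_gt pois_cdf_cvg _ v1.
  have ex : exists n, v < pois_cdf n by exists n; exact: (hn n (leqnn n)).
  case: (ex_minnP ex) => -[|m] vm mmin; first by move: vm; rewrite /pois_cdf big_ord0 ltNge v0.
  exfalso; apply: (no m) => /=; rewrite vm andbT leNgt; apply/negP => /mmin; rewrite ltnn//.
move=> [|].
  rewrite in_itv/= => h; rewrite /pois_quantile; case: xgetP => [j _ /= jv|no]; first exact: quantile_uniq jv h.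
  by exfalso; exact: (no k).
case: eqP => // -> /=; rewrite in_itv/= => /negP h; rewrite /pois_quantile; case: xgetP => // j _ /= /andP[jv vj].
exfalso; move/negP: h; apply; apply/andP; split; [exact: le_trans (cdf_ge0 _) jv|exact: lt_le_trans vj (cdf_le1 _)].
Qed.

Lemma measurable_pois_quantile : measurable_fun setT pois_quantile.
Proof.
apply: measurable_fun_nat_of => k; rewrite pois_quantileE; apply: measurableU => //.
by case: (k == 0%N) => //; apply: measurableC.
Qed.

Lemma pois_quantile_law k : (\int[mu]_v (pois_quantile v == k)%:R%:E = (pois 1 k)%:E)%E.
Proof.
have mk : measurable (pois_quantile @^-1` [set k]) by apply: measurable_nat_eq; exact: measurable_pois_quantile.
rewrite (eq_integral (fun v => (\1_(pois_quantile @^-1` [set k]) v)%:E)); last first.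
  move=> v _; rewrite indicE; congr (_ %:R%:E); congr nat_of_bool.
  by apply/idP/idP => [/eqP e|]; [rewrite inE|rewrite inE => /eqP].
transitivity (mu (pois_quantile @^-1` [set k])); first by rewrite (integral_indic mu measurableT mk) setIT.
rewrite muE// pois_quantileE; have c0 := cdf_ge0 k.
have cE : pois_cdf k.+1 = pois_cdf k + pois 1 k by rewrite /pois_cdf big_ord_recr.
have p0 : 0 < pois (1 : R) k.
  by rewrite /pois divr_gt0// ?ltr0n ?fact_gt0// mulr_gt0 ?expR_gt0// exprn_gt0.
rewrite (_ : _ `&` _ = `[pois_cdf k, pois_cdf k.+1[%classic); last first.
  apply/seteqP; split => v /=.
    by move=> [[//|]]; case: eqP => //= _.
  rewrite !in_itv/= => /andP[a b]; split; first by left; rewrite a b.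
  by rewrite (le_trans c0 a) (lt_le_trans b).
by rewrite lebR_itv/= lte_fin cE ltrDl p0 -EFinB addrAC subrr add0r.
Qed.

Definition unif_point (k : nat) (a : R) : R * R := (even_bits (seed k a), odd_bits (seed k a)).

Lemma measurable_unif_point k : measurable_fun setT (unif_point k).
Proof. exact: (measurableT_comp measurable_split (measurable_seed k)). Qed.

(** The number of points is read from the odd digits and their positions from the even ones, so both
    are independent. Given [k] points the mean is [m ^+ k], and the Poisson average of these powers
    is [expR (m - 1)]. *)
Lemma box_pgf (F : R * R -> R) (m : R) : measurable_fun setT F -> (forall p, 0 <= F p) ->
  (\int[(mu \x mu)%E]_p (F p)%:E = m%:E)%E ->
  (\int[mu]_u (\prod_(k < pois_quantile (odd_bits u)) F (unif_point k (even_bits u)))%:E = (expR (m - 1))%:E)%E.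
Proof.
move=> mF F0 Fm.
have m0 : 0 <= m by rewrite -lee_fin -Fm integral_ge0// => p _; rewrite lee_fin.
have mG k : measurable_fun setT (fun a => \prod_(j < k) F (unif_point j a)).
  by apply: measurable_prod => j _; exact: (measurableT_comp mF (measurable_unif_point j)).
have mG' k : measurable_fun setT (fun u => (\prod_(j < k) F (unif_point j (even_bits u)) * (pois_quantile (odd_bits u) == k)%:R)%:E).
  apply/measurable_EFinP; apply: measurable_funM; first exact: (measurableT_comp (mG k) measurable_even_bits).
  exact: (measurable_nat_indic _ k (measurableT_comp measurable_pois_quantile measurable_odd_bits)).
have G0 k a : 0 <= \prod_(j < k) F (unif_point j a) by rewrite prodr_ge0.
rewrite (eq_integral (fun u => \sum_(k <oo) (\prod_(j < k) F (unif_point j (even_bits u)) * (pois_quantile (odd_bits u) == k)%:R)%:E)%E); last first.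
  move=> u _; rewrite -(select_sum (fun u => pois_quantile (odd_bits u)) (fun k => \prod_(j < k) F (unif_point j (even_bits u)))).
  by apply: eq_eseriesr => k _; rewrite mulrC.
rewrite integral_nneseries//; last by move=> k u _; rewrite lee_fin mulr_ge0.
rewrite -pois1_pgf//; apply: eq_eseriesr => k _.
rewrite (split_mean (fun v => (pois_quantile v == k)%:R) (fun a => \prod_(j < k) F (unif_point j a)) (pois 1 k) (m ^+ k))//.
- by rewrite mulrC.
- exact: (measurable_nat_indic _ k measurable_pois_quantile).
- exact: pois_quantile_law.
- rewrite (seeds_mean k (fun _ x => F (even_bits x, odd_bits x)) (fun=> m))//.
  + by rewrite prodr_const card_ord.
  + by move=> _; exact: (measurableT_comp mF measurable_split).
  + by move=> _; rewrite (integral_split mu muE (fun p => (F p)%:E))//; exact/measurable_EFinP.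
Qed.

Lemma integral_shift (j : R) (G : R -> \bar R) : measurable_fun setT G -> (forall y, (0 <= G y)%E) ->
  (forall y, G y != 0%E -> j <= y < j + 1) ->
  (\int[mu]_y G (j + y)%R = \int[lebR]_y G y)%E.
Proof.
move=> mG G0 Gj.
have ms : measurable_fun [set: R] (fun s : R => j + 1 * s) by apply: measurable_funD => //; exact: measurable_funM.
have := @ge0_integral_affine R j 1 G ltr01 mG G0; rewrite invr1 mul1e => <-.
under [RHS]eq_integral do rewrite mul1r.
have mGs : measurable_fun setT (fun y => G (j + y)) by apply: (measurableT_comp mG); exact: measurable_funD.
have E := ge0_integral_transfer lebR mu id (fun y => (\1_(`[0%R, 1%R[%classic) y)%:E).
rewrite (E _ _ _ _ _ (fun y => G (j + y)))//.
- apply: eq_integral => y _; rewrite indicE mem_setE.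
  have [_|yn] := boolP (y \in `[0, 1[); first by rewrite mul1e.
  rewrite mul0e; apply/esym/eqP/negPn/negP => /Gj /andP[a b]; move/negP: yn; apply.
  by rewrite in_itv/=; apply/andP; split; lra.
- by apply/measurable_EFinP; exact: measurable_indic.
- move=> A mA; apply: (etrans (muE A mA)); have mA1 : measurable (A `&` `[0%R, 1%R[) by exact: measurableI.
  rewrite -[A `&` _]setIT -integral_indic//.
  by apply: eq_integral => y _; rewrite setIC indicI/= EFinM.
Qed.

End uniform_seeds.

(** * Construction of Poisson random measures on the quadrant *)

Section unit_boxes.
Context {R : realType}.

Definition box_corner (q : nat) : R * R :=
  if @pickle_inv (nat * nat)%type q is Some ij then (ij.1%:R, ij.2%:R) else (0, 0).

(** Unit squares are enumerated through codes of pairs of integers. [pickle_inv] only accepts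
    genuine codes, so every other index gets the empty set and no square appears twice. *)
Definition unit_box (q : nat) : set (R * R) :=
  if @pickle_inv (nat * nat)%type q is Some ij then
    `[ij.1%:R, ij.1%:R + 1[%classic `*` `[ij.2%:R, ij.2%:R + 1[%classic else set0.

Lemma measurable_unit_box q : measurable (unit_box q).
Proof. by rewrite /unit_box; case: pickle_inv => [ij|//]; exact: measurableX. Qed.

Lemma unit_box_corner q p : unit_box q p ->
  ((box_corner q).1 <= p.1 < (box_corner q).1 + 1) /\ ((box_corner q).2 <= p.2 < (box_corner q).2 + 1).
Proof. by rewrite /unit_box /box_corner; case: pickle_inv => [ij|//] /= [] /=; rewrite !in_itv. Qed.

Lemma unit_box_disjoint q q' p : unit_box q p -> unit_box q' p -> q = q'.
Proof.
rewrite /unit_box; have := @pickle_invK (nat * nat)%type q; have := @pickle_invK (nat * nat)%type q'.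
case: (pickle_inv q) => [[i j]|//]; case: (pickle_inv q') => [[i' j']|//] /= <- <-.
rewrite !in_itv/= => -[/andP[a1 b1] /andP[c1 d1]] [/andP[a2 b2] /andP[c2 d2]].
have same (m n : nat) (x : R) : m%:R <= x -> x < m%:R + 1 -> n%:R <= x -> x < n%:R + 1 -> m = n.
  move=> h1 h2 h3 h4.
  have l1 : (m < n.+1)%N by rewrite -(ltr_nat R) -natr1; exact: le_lt_trans h4.
  have l2 : (n < m.+1)%N by rewrite -(ltr_nat R) -natr1; exact: le_lt_trans h2.
  by apply/eqP; rewrite eqn_leq -ltnS l1 -ltnS l2.
by rewrite (same i i' p.1)// (same j j' p.2).
Qed.

Lemma quadrant_unit_box : quadrant `<=` \bigcup_q unit_box q.
Proof.
move=> [x y] [/=]; rewrite !in_itv/= !andbT => x0 y0.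
exists (pickle (Num.trunc x, Num.trunc y)) => //.
by rewrite /unit_box pickleK_inv/=; split; rewrite /= in_itv/= natr1; exact: trunc_itv.
Qed.

End unit_boxes.

Section poisson_points.
Context {R : realType}.
Variable mu : probability R R.
Hypothesis muE : forall A, measurable A -> mu A = lebR (A `&` `[0%R, 1%R[).

Definition box_count (q : nat) (w : R) : nat := pois_quantile (odd_bits (seed q w)).

Definition box_point (q k : nat) (w : R) : R * R :=
  ((@box_corner R q).1 + (unif_point k (even_bits (seed q w))).1,
   (@box_corner R q).2 + (unif_point k (even_bits (seed q w))).2).

(** A Poisson number of uniform points in each unit square. Each Dirac mass is restricted to its
    square, since [even_bits] and [odd_bits] may take the value 1 and land on the excluded upper
    edges. *)
Definition poisson_points (w : R) : {measure set (R * R) -> \bar R} :=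
  mseries (fun q => msum (fun k => mrestr (dirac (box_point q k w)) (@measurable_unit_box R q)) (box_count q w)) 0.

Definition hits (q : nat) (D : set (R * R)) (w : R) : nat :=
  (\sum_(k < box_count q w) (box_point q k w \in D `&` unit_box q))%N.

Lemma poisson_pointsE w D : measurable D ->
  poisson_points w D = (\sum_(q <oo) (hits q D w)%:R%:E)%E.
Proof.
move=> mD; rewrite /poisson_points/= /mseries; apply: eq_eseriesr => q _.
rewrite /msum /hits natr_sum -sumEFin; apply: eq_bigr => k _.
exact: diracE.
Qed.

Lemma measurable_box_count q : measurable_fun setT (box_count q).
Proof. exact: (measurableT_comp measurable_pois_quantile (measurableT_comp measurable_odd_bits (measurable_seed q))). Qed.

Lemma measurable_box_point q k : measurable_fun setT (box_point q k).
Proof.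
have m : measurable_fun setT (fun w : R => unif_point k (even_bits (seed q w))).
  exact: (measurableT_comp (measurable_unif_point k) (measurableT_comp measurable_even_bits (measurable_seed q))).
apply: measurable_fun_pair; apply: measurable_funD => //.
  exact: (measurableT_comp measurable_fst m).
exact: (measurableT_comp measurable_snd m).
Qed.

Let mDb (D : set (R * R)) q : measurable D -> measurable (D `&` unit_box q).
Proof. by move=> mD; apply: measurableI => //; exact: measurable_unit_box. Qed.

Let measurable_mem (E : set R) : measurable E -> measurable_fun setT (fun w : R => (w \in E) : nat).
Proof.
move=> mE; apply: measurable_fun_nat_of => -[|[|k]].
- rewrite (_ : _ @^-1` _ = ~` E); first exact: measurableC.
  by apply/seteqP; split => w /=; [case: (boolP (w \in E)) => // /negP h _ /mem_set|move=> h; rewrite memNset].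
- rewrite (_ : _ @^-1` _ = E)//.
  by apply/seteqP; split => w /=; [case: (boolP (w \in E)) => // /set_mem|move=> h; rewrite mem_set].
- rewrite (_ : _ @^-1` _ = set0)//.
  by apply/seteqP; split => w //=; case: (w \in E).
Qed.

Lemma measurable_hits q D : measurable D -> measurable_fun setT (hits q D).
Proof.
move=> mD; apply: (measurable_fun_select (box_count q) (fun n w => (\sum_(k < n) (box_point q k w \in D `&` unit_box q))%N)).
  exact: measurable_box_count.
move=> n; elim: n => [|n IH].
  rewrite (_ : (fun w => _) = cst 0%N); first exact: measurable_cst.
  by apply/funext => w; rewrite big_ord0.
rewrite (_ : (fun w => _) = (fun w => (\sum_(k < n) (box_point q k w \in D `&` unit_box q))%N + (box_point q n w \in D `&` unit_box q))%N); last first.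
  by apply/funext => w; rewrite big_ord_recr.
apply: measurable_addn => //.
have := measurable_mem (box_point q n @^-1` (D `&` unit_box q)).
rewrite (_ : (fun w => nat_of_bool (w \in _)) = (fun w => (box_point q n w \in D `&` unit_box q) : nat)); last first.
  by apply/funext => w; congr nat_of_bool; apply/idP/idP; rewrite !inE.
apply; rewrite -[X in measurable X]setTI; apply: (measurable_box_point q n) => //; exact: mDb.
Qed.

Let mtrans (q : nat) : measurable_fun setT (fun p : R * R => ((box_corner q).1 + p.1, (box_corner q).2 + p.2)).
Proof. by apply: measurable_fun_pair; apply: measurable_funD. Qed.

(** Tonelli together with [integral_shift] in each coordinate: the uniform law translated to a
    corner is Lebesgue measure on the square. *)
Lemma box_translate q D : measurable D ->
  ((mu \x mu)%E [set p | (D `&` unit_box q) ((box_corner q).1 + p.1, (box_corner q).2 + p.2)] = leb2 (D `&` unit_box q)).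
Proof.
move=> mD; set S := D `&` unit_box q; have mS : measurable S by exact: mDb.
have Sb p : S p -> unit_box q p by case.
set i := (box_corner q).1; set j := (box_corner q).2.
pose G (x : R) : \bar R := lebR (xsection S x).
have mG : measurable_fun setT G by exact: (measurable_fun_xsection lebR mS).
have G0 x : (0 <= G x)%E by exact: measure_ge0.
have sec x : mu (xsection [set p | S (i + p.1, j + p.2)] x) = G (i + x).
  have mX : measurable (xsection S (i + x)) by exact: measurable_xsection.
  rewrite (_ : xsection _ x = (fun y => j + y) @^-1` xsection S (i + x)); last first.
    by apply/seteqP; split => y /=; [move/xsectionP => ?; exact/xsectionP|move/xsectionP => ?; exact/xsectionP].
  have mpre : measurable ((fun y => j + y) @^-1` xsection S (i + x)).
    have mj : measurable_fun setT (fun y : R => j + y) by apply: measurable_funD.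
    by rewrite -[X in measurable X]setTI; apply: mj.
  transitivity (\int[mu]_y (\1_(xsection S (i + x)) (j + y))%:E)%E.
    rewrite -[X in mu X]setIT -(integral_indic mu measurableT mpre); apply: eq_integral => y _.
    by rewrite !indicE.
  rewrite (integral_shift mu muE j (fun y => (\1_(xsection S (i + x)) y)%:E)).
  - by rewrite (integral_indic lebR measurableT mX) setIT.
  - by apply/measurable_EFinP; exact: measurable_indic.
  - by move=> y; rewrite lee_fin.
  - move=> y; rewrite indicE eqe; case: (boolP (y \in _)) => [|_]; last by rewrite eqxx.
    by rewrite inE => /xsectionP /Sb /unit_box_corner [].
transitivity (\int[mu]_x G (i + x)%R)%E; first by apply: eq_integral => x _; exact: sec.
rewrite (integral_shift mu muE i G mG G0).
  rewrite -ge0_integral_lebR//.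
move=> x Gx; have [y Sxy] : exists y, S (x, y).
  apply: contrapT => no; move/negP: Gx; apply; apply/eqP; rewrite /G (_ : xsection S x = set0) ?measure0//.
  by apply/seteqP; split => // y /xsectionP Sxy; exfalso; apply: no; exists y.
by have [] := unit_box_corner q (x, y) (Sb _ Sxy).
Qed.

Section pgf.
Variables (n : nat) (D : nat -> set (R * R)) (s : nat -> R).
Hypotheses (mD : forall i, (i < n)%N -> measurable (D i)) (s01 : forall i, 0 <= s i <= 1)
  (disj : forall i j, (i < n)%N -> (j < n)%N -> i <> j -> D i `&` D j = set0).

Let weight_at q (p : R * R) : R :=
  \prod_(i < n) s i ^+ (((box_corner q).1 + p.1, (box_corner q).2 + p.2) \in D i `&` unit_box q).

Let measurable_weight q : measurable_fun setT (weight_at q).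
Proof.
pose E i := [set p : R * R | (D i `&` unit_box q) ((box_corner q).1 + p.1, (box_corner q).2 + p.2)].
have mE i : (i < n)%N -> measurable (E i).
  move=> /mD mDi; rewrite -[X in measurable X]setTI; apply: mtrans => //; exact: mDb.
apply: measurable_prod => i _.
rewrite (_ : (fun p => _) = (fun p => 1 + (s i - 1) * \1_(E i) p)).
  apply: measurable_funD => //; apply: measurable_funM => //; apply: measurable_indic; exact: mE.
apply/funext => p; rewrite indicE (_ : (_ \in _) = (p \in E i)); last by apply/idP/idP; rewrite !inE.
by case: (_ \in _); rewrite ?expr1 ?expr0 ?mulr1 ?mulr0 ?addr0// addrC subrK.
Qed.

Let fin i q : (i < n)%N -> (leb2 (D i `&` unit_box q) < +oo)%E.
Proof.
move=> /mD mDi; rewrite -box_translate//; apply: le_lt_trans (ltry 1).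
apply: probability_le1; rewrite -[X in measurable X]setTI; apply: mtrans => //; exact: mDb.
Qed.

(** The sets are disjoint, so at most one exponent is 1 and [weight_at] plus the sum of the terms
    [(1 - s i)] on the sets is identically 1. Integrating this sum of nonnegative terms yields the
    mean. *)
Let weight_mean q : (\int[(mu \x mu)%E]_p (weight_at q p)%:E =
  (1 + \sum_(i < n) (s i - 1) * fine (leb2 (D i `&` unit_box q)))%:E)%E.
Proof.
pose E i := [set p : R * R | (D i `&` unit_box q) ((box_corner q).1 + p.1, (box_corner q).2 + p.2)].
have mE i : (i < n)%N -> measurable (E i).
  move=> /mD mDi; rewrite -[X in measurable X]setTI; apply: mtrans => //; exact: mDb.
have memE i p : (((box_corner q).1 + p.1, (box_corner q).2 + p.2) \in D i `&` unit_box q) = (p \in E i).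
  by apply/idP/idP; rewrite !inE.
have pt p : weight_at q p + \sum_(i < n) (1 - s i) * \1_(E i) p = 1.
  have [[i0 Ei0]|no] := pselect (exists i : 'I_n, E i p).
    have other (i : 'I_n) : i != i0 -> (p \in E i) = false.
      move=> /eqP ii; apply/negP; rewrite inE => Ei.
      have : (D i `&` D i0) ((box_corner q).1 + p.1, (box_corner q).2 + p.2) by split; [case: Ei|case: Ei0].
      by rewrite disj// => e; apply: ii; apply: val_inj.
    rewrite /weight_at (bigD1 i0)//= [X in _ + X](bigD1 i0)//=.
    rewrite (mem_set (Ei0 : (D i0 `&` unit_box q) _)) indicE (mem_set Ei0) !big1 ?addr0 ?mulr1 ?expr1 ?subrKC//.
      by move=> i ii; rewrite indicE other// mulr0.
    by move=> i ii; rewrite memE other// expr0.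
  have out (i : 'I_n) : (p \in E i) = false.
    by apply/negP; rewrite inE => Ei; apply: no; exists i.
  rewrite /weight_at !big1 ?addr0//.
    by move=> i _; rewrite indicE out mulr0.
  by move=> i ii; rewrite memE out expr0.
have s1 i : 0 <= 1 - s i by rewrite subr_ge0; case/andP: (s01 i).
have mI (i : 'I_n) : measurable_fun setT (fun p => ((1 - s i) * \1_(E i) p)%:E).
  apply/measurable_EFinP; apply: measurable_funM => //; apply: measurable_indic; exact: mE.
have I0 (i : 'I_n) p : (0 <= ((1 - s i) * \1_(E i) p)%:E)%E by rewrite lee_fin mulr_ge0.
have mS : measurable_fun setT (fun p => (\sum_(i < n) (1 - s i) * \1_(E i) p)%:E).
  rewrite (_ : (fun p => _) = (fun p => \sum_(i < n) ((1 - s i) * \1_(E i) p)%:E)%E).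
    by apply: emeasurable_sum => i; exact: mI.
  by apply/funext => p; rewrite sumEFin.
have w0 p : 0 <= weight_at q p by apply: prodr_ge0 => i _; rewrite exprn_ge0//; case/andP: (s01 i).
have tot : (\int[(mu \x mu)%E]_p (weight_at q p)%:E + (\sum_(i < n) (1 - s i) * fine (leb2 (D i `&` unit_box q)))%:E = 1)%E.
  have -> : ((\sum_(i < n) (1 - s i) * fine (leb2 (D i `&` unit_box q)))%:E = \int[(mu \x mu)%E]_p (\sum_(i < n) (1 - s i) * \1_(E i) p)%:E)%E.
    under [RHS]eq_integral do rewrite -sumEFin.
    rewrite ge0_integral_sum// -sumEFin; apply: eq_bigr => i _.
    under [RHS]eq_integral do rewrite EFinM.
    rewrite ge0_integralZl//.
    - rewrite (integral_indic _ measurableT (mE i (ltn_ord i))) setIT -/(E i) EFinM fineK.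
        by rewrite -(box_translate q (D i) (mD i (ltn_ord i))).
      by rewrite ge0_fin_numE ?measure_ge0// fin.
    - by apply/measurable_EFinP; apply: measurable_indic; exact: mE.
    - by rewrite lee_fin.
  rewrite -ge0_integralD//.
  - rewrite (eq_integral (cst 1%E)); last by move=> p _; rewrite -EFinD pt.
    by rewrite (integral_cst (mu \x mu)%E measurableT) mul1e; exact: probability_setT.
  - by move=> p _; rewrite lee_fin.
  - by apply/measurable_EFinP; exact: measurable_weight.
  - by move=> p _; rewrite lee_fin sumr_ge0// => i _; rewrite mulr_ge0.
have -> : (1 + \sum_(i < n) (s i - 1) * fine (leb2 (D i `&` unit_box q))) = 1 - \sum_(i < n) (1 - s i) * fine (leb2 (D i `&` unit_box q)).
  by rewrite -sumrN; congr (_ + _); apply: eq_bigr => i _; rewrite -mulNr opprB.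
by rewrite EFinB -tot addeK.
Qed.

(** Different squares use different seeds, so the generating functions of the squares multiply;
    regrouping the exponents by set instead of by square gives independent Poisson counts. *)
Lemma hits_pgf Q : (\int[mu]_w (\prod_(i < n) s i ^+ (\sum_(q < Q) hits q (D i) w)%N)%:E =
  (\prod_(i < n) expR ((\sum_(q < Q) fine (leb2 (D i `&` unit_box q))) * (s i - 1)))%:E)%E.
Proof.
have w0 q p : 0 <= weight_at q p by apply: prodr_ge0 => i _; rewrite exprn_ge0//; case/andP: (s01 i).
pose f q u := \prod_(k < pois_quantile (odd_bits u)) weight_at q (unif_point k (even_bits u)).
pose m q := 1 + \sum_(i < n) (s i - 1) * fine (leb2 (D i `&` unit_box q)).
have mf q : measurable_fun setT (f q).
  apply: (measurable_fun_select (fun u => pois_quantile (odd_bits u)) (fun K u => \prod_(k < K) weight_at q (unif_point k (even_bits u)))).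
    exact: (measurableT_comp measurable_pois_quantile measurable_odd_bits).
  move=> K; apply: measurable_prod => k _.
  exact: (measurableT_comp (measurable_weight q) (measurableT_comp (measurable_unif_point k) measurable_even_bits)).
have := seeds_mean mu muE Q f (fun q => expR (m q - 1)) mf (fun q u => prodr_ge0 _ (fun k _ => w0 _ _))
  (fun q => box_pgf mu muE (weight_at q) (m q) (measurable_weight q) (w0 q) (weight_mean q)).
have -> : \prod_(q < Q) expR (m q - 1) = \prod_(i < n) expR ((\sum_(q < Q) fine (leb2 (D i `&` unit_box q))) * (s i - 1)).
  rewrite -!expR_sum; congr expR; rewrite (eq_bigr (fun q : 'I_Q => \sum_(i < n) (s i - 1) * fine (leb2 (D i `&` unit_box q)))).
    by rewrite exchange_big/=; apply: eq_bigr => i _; rewrite -mulr_sumr mulrC.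
  by move=> q _; rewrite /m addrAC subrr add0r.
move=> <-; apply: eq_integral => w _; congr (_%:E).
rewrite /f /weight_at; under [RHS]eq_bigr do rewrite exchange_big/=.
rewrite exchange_big/=; apply: eq_bigr => i _.
by rewrite -prodrXr; apply: eq_bigr => q _; rewrite /hits -prodrXr.
Qed.

End pgf.

End poisson_points.

(** The limit may be infinite. Either the nondecreasing sequence passes [k], and both sides are
    false from then on, or it stays bounded by [k] and is eventually constant. *)
Lemma nat_cvg_near {R : realType} (u : nat -> nat) (l : \bar R) (k : nat) :
  {homo u : m n / (m <= n)%N} -> (u n)%:R%:E @[n --> \oo] --> l ->
  \forall n \near \oo, u n = k <-> l = k%:R%:E.
Proof.
move=> hu ul.
have ge n : ((u n)%:R%:E <= l)%E.
  rewrite -(cvg_lim (@ereal_hausdorff R) ul).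
  by apply: lime_ge; [exact: cvgP ul|exists n => // m /= nm; rewrite lee_fin ler_nat hu].
have [[n0 kn0]|no] := pselect (exists n, (k < u n)%N).
  exists n0 => // n /= n0n; split => [un|lk].
    by have := hu _ _ n0n; rewrite un leqNgt kn0.
  by have := ge n0; rewrite lk lee_fin ler_nat leqNgt kn0.
have le n : (u n <= k)%N by rewrite leqNgt; apply/negP => kn; apply: no; exists n.
have lk : (l <= k%:R%:E)%E.
  rewrite -(cvg_lim (@ereal_hausdorff R) ul); apply: lime_le; first exact: cvgP ul.
  by apply: nearW => n; rewrite lee_fin ler_nat.
have lf : l \is a fin_num.
  by rewrite fin_numElt (lt_le_trans (ltNyr _) (ge 0%N)) (le_lt_trans lk (ltry _)).
have [_ ev] := isnat_cvg _ _ (fun n => ex_intro _ (u n) erefl) lf ul.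
apply: filterS ev => n <-; split => [->//|[]/eqP]; rewrite eqr_nat => /eqP //.
Qed.

Lemma cvg_prod_ord {R : realType} n (u : nat -> nat -> R) (l : nat -> R) :
  (forall i, (i < n)%N -> u i m @[m --> \oo] --> l i) ->
  \prod_(i < n) u i m @[m --> \oo] --> \prod_(i < n) l i.
Proof.
elim: n => [|n IH] h.
  by rewrite big_ord0 (_ : (fun m => _) = cst 1); [exact: cvg_cst|apply/funext => m; rewrite big_ord0].
rewrite big_ord_recr (_ : (fun m => _) = (fun m => \prod_(i < n) u i m * u n m)); last first.
  by apply/funext => m; rewrite big_ord_recr.
by apply: cvgM; [apply: IH => i ni; apply: h; exact: ltnW|exact: h].
Qed.

Lemma continuous_pois {R : realType} (k : nat) : continuous (fun r : R => pois r k).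
Proof.
move=> r; rewrite /pois; apply: cvgM; last exact: cvg_cst.
apply: cvgM.
  by apply: (@continuous_comp _ _ _ -%R (@expR R)); [exact: cvgN|exact: continuous_expR].
exact: exprn_continuous.
Qed.

Section poisson_law.
Context {R : realType}.
Variable mu : probability R R.
Hypothesis muE : forall A, measurable A -> mu A = lebR (A `&` `[0%R, 1%R[).

Lemma measurable_poisson_points A : measurable A -> measurable_fun setT (fun w : R => poisson_points w A).
Proof.
move=> mA; under eq_fun do rewrite poisson_pointsE//.
apply: ge0_emeasurable_sum => [q w _ _|q _]; first by rewrite lee_fin.
apply/measurable_EFinP.
apply: (measurable_fun_select (hits q A) (fun k (_ : R) => k%:R : R)); first exact: measurable_hits.
by move=> k; exact: measurable_cst.
Qed.

Let leb2_boxes (A : set (R * R)) : measurable A -> A `<=` quadrant ->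
  leb2R A = (\sum_(q <oo) leb2R (A `&` unit_box q))%E.
Proof.
move=> mA Aq; have mAq q : measurable (A `&` unit_box q) by apply: measurableI => //; exact: measurable_unit_box.
rewrite -measure_semi_bigcup//.
- by rewrite -setI_bigcupr setIidl//; exact: subset_trans Aq (@quadrant_unit_box R).
- by apply/trivIsetP => q q' _ _ /eqP qq; apply/seteqP; split => // p [[_ a] [_ b]]; apply: qq; exact: unit_box_disjoint a b.
- exact: bigcupT_measurable.
Qed.

(** For the first [Q] squares the joint law follows from generating functions. As [Q] grows the
    counts increase to those of the full measure, the areas converge, and the Poisson weights are
    continuous in the rate. *)
Lemma poisson_law n (D : nat -> set (R * R)) (k : nat -> nat) :
  (forall i, (i < n)%N -> [/\ measurable (D i), D i `<=` quadrant & (leb2 (D i) < +oo)%E]) ->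
  (forall i j, (i < n)%N -> (j < n)%N -> i <> j -> D i `&` D j = set0) ->
  mu (\bigcap_(i in `I_n) [set w : R | poisson_points w (D i) = (k i)%:R%:E]) =
  (\prod_(i < n) (pois (fine (leb2 (D i))) (k i))%:E)%E.
Proof.
(* Padding the family with empty sets makes measurability hold at every index. *)
move=> hD disj; pose D' i := if (i < n)%N then D i else set0.
have mD i : (i < n)%N -> measurable (D i) by case/hD.
have mD' i : measurable (D' i) by rewrite /D'; case: ifP => // /mD.
have D'E i : (i < n)%N -> D' i = D i by rewrite /D' => ->.
pose C Q i w := (\sum_(q < Q) hits q (D' i) w)%N.
pose r Q i : R := \sum_(q < Q) fine (leb2 (D' i `&` unit_box q)).
have mC Q i : measurable_fun setT (C Q i).
  elim: Q => [|Q IH].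
    by rewrite /C (_ : (fun w => _) = cst 0%N); [exact: measurable_cst|apply/funext => w; rewrite big_ord0].
  rewrite (_ : C Q.+1 i = fun w => (C Q i w + hits Q (D' i) w)%N).
    by apply: measurable_addn => //; exact: measurable_hits.
  by apply/funext => w; rewrite /C big_ord_recr.
have law Q : mu (\bigcap_(i in `I_n) [set w | C Q i w = k i]) = (\prod_(i < n) pois (r Q i) (k i))%:E.
  rewrite -(joint_pgf_pmf mu n (C Q) (r Q) k).
  - have mE : measurable (\bigcap_(i in `I_n) [set w | C Q i w = k i]).
      apply: fin_bigcap_measurable; first exact: finite_II.
      by move=> i _; exact: measurable_nat_eq.
    rewrite -[X in mu X]setIT -(integral_indic mu measurableT mE); apply: eq_integral => w _.
    congr (_%:E); rewrite indicE; have [|h] := boolP (w \in _).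
      rewrite inE => h; rewrite big1// => i _; have := h i (ltn_ord i) => /= ->; by rewrite eqxx.
    have [i hi] : exists i : 'I_n, C Q i w != k i.
      apply: contrapT => no; move/negP: h; apply; rewrite inE => i /= ni.
      by apply: contrapT => /eqP ci; apply: no; exists (Ordinal ni).
    by rewrite (bigD1 i)//= (negbTE hi) mul0r.
  - by move=> i; exact: mC.
  - by move=> i; rewrite sumr_ge0// => q _; rewrite fine_ge0.
  - move=> s s01; apply: hits_pgf => // [i j ni nj ij].
    by rewrite !D'E//; exact: disj.
have c1 : mu (\bigcap_(i in `I_n) [set w | C Q i w = k i]) @[Q --> \oo] -->
    mu (\bigcap_(i in `I_n) [set w | poisson_points w (D i) = (k i)%:R%:E]).
  apply: cvg_measure_near.
  - move=> Q; apply: fin_bigcap_measurable; first exact: finite_II.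
    by move=> i _; exact: measurable_nat_eq.
  - apply: fin_bigcap_measurable; first exact: finite_II.
    move=> i ni; rewrite (_ : [set w | _] = (fun w => poisson_points w (D i)) @^-1` [set (k i)%:R%:E])//.
    rewrite -[X in measurable X]setTI; apply: measurable_poisson_points => //; exact: mD.
  - apply: aeW => w.
    have ev : \forall Q \near \oo, forall i : 'I_n, C Q i w = k i <-> poisson_points w (D i) = (k i)%:R%:E.
      apply: filter_forall => i; apply: nat_cvg_near.
        by apply: homo_leq => // [a b c|Q]; [exact: leq_trans|rewrite /C big_ord_recr leq_addr].
      rewrite poisson_pointsE; last exact: mD.
      rewrite (_ : (fun Q => _) = (fun Q => (\sum_(0 <= q < Q) (hits q (D i) w)%:R%:E)%E)).
        by apply: is_cvg_nneseries => q *; rewrite lee_fin.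
      by apply/funext => Q; rewrite /C D'E// natr_sum sumEFin big_mkord.
    apply: filterS ev => Q h; split => H i ni; have /= := H i ni; have := h (Ordinal ni) => /= -[h1 h2].
      exact: h1.
    exact: h2.
have c2 : (\prod_(i < n) pois (r Q i) (k i))%:E @[Q --> \oo] --> (\prod_(i < n) (pois (fine (leb2 (D i))) (k i)))%:E.
  apply: cvg_EFin; first exact: nearW.
  apply: (cvg_prod_ord n (fun i Q => pois (r Q i) (k i)) (fun i => pois (fine (leb2 (D i))) (k i))) => i ni.
  apply: (@cvg_comp _ _ _ (fun Q => r Q i) (fun x => pois x (k i)) _ (nbhs (fine (leb2 (D i))))); last exact: continuous_pois.
  have [mDi Diq Dif] := hD i ni.
  have -> : (fun Q => r Q i) = fine \o (fun Q => (\sum_(0 <= q < Q) leb2R (D i `&` unit_box q))%E).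
    apply/funext => Q; rewrite /r /= D'E// big_mkord -[LHS]/(fine (_%:E)) -sumEFin; congr fine.
    apply: eq_bigr => q _; rewrite fineK// ge0_fin_numE// (le_lt_trans _ Dif)// -[leRHS]/(leb2R _) le_measure ?inE//.
    by apply: measurableI => //; exact: measurable_unit_box.
  apply: fine_cvg; rewrite fineK; last by rewrite ge0_fin_numE.
  by rewrite -[leb2 _]/(leb2R _) (leb2_boxes _ mDi Diq); apply: is_cvg_nneseries.
rewrite prodEFin -(cvg_lim (@ereal_hausdorff R) c2) -(cvg_lim (@ereal_hausdorff R) c1).
by apply: congr_lim; apply/funext => Q; rewrite law.
Qed.

(** Three independent coordinates: one seed for each measure, and the initial state itself. *)
Lemma PRM_exists (g : probability R R) :
  PRM_indep ((mu \x mu) \x g)%E (fun w : (R * R) * R => poisson_points w.1.1) (fun w => poisson_points w.1.2)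
    (fun w => w.2) g.
Proof.
split.
  by move=> A mA; apply: (measurableT_comp (measurable_poisson_points A mA)); exact: (measurableT_comp measurable_fst).
split.
  by move=> A mA; apply: (measurableT_comp (measurable_poisson_points A mA)); exact: (measurableT_comp measurable_snd).
split; first exact: measurable_snd.
move=> n m A k B l C hA dA hB dB mC.
pose EA := \bigcap_(i in `I_n) [set w : R | poisson_points w (A i) = (k i)%:R%:E].
pose EB := \bigcap_(i in `I_m) [set w : R | poisson_points w (B i) = (l i)%:R%:E].
have mcap (n' : nat) (A' : nat -> set (R * R)) (k' : nat -> nat) : (forall i, (i < n')%N -> measurable (A' i)) ->
    measurable (\bigcap_(i in `I_n') [set w : R | poisson_points w (A' i) = (k' i)%:R%:E]).
  move=> mA'; apply: fin_bigcap_measurable; first exact: finite_II.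
  move=> i ni; rewrite (_ : [set w | _] = (fun w => poisson_points w (A' i)) @^-1` [set (k' i)%:R%:E])//.
  rewrite -[X in measurable X]setTI; apply: measurable_poisson_points => //; exact: mA'.
have mEA : measurable EA by apply: mcap => i /hA [].
have mEB : measurable EB by apply: mcap => i /hB [].
rewrite (_ : _ `&` _ = (EA `*` EB) `*` C).
  apply: (etrans (product_measure1E (mu \x mu)%E g (measurableX mEA mEB) mC)).
  congr (_ * _)%E; apply: (etrans (product_measure1E mu mu mEA mEB)).
  by congr (_ * _)%E; exact: poisson_law.
by apply/seteqP; split => -[[a b] c] [[h1 h2] h3]; exact: (conj (conj h1 h2) h3).
Qed.

End poisson_law.

(** * Invariance of the Dirac mass at zero *)

Section dirac_invariant.
Context {R : realType}.

(** The zero path is a solution: jumps are proportional to the state, and both mean field terms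
    equal [phi 0] and cancel. Only the two Poisson measures are taken from the given space. *)
Let dirac0_invariant_of (h : R) (phi : R -> R) d (T : measurableType d) (P : probability T R)
    (Np Nm : T -> {measure set (R * R) -> \bar R}) (U0 : T -> R) (g : probability R R) :
  PRM_indep P Np Nm U0 g -> is_invariant h phi delta0.
Proof.
move=> [mp [mm [_ law]]].
pose U (t : R) (w : T) : R := 0.
have cst0 (C : set R) : (cst 0 : T -> R) @^-1` C = if (0 : R) \in C then setT else set0.
  apply/seteqP; split => w /=; first by move=> C0; rewrite mem_set.
  by case: ifPn => [/set_mem|].
have driftE s : drift P phi U s = 0.
  rewrite /drift big_cons big_cons big_nil /U !mulr0 !mulN1r mul1r addr0 addNr//.
have ll w (s : R) : left_lim (fun s => U s w) s = 0.
  by rewrite /left_lim /U; apply: cvg_lim => //; exact: cvg_cst.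
exists d, T, P, Np, Nm, U; split.
- split; first exact: mp.
  split; first exact: mm.
  split; first exact: measurable_cst.
  move=> n m A k B l C hA dA hB dB mC.
  have := law n m A k B l setT hA dA hB dB measurableT.
  rewrite preimage_setT setIT probability_setT mule1 /delta0 diracE => E.
  have -> : U 0 @^-1` C = if (0 : R) \in C then setT else set0 by exact: cst0.
  case: (_ \in C); first by rewrite setIT mule1; exact: E.
  by rewrite setI0 measure0 mule0.
- split; first by move=> t; exact: measurable_cst.
  split; first by move=> w t _; exact: cvg_cst.
  split; first by move=> w t _; apply/cvg_ex; exists 0; exact: cvg_cst.
  split; first by move=> s o _ _; rewrite /U; exact: finite_measure_integrable_cst.
  split.
    move=> t _; rewrite (_ : (fun s => _) = cst 0%E); first exact: integrable0.
    by apply/funext => s; rewrite driftE.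
  apply: aeW => w t t0; split.
    move=> o _; rewrite (_ : (fun p => _) = cst 0%E); first exact: integrable0.
    by apply/funext => p; rewrite ll mul0r.
  rewrite big1 => [|o _]; last first.
    by apply: integral0_eq => p _; rewrite ll mul0r.
  have -> : (\int[leb]_(s in `[0%R, t]) (drift P phi U s)%:E = 0)%E.
    by apply: integral0_eq => s _; rewrite driftE.
  by rewrite mule0 sube0 adde0.
- move=> t _ A mA; rewrite /delta0 diracE.
  have -> : U t @^-1` A = if (0 : R) \in A then setT else set0 by exact: cst0.
  by case: (_ \in A); rewrite ?measure0// probability_setT.
Qed.

Lemma dirac0_invariant (h : R) (phi : R -> R) : is_invariant h phi delta0.
Proof.
have [mu muE] := @uniform_exists R.
have prm := PRM_exists mu muE mu.
exact: (dirac0_invariant_of h phi _ _ _ _ _ _ mu prm).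
Qed.

End dirac_invariant.

(** * Event-by-event construction of a path for bounded rates *)

Section path_construction.
Context {R : realType}.
Variables (Np Nm : {measure set (R * R) -> \bar R}) (c : R) (phi : R -> R) (K : nat) (x0 : R).
Hypotheses (cNp : forall M : nat, counting_on Np (sqbox M%:R))
           (cNm : forall M : nat, counting_on Nm (sqbox M%:R)).
Hypothesis simpleN : forall (M : nat) (r : R), 0 < r -> r <= M%:R ->
  (Np ([set r] `*` `[0%R, M%:R]) + Nm ([set r] `*` `[0%R, M%:R]) <= 1)%E.
Hypotheses (c0 : 0 <= c) (x00 : 0 <= x0) (phi0 : forall x, 0 <= phi x) (phiK : forall x, phi x <= K%:R)
  (mphi : measurable_fun setT phi).

Let mrow : measurable (setT `*` `[0%R, (K%:R : R)] : set (R * R)).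
Proof. exact: measurableX. Qed.

Let NN : {measure set (R * R) -> \bar R} := measure_add Np Nm.

(** Only points of height at most [K] can be accepted. This measure counts their times, which are
    locally finite. *)
Definition events : {measure set R -> \bar R} :=
  measure_function_pushforward__canonical__measure_function_Measure
    (measure_function_mrestr__canonical__measure_function_Measure NN mrow)
    (measurable_fst : measurable_fun [set: R * R] (fst : R * R -> R)).

Lemma eventsE A : events A = (Np (A `*` `[0%R, K%:R]) + Nm (A `*` `[0%R, K%:R]))%E.
Proof.
rewrite /events/= /pushforward /mrestr (_ : _ `&` _ = A `*` `[0%R, K%:R]).
  exact: measure_addE.
by apply/seteqP; split => -[p q] /=; tauto.
Qed.

Lemma events_isnat (t : R) A : measurable A -> A `<=` `]0, t]%classic -> isnat (events A).
Proof.
move=> mA At; rewrite eventsE; pose M := maxn K (Num.trunc t).+1.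
have sub : A `*` `[0%R, (K%:R : R)] `<=` sqbox M%:R.
  move=> -[p q] [/= /At]; rewrite !in_itv/= => /andP[p0 pt] /andP[q0 qK].
  have tM : t <= M%:R.
    have [t0|t0] := leP 0 t.
      by have /andP[_ /ltW h] := trunc_itv t0; rewrite (le_trans h)// ler_nat leq_maxr.
    by rewrite (le_trans (ltW t0)).
  have p0' : 0 <= p by exact: (ltW p0).
  have pM : p <= M%:R by exact: (le_trans (pt : p <= t) tM).
  by split; rewrite /= in_itv/= ?p0' ?pM// q0 (le_trans qK)// ler_nat leq_maxl.
have mAK : measurable (A `*` `[0%R, (K%:R : R)]) by exact: measurableX.
have [k1 ->] := cNp M _ mAK sub; have [k2 ->] := cNm M _ mAK sub.
by exists (k1 + k2)%N; rewrite natrD EFinD.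
Qed.

(** The intervals to the right of [t] shrink to the empty set and carry integer counts, so some
    count is already 0. *)
Lemma events_gap (t : R) : 0 <= t -> exists2 e : R, 0 < e & events `]t, t + e]%classic = 0%E.
Proof.
move=> t0; pose F n := `]t, t + n.+1%:R^-1]%classic : set R.
have F0 : \bigcap_n F n = set0.
  apply/seteqP; split => // x h.
  have tx : t < x by have := h 0%N I; rewrite /F/= in_itv/= => /andP[].
  have [n] : exists n, n.+1%:R^-1 < x - t.
    have /cvgrPdist_lt /(_ (x - t)) := @cvg_harmonic R; rewrite subr_gt0 => /(_ tx) [n _ hn].
    by exists n; have := hn n (leqnn n); rewrite /= sub0r normrN gtr0_norm ?invr_gt0//.
  by move=> hn; have := h n I; rewrite /F/= in_itv/= => /andP[_ h2]; move: hn; rewrite ltrBrDl ltNge h2.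
have sub n : F n `<=` `]0, t + 1]%classic.
  move=> x; rewrite /F/= !in_itv/= => /andP[tx xn]; rewrite (le_lt_trans t0 tx)/= (le_trans xn)// lerD2l.
  by rewrite invf_le1// ler1n.
have cv : events (F n) @[n --> \oo] --> events (\bigcap_n F n).
  apply: nonincreasing_cvg_mu => //.
  - by have [k ->] := events_isnat (t + 1) (F 0%N) (measurable_itv _) (sub 0%N); rewrite ltry.
  - by move=> i; rewrite /F.
  - by rewrite F0.
  - move=> n m nm; apply/subsetPset => x; rewrite /F/= !in_itv/= => /andP[-> /le_trans]; apply.
    by rewrite lerD2l lef_pV2 ?posrE// ler_nat.
rewrite F0 measure0 in cv.
have [_ [n _ hn]] := isnat_cvg _ _ (fun n => events_isnat (t + 1) (F n) (measurable_itv _) (sub n)) (erefl : 0%E \is a fin_num) cv.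
by exists n.+1%:R^-1; [rewrite invr_gt0|exact: (hn n (leqnn n))].
Qed.

(** The supremum of the event-free times after [t], capped at [t + 1]; the cap covers the case where
    no event follows soon. *)
Lemma next_event (t : R) : 0 <= t -> exists s : R, [/\ t < s, s <= t + 1, events `]t, s[%classic = 0%E &
  s = t + 1 \/ (1 <= events [set s])%E].
Proof.
move=> t0; pose E := [set s : R | t <= s <= t + 1 /\ events `]t, s]%classic = 0%E].
have Et : E t by split; [lra|rewrite set_itvoc0 measure0].
have ubE : has_ubound E by exists (t + 1) => s [/andP[]].
have supE : has_sup E by split => //; exists t.
have sub s : s <= t + 1 -> `]t, s]%classic `<=` `]0, t + 1]%classic.
  by move=> st x /=; rewrite !in_itv/= => /andP[tx xs]; rewrite (le_lt_trans t0 tx) (le_trans xs).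
pose s := sup E.
have s1 : s <= t + 1 by apply: ge_sup; [exists t|move=> x [/andP[]]].
have ts : t < s.
  have [e e0 he] := events_gap t t0; pose e' := Num.min e 1.
  have e'0 : 0 < e' by rewrite lt_min e0 ltr01.
  have Ee : E (t + e').
    split; first by rewrite lerD2l ge_min lexx orbT andbT lerDl ltW.
    apply/eqP; rewrite eq_le measure_ge0 andbT -he le_measure ?inE//.
    by move=> x /=; rewrite !in_itv/= => /andP[-> /le_trans]; apply; rewrite lerD2l ge_min lexx.
  have := ub_le_sup ubE Ee; rewrite -/s; lra.
have op : events `]t, s[%classic = 0%E.
  pose F n := `]t, s - n.+1%:R^-1]%classic : set R.
  have FU : `]t, s[%classic = \bigcup_n F n.
    apply/seteqP; split => x /=.
      rewrite in_itv/= => /andP[tx xs].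
      have /cvgrPdist_lt /(_ (s - x)) := @cvg_harmonic R; rewrite subr_gt0 => /(_ xs) [n _ hn].
      exists n => //; rewrite /F/= in_itv/= tx/=.
      have := hn n (leqnn n); rewrite /harmonic/= sub0r normrN gtr0_norm ?invr_gt0// => hn'; rewrite lerBrDr -lerBrDl; exact: ltW.
    move=> [n _]; rewrite /F/= !in_itv/= => /andP[-> /le_lt_trans]; apply.
    by rewrite ltrBlDr ltrDl invr_gt0.
  have F0 n : events (F n) = 0%E.
    have [|x [_ xE] sx] := @sup_adherent _ E n.+1%:R^-1 _ supE; first by rewrite invr_gt0.
    have mF : measurable (F n) by rewrite /F.
    apply/eqP; rewrite eq_le measure_ge0 andbT -xE le_measure ?inE//.
    by move=> y; rewrite /F/= !in_itv/= => /andP[-> /le_trans]; apply; exact: ltW.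
  have mF n : measurable (F n) by rewrite /F.
  rewrite FU; apply/negligibleP; first exact: bigcupT_measurable.
  by apply: negligible_bigcup => n; apply/negligibleP => //; exact: F0.
exists s; split => //.
have [->|/eqP s1'] := eqVneq s (t + 1); [by left|right].
have s0 : 0 < s by exact: le_lt_trans ts.
have [k kE] : isnat (events [set s]).
  by apply: (events_isnat s) => // x /= ->; rewrite in_itv/= s0 lexx.
(* Were there no event at [s], the gap after [s] would prolong the event-free interval beyond its
   supremum. *)
rewrite kE lee_fin (ler_nat _ 1) lt0n; apply/eqP => k0; rewrite k0 in kE.
have [e e0 he] := events_gap s (ltW s0).
have st1 : s < t + 1 by rewrite lt_neqAle s1 andbT; exact/eqP.
pose r := Num.min (s + e) (t + 1).
have sr : s < r by rewrite lt_min ltrDl e0.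
have Er : E r.
  split; first by rewrite ge_min lexx orbT andbT ltW// (lt_trans ts).
  have rE : (`]t, r]%classic : set R) `<=` (`]t, s[%classic `|` [set s]) `|` `]s, s + e]%classic.
    move=> x /=; rewrite !in_itv/= => /andP[-> xr]; have [xs|xs|->] := ltgtP x s; [by left; left| |by left; right].
    by right; rewrite (le_trans xr)// ge_min lexx.
  apply/negligibleP => //; apply: (negligibleS rE).
  by apply: negligibleU; [apply: negligibleU|]; apply/negligibleP => //; rewrite ?kE.
have := ub_le_sup ubE Er; rewrite -/s; lra.
Qed.

Lemma jump_high (u : R -> R) o p : ~ (p.2 <= K%:R) -> jump u phi o p = 0%E.
Proof.
move=> h; rewrite /jump; have [q|_] := leP p.2 _; last by rewrite mulr0.
by exfalso; apply: h; exact: le_trans q (phiK _).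
Qed.

Let null_integral (N : {measure set (R * R) -> \bar R}) (u : R -> R) (o t : R) (A : set (R * R)) :
  N.-integrable (strip 0 t) (jump u phi o) ->
  measurable A -> A `<=` strip 0 t -> N (A `&` (setT `*` `[0%R, K%:R])) = 0%E ->
  (\int[N]_(p in A) jump u phi o p = 0)%E.
Proof.
move=> iN mA At N0.
have mst : measurable (strip 0 t : set (R * R)) by exact: measurableX.
have iA : N.-integrable A (jump u phi o) by apply: integrableS At iN.
have mAK : measurable (A `&` (setT `*` `[0%R, K%:R])) by exact: measurableI.
rewrite (negligible_integral mAK mA iA N0); apply: integral0_eq => -[p q] [/= Apq h].
rewrite jump_high//= => qK; apply: h; split => //; split => //=; rewrite in_itv/= qK andbT.
by have [_] := At _ Apq; rewrite /= in_itv/= andbT.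
Qed.

Lemma J_null_events (u : R -> R) (t : R) (E : set R) : 0 <= t ->
  Np.-integrable (strip 0 t) (jump u phi 1) -> Nm.-integrable (strip 0 t) (jump u phi (-1)) ->
  measurable E -> E `<=` `]0, t]%classic -> events E = 0%E ->
  J Np Nm u phi (E `*` `[0, +oo[%classic) = 0%E.
Proof.
move=> t0 ip im mE Et; rewrite eventsE => /eqP; rewrite padde_eq0// => /andP[/eqP n1 /eqP n2].
have mA : measurable (E `*` `[(0 : R), +oo[%classic) by exact: measurableX.
have At : E `*` `[(0 : R), +oo[%classic `<=` strip 0 t by move=> p [/= /Et h1 h2].
have sec : E `*` `[(0 : R), +oo[%classic `&` (setT `*` `[0%R, K%:R]) = E `*` `[0%R, K%:R].
  by apply/seteqP; split => -[p q] /=; rewrite !in_itv/= ?andbT; [tauto|move=> [h1 /andP[h2 h3]]; rewrite h2 h3].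
rewrite /J (null_integral Np u 1 t _ ip mA At) ?sec// (null_integral Nm u (-1) t _ im mA At) ?sec//.
by rewrite adde0.
Qed.

Section trajectory.
Variable nx : R -> R.
Hypothesis nxP : forall t, 0 <= t -> [/\ t < nx t, nx t <= t + 1, events `]t, nx t[%classic = 0%E &
  nx t = t + 1 \/ (1 <= events [set nx t])%E].

Definition hit_count (s y : R) : \bar R :=
  (Np ([set s] `*` `[0%R, phi y]) + Nm ([set s] `*` `[0%R, phi (- y)]))%E.

(** A pair of a time and a value: drift to the next event time, then reset to 0 if a point lies
    below the rate at the value just reached. *)
Definition next_state (p : R * R) : R * R :=
  let s := nx p.1 in let y := p.2 + c * (s - p.1) in
  (s, if hit_count s y == 0%E then y else 0).

Let tau k : R := (iter k next_state (0, x0)).1.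
Let X k : R := (iter k next_state (0, x0)).2.

Let tau0 : tau 0 = 0. Proof. by []. Qed.
Let tauS k : tau k.+1 = nx (tau k). Proof. by []. Qed.
Let XS k : X k.+1 = if hit_count (tau k.+1) (X k + c * (tau k.+1 - tau k)) == 0%E
  then X k + c * (tau k.+1 - tau k) else 0.
Proof. by []. Qed.

Let tau_ge0 k : 0 <= tau k.
Proof. by elim: k => [|k IH]; rewrite ?tauS//; have [/ltW h _ _ _] := nxP _ IH; exact: le_trans h. Qed.

Let tau_lt k : tau k < tau k.+1.
Proof. by have [] := nxP _ (tau_ge0 k). Qed.

Let tau_homo : {homo tau : m n / (m <= n)%N >-> m <= n}.
Proof. by apply: homo_leq => // [a b e|n]; [exact: le_trans|exact: ltW]. Qed.

Let X_ge0 k : 0 <= X k <= x0 + c * tau k.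
Proof.
elim: k => [|k /andP[h1 h2]]; first by rewrite tau0 mulr0 addr0 lexx andbT.
have tt := tau_lt k; have tg := tau_ge0 k.+1.
rewrite XS; case: ifP => _; last by rewrite lexx addr_ge0// mulr_ge0.
by rewrite addr_ge0 ?mulr_ge0 ?subr_ge0 ?(ltW tt)//=; have := ler_wpM2l c0 (ltW tt); lra.
Qed.

(** Each step either consumes an event or lasts one unit of time, so [k] is bounded by the events
    met plus the time elapsed. Hence the step times cannot accumulate. *)
Let tau_count k : (k%:R%:E <= events `]0%R, tau k]%classic + (tau k)%:E)%E.
Proof.
elim: k => [|k IH]; first by rewrite tau0 adde0 measure_ge0.
have [h1 h2 h3 h4] := nxP _ (tau_ge0 k); have tt := tau_lt k; have tg := tau_ge0 k.
have U : `]0, tau k.+1]%classic = `]0, tau k]%classic `|` `]tau k, tau k.+1]%classic :> set R.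
  by rewrite -itv_bndbnd_setU// bnd_simp// ltW.
have UE : events `]0, tau k.+1]%classic = (events `]0%R, tau k]%classic + events `]tau k, tau k.+1]%classic)%E.
  rewrite U measureU//; apply/seteqP; split => // x [/=]; rewrite !in_itv/= => /andP[_ a] /andP[b _]; by have := lt_le_trans b a; rewrite ltxx.
have step : (1 + (tau k)%:E <= events `]tau k, tau k.+1]%classic + (tau k.+1)%:E)%E.
  rewrite -tauS in h4; case: h4 => [e|h4].
    apply: (@le_trans _ _ (0 + (tau k.+1)%:E)%E); first by rewrite add0e e EFinD addeC.
    by rewrite leeD2r// measure_ge0.
  rewrite leeD ?lee_fin ?(ltW tt)//; apply: (le_trans h4); rewrite le_measure ?inE//.
  by move=> x /= ->; rewrite in_itv/= tt lexx.
rewrite UE -addeA; apply: (le_trans _ (leeD2l _ step)).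
by rewrite addeCA -natr1 EFinD [leLHS]addeC; exact: leeD2l.
Qed.

Let tau_unbounded t : exists k, t < tau k.
Proof.
apply: contrapT => no; have le k : tau k <= t by rewrite leNgt; apply/negP => h; apply: no; exists k.
have t0 : 0 <= t := le_trans (tau_ge0 0%N) (le 0%N).
have [m mE] := events_isnat t `]0, t]%classic (measurable_itv _) (@subset_refl _ _).
have h k : k%:R <= m%:R + t.
  rewrite -lee_fin EFinD; apply: (le_trans (tau_count k)); rewrite leeD ?lee_fin// -mE le_measure ?inE//.
  by move=> x /=; rewrite !in_itv/= => /andP[-> /le_trans]; apply.
have /andP[_ h2] := trunc_itv t0.
have := h (m + (Num.trunc t).+1)%N; rewrite natrD lerD2l leNgt h2//.
Qed.

Let idx_exists t : exists k, 0 <= t -> tau k <= t < tau k.+1.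
Proof.
have [t0|t0] := leP 0 t; last by exists 0%N; rewrite leNgt t0.
case: (ex_minnP (tau_unbounded t)) => -[|k] tk kmin; first by move: tk; rewrite tau0 ltNge t0.
by exists k => _; rewrite tk andbT leNgt; apply/negP => /kmin; rewrite ltnn.
Qed.

Let idx_uniq t j k : tau j <= t < tau j.+1 -> tau k <= t < tau k.+1 -> j = k.
Proof.
move=> /andP[a b] /andP[e f]; apply/eqP; rewrite eqn_leq; apply/andP; split; rewrite leqNgt; apply/negP => h.
  have := tau_homo _ _ h; lra.
have := tau_homo _ _ h; lra.
Qed.

Definition idx t := projT1 (choice idx_exists) t.

Let idxP t : 0 <= t -> tau (idx t) <= t < tau (idx t).+1.
Proof. by rewrite /idx; case: (choice idx_exists) => f /= /(_ t). Qed.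

Definition traj t := if 0 <= t then X (idx t) + c * (t - tau (idx t)) else 0.

Let trajE k t : tau k <= t < tau k.+1 -> traj t = X k + c * (t - tau k).
Proof.
move=> h; have t0 : 0 <= t by case/andP: h => h _; exact: le_trans (tau_ge0 k) h.
by rewrite /traj t0 (idx_uniq _ _ _ (idxP _ t0) h).
Qed.

Lemma traj0 : traj 0 = x0.
Proof. by rewrite (trajE 0) ?tau0 ?lexx ?subrr ?mulr0 ?addr0//=; have := tau_lt 0; rewrite tau0. Qed.

Lemma traj_right t : 0 <= t -> traj @ t^'+ --> traj t.
Proof.
move=> t0; have h := idxP _ t0; rewrite (trajE _ _ h).
have c1 : (fun s => X (idx t) + c * (s - tau (idx t))) @ t^'+ --> X (idx t) + c * (t - tau (idx t)).
  apply: cvg_at_right_filter; apply: cvgD; first exact: cvg_cst.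
  by apply: cvgM; [exact: cvg_cst|apply: cvgB; [exact: cvg_id|exact: cvg_cst]].
apply: cvg_trans c1; apply: near_eq_cvg.
have /andP[h1 h2] := h.
near=> s; apply/esym/trajE; apply/andP; split; first by apply: (le_trans h1); near: s; exact: nbhs_right_ge.
by near: s; exact: nbhs_right_lt.
Unshelve. all: by end_near. Qed.

Let traj_left k t : tau k < t -> t <= tau k.+1 -> traj @ t^'- --> X k + c * (t - tau k).
Proof.
move=> h1 h2.
have c1 : (fun s => X k + c * (s - tau k)) @ t^'- --> X k + c * (t - tau k).
  apply: cvg_at_left_filter; apply: cvgD; first exact: cvg_cst.
  by apply: cvgM; [exact: cvg_cst|apply: cvgB; [exact: cvg_id|exact: cvg_cst]].
apply: cvg_trans c1; apply: near_eq_cvg.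
near=> s; apply/esym/trajE; apply/andP; split; first by near: s; exact: nbhs_left_ge.
by rewrite (lt_le_trans _ h2)//; near: s; exact: nbhs_left_lt.
Unshelve. all: by end_near. Qed.

Let left_idx t : 0 < t -> exists2 k, tau k < t & t <= tau k.+1.
Proof.
move=> t0; case: (ex_minnP (tau_unbounded t)) => -[|k] tk kmin; first by move: tk; rewrite tau0 ltNge (ltW t0).
have kt : tau k <= t by rewrite leNgt; apply/negP => /kmin; rewrite ltnn.
move: kt; rewrite le_eqVlt => /orP[/eqP kt|kt]; last by exists k => //; exact: ltW.
case: k kt {kmin tk} => [|k] kt; first by move: t0; rewrite -kt tau0 ltxx.
by exists k; rewrite -?kt// tau_lt.
Qed.

Let left_limE k t : tau k < t -> t <= tau k.+1 -> left_lim traj t = X k + c * (t - tau k).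
Proof. by move=> h1 h2; apply: cvg_lim => //; exact: traj_left. Qed.

Lemma traj_left_cvg t : 0 < t -> cvg (traj @ t^'-).
Proof. by move=> /left_idx[k h1 h2]; apply/cvg_ex; eexists; exact: traj_left h2. Qed.

Lemma traj_bound t : 0 <= t -> 0 <= traj t <= x0 + c * t.
Proof.
move=> t0; have h := idxP _ t0; have /andP[h1 h2] := h; rewrite (trajE _ _ h).
have /andP[a b] := X_ge0 (idx t).
by rewrite addr_ge0 ?mulr_ge0 ?subr_ge0//=; have := ler_wpM2l c0 h1; lra.
Qed.

Lemma left_bound t : 0 < t -> 0 <= left_lim traj t <= x0 + c * t.
Proof.
move=> /left_idx[k h1 h2]; rewrite (left_limE _ _ h1 h2).
have /andP[a b] := X_ge0 k.
by rewrite addr_ge0 ?mulr_ge0 ?subr_ge0 ?(ltW h1)//=; have := ler_wpM2l c0 (ltW h1); lra.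
Qed.

Let jmp (o : R) := jump traj phi o.

Let measurable_left : measurable_fun (`]0, +oo[%classic : set R) (left_lim traj).
Proof.
pose F k := `]tau k, tau k.+1]%classic : set R.
have E : `]0, +oo[%classic = \bigcup_k F k.
  apply/seteqP; split => t /=; rewrite /F ?in_itv/= ?andbT.
    by move=> /left_idx[k h1 h2]; exists k => //=; rewrite in_itv/= h1.
  by move=> [k _ /=]; rewrite !in_itv/= => /andP[/(le_lt_trans (tau_ge0 k)) ->].
have mF k : measurable (F k) by rewrite /F.
rewrite E; apply/measurable_fun_bigcup => // k.
apply: (@eq_measurable_fun _ _ _ _ (F k) (fun t : R => X k + c * (t - tau k))).
  by move=> t; rewrite inE /F/= in_itv/= => /andP[h1 h2]; rewrite (left_limE _ _ h1 h2).
by apply: measurable_funTS; apply: measurable_funD => //; apply: measurable_funM => //; exact: measurable_funB.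
Qed.

Let low (t : R) : set (R * R) := `]0, t]%classic `*` `[0, K%:R]%classic.
Let mlow t : measurable (low t). Proof. exact: measurableX. Qed.
Let mstrip' a b : measurable (strip a b : set (R * R)). Proof. exact: measurableX. Qed.

Let measurable_jump (o t : R) : measurable_fun (strip 0 t : set (R * R))
  (fun p : R * R => left_lim traj p.1 * ((p.2 <= phi (o * left_lim traj p.1))%R : bool)%:R).
Proof.
pose g := left_lim traj \_ `]0, +oo[%classic.
have mg : measurable_fun setT g by apply/(measurable_restrictT _ _).1.
have mg1 : measurable_fun setT (fun p : R * R => g p.1) by exact: (measurableT_comp mg measurable_fst).
have mS : measurable [set p : R * R | p.2 <= phi (o * g p.1)].
  rewrite -[X in measurable X]setTI; apply: measurable_fun_le => //.
  by apply: (measurableT_comp mphi); exact: measurable_funM.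
apply: (@eq_measurable_fun _ _ _ _ (strip 0 t) (fun p : R * R => g p.1 * \1_[set p : R * R | p.2 <= phi (o * g p.1)] p)).
  move=> p; rewrite inE => -[/= + _]; rewrite in_itv/= => /andP[p0 _].
  have gE : g p.1 = left_lim traj p.1 by rewrite /g patchE mem_set//= in_itv/= andbT.
  rewrite gE indicE; congr (_ * (nat_of_bool _)%:R); apply/idP/idP; first by rewrite inE/= gE.
  by move=> h; rewrite inE/= gE.
by apply: measurable_funTS; apply: measurable_funM => //; exact: measurable_indic.
Qed.

(** The integrand vanishes above level [K], and on the remaining set of finite mass it is bounded by
    [x0 + c * t]. *)
Let intJ (N : {measure set (R * R) -> \bar R}) o t : (forall M : nat, counting_on N (sqbox M%:R)) ->
  0 <= t -> N.-integrable (strip 0 t) (jmp o).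
Proof.
move=> cN t0.
have sub : low t `<=` strip 0 t.
  by move=> -[p q] [/= h1]; rewrite in_itv/= => /andP[q0 _]; split => //; rewrite /= in_itv/= q0.
have lowfin : (N (low t) < +oo)%E.
  pose M := maxn K (Num.trunc t).+1.
  have [|k ->] := cN M (low t) (mlow t); last by rewrite ltry.
  have tM : t <= M%:R.
    by have /andP[_ /ltW h] := trunc_itv t0; rewrite (le_trans h)// ler_nat leq_maxr.
  move=> -[p q] [/=]; rewrite !in_itv/= => /andP[p0 pt] /andP[q0 qK].
  by split; rewrite /= in_itv/= ?q0 ?(ltW p0) ?(le_trans pt tM)//= (le_trans qK)// ler_nat leq_maxl.
have I : N.-integrable (low t) (jmp o).
  apply: measurable_bounded_integrable => //; first exact: measurable_funS (mstrip' 0 t) sub (measurable_jump o t).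
  exists (x0 + c * t); split; first exact: num_real.
  move=> B hB -[p q] [/=]; rewrite in_itv/= => /andP[p0 pt] _.
  have /andP[a b] := left_bound _ p0; have ct := ler_wpM2l c0 pt.
  apply: (@le_trans _ _ (left_lim traj p)); last by lra.
  by rewrite normrM (ger0_norm a) ler_piMr// normr_nat (ler_nat _ _ 1) leq_b1.
apply/integrableP; split; first by apply/measurable_EFinP; exact: measurable_jump.
have /integrableP[_] := I; apply: le_lt_trans.
rewrite [leLHS]integral_mkcond [leRHS]integral_mkcond.
rewrite le_eqVlt; apply/orP; left; apply/eqP; apply: eq_integral => -[p q] _.
rewrite /patch; have [|h] := boolP ((p, q) \in low t); first by move=> h; rewrite mem_set//; apply: sub; exact: set_mem.
case: ifP => // /set_mem[/= pt]; rewrite in_itv/= andbT => q0.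
have hq : ~ ((p, q).2 <= K%:R) by move=> /= qK; move/negP: h; apply; apply/mem_set; split => //=; rewrite in_itv/= q0.
by transitivity (`|jump traj phi o (p, q)|)%E => //; rewrite jump_high// abse0.
Qed.

Let Jn := J Np Nm traj phi.

Let intp t : 0 <= t -> Np.-integrable (strip 0 t) (jmp 1). Proof. exact: intJ. Qed.
Let intm t : 0 <= t -> Nm.-integrable (strip 0 t) (jmp (-1)). Proof. exact: intJ. Qed.

Let strip_sub a b t : 0 <= a -> b <= t -> strip a b `<=` (strip 0 t : set (R * R)).
Proof.
move=> a0 bt -[p q] [/=]; rewrite !in_itv/= => /andP[ap pb] q0; split => //=.
by rewrite in_itv/= (le_lt_trans a0 ap) (le_trans pb).
Qed.

Let J_null (t : R) (E : set R) : 0 <= t -> measurable E -> E `<=` `]0, t]%classic -> events E = 0%E ->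
  Jn (E `*` `[0, +oo[%classic) = 0%E.
Proof. by move=> t0; apply: (J_null_events traj t E t0); [exact: intp|exact: intm]. Qed.

Let atom_integral (N : {measure set (R * R) -> \bar R}) o r : (forall M : nat, counting_on N (sqbox M%:R)) -> 0 < r ->
  (\int[N]_(p in [set r] `*` `[0%R, +oo[) jmp o p =
   (left_lim traj r)%:E * N ([set r] `*` `[0%R, phi (o * left_lim traj r)]))%E.
Proof.
move=> cN r0; set y := left_lim traj r; have /andP[y0 _] := left_bound _ r0.
have mA : measurable ([set r] `*` `[(0 : R), +oo[%classic) by exact: measurableX.
have mB : measurable ([set r] `*` `[(0 : R), phi (o * y)]%classic) by exact: measurableX.
rewrite (eq_integral (fun p => y%:E * (\1_([set r] `*` `[(0 : R), phi (o * y)]%classic) p)%:E)%E); last first.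
  move=> -[p q]; rewrite inE/= in_itv/= andbT => -[pr q0].
  rewrite /jmp /jump /= pr -/y -EFinM indicE; congr (_ * (nat_of_bool _)%:R)%:E.
  apply/idP/idP; first by move=> h; rewrite inE/=; split => //; rewrite in_itv/= q0.
  by rewrite inE/= in_itv/= => -[_ /andP[]].
rewrite ge0_integralZl//; last by apply: measurable_funTS; apply/measurable_EFinP; exact: measurable_indic.
rewrite integral_indic//; congr (_ * N _)%E; apply/seteqP; split => -[p q] /=; rewrite !in_itv/= ?andbT; first by case.
by move=> [-> /andP[a b]]; rewrite a b.
Qed.

Let eqn_step (a t : R) : 0 <= a -> a <= t ->
  ((traj a)%:E = (traj 0)%:E - Jn (strip 0 a) + (c * a)%:E)%E ->
  ((traj t)%:E = (traj a)%:E - Jn (strip a t) + (c * (t - a))%:E)%E ->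
  ((traj t)%:E = (traj 0)%:E - Jn (strip 0 t) + (c * t)%:E)%E.
Proof.
move=> a0 at0 ea et; have t0 := le_trans a0 at0.
have U : strip 0 t = strip 0 a `|` strip a t :> set (R * R).
  rewrite /strip [in LHS](@itv_bndbnd_setU _ _ (BRight 0) (BRight a)) ?bnd_simp//.
  by apply/seteqP; split => -[p q] /=; tauto.
have s1 : strip 0 a `<=` (strip 0 t : set (R * R)) by exact: strip_sub.
have s2 : strip a t `<=` (strip 0 t : set (R * R)) by exact: strip_sub.
have := J_fin Np Nm traj phi intp intm _ t t0 (mstrip' _ _) s1.
have := J_fin Np Nm traj phi intp intm _ t t0 (mstrip' _ _) s2.
move: ea et; rewrite /Jn U (J_setU Np Nm traj phi intp intm _ _ t t0 (mstrip' _ _) (mstrip' _ _) s1 s2); last first.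
  apply/disj_setPS => -[p q] [[/= + _] [/= + _]]; rewrite !in_itv/= => /andP[_ ps] /andP[/lt_le_trans/(_ ps)].
  by rewrite ltxx.
case: (J _ _ _ _ (strip a t)) => // j2; case: (J _ _ _ _ (strip 0 a)) => // j1.
rewrite -[(j1%:E + _)%E]EFinD -!EFinB -!EFinD => -[ea] -[et] _ _; congr EFin; rewrite et ea; ring.
Qed.

Let trajtau k : traj (tau k) = X k.
Proof. by rewrite (trajE k) ?lexx ?tau_lt// subrr mulr0 addr0. Qed.

Let seg_eqn k t : tau k <= t < tau k.+1 -> ((traj t)%:E = (traj (tau k))%:E - Jn (strip (tau k) t) + (c * (t - tau k))%:E)%E.
Proof.
move=> h; have /andP[h1 h2] := h; have t0 := le_trans (tau_ge0 k) h1.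
have [_ _ e0 _] := nxP _ (tau_ge0 k).
rewrite /strip (J_null t)//.
- by rewrite trajtau (trajE _ _ h) sube0 -EFinD.
- by move=> x /=; rewrite !in_itv/= => /andP[/(le_lt_trans (tau_ge0 k)) -> ->].
- apply/eqP; rewrite eq_le measure_ge0 andbT -e0 le_measure ?inE//.
  by move=> x /=; rewrite !in_itv/= -tauS => /andP[-> /le_lt_trans]; apply.
Qed.

(** Inside a step there is no event, so only the line over its final time contributes. By simplicity
    at most one point is accepted there, and the jump removes nothing or the whole left limit. *)
Let jump_eqn k : ((traj (tau k.+1))%:E = (traj (tau k))%:E - Jn (strip (tau k) (tau k.+1)) + (c * (tau k.+1 - tau k))%:E)%E.
Proof.
set r := tau k.+1; have tr := tau_lt k; have r0 : 0 < r := le_lt_trans (tau_ge0 k) tr.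
have [_ _ e0 _] := nxP _ (tau_ge0 k).
set y := X k + c * (r - tau k).
have ly : left_lim traj r = y by exact: left_limE.
have U : strip (tau k) r = `]tau k, r[%classic `*` `[(0 : R), +oo[%classic `|` [set r] `*` `[(0 : R), +oo[%classic.
  apply/seteqP; split => -[p q] /=; rewrite !in_itv/= ?andbT.
    rewrite /strip/= !in_itv/= andbT => -[/andP[a b] q0].
    have [pr|pr|->] := ltgtP p r; [by left; rewrite a|by move: b; rewrite leNgt pr|by right].
  rewrite /strip/= !in_itv/= andbT => -[[/andP[a b] q0]|[-> q0]]; first by rewrite a (ltW b).
  by rewrite tr lexx.
have m1 : measurable (`]tau k, r[%classic `*` `[(0 : R), +oo[%classic) by exact: measurableX.
have m2 : measurable ([set r] `*` `[(0 : R), +oo[%classic) by exact: measurableX.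
have s12 : strip (tau k) r `<=` (strip 0 r : set (R * R)) by apply: strip_sub.
have s1 : `]tau k, r[%classic `*` `[(0 : R), +oo[%classic `<=` strip 0 r.
  by apply: subset_trans s12; rewrite U; exact: subsetUl.
have s2 : [set r] `*` `[(0 : R), +oo[%classic `<=` strip 0 r.
  by apply: subset_trans s12; rewrite U; exact: subsetUr.
rewrite /Jn U (J_setU Np Nm traj phi intp intm _ _ r (ltW r0) m1 m2 s1 s2); last first.
  by apply/disj_setPS => -[p q] [[/= pr _] [/= e _]]; move: pr; rewrite e in_itv/= ltxx andbF.
have -> : J Np Nm traj phi (`]tau k, r[%classic `*` `[(0 : R), +oo[%classic) = 0%E.
  apply: (J_null r) => //; first exact: ltW.
  by move=> x /=; rewrite !in_itv/= => /andP[/(le_lt_trans (tau_ge0 k)) -> /ltW ->].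
rewrite add0e /J (atom_integral Np 1 r cNp r0) (atom_integral Nm (-1) r cNm r0) ly mul1r mulN1r.
rewrite -ge0_muleDr// -/(hit_count r y) !trajtau XS -/r -/y.
have y0 : 0 <= y by rewrite -ly; case/andP: (left_bound _ r0).
pose M := maxn K (Num.trunc r).+1.
have rM : r <= M%:R.
  by have /andP[_ /ltW rt] := trunc_itv (ltW r0); rewrite (le_trans rt)// ler_nat leq_maxr.
have sub (v : R) : [set r] `*` `[(0 : R), phi v]%classic `<=` [set r] `*` `[(0 : R), M%:R]%classic.
  move=> -[p q] [/= ->]; rewrite in_itv/= => /andP[q0 qv]; split => //=; rewrite in_itv/= q0/=.
  by rewrite (le_trans qv)// (le_trans (phiK _))// ler_nat leq_maxl.
have msq (v : R) : measurable ([set r] `*` `[(0 : R), v]%classic) by exact: measurableX.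
have box : [set r] `*` `[(0 : R), M%:R]%classic `<=` sqbox M%:R.
  by move=> -[p q] [/= -> h]; split => //=; rewrite in_itv/= (ltW r0).
have [k1 n1] := cNp M _ (msq (phi y)) (subset_trans (sub y) box).
have [k2 n2] := cNm M _ (msq (phi (- y))) (subset_trans (sub (- y)) box).
have le1 : (hit_count r y <= 1)%E.
  by apply: (le_trans _ (simpleN M r r0 rM)); rewrite leeD// le_measure ?inE//; exact: sub.
move: le1; rewrite /hit_count n1 n2 -EFinD -natrD lee_fin (ler_nat _ _ 1) eqe pnatr_eq0.
case: (k1 + k2)%N => [|[|//]] _ /=.
  by rewrite -!EFinD; congr (_%:E); rewrite /y; ring.
by rewrite -!EFinD; congr (_%:E); rewrite /y; ring.
Qed.

Lemma traj_eqn t : 0 <= t -> ((traj t)%:E = (traj 0)%:E - Jn (strip 0 t) + (c * t)%:E)%E.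
Proof.
have base k : ((traj (tau k))%:E = (traj 0)%:E - Jn (strip 0 (tau k)) + (c * tau k)%:E)%E.
  elim: k => [|k IH].
    rewrite tau0 mulr0 adde0 /strip (J_null 0) ?sube0// set_itvoc0 ?measure0//.
  exact: (eqn_step (tau k) _ (tau_ge0 k) (ltW (tau_lt k)) IH (jump_eqn k)).
move=> t0; have h := idxP _ t0; have /andP[h1 h2] := h.
exact: (eqn_step _ _ (tau_ge0 _) h1 (base _) (seg_eqn _ _ h)).
Qed.

Lemma traj_integrable t : 0 <= t ->
  Np.-integrable (strip 0 t) (jump traj phi 1) /\ Nm.-integrable (strip 0 t) (jump traj phi (-1)).
Proof. by move=> t0; split; [exact: intp|exact: intm]. Qed.

End trajectory.

Lemma path_exists : exists u : R -> R, [/\ u 0 = x0,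
  (forall t, 0 <= t -> u @ t^'+ --> u t), (forall t, 0 < t -> cvg (u @ t^'-)) &
  [/\ (forall t, t < 0 -> u t = 0), (forall t, 0 <= t -> 0 <= u t),
   (forall t, 0 <= t -> Np.-integrable (strip 0 t) (jump u phi 1) /\ Nm.-integrable (strip 0 t) (jump u phi (-1))) &
   (forall t, 0 <= t -> ((u t)%:E = (u 0)%:E - J Np Nm u phi (strip 0 t) + (c * t)%:E)%E)]].
Proof.
have [nx nxP] : exists nx : R -> R, forall t, 0 <= t -> [/\ t < nx t, nx t <= t + 1, events `]t, nx t[%classic = 0%E &
    nx t = t + 1 \/ (1 <= events [set nx t])%E].
  have ex t : exists s, 0 <= t -> [/\ t < s, s <= t + 1, events `]t, s[%classic = 0%E &
      s = t + 1 \/ (1 <= events [set s])%E].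
    by have [/next_event [s hs]|t0] := leP 0 t; [exists s|exists 0; rewrite ?leNgt ?t0].
  by have [nx h] := choice ex; exists nx.
exists (traj nx nxP); split.
- exact: traj0.
- exact: traj_right.
- exact: traj_left_cvg.
- split.
  + by move=> t t0; rewrite /traj leNgt t0.
  + by move=> t /(traj_bound nx nxP)/andP[].
  + exact: traj_integrable.
  + exact: traj_eqn.
Qed.

End path_construction.

(** * Reflection symmetry of the equation *)

Lemma eqm_invariant {R : realType} (h : R) (phi : R -> R) (g1 g2 : set R -> \bar R) :
  eqm g1 g2 -> is_invariant h phi g1 -> is_invariant h phi g2.
Proof.
move=> g12 [d [T [P [Np [Nm [U [prm sol inv]]]]]]]; exists d, T, P, Np, Nm, U; split => //.
- have [mp [mm [mU H]]] := prm; split => //; split => //; split => // n m A k B l C hA tA hB tB mC.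
  by rewrite H// g12.
- by move=> t t0 A mA; rewrite inv// g12.
Qed.

Lemma measurable_reflect {R : realType} (A : set R) : measurable A -> measurable ((fun x : R => - x) @^-1` A).
Proof. by move=> mA; rewrite -[X in measurable X]setTI; exact: oppr_measurable. Qed.

Section reflect.
Context {d : measure_display} {T : measurableType d} {R : realType}.
Variables (P : probability T R) (Np Nm : T -> {measure set (R * R) -> \bar R}) (U : R -> T -> R).
Let U' (t : R) (w : T) : R := - U t w.

Lemma PRM_indep_reflect (g : set R -> \bar R) : PRM_indep P Np Nm (U 0) g ->
  PRM_indep P Nm Np (U' 0) (fun A => g ((fun x : R => - x) @^-1` A)).
Proof.
move=> [mp [mm [mU H]]]; split => //; split => //; split; first exact: measurableT_comp.
move=> n m A k B l C hA tA hB tB mC.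
have := H m n B l A k _ hB tB hA tA (measurable_reflect _ mC).
by rewrite [X in P (X `&` _)]setIC => ->; rewrite [X in (X * _)%E]muleC.
Qed.

Lemma drift_reflect (phi : R -> R) s : drift P phi U' s = - drift P phi U s.
Proof.
rewrite /drift !big_cons !big_nil !mul1r !addr0 !mulN1r opprD opprK addrC.
by congr (_ - _); congr (fine _); apply: eq_integral => w _; rewrite /U' ?mulN1r ?mul1r ?opprK.
Qed.

(** Changing the sign of the state exchanges [o] with [- o], hence the two driving measures, and
    reverses jumps and drift alike. *)
Lemma solves_reflect (h : R) (phi : R -> R) : solves P Np Nm U h phi -> solves P Nm Np U' h phi.
Proof.
move=> [mU [rc [ll [iphi [idrift ae]]]]].
have oN o : o = 1 \/ o = -1 -> - o = 1 \/ - o = -1 :> R by case=> ->; rewrite ?opprK; tauto.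
split; first by move=> t; exact: measurableT_comp.
split; first by move=> w t t0; apply: cvgN; exact: rc.
split; first by move=> w t t0; apply: is_cvgN; exact: ll.
split.
  move=> s o s0 ho; have := iphi s (- o) s0 (oN _ ho).
  by under eq_fun do rewrite mulNr -mulrN.
split.
  move=> t t0; have -> : (fun s => (drift P phi U' s)%:E) = (fun s => - (drift P phi U s)%:E)%E.
    by apply/funext => s; rewrite drift_reflect.
  exact: integrableN (idrift t t0).
apply: filterS ae => w hw t t0; have [hi e] := hw t t0.
have NselN (o : R) : o = 1 \/ o = -1 -> Nsel Nm Np o w = Nsel Np Nm (- o) w.
  by move=> [->|->]; rewrite /Nsel ?opprK ?eqxx ?negrr1.
have lN (s : R) : 0 < s -> left_lim (fun s => U' s w) s = - left_lim (fun s => U s w) s.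
  by move=> s0; rewrite /left_lim -limN//; exact: ll.
pose f (o : R) (p : R * R) : \bar R := (left_lim (fun s => U s w) p.1 *
             ((p.2 <= phi (o * left_lim (fun s => U s w) p.1))%R : bool)%:R)%:E.
have fN (o : R) (p : R * R) : (`]0%R, t] `*` `[0%R, +oo[) p -> (- f (- o)%R p)%E = (left_lim (fun s => U' s w) p.1 *
             ((p.2 <= phi (o * left_lim (fun s => U' s w) p.1))%R : bool)%:R)%:E.
  by move=> [/=]; rewrite in_itv/= => /andP[p0 _] _; rewrite lN// /f mulrN -(mulNr o) (mulNr (left_lim _ _)).
have mD : measurable (`]0%R, t] `*` `[(0 : R), +oo[) by exact: measurableX.
have int o : o = 1 \/ o = -1 -> (Nsel Nm Np o w).-integrable (`]0%R, t] `*` `[0%R, +oo[) (fun p => - f (- o)%R p)%E.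
  by move=> ho; rewrite NselN//; apply: integrableN; exact: hi (oN _ ho).
split.
  move=> o ho; apply: eq_integrable (int o ho) => // p; rewrite inE => /fN <- //.
have IN o : o = 1 \/ o = -1 -> (\int[Nsel Nm Np o w]_(p in `]0%R, t] `*` `[0%R, +oo[) (left_lim (fun s => U' s w) p.1 *
             ((p.2 <= phi (o * left_lim (fun s => U' s w) p.1))%R : bool)%:R)%:E =
    - \int[Nsel Np Nm (- o)%R w]_(p in `]0%R, t] `*` `[0%R, +oo[) f (- o)%R p)%E.
  move=> ho; rewrite -NselN// -integralN; last first.
    by apply: (integrable_add_def mD); rewrite NselN//; exact: hi (oN _ ho).
  by apply: eq_integral => p; rewrite inE => /fN <-.
have If o : o = 1 \/ o = -1 -> (\int[Nsel Np Nm o w]_(p in `]0%R, t] `*` `[0%R, +oo[) f o p)%E \is a fin_num.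
  by move=> ho; apply: integrable_fin_num => //; exact: hi ho.
have Dfin : (\int[leb]_(s in `[0%R, t]) (drift P phi U s)%:E)%E \is a fin_num.
  by apply: integrable_fin_num => //; exact: idrift.
have DN : (\int[leb]_(s in `[0%R, t]) (drift P phi U' s)%:E = - \int[leb]_(s in `[0%R, t]) (drift P phi U s)%:E)%E.
  rewrite -integralN; last first.
    by apply: integrable_add_def => //; exact: idrift.
  by apply: eq_integral => s _; rewrite drift_reflect.
rewrite DN !big_cons !big_nil !IN ?opprK; [|tauto|tauto].
move: e; rewrite !big_cons !big_nil -/(f 1) -/(f (-1)).
rewrite -(fineK Dfin) -(fineK (If 1 (or_introl erefl))) -(fineK (If (-1) (or_intror erefl))).
rewrite !adde0 -?EFinN -?EFinD -?EFinM -?EFinB -?EFinD => -[e]; congr EFin; rewrite /U' e; ring.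
Qed.

End reflect.

Lemma reflect_invariant {R : realType} (h : R) (phi : R -> R) (g : set R -> \bar R) :
  is_invariant h phi g -> is_invariant h phi (fun A => g ((fun x : R => - x) @^-1` A)).
Proof.
move=> [d [T [P [Np [Nm [U [prm sol inv]]]]]]].
exists d, T, P, Nm, Np, (fun t w => - U t w); split.
- exact: PRM_indep_reflect prm.
- exact: solves_reflect sol.
- by move=> t t0 A mA; rewrite -(inv t t0)//; exact: measurable_reflect.
Qed.

(** * From the solution space to the invariant law; the sign of the mean drift *)

Section invariant_facts.
Context {R : realType}.
Variables (h : R) (phi : R -> R) (g : probability R R).
Hypotheses (phi_ge0 : forall x, 0 <= phi x) (mphi : measurable_fun setT phi).
Hypothesis inv : is_invariant h phi g.

Definition mean_drift (g : {measure set R -> \bar R}) : R :=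
  fine (\int[g]_x (phi x)%:E)%E - fine (\int[g]_x (phi (- x))%:E)%E.

Let c := h * mean_drift g.

(** The consequences of the dynamics restated for [g] alone. From here on the probability space and
    the path are forgotten. *)
Lemma invariant_facts :
  [/\ g.-integrable setT (fun x => (phi x)%:E),
      g.-integrable setT (fun x => (phi (- x))%:E),
      (c != 0 -> g [set 0] = 0%E) &
  forall (A : set R) (t : R), 0 <= t -> measurable A ->
  (forall x s : R, A x -> 0 <= s -> s <= t -> x + c * s != 0) ->
  g [set y | A (y - c * t)] = (\int[g]_(x in A) expeR (- rate phi c x t))%E].
Proof.
have [d [T [P [Np [Nm [U [prm sol st]]]]]]] := inv.
have [mU [_ [_ [iphi _]]]] := sol.
have pushE (D : set R) (f : R -> \bar R) : measurable D -> measurable_fun D f -> (forall x, (0 <= f x)%E) ->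
    (\int[g]_(x in D) f x = \int[P]_(w in U 0%R @^-1` D) f (U 0%R w))%E.
  move=> mD mf f0; have := @ge0_integral_pushforward _ _ T R R (U 0) (mU 0) P D f mD mf (fun x _ => f0 x).
  move=> <-; apply: eq_measure_integral => A mA _.
  by rewrite /= /pushforward st.
have mphiN : measurable_fun setT (fun x : R => phi (- x)) by apply: (measurableT_comp mphi); exact: oppr_measurable.
have i1 := iphi 0 1 (lexx _) (or_introl erefl).
have i2 := iphi 0 (-1) (lexx _) (or_intror erefl).
have E1 : (\int[g]_x (phi x)%:E = \int[P]_w (phi (1 * U 0 w)%R)%:E)%E.
  rewrite (pushE setT (fun x => (phi x)%:E))//.
  - by rewrite preimage_setT; apply: eq_integral => w _; rewrite mul1r.
  - exact/measurable_EFinP.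
have E2 : (\int[g]_x (phi (- x)%R)%:E = \int[P]_w (phi (-1 * U 0 w)%R)%:E)%E.
  have := pushE setT (fun x : R => (phi (- x)%R)%:E) measurableT.
  rewrite preimage_setT => ->.
  - by apply: eq_integral => w _; rewrite mulN1r.
  - exact/measurable_EFinP.
  - by move=> x; rewrite lee_fin.
have cE : c = h * drift P phi U 0.
  rewrite /c /mean_drift E1 E2 /drift !big_cons !big_nil addr0 mulN1r mul1r addrC.
  by [].
split.
- apply/integrableP; split; first exact/measurable_EFinP.
  under eq_integral do rewrite gee0_abs ?lee_fin//.
  by rewrite E1 ltey_eq integrable_fin_num.
- apply/integrableP; split; first exact/measurable_EFinP.
  under eq_integral do rewrite gee0_abs ?lee_fin//.
  by rewrite E2 ltey_eq integrable_fin_num.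
- move=> c0; apply: (no_atom0 P Np Nm U h phi g) => //.
  by rewrite -cE.
- move=> A t t0 mA; rewrite cE => nz.
  have mA' : measurable [set y | A (y - h * drift P phi U 0 * t)].
    have mf : measurable_fun setT (fun y : R => y - h * drift P phi U 0 * t) by exact: measurable_funB.
    by have := mf measurableT _ mA; rewrite setTI.
  rewrite -(st t t0 _ mA') (shift_law P Np Nm U h phi g phi_ge0 mphi prm sol st A t t0 mA nz).
  rewrite (pushE A (fun x => expeR (- rate phi (h * drift P phi U 0) x t))%E)//.
  + apply: measurable_funTS; apply: (measurableT_comp measurable_expeR); apply: measurableT_comp => //.
    exact: measurable_rate.
  + by move=> x; exact: expeR_ge0.
Qed.

Lemma intPhi_fin : (\int[g]_x (Phi phi x)%:E < +oo)%E.
Proof.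
have [i1 i2 _ _] := invariant_facts.
have := integrableD measurableT i1 i2; move/integrable_fin_num; rewrite -ge0_fin_numE => [->//|].
by apply: integral_ge0 => x _; rewrite lee_fin addr_ge0.
Qed.

End invariant_facts.

Section invariant_sign.
Context {R : realType}.
Variables (h : R) (phi : R -> R).
Hypotheses (h0 : 0 < h) (phi_ge0 : forall x, 0 <= phi x) (mphi : measurable_fun setT phi).

Lemma mean_drift0 (g : probability R R) : hypA phi -> is_invariant h phi g -> mean_drift phi g = 0 -> eqm g delta0.
Proof.
move=> hA inv m0; have [_ _ _ shift] := invariant_facts h phi g phi_ge0 mphi inv.
have g0 := zero_drift_law g phi _ phi_ge0 mphi shift (_ : h * mean_drift phi g = 0) hA.
have {}g0 : g [set 0] = 1%E by apply: g0; rewrite m0 mulr0.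
have gn0 : g (~` [set 0]) = 0%E by rewrite probability_setC// g0 subee.
move=> A mA; rewrite /delta0 diracE.
have [A0|A0] := boolP (0 \in A).
  apply/eqP; rewrite eq_le probability_le1//= -g0 le_measure ?inE//.
  by move=> x ->; rewrite -[A 0]inE.
transitivity (0%E : \bar R) => //.
apply/eqP; rewrite eq_le measure_ge0 andbT -gn0 le_measure ?inE//; first exact: measurableC.
by move=> x Ax x0; move/negP: A0; apply; rewrite -x0; exact: mem_set.
Qed.

Lemma ZgamE (m : R) : Zgam h phi m = weight phi (h * m) `]0%R, +oo[%classic.
Proof.
have mq := measurable_q phi (h * m) phi_ge0 mphi.
rewrite /Zgam mulrC /leb -integral_itv_obnd_cbnd; last exact: measurable_funTS mq.
rewrite -/leb ge0_integral_lebR//; first exact: measurable_funTS mq.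
by move=> x _; exact: expeR_ge0.
Qed.

(** The normalising integral is the one in [hypB] for the value [(h * m)^-1] of [lam]. *)
Lemma weight_total (m : R) : hypB phi -> 0 < m -> (weight phi (h * m) `]0%R, +oo[%classic < +oo)%E.
Proof.
move=> hB m0; have ci : 0 < (h * m)^-1 by rewrite invr_gt0 mulr_gt0.
have := hB _ ci; rewrite -ZgamE /Zgam (mulrC m).
by congr (_ < _)%E; apply: eq_integral => s _; rewrite muleC.
Qed.

Lemma mean_drift_pos (g : probability R R) : hypB phi -> is_invariant h phi g -> 0 < mean_drift phi g ->
  supp_pos g /\ g `]0%R, +oo[%classic = 1%E /\
  forall A, measurable A -> g A = (\int[leb]_(x in A `&` `[0%R, +oo[) ggam h phi (mean_drift phi g) x)%E.
Proof.
move=> hB inv m0; set m := mean_drift phi g in m0 *.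
have c0 : 0 < h * m by rewrite mulr_gt0.
have [_ _ g0 shift] := invariant_facts h phi g phi_ge0 mphi inv.
have {}g0 : g [set 0] = 0%E by apply: g0; rewrite gt_eqF.
have iPhi := intPhi_fin h phi g phi_ge0 mphi inv.
have wf := weight_total _ hB m0.
split; first exact: (no_mass_neg g phi (h * m) phi_ge0 mphi shift c0).
split; first exact: (mass_pos g phi (h * m) phi_ge0 mphi shift c0 g0).
move=> A mA; rewrite (stationary_law g phi (h * m) phi_ge0 mphi shift c0 g0 iPhi wf A mA).
have mAp : measurable (A `&` `[0%R, +oo[%classic) by exact: measurableI.
have mq := measurable_q phi (h * m) phi_ge0 mphi.
rewrite -ge0_integral_lebR//.
- apply: eq_integral => x; rewrite inE/= in_itv/= andbT => -[_ x0].
  by rewrite /ggam x0 ZgamE (mulrC m).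
- by apply: measurable_funTS; apply: emeasurable_funM.
- move=> x _; rewrite mule_ge0 ?expeR_ge0// lee_fin invr_ge0 fine_ge0//.
  by rewrite integral_ge0// => y _; exact: expeR_ge0.
Qed.

End invariant_sign.

(** * Reflection of Lebesgue integrals *)

Section reflect_integral.
Context {R : realType}.
Import HBNNSimple.
Let RR := measurableTypeR R.

Lemma nnsfun_reflect (s : {nnsfun RR >-> R}) : exists s' : {nnsfun RR >-> R},
  (forall x, s' x = s (- x)) /\ sintegral leb s' = sintegral leb s.
Proof.
pose f : RR -> R := fun x => s (- x).
have mf : measurable_fun [set: RR] f by apply: (measurableT_comp (@measurable_funP _ _ _ _ setT s)); exact: oppr_measurable.
have fin : finite_set (range f) by apply: sub_finite_set (fimfunP s) => _ [x _ <-]; exists (- x).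
have f0 x : 0 <= f x by [].
pose s' : {nnsfun RR >-> R} := HB.pack f (isMeasurableFun.Build _ _ _ _ f mf) (FiniteImage.Build _ _ f fin) (isNonNegFun.Build _ _ f f0).
exists s'; split => //.
rewrite !sintegralET; apply: eq_fsbigr => x _; congr (_ * _)%E.
have mB : measurable (s @^-1` [set x] : set RR) by exact: measurable_sfunP.
exact: (lebesgue_measureN mB).
Qed.

Let nnintegral (F : RR -> \bar R) : \bar R :=
  ereal_sup [set sintegral leb h | h in [set h : {nnsfun RR >-> R} | forall x, ((h x)%:E <= F x)%E]].

Lemma nnintegral_reflect (F : RR -> \bar R) : nnintegral (fun x => F (- x)) = nnintegral F.
Proof.
have le (G : RR -> \bar R) : (nnintegral (fun x => G (- x)%R) <= nnintegral G)%E.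
  apply: ub_ereal_sup => _ [s sG <-]; have [s' [s'E <-]] := nnsfun_reflect s.
  apply: ereal_sup_ubound; exists s' => // x; rewrite s'E.
  by rewrite -[x in leRHS]opprK; exact: sG.
apply/eqP; rewrite eq_le le/=.
have := le (fun x => F (- x)).
by rewrite (_ : (fun x => F (- - x)) = F)//; apply/funext => x; rewrite opprK.
Qed.

(** The density in the reflection statement is an arbitrary function, so the argument works on the
    definition of the integral: positive and negative parts are suprema over simple functions, and
    reflection permutes these while preserving their integrals. *)
Lemma integral_reflect (A : set R) (f : R -> \bar R) :
  (\int[leb]_(x in A) f (- x)%R = \int[leb]_(x in (fun x : R => - x)%R @^-1` A) f x)%E.
Proof.
rewrite /integral.
have E : ((fun x : RR => f (- x)) \_ A) = (fun x : RR => (f \_ ((fun x : R => - x)%R @^-1` A)) (- x)).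
  apply/funext => x; rewrite /patch (_ : (- x \in _ @^-1` A) = (x \in A))//.
  by apply/idP/idP; rewrite !inE /= opprK.
set B := (fun x : R => - x)%R @^-1` A in E *.
transitivity (nnintegral (fun x : RR => ((f \_ B)^\+ (- x)%R)%E) - nnintegral (fun x : RR => ((f \_ B)^\- (- x)%R)%E))%E.
  have E1 : (((fun x : RR => f (- x)%R) \_ A)^\+)%E = (fun x : RR => ((f \_ B)^\+ (- x)%R)%E).
    by rewrite E; apply/funext => x; rewrite !funeposE.
  have E2 : (((fun x : RR => f (- x)%R) \_ A)^\-)%E = (fun x : RR => ((f \_ B)^\- (- x)%R)%E).
    by rewrite E; apply/funext => x; rewrite !funenegE.
  by rewrite -E1 -E2.
by rewrite !nnintegral_reflect.
Qed.

End reflect_integral.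

(** * Support, density and reflection of invariant laws *)

Section invariant_parts.
Context {R : realType}.
Variables (h : R) (phi : R -> R).
Hypotheses (h0 : 0 < h) (phi_ge0 : forall x, 0 <= phi x) (mphi : measurable_fun setT phi).
Hypotheses (hA : hypA phi) (hB : hypB phi).

Lemma reflect_probability (g : probability R R) :
  exists g' : probability R R, forall A, g' A = g ((fun x : R => - x) @^-1` A).
Proof.
have mo : measurable_fun [set: R] (fun x : R => - x) by exact: oppr_measurable.
pose X : {mfun R >-> R} := HB.pack (fun x : R => - x) (isMeasurableFun.Build _ _ _ _ _ mo).
by exists (distribution g X).
Qed.

Lemma mean_drift_reflect (g g' : probability R R) : (forall A, g' A = g ((fun x : R => - x) @^-1` A)) ->
  mean_drift phi g' = - mean_drift phi g.
Proof.
move=> gE.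
have mo : measurable_fun [set: R] (fun x : R => - x) by exact: oppr_measurable.
have H (f : R -> \bar R) : measurable_fun setT f -> (forall x, (0 <= f x)%E) ->
    (\int[g']_x f x = \int[g]_x f (- x)%R)%E.
  move=> mf f0; rewrite (eq_measure_integral (measure_function_pushforward__canonical__measure_function_Measure g mo)); last first.
    by move=> A mA _; exact: gE.
  by rewrite ge0_integral_pushforward.
have mphiN : measurable_fun setT (fun x : R => phi (- x)) by apply: (measurableT_comp mphi).
have H1 := H (fun x => (phi x)%:E); have H2 := H (fun x => (phi (- x))%:E).
have m1 : measurable_fun setT (fun x : R => (phi x)%:E) by exact/measurable_EFinP.
have m2 : measurable_fun setT (fun x : R => (phi (- x))%:E) by exact/measurable_EFinP.
rewrite /mean_drift opprB (H1 m1)// (H2 m2)//.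
  by congr (_ - fine _); apply: eq_integral => x _; rewrite opprK.
by move=> x; rewrite lee_fin.
Qed.

Lemma reflected_invariant (g g' : probability R R) : (forall A, g' A = g ((fun x : R => - x) @^-1` A)) ->
  is_invariant h phi g -> is_invariant h phi g'.
Proof.
move=> gE inv; apply: eqm_invariant (reflect_invariant h phi g inv).
by move=> A mA; rewrite gE.
Qed.

Lemma opp_itvNy0 : (fun x : R => - x) @^-1` `]-oo, 0%R[%classic = `]0%R, +oo[%classic.
Proof. by apply/seteqP; split => x /=; rewrite !in_itv/= andbT oppr_lt0. Qed.

Lemma invariant_support (g : probability R R) : is_invariant h phi g -> ~ eqm g delta0 -> supp_pos g \/ supp_neg g.
Proof.
move=> inv ng; have [m0|m0|m0] := ltgtP 0 (mean_drift phi g).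
- by left; have [] := mean_drift_pos h phi h0 phi_ge0 mphi g hB inv m0.
- have [g' g'E] := reflect_probability g; right.
  have inv' := reflected_invariant g g' g'E inv.
  have m' : 0 < mean_drift phi g' by rewrite (mean_drift_reflect g g' g'E) oppr_gt0.
  have [+ _] := mean_drift_pos h phi h0 phi_ge0 mphi g' hB inv' m'.
  by rewrite /supp_pos /supp_neg g'E opp_itvNy0.
- by case: ng; exact: (mean_drift0 h phi phi_ge0 mphi g hA inv (esym m0)).
Qed.

(** A negative mean drift would, by reflection, put all the mass on the negative half-line; a zero
    one would give the Dirac mass. *)
Lemma supp_pos_drift (g : probability R R) : is_invariant h phi g -> ~ eqm g delta0 -> supp_pos g ->
  0 < mean_drift phi g.
Proof.
move=> inv ng sg; have [//|m0|m0] := ltgtP 0 (mean_drift phi g).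
- have [g' g'E] := reflect_probability g.
  have inv' := reflected_invariant g g' g'E inv.
  have m' : 0 < mean_drift phi g' by rewrite (mean_drift_reflect g g' g'E) oppr_gt0.
  have [_ [+ _]] := mean_drift_pos h phi h0 phi_ge0 mphi g' hB inv' m'.
  rewrite g'E (_ : _ @^-1` _ = `]-oo, 0%R[%classic); last first.
    by apply/seteqP; split => x /=; rewrite !in_itv/= andbT oppr_gt0.
  by rewrite sg => /eqP; rewrite eq_sym onee_eq0.
- by case: ng; exact: (mean_drift0 h phi phi_ge0 mphi g hA inv (esym m0)).
Qed.

Lemma ggam_props (m : R) : 0 < m ->
  [/\ measurable_fun (`[0, +oo[%classic : set R) (ggam h phi m),
      forall x, (0 <= ggam h phi m x)%E & forall x, ggam h phi m x \is a fin_num].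
Proof.
move=> m0; have mq := measurable_q phi (h * m) phi_ge0 mphi.
have z0 : (0 <= ((fine (Zgam h phi m))^-1)%:E)%E.
  by rewrite lee_fin invr_ge0 fine_ge0// integral_ge0// => x _; exact: expeR_ge0.
split.
- apply: (eq_measurable_fun (fun x => (expeR (- (Psi phi x * ((h * m)^-1)%:E)) * ((fine (Zgam h phi m))^-1)%:E)%E)).
    by move=> x; rewrite inE/= in_itv/= andbT => x0; rewrite /ggam x0 (mulrC m).
  by apply: measurable_funTS; apply: emeasurable_funM.
- by move=> x; rewrite /ggam; case: ifPn => // _; rewrite mule_ge0 ?expeR_ge0.
- move=> x; rewrite /ggam; case: ifPn => // _.
  have p0 : (0 <= Psi phi x * ((m * h)^-1)%:E)%E.
    by rewrite mule_ge0 ?(Psi_ge0 phi phi_ge0 x)// lee_fin invr_ge0 ltW// mulr_gt0.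
  by rewrite fin_numM// (expeRN_fin _ p0).1.
Qed.

Lemma integral_ggam (g : probability R R) (f : R -> R) : is_invariant h phi g -> 0 < mean_drift phi g ->
  measurable_fun setT f -> (forall x, 0 <= f x) ->
  (\int[leb]_(x in `[0%R, +oo[) ((f x)%:E * ggam h phi (mean_drift phi g) x) = \int[g]_x (f x)%:E)%E.
Proof.
move=> inv m0 mf f0; set m := mean_drift phi g in m0 *.
have [_ [_ gE]] := mean_drift_pos h phi h0 phi_ge0 mphi g hB inv m0.
pose z : R := (fine (Zgam h phi m))^-1.
have z0 : 0 <= z by rewrite invr_ge0 fine_ge0// integral_ge0// => x _; exact: expeR_ge0.
pose q (x : R) : \bar R := expeR (- (Psi phi x * ((h * m)^-1)%:E)).
have mq : measurable_fun setT q by exact: (measurable_q phi (h * m) phi_ge0 mphi).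
pose k (x : R) : \bar R := ((\1_(`[0%R, +oo[%classic) x)%:E * (q x * z%:E))%E.
have mk : measurable_fun setT k.
  by apply: emeasurable_funM; [apply/measurable_EFinP; exact: measurable_indic|exact: emeasurable_funM].
have q0 x : (0 <= q x * z%:E)%E by rewrite mule_ge0 ?expeR_ge0.
have k0 x : (0 <= k x)%E by rewrite mule_ge0.
have kf x : k x \is a fin_num.
  have p0 : (0 <= Psi phi x * ((h * m)^-1)%:E)%E.
    by rewrite mule_ge0 ?(Psi_ge0 phi phi_ge0 x)// lee_fin invr_ge0 ltW// mulr_gt0.
  by rewrite fin_numM// fin_numM// (expeRN_fin _ p0).1.
have ggE x : 0 <= x -> ggam h phi m x = (q x * z%:E)%E.
  by move=> x0; rewrite /ggam x0 (mulrC m).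
have toR (A : set R) (f' : R -> R) : measurable A -> measurable_fun setT f' -> (forall x, 0 <= f' x) ->
    (\int[leb]_(x in A `&` `[0%R, +oo[) ((f' x)%:E * ggam h phi m x) = \int[lebR]_(x in A) (k x * (f' x)%:E))%E.
  move=> mA mf' f'0; transitivity (\int[leb]_(x in A `&` `[0%R, +oo[) ((q x * z%:E) * (f' x)%:E))%E.
    by apply: eq_integral => x; rewrite inE/= in_itv/= andbT => -[_ x0]; rewrite ggE// muleC.
  rewrite ge0_integral_lebR//; last 3 first.
  - exact: measurableI.
  - apply: measurable_funTS; apply: emeasurable_funM; last exact/measurable_EFinP.
    exact: emeasurable_funM.
  - by move=> x _; rewrite mule_ge0// lee_fin.
  rewrite integral_mkcondr; apply: eq_integral => x _; rewrite /patch /k indicE.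
  by case: (x \in _); rewrite ?mul1e ?mul0e.
have mid : measurable_fun [set: R] (id : R -> R) by exact: measurable_id.
have H (B : set R) : measurable B -> g B = (\int[lebR]_x (k x * (\1_B x)%:E))%E.
  move=> mB; rewrite gE//.
  transitivity (\int[leb]_(x in B `&` `[0%R, +oo[) ((1%R : R)%:E * ggam h phi m x))%E.
    by apply: eq_integral => x _; rewrite mul1e.
  rewrite (toR _ (fun=> 1))// [LHS]integral_mkcond; apply: eq_integral => x _; rewrite /patch indicE.
  by case: (x \in B); rewrite ?mule1 ?mule0.
have mfE : measurable_fun setT (fun x => (f x)%:E) by exact/measurable_EFinP.
have fE0 x : (0 <= (f x)%:E)%E by rewrite lee_fin.
rewrite (ge0_integral_transfer lebR g id k mid mk k0 kf H (fun x => (f x)%:E) mfE fE0) -toR//.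
by rewrite setTI.
Qed.

Lemma invariant_density (g : probability R R) : is_invariant h phi g -> ~ eqm g delta0 -> supp_pos g ->
  exists gam : R, [/\ 0 < gam,
       forall A, measurable A ->
         g A = (\int[leb]_(x in A `&` `[0%R, +oo[) ggam h phi gam x)%E,
       (\int[leb]_(x in `[0%R, +oo[) ((phi x - phi (- x))%:E * ggam h phi gam x))%E
         = gam%:E &
       (\int[leb]_(x in `[0%R, +oo[) ggam h phi gam x)%E = 1%E].
Proof.
move=> inv ng sg; have m0 := supp_pos_drift g inv ng sg.
have [_ [_ gE]] := mean_drift_pos h phi h0 phi_ge0 mphi g hB inv m0.
(* The parameter is the mean drift of [g] itself, so the equation for [gam] is its definition,
   rewritten as an integral against the density. *)
exists (mean_drift phi g); split => //; last by rewrite -[X in integral _ X _]setTI -gE// probability_setT.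
have [i1 i2 _ _] := invariant_facts h phi g phi_ge0 mphi inv.
have mphiN : measurable_fun setT (fun x : R => phi (- x)) by apply: (measurableT_comp mphi); exact: oppr_measurable.
have I1 := integral_ggam g phi inv m0 mphi phi_ge0.
have I2 := integral_ggam g (fun x => phi (- x)) inv m0 mphiN (fun x => phi_ge0 _).
have [mgg gg0 ggf] := ggam_props _ m0.
have int (f : R -> R) : measurable_fun setT f -> (forall x, 0 <= f x) ->
    (\int[leb]_(x in `[0%R, +oo[) ((f x)%:E * ggam h phi (mean_drift phi g) x) < +oo)%E ->
    leb.-integrable `[0%R, +oo[%classic (fun x => (f x)%:E * ggam h phi (mean_drift phi g) x)%E.
  move=> mf f0 fin; apply/integrableP; split.
    by apply: emeasurable_funM => //; apply/measurable_EFinP; exact: measurable_funTS mf.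
  by under eq_integral do rewrite gee0_abs ?mule_ge0 ?lee_fin//.
have J1 : leb.-integrable `[0%R, +oo[%classic (fun x => (phi x)%:E * ggam h phi (mean_drift phi g) x)%E.
  by apply: int => //; rewrite I1 ltey_eq integrable_fin_num.
have J2 : leb.-integrable `[0%R, +oo[%classic (fun x => (phi (- x))%:E * ggam h phi (mean_drift phi g) x)%E.
  by apply: (int (fun x => phi (- x))) => //; rewrite I2 ltey_eq integrable_fin_num.
transitivity (\int[leb]_(x in `[0%R, +oo[) ((phi x)%:E * ggam h phi (mean_drift phi g) x -
    (phi (- x))%:E * ggam h phi (mean_drift phi g) x))%E.
  apply: eq_integral => x _; rewrite EFinB -[in LHS](fineK (ggf x)) -[in RHS](fineK (ggf x)).
  by rewrite -EFinB -!EFinM -EFinB mulrBl.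
rewrite (integralB _ J1 J2)// I1 I2 /mean_drift EFinB !fineK// integrable_fin_num//.
Qed.

Lemma reflect_density_invariant (gd : R -> R) (g gt : probability R R) :
  (forall A, measurable A -> g A = (\int[leb]_(x in A) (gd x)%:E)%E) ->
  (forall A, measurable A -> gt A = (\int[leb]_(x in A) (gd (- x))%:E)%E) ->
  ((is_invariant h phi g /\ supp_pos g) <-> (is_invariant h phi gt /\ supp_neg gt)).
Proof.
move=> gE gtE.
have gtg A : measurable A -> gt A = g ((fun x : R => - x) @^-1` A).
  move=> mA; rewrite gtE// gE; first exact: (integral_reflect A (fun x => (gd x)%:E)).
  exact: measurable_reflect.
have ggt A : measurable A -> g A = gt ((fun x : R => - x) @^-1` A).
  move=> mA; rewrite gtg; last exact: measurable_reflect.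
  by congr (g _); apply/seteqP; split => x /=; rewrite opprK.
split=> -[inv supp]; split.
- by apply: eqm_invariant (reflect_invariant h phi g inv) => A mA; rewrite gtg.
- rewrite /supp_neg gtg//; rewrite -[RHS]supp; congr (g _).
  by apply/seteqP; split => x /=; rewrite !in_itv/= andbT oppr_gt0.
- by apply: eqm_invariant (reflect_invariant h phi gt inv) => A mA; rewrite ggt.
- by rewrite /supp_pos ggt// opp_itvNy0.
Qed.

End invariant_parts.

(** * Exponential laws, known through their tails *)

Definition exp_tail {R : realType} (m : R) (g : set R -> \bar R) : Prop :=
  forall b : R, 0 <= b -> g `]b, +oo[%classic = (expR (- (b / m)))%:E.

Section exponential_law.
Context {R : realType}.
Implicit Types (m b : R).

Lemma exponential_pdf_tail m b : 0 < m -> 0 <= b ->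
  (\int[leb]_(x in `]b, +oo[) (exponential_pdf m^-1 x)%:E = (expR (- (b / m)))%:E)%E.
Proof.
move=> m0 b0; have mi : 0 < m^-1 by rewrite invr_gt0.
have mp := measurable_exponential_pdf m^-1.
rewrite /leb integral_itv_obnd_cbnd; last by apply/measurable_EFinP; exact: measurable_funTS mp.
have cexp : continuous (fun z : R => - expR (- m^-1 * z)).
  move=> z; apply: cvgN; apply: continuous_comp; last exact: continuous_expR.
  by apply: continuousM => //; exact: cst_continuous.
rewrite (@ge0_continuous_FTC2y _ _ (fun x => - (expR (- m^-1 * x))) b 0)//.
- by rewrite EFinN oppeK add0e mulNr mulrC.
- by move=> x _; apply: exponential_pdf_ge0; exact: ltW.
- apply: (@continuous_subspaceW R _ _ `[0, +oo[%classic); last exact: within_continuous_exponential_pdf.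
  by move=> x /=; rewrite !in_itv/= !andbT; exact: le_trans.
- rewrite -oppr0; apply: cvgN.
  rewrite (_ : (fun x => expR (- m^-1 * x)) =
               (fun z => expR (- z)) \o (fun z => m^-1 * z)); last first.
    by apply: eq_fun => x; rewrite mulNr.
  apply: (@cvg_comp _ _ _ _ _ _ (pinfty_nbhs R)); last exact: cvgr_expR.
  exact: gt0_cvgMry.
- by apply/cvg_at_right_filter; exact: cexp.
- move=> z; rewrite in_itv/= andbT => bz; apply: derive1_exponential_pdf.
  by rewrite in_itv/= andbT (le_lt_trans b0).
Qed.

Lemma exp_tail_exists m : 0 < m -> exists g : probability R R, exp_tail m g.
Proof.
move=> m0; have mi : 0 < m^-1 by rewrite invr_gt0.
pose k (x : R) : \bar R := (exponential_pdf m^-1 x)%:E.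
have mk : measurable_fun setT k by apply/measurable_EFinP; exact: measurable_exponential_pdf.
have k0 x : (0 <= k x)%E by rewrite lee_fin exponential_pdf_ge0// ltW.
pose mu := density_measure lebR k mk k0.
have muE (A : set R) : measurable A -> mu A = (\int[leb]_(x in A) (exponential_pdf m^-1 x)%:E)%E.
  move=> mA; rewrite /mu density_measureE ge0_integral_lebR//.
    exact: measurable_funTS mk.
  by move=> x _; exact: k0.
have mu1 : mu setT = 1%E by rewrite muE//; exact: integral_exponential_pdf.
pose g : probability R R := HB.pack (Measure.sort mu) (Measure_isProbability.Build _ _ _ mu mu1).
exists g => b b0; transitivity (mu `]b, +oo[%classic) => //.
by rewrite muE//; exact: exponential_pdf_tail.
Qed.

Lemma exp_tail_pos m (g : set R -> \bar R) : exp_tail m g -> g `]0, +oo[%classic = 1%E.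
Proof. by move=> /(_ 0 (lexx _)); rewrite mul0r oppr0 expR0. Qed.

Lemma exp_tail_unique m (g g' : probability R R) : exp_tail m g -> exp_tail m g' ->
  forall A, measurable A -> g A = g' A.
Proof.
move=> gm gm'; have gT : (g setT < +oo)%E by rewrite probability_setT ltry.
apply: (measure_tail_unique g g' gT).
move=> b; have [b0|b0] := leP 0 b; first exact: etrans (gm b b0) (esym (gm' b b0)).
have one (p : probability R R) : exp_tail m p -> p `]b, +oo[%classic = 1%E.
  move=> pm; apply/eqP; rewrite eq_le probability_le1//= -(exp_tail_pos _ _ pm) le_measure ?inE//.
  by move=> x /=; rewrite !in_itv/= !andbT; exact: lt_trans.
exact: etrans (one g gm) (esym (one g' gm')).
Qed.

Lemma exp_tail_integral m (g nu : probability R R) (F : R -> \bar R) : 0 < m -> exp_tail m g -> exp_tail 1 nu ->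
  measurable_fun setT F -> (forall x, (0 <= F x)%E) -> (\int[g]_x F x = \int[nu]_y F (m * y)%R)%E.
Proof.
move=> m0 gm num mF F0.
have ms : measurable_fun [set: R] (fun y : R => m * y) by exact: measurable_funM.
have := @ge0_integral_pushforward _ _ R R R _ ms nu setT F measurableT mF (fun x _ => F0 x).
rewrite preimage_setT => <-.
have gT : (g setT < +oo)%E by rewrite probability_setT ltry.
apply: eq_measure_integral => A mA _.
pose g' := measure_function_pushforward__canonical__measure_function_Measure nu ms.
apply: (measure_tail_unique g g' gT) => // b; rewrite /= /pushforward.
have -> : (fun y : R => m * y) @^-1` `]b, +oo[%classic = `]b / m, +oo[%classic.
  by apply/seteqP; split => y /=; rewrite !in_itv/= !andbT ltr_pdivrMr// mulrC.
have [b0|b0] := leP 0 b.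
  rewrite gm// num; first by rewrite divr1.
  by rewrite divr_ge0// ltW.
have one (p : probability R R) (m' b' : R) : exp_tail m' p -> b' < 0 -> p `]b', +oo[%classic = 1%E.
  move=> pm b'0; apply/eqP; rewrite eq_le probability_le1//= -(exp_tail_pos _ _ pm) le_measure ?inE//.
  by move=> x /=; rewrite !in_itv/= !andbT; exact: lt_trans.
rewrite (one g m)// (one nu 1)//.
by rewrite ltr_pdivrMr// mul0r.
Qed.

Lemma exp_tail_nonpos (nu : probability R R) m : exp_tail m nu -> nu (~` `]0, +oo[%classic) = 0%E.
Proof. by move=> num; rewrite probability_setC// (exp_tail_pos _ _ num) subee. Qed.

Lemma integral_on_pos (nu : probability R R) m : exp_tail m nu -> forall F : R -> \bar R,
  measurable_fun setT F -> (forall y, (0 <= F y)%E) ->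
  (\int[nu]_y F y = \int[nu]_(y in `]0%R, +oo[) F y)%E.
Proof.
move=> num F mF F0; have P0 : measurable (`]0, +oo[%classic : set R) by [].
rewrite (ge0_negligible_integral (measurableC P0) measurableT mF (fun y _ => F0 y) (exp_tail_nonpos _ _ num)).
by rewrite setTD setCK.
Qed.

(** Layer cake: by Tonelli the mean is the integral of the tail, which is the exponential density of
    rate 1. *)
Lemma exp_tail_mean (nu : probability R R) : exp_tail 1 nu ->
  (\int[nu]_y (`|y|)%:E = 1)%E.
Proof.
move=> num.
pose G (p : R * R) : \bar R := ((\1_(`[0%R, +oo[%classic) p.2)%:E * (\1_(`]0%R, +oo[%classic) (p.1 - p.2)%R)%:E)%E.
have mminus : measurable_fun setT (fun p : R * R => p.1 - p.2).
  by apply: measurable_funB; [exact: measurable_fst|exact: measurable_snd].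
have mG : measurable_fun setT G.
  apply: emeasurable_funM; apply/measurable_EFinP; (apply: measurableT_comp; first exact: measurable_indic) => //.
have G0 p : (0 <= G p)%E by rewrite mule_ge0.
have L : (\int[nu]_y (`|y|)%:E = \int[nu]_y \int[lebR]_t G (y, t))%E.
  have E y : 0 < y -> (\int[lebR]_t G (y, t) = y%:E)%E.
    move=> y0; have -> : y%:E = lebR `[(0 : R), y[%classic by rewrite lebR_itv/= lte_fin y0 -EFinB subr0.
    rewrite -[X in lebR X]setIT -integral_indic//; apply: eq_integral => t _.
    rewrite /G !indicE/= !mem_setE !in_itv/= !andbT subr_gt0 -EFinM.
    by case: (0 <= t); case: (t < y); rewrite /= ?mulr0 ?mulr1 ?mul0r.
  have mI : measurable_fun setT (fun y => \int[lebR]_t G (y, t))%E by exact: (measurable_fun_fubini_tonelli_F (m2 := @lebR R) G mG G0).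
  rewrite (@integral_on_pos nu _ num)//; last by apply/measurable_EFinP.
  rewrite [RHS](@integral_on_pos nu _ num)//; last by move=> y; apply: integral_ge0.
  apply: eq_integral => y; rewrite inE/= in_itv/= andbT => y0; rewrite E// gtr0_norm//.
rewrite L (fubini_tonelli (m1 := nu) (m2 := lebR) G mG G0).
have E2 t : (\int[nu]_y G (y, t) = ((exponential_pdf 1 \_ `[0%R, +oo[) t)%:E)%E.
  rewrite /patch mem_setE.
  have [t0|t0] := boolP (t \in `[(0 : R), +oo[).
    have t0' : 0 <= t by move: t0; rewrite in_itv/= andbT.
    transitivity (nu `]t, +oo[%classic).
      rewrite -[X in nu X]setIT -integral_indic//; apply: eq_integral => y _.
      rewrite /G !indicE/= !mem_setE t0 !in_itv/= !andbT subr_gt0 mul1e.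
      done.
    rewrite num// divr1 /exponential_pdf patchE mem_setE t0 mul1r mulN1r//.
  apply: integral0_eq => y _; rewrite /G !indicE/= !mem_setE (negbTE t0) mul0e//.
under eq_integral do rewrite E2.
have := integral_exponential_pdf (ltr01 : (0:R) < 1).
have -> : (exponential_pdf 1 \_ `[0%R, +oo[) = exponential_pdf (1 : R).
  by apply/funext => t; rewrite /exponential_pdf !patchE; case: ifP => // ->.
move=> I1; rewrite -ge0_integral_lebR//.
  by apply/measurable_EFinP; exact: measurable_exponential_pdf.
by move=> x _; rewrite lee_fin exponential_pdf_ge0.
Qed.

End exponential_law.

(** * The self-consistency equation for the mean of an exponential law *)

Section response.
Context {R : realType}.
Variables (f : R -> R) (B : R).
Hypotheses (fodd : forall x, f (- x) = - f x) (f0 : f 0 = 0)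
     (df : forall x, derivable f x 1) (fB : forall x, f x <= B) (f'pos : forall x, 0 < derive1 f x)
     (f'dec : forall x y, 0 <= x -> x < y -> derive1 f y < derive1 f x).
Let L := derive1 f 0.

Let mvt (a b : R) : a < b -> exists2 x, a < x < b & f b - f a = derive1 f x * (b - a).
Proof.
move=> ab; have [||x xab ->] := @MVT R f (derive1 f) a b ab.
- by move=> x _; rewrite derive1E; exact/derivableP.
- by apply: derivable_within_continuous => x _; exact: df.
by exists x => //; move: xab; rewrite in_itv.
Qed.

Lemma response_lt (x : R) : 0 < x -> f x < L * x.
Proof.
move=> x0; have [y /andP[y0 yx]] := mvt _ _ x0; rewrite f0 !subr0 => ->.
by rewrite ltr_pM2r// f'dec.
Qed.

(** Strict concavity on the positive half-line: the ratio [f x / x] decreases strictly. It is stated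
    without quotients so that it can be integrated. *)
Lemma response_ratio (x y : R) : 0 < x -> x < y -> x * f y < y * f x.
Proof.
move=> x0 xy; have [u /andP[u0 ux]] := mvt _ _ x0; rewrite f0 !subr0 => fx.
have [v /andP[xv vy] fy] := mvt _ _ xy.
have duv : derive1 f v < derive1 f u by apply: f'dec; [exact: ltW|exact: lt_trans xv].
have -> : f y = f x + derive1 f v * (y - x) by rewrite -fy addrC subrK.
rewrite fx mulrDr; have yx : 0 < y - x by rewrite subr_gt0.
have := mulr_gt0 x0 yx; nra.
Qed.

Let pos (a b : R) : 0 <= a -> a <= b -> 0 <= f b - f a <= L * (b - a).
Proof.
move=> a0; rewrite le_eqVlt => /orP[/eqP ->|ab]; first by rewrite !subrr mulr0 lexx.
have [x /andP[ax xb] ->] := mvt _ _ ab; have ba : 0 < b - a by rewrite subr_gt0.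
by rewrite mulr_ge0 ?ltW//= ?f'pos// ltr_pM2r// f'dec// (le_lt_trans a0).
Qed.

(** Slopes on the positive half-line lie between 0 and [L]. Oddness transports this to the negative
    half-line, and arguments of opposite signs are compared through 0. *)
Lemma response_lip (a b : R) : `|f a - f b| <= L * `|a - b|.
Proof.
wlog ab : a b / a <= b.
  by move=> h; have [ab|/ltW ba] := leP a b; [exact: h|rewrite distrC (distrC a); exact: h].
rewrite distrC (distrC a) (ger0_norm (x := b - a)) ?subr_ge0//.
suff /andP[h1 h2] : 0 <= f b - f a <= L * (b - a) by rewrite ger0_norm.
have [a0|a0] := leP 0 a; first exact: pos.
have [b0|b0] := leP b 0.
  have := pos (- b) (- a); rewrite oppr_ge0 lerN2 !fodd => /(_ b0 ab).
  by rewrite opprK addrC (addrC (- a)) opprK.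
have := pos 0 b (lexx _) (ltW b0); have := pos 0 (- a) (lexx _); rewrite oppr_ge0 => /(_ (ltW a0)).
rewrite f0 !subr0 fodd => /andP[h1 h2] /andP[h3 h4]; apply/andP; split; lra.
Qed.

Lemma response_bound (x : R) : `|f x| <= B.
Proof. by rewrite ler_norml fB andbT lerNl -fodd. Qed.

Lemma measurable_response : measurable_fun setT f.
Proof.
apply: continuous_measurable_fun => x; apply: differentiable_continuous.
exact/derivable1_diffP.
Qed.

Variable (nu : probability R R).
Hypothesis nu1 : exp_tail 1 nu.

(** The mean of [f] under the exponential law of mean [m], written as [m] times a standard
    exponential variable so that the law of integration is fixed. *)
Definition response_mean (m : R) : R := (\int[nu]_y f (m * y))%R.

Let mfm (m : R) : measurable_fun setT (fun y => f (m * y)).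
Proof. by apply: (measurableT_comp measurable_response); exact: measurable_funM. Qed.

Let ifm (m : R) : nu.-integrable setT (EFin \o (fun y => f (m * y))).
Proof.
have fin : (nu setT < +oo)%E by rewrite probability_setT ltry.
apply: measurable_bounded_integrable => //.
exists B; split; first exact: num_real.
by move=> M BM y _ /=; rewrite (le_trans (response_bound _))// ltW.
Qed.

Let inorm : nu.-integrable setT (EFin \o (fun y : R => `|y|)).
Proof.
apply/integrableP; split; first by apply/measurable_EFinP; exact: measurableT_comp.
under eq_integral do rewrite /= normr_id.
by rewrite exp_tail_mean// ltry.
Qed.

Let mean1 : (\int[nu]_y `|y| = 1 :> R)%R.
Proof. by rewrite /Rintegral exp_tail_mean. Qed.

(** Equal integrals would force the nonnegative difference to vanish almost everywhere on the
    positive half-line, which carries all the mass. *)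
Lemma strict_integral (F1 F2 : R -> R) : nu.-integrable setT (EFin \o F1) -> nu.-integrable setT (EFin \o F2) ->
  (forall y, 0 < y -> F1 y < F2 y) -> (\int[nu]_y F1 y < \int[nu]_y F2 y)%R.
Proof.
move=> i1 i2 F12; rewrite -subr_gt0 -RintegralB//.
have iD := integrableB measurableT i2 i1; have mD := measurable_int nu iD.
have P0 : measurable (`]0, +oo[%classic : set R) by [].
have null : nu (~` (`]0, +oo[%classic : set R)) = 0%E by exact: exp_tail_nonpos nu1.
have E : (\int[nu]_y (F2 y - F1 y)%:E = \int[nu]_(y in `]0%R, +oo[) `|(F2 y - F1 y)%:E|)%E.
  rewrite (negligible_integral (measurableC P0) measurableT iD null) setTD setCK.
  apply: eq_integral => y; rewrite inE/= in_itv/= andbT => y0.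
  by rewrite gtr0_norm// subr_gt0 F12.
have X0 : (0 < \int[nu]_y (F2 y - F1 y)%:E)%E.
  rewrite lt_neqAle; apply/andP; split; last by rewrite E integral_ge0.
  apply/eqP => /esym; rewrite E => /(ae_eq_integral_abs nu P0 (measurable_funTS mD)) [N [mN N0 sN]].
  have : (nu `]0%R, +oo[%classic <= nu N)%E.
    apply: le_measure; rewrite ?inE// => y y0; apply: sN => /= /(_ y0) /eqP.
    move: y0; rewrite /= in_itv/= andbT => y0; rewrite eqe subr_eq0 => /eqP e.
    by have := F12 y y0; rewrite e ltxx.
  by rewrite (exp_tail_pos _ _ nu1) N0 lee_fin ler10.
rewrite /Rintegral fine_gt0// X0 ltey_eq.
by rewrite (integrable_fin_num measurableT iD).
Qed.

Lemma response_mean_lt (m : R) : 0 < m -> response_mean m < L * m.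
Proof.
move=> m0; rewrite /response_mean.
have -> : L * m = (\int[nu]_y (L * m * `|y|))%R by rewrite RintegralZl// mean1 mulr1.
apply: strict_integral.
- exact: ifm.
- exact: (integrableZl measurableT (L * m) inorm).
- by move=> y y0; rewrite gtr0_norm// -mulrA; apply: response_lt; exact: mulr_gt0.
Qed.

Lemma response_mean_ratio (m m' : R) : 0 < m -> m < m' -> m * response_mean m' < m' * response_mean m.
Proof.
move=> m0 mm'; rewrite /response_mean -!RintegralZl//.
apply: strict_integral.
- exact: (integrableZl measurableT m (ifm m')).
- exact: (integrableZl measurableT m' (ifm m)).
- move=> y y0; have := response_ratio (m * y) (m' * y) (mulr_gt0 m0 y0); rewrite ltr_pM2r// => /(_ mm').
  by rewrite ![_ * y * _]mulrAC !ltr_pM2r.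
Qed.

Lemma response_mean_lip (a b : R) : `|response_mean a - response_mean b| <= L * `|a - b|.
Proof.
rewrite /response_mean -RintegralB//; apply: (le_trans (le_normr_Rintegral _ _)) => //.
  exact: (integrableB measurableT (ifm a) (ifm b)).
have -> : L * `|a - b| = (\int[nu]_y (L * `|a - b| * `|y|))%R by rewrite RintegralZl// mean1 mulr1.
apply: le_Rintegral => //.
- exact: (integrable_norm (integrableB measurableT (ifm a) (ifm b))).
- exact: (integrableZl measurableT (L * `|a - b|) inorm).
- by move=> y _; apply: (le_trans (response_lip _ _)); rewrite -mulrBl normrM mulrA.
Qed.

Let derivable_cvg1 : h^-1 *: f h @[h --> 0^'] --> 'D_1 f 0.
Proof.
have := df 0; rewrite /derivable /derive.
rewrite (_ : (fun h => h^-1 *: ((f \o shift 0) h%:A - f 0)) = (fun h => h^-1 *: f h)) => // .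
by apply/funext => z; rewrite /= f0 subr0 addr0 /GRing.scale/= mulr1.
Qed.

(** The slope of [response_mean] at 0 along [1 / n.+1]. The difference quotients converge to [L * y]
    and are dominated by [L * |y|], an integrable function. *)
Lemma response_mean_slope : n.+1%:R * response_mean n.+1%:R^-1 @[n --> \oo] --> L.
Proof.
have P0 : measurable (`]0, +oo[%classic : set R) by [].
have null : nu (~` (`]0, +oo[%classic : set R)) = 0%E by exact: exp_tail_nonpos nu1.
have toP (F : R -> R) : nu.-integrable setT (EFin \o F) -> (\int[nu]_y F y = \int[nu]_(y in `]0%R, +oo[) F y)%R.
  move=> iF; rewrite /Rintegral (negligible_integral (measurableC P0) measurableT iF null) setTD setCK//.
pose F_ n y : R := n.+1%:R * f (n.+1%:R^-1 * y).
have iF n : nu.-integrable setT (EFin \o F_ n) by exact: (integrableZl measurableT n.+1%:R (ifm n.+1%:R^-1)).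
have iL : nu.-integrable setT (EFin \o (fun y : R => L * `|y|)) by exact: (integrableZl measurableT L inorm).
have LE : L = (\int[nu]_(y in `]0%R, +oo[) (L * `|y|))%R by rewrite -toP// RintegralZl// mean1 mulr1.
have FE n : n.+1%:R * response_mean n.+1%:R^-1 = (\int[nu]_(y in `]0%R, +oo[) F_ n y)%R.
  by rewrite -toP//  RintegralZl.
under eq_fun do rewrite FE.
have cF y : 0 < y -> F_ n y @[n --> \oo] --> L * y.
  move=> y0; have cf := derivable_cvg1.
  have /cvg_at_rightP /(_ (fun n => n.+1%:R^-1 * y)) := cvg_dnbhs_at_right cf.
  rewrite -derive1E -/L => cn.
  rewrite (_ : (fun n => _) = (fun n => y * ((n.+1%:R^-1 * y)^-1 *: (f (n.+1%:R^-1 * y))))); last first.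
    apply/funext => n; rewrite /F_ /GRing.scale/= invfM invrK mulrA mulrCA divff ?gt_eqF// mulr1//.
  rewrite [L * y]mulrC; apply: cvgM; first exact: cvg_cst.
  apply: cn; split; first by move=> n; rewrite mulr_gt0.
  rewrite -[X in _ --> X](mul0r y); apply: cvgM; last exact: cvg_cst.
  exact: cvg_harmonic.
have C1 : \forall x \ae nu, `]0, +oo[%classic x -> (F_ n x)%:E @[n --> \oo] --> (L * `|x|)%:E.
  apply: aeW => y; rewrite /= in_itv/= andbT => y0; apply: cvg_EFin; first exact: nearW.
  by rewrite gtr0_norm//; exact: cF.
have C2 : \forall x \ae nu, forall n : nat, `]0, +oo[%classic x -> (`|(F_ n x)%:E| <= (L * `|x|)%:E)%E.
  apply: aeW => y n; rewrite /= in_itv/= andbT => y0; rewrite lee_fin /F_ normrM gtr0_norm//.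
  have := response_lip (n.+1%:R^-1 * y) 0; rewrite f0 !subr0 normrM => H.
  by rewrite mulrC -ler_pdivlMr// (le_trans H)// (@gtr0_norm _ (n.+1%:R^-1)) ?invr_gt0// mulrCA mulrC.
have [_ _ lim] := dominated_convergence P0
  (fun n => measurable_funTS (measurable_int nu (iF n))) (measurable_funTS (measurable_int nu iL))
  C1 (integrableS measurableT P0 (@subsetT _ _) iL) C2.
have fin : (\int[nu]_(x in `]0%R, +oo[) (L * `|x|)%:E)%E \is a fin_num.
  exact: (integrable_fin_num P0 (integrableS measurableT P0 (@subsetT _ _) iL)).
suff : (\int[nu]_(y in `]0, +oo[) F_ n y)%R @[n --> \oo] --> (\int[nu]_(y in `]0, +oo[) (L * `|y|))%R by rewrite -LE.
by apply: fine_cvg; rewrite fineK.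
Qed.

(** Intermediate value theorem: near 0 the mean response exceeds [k * m] because its slope there is
    [L > k], while for large [m] it is capped by [B]. *)
Lemma response_fixpoint (k : R) : 0 < k -> k < L -> exists2 m : R, 0 < m & response_mean m = k * m.
Proof.
move=> k0 kL.
have [n hn] : exists n : nat, k < n.+1%:R * response_mean n.+1%:R^-1.
  have /cvgrPdist_lt /(_ (L - k)) := response_mean_slope; rewrite subr_gt0 => /(_ kL) [n _ hn].
  exists n; have /= := hn n (leqnn n); rewrite ltr_norml => /andP[_]; lra.
pose a : R := n.+1%:R^-1; have a0 : 0 < a by rewrite invr_gt0.
(* Chosen so that [k * b] exceeds [B], the bound on the mean response. *)
pose b : R := a + (B / k + 1).
have B0 : 0 <= B by have := fB 0; rewrite f0.
have ab : a <= b by rewrite lerDl addr_ge0// divr_ge0// ltW.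
pose H (m : R) := response_mean m - k * m.
have cH : {within `[a, b], continuous H}.
  apply: continuous_subspaceT => x; apply: cvgB; last first.
    by apply: cvgM; [exact: cvg_cst|exact: cvg_id].
  apply/cvgrPdist_le => e e0.
  have L0 : 0 < L by exact: f'pos.
  near=> y; rewrite (le_trans (response_mean_lip _ _))// -ler_pdivlMl//.
  by near: y; apply: cvgr_dist_le => //; rewrite mulr_gt0 ?invr_gt0.
have Ha : 0 <= H a.
  rewrite /H subr_ge0 ltW// -(ltr_pM2l (ltr0Sn R n)) mulrCA /a divff ?mulr1//.
have Hb : H b <= 0.
  rewrite /H subr_le0 (@le_trans _ _ B)//.
    rewrite /response_mean; have -> : B = (\int[nu]_y (cst B y))%R.
      by rewrite Rintegral_cst//= probability_setT mulr1.
    apply: le_Rintegral => //; exact: finite_measure_integrable_cst.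
  rewrite /b mulrDr mulrDr mulr1 [k * (_ / _)]mulrC divfK ?gt_eqF//.
  have := mulr_gt0 k0 a0; lra.
have [|x xab Hx] := @IVT R H a b 0 ab cH.
  by rewrite ge_min Hb orbT/= le_max Ha.
exists x; first by move: xab; rewrite in_itv/= => /andP[/(lt_le_trans a0)].
by apply/eqP; rewrite -subr_eq0; exact/eqP.
Unshelve. all: by end_near. Qed.

End response.

(** * The discretised chain and its tails *)

Section reset_chain.
Context {R : realType} {d : measure_display} {T : measurableType d}.
Variables (P : probability T R) (Np Nm : T -> {measure set (R * R) -> \bar R}).

Lemma finfam_le (s s' : R) n A : s <= s' -> finfam s' n A -> finfam s n A.
Proof.
move=> ss' [h1 h2]; split => // i /h1[m1 sub l]; split => //; apply: subset_trans sub _.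
by move=> -[p q] [/=]; rewrite !in_itv/= !andbT => sp q0; split => //=; exact: le_lt_trans sp.
Qed.

Definition reset (V : T -> R) (a : R) (E : set T) (w : T) : R := if w \in E then V w + a else 0.

Lemma measurable_reset V a E : measurable_fun setT V -> measurable E -> measurable_fun setT (reset V a E).
Proof.
move=> mV mE; rewrite (_ : reset V a E = fun w => (V w + a) * \1_E w).
  by apply: measurable_funM; [exact: measurable_funD|exact: measurable_indic].
by apply/funext => w; rewrite /reset indicE; case: (w \in E); rewrite ?mulr1 ?mulr0.
Qed.

Variables (s s' M : R) (V : T -> R) (G : set T) (S S' : set (R * (R * R))).
Hypotheses (indV : indep_after P Np Nm s V) (ss' : s <= s') (law : void_law P Np Nm s s' M V G S S').
Let E := void_set Np Nm s s' M V G S S'.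
Let rate_fun w := void_rate s s' M S S' (V w).

(** A set that misses 0 can only be reached by surviving, so its preimage is a void event cut by a
    condition on the previous state. *)
Lemma reset_law (a : R) (C : set R) : measurable C -> ~ C 0 ->
  P (reset V a E @^-1` C) = (\int[P]_(w in V @^-1` [set x | C (x + a)%R]) (rate_fun w)%:E)%E /\
  forall n m A k B l, finfam s' n A -> finfam s' m B ->
    P (counts Np n A k `&` counts Nm m B l `&` reset V a E @^-1` C) =
    (pfam n A k * pfam m B l * P (reset V a E @^-1` C))%E.
Proof.
move=> mC C0; have [mE _ L] := law.
pose C' := [set x : R | C (x + a)].
have mC' : measurable C'.
  have ma : measurable_fun setT (fun x : R => x + a) by apply: measurable_funD.
  by rewrite -[X in measurable X]setTI; apply: ma.
have pre : reset V a E @^-1` C = V @^-1` C' `&` E.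
  apply/seteqP; split => w /=; rewrite /reset; first by case: ifPn => // /set_mem.
  by move=> [h1 h2]; rewrite mem_set.
have eF : forall n m A k B l, finfam s' n A -> finfam s' m B ->
    P (counts Np n A k `&` counts Nm m B l `&` reset V a E @^-1` C) =
    (pfam n A k * pfam m B l * \int[P]_(w in V @^-1` C') (rate_fun w)%:E)%E.
  by move=> n m A k B l fA fB; rewrite pre setIA; exact: L.
have f0 : finfam s' 0 (fun=> set0 : set (R * R)) by split.
have e0 : P (reset V a E @^-1` C) = (\int[P]_(w in V @^-1` C') (rate_fun w)%:E)%E.
  have := eF 0%N 0%N (fun=> set0) (fun=> 0%N) (fun=> set0) (fun=> 0%N) f0 f0.
  by rewrite !counts0 !setTI /pfam !big_ord0 !mul1e.
by split => // n m A k B l fA fB; rewrite eF// e0.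
Qed.

(** Sets containing 0 are treated through their complement, to which [reset_law] applies; the
    product formula is stable under complements. *)
Lemma reset_indep (a : R) : indep_after P Np Nm s' (reset V a E).
Proof.
have [mp mm mV hV] := indV; have [mE _ _] := law.
have mr := measurable_reset V a E mV mE.
have mpre (C : set R) : measurable C -> measurable (reset V a E @^-1` C).
  by move=> mC; rewrite -[X in measurable X]setTI; exact: mr.
split => // n m A k B l C fA fB mC.
have [C0|C0] := pselect (C 0); last by have [_] := reset_law a C mC C0; apply.
have nC0 : ~ (~` C) 0 by apply.
have [_ /(_ n m A k B l fA fB) LC] := reset_law a (~` C) (measurableC mC) nC0.
pose F := counts Np n A k `&` counts Nm m B l.
have mF : measurable F.
  by apply: measurableI; apply: measurable_counts => //; [case: fA|case: fB] => h _ i /h [].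
have PF : P F = (pfam n A k * pfam m B l)%E.
  have := hV n m A k B l setT (finfam_le _ _ _ _ ss' fA) (finfam_le _ _ _ _ ss' fB) measurableT.
  by rewrite preimage_setT setIT probability_setT mule1.
have D : F = (F `&` reset V a E @^-1` C) `|` (F `&` reset V a E @^-1` (~` C)).
  by rewrite -setIUr -preimage_setU setUv preimage_setT setIT.
have PD : P F = (P (F `&` reset V a E @^-1` C) + P (F `&` reset V a E @^-1` (~` C)))%E.
  rewrite {1}D measureU//; [exact: measurableI (mpre _ mC)|exact: measurableI (mpre _ (measurableC mC))|].
  by apply/seteqP; split => // w [[_ h1] [_ h2]]; exact: h2.
have PC : P (reset V a E @^-1` C) = (1 - P (reset V a E @^-1` (~` C)))%E.
  rewrite -(probability_setC P (mpre _ (measurableC mC))); congr (P _).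
  by rewrite preimage_setC setCK.
have finP X : measurable X -> P X \is a fin_num by exact: fin_num_measure.
have mFC : measurable (F `&` reset V a E @^-1` C) by exact: measurableI (mpre _ mC).
rewrite -/F PC; move: PD; rewrite [X in _ = (_ + X)%E]LC -PF => PD.
move: PD (finP _ mF) (finP _ (mpre _ (measurableC mC))) (finP _ mFC).
case: (P F) => // pf; case: (P (reset V a E @^-1` (~` C))) => // pn; case: (P (F `&` _)) => // px.
rewrite -EFinM -EFinD => -[e] _ _ _; rewrite -EFinB -EFinM; congr (_%:E).
by rewrite mulrBr mulr1; lra.
Qed.

End reset_chain.

Section exponential_chain.
Context {R : realType} {d : measure_display} {T : measurableType d}.
Variables (P : probability T R) (Np Nm : T -> {measure set (R * R) -> \bar R}) (U0 : T -> R) (g : probability R R).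
Variables (phi : R -> R) (B L c m : R) (K : nat) (G : set T).
Hypotheses (prm : PRM_indep P Np Nm U0 g) (mG : measurable G) (PG : P G = 1%E)
  (Gcount : forall w, G w -> (forall M : nat, counting_on (Np w) (sqbox M%:R)) /\
     (forall M : nat, counting_on (Nm w) (sqbox M%:R))).
Hypotheses (m0 : 0 < m) (gm : exp_tail m g) (c0 : 0 < c) (cm : c / m = 2 * B) (L0 : 0 <= L) (B0 : 0 < B).
Hypotheses (mphi : measurable_fun setT phi) (phi0 : forall x, 0 <= phi x) (phiK : forall x, phi x <= K%:R)
  (phiB : forall x, phi x + phi (- x) = 2 * B) (phi_homo : {homo phi : x y / x <= y})
  (phiL : forall x y, x <= y -> phi y <= phi x + L * (y - x)).

(** Rates frozen at upper bounds over a step of displacement [e]. For monotone [phi] the two regions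
    dominate the rates at every position between [x] and [x + 2 * e]; the factor 2 covers the lag of
    the chain behind the path plus the move within the step. *)
Definition upper_region (e : R) : set (R * (R * R)) := [set p | 0 <= p.2.2 <= phi (p.1 + 2 * e)].
Definition lower_region : set (R * (R * R)) := [set p | 0 <= p.2.2 <= phi (- p.1)].

Fixpoint chain (e : R) (i : nat) : T -> R :=
  if i is j.+1 then reset (chain e j) (c * e)
    (void_set Np Nm (j%:R * e) (j.+1%:R * e) K%:R (chain e j) G (upper_region (c * e)) lower_region)
  else U0.

Let mreg (f : R -> R) : measurable_fun setT f -> measurable [set p : R * (R * R) | 0 <= p.2.2 <= phi (f p.1)].
Proof.
move=> mf.
have m2 : measurable_fun setT (fun p : R * (R * R) => p.2.2) by exact: (measurableT_comp measurable_snd measurable_snd).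
have m1 : measurable_fun setT (fun p : R * (R * R) => phi (f p.1)).
  exact: (measurableT_comp mphi (measurableT_comp mf measurable_fst)).
rewrite (_ : [set p | _] = [set p | 0 <= p.2.2] `&` [set p | p.2.2 <= phi (f p.1)]).
  by apply: measurableI; rewrite -[X in measurable X]setTI; exact: measurable_fun_le.
by apply/seteqP; split => p /=; [move/andP|move=> [-> ->]].
Qed.

Let mup e : measurable (upper_region e).
Proof. by apply: (mreg (fun x => x + 2 * e)); exact: measurable_funD. Qed.

Let mlo : measurable lower_region.
Proof. exact: (mreg -%R (@oppr_measurable R setT)). Qed.

Let grid_le (e : R) j : 0 < e -> j%:R * e <= j.+1%:R * e.
Proof. by move=> e0; rewrite ler_pM2r// ler_nat. Qed.

Let Gbox (a b : R) : 0 <= a -> forall w, G w ->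
  counting_on (Np w) (`]a, b] `*` `[0, K%:R]) /\ counting_on (Nm w) (`]a, b] `*` `[0, K%:R]).
Proof.
move=> a0 w /Gcount[h1 h2]; pose M := maxn K (Num.trunc (Num.max b 0)).+1.
have bM : b <= M%:R.
  have bm : 0 <= Num.max b 0 by rewrite le_max lexx orbT.
  have /andP[_ /ltW h] := trunc_itv bm.
  by rewrite (@le_trans _ _ (Num.max b 0)) ?le_max ?lexx// (le_trans h)// ler_nat leq_maxr.
have sub : `]a, b] `*` `[0, (K%:R : R)] `<=` sqbox M%:R.
  move=> -[p q] [/=]; rewrite !in_itv/= => /andP[ap pb] /andP[q0 qK].
  split; rewrite /= in_itv/= ?q0 ?(le_trans a0 (ltW ap)) ?(le_trans pb bM)//=.
  by rewrite (le_trans qK)// ler_nat leq_maxl.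
by split=> Q mQ QB; [apply: (h1 M)|apply: (h2 M)] => //; exact: subset_trans sub.
Qed.

Lemma chain_indep (e : R) i : 0 < e -> indep_after P Np Nm (i%:R * e) (chain e i).
Proof.
move=> e0; elim: i => [|i IH]; first by rewrite mul0r; exact: PRM_indep_after prm.
have ie : 0 <= i%:R * e by rewrite mulr_ge0// ltW.
have L' := void_lawT P Np Nm _ _ K%:R _ IH (grid_le e i e0) G mG PG (Gbox _ _ ie) _ _ (mup (c * e)) mlo.
exact: reset_indep IH (grid_le e i e0) L' (c * e).
Qed.

Let law e i (e0 : 0 < e) : void_law P Np Nm (i%:R * e) (i.+1%:R * e) K%:R (chain e i) G (upper_region (c * e)) lower_region.
Proof.
have ie : 0 <= i%:R * e by rewrite mulr_ge0// ltW.
exact: (void_lawT P Np Nm _ _ K%:R _ (chain_indep e i e0) (grid_le e i e0) G mG PG (Gbox _ _ ie) _ _ (mup (c * e)) mlo).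
Qed.

Let sec_rate (e x v : R) i (S : set (R * (R * R))) : 0 < e -> 0 <= v -> v <= K%:R -> S = [set p | S p] ->
  (forall p, S (x, p) <-> 0 <= p.2 <= v) ->
  fine (leb2 (xsection S x `&` (`]i%:R * e, i.+1%:R * e] `*` `[0%R, K%:R]))) = e * v.
Proof.
move=> e0 v0 vK _ hS.
rewrite (_ : _ `&` _ = `]i%:R * e, i.+1%:R * e]%classic `*` `[0, v]%classic).
  rewrite leb2X// /leb !lebesgue_measure_itv/= !lte_fin ltr_pM2r// ltr_nat ltnSn.
  have -> : ((i.+1%:R * e)%:E - (i%:R * e)%:E = e%:E)%E by rewrite -EFinB -natr1; congr (_%:E); ring.
  case: ltP => [_|v0']; first by rewrite -EFinB subr0 -EFinM.
  by have -> : v = 0 by [apply/eqP; rewrite eq_le v0' v0]; rewrite mule0 mulr0.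
apply/seteqP; split => -[p q] /=.
  by move=> [/xsectionP /hS /= h [/= h1 _]]; split => //=; rewrite in_itv.
move=> [/= h1]; rewrite in_itv/= => h; split; first by apply/xsectionP/hS.
by split => //=; move: h; rewrite in_itv/= => /andP[-> /le_trans]; apply.
Qed.

Let rateE (e x : R) i : 0 < e -> void_rate (i%:R * e) (i.+1%:R * e) K%:R (upper_region (c * e)) lower_region x =
  expR (- (e * (phi (x + 2 * (c * e)) + phi (- x)))).
Proof.
move=> e0; rewrite /void_rate.
rewrite (sec_rate e x (phi (x + 2 * (c * e))))// (sec_rate e x (phi (- x)))//.
by congr expR; ring.
Qed.

Let q e := expR (- (2 * B * e)).
Let eta e := expR (- (2 * L * c * e * e)).

Let rate_bounds e x i : 0 < e ->
  eta e * q e <= void_rate (i%:R * e) (i.+1%:R * e) K%:R (upper_region (c * e)) lower_region x <= q e.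
Proof.
move=> e0; rewrite rateE// /eta /q -expRD !ler_expR.
have ce : 0 < c * e by exact: mulr_gt0.
have x2 : x <= x + 2 * (c * e) by rewrite lerDl mulr_ge0// ltW.
have h1 := phi_homo _ _ x2; have h2 := phiL _ _ x2; have h3 := phiB x.
have l1 : e * (2 * B) <= e * (phi (x + 2 * (c * e)) + phi (- x)) by rewrite ler_pM2l//; lra.
have l2 : e * (phi (x + 2 * (c * e)) + phi (- x)) <= e * (2 * B + L * (2 * (c * e))).
  by rewrite ler_pM2l//; move: h2; rewrite addrAC subrr add0r; lra.
by apply/andP; split; lra.
Qed.

Let mchain e i : 0 < e -> measurable_fun setT (chain e i).
Proof. by move=> /(chain_indep e i)[]. Qed.

Let mtail (e : R) i (y : R) : 0 < e -> measurable (chain e i @^-1` `]y, +oo[%classic).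
Proof. by move=> e0; rewrite -[X in measurable X]setTI; exact: mchain. Qed.

Let tail_step (e : R) i (y : R) : 0 < e -> 0 <= y ->
  ((eta e * q e)%:E * P (chain e i @^-1` `](y - c * e)%R, +oo[%classic) <= P (chain e i.+1 @^-1` `]y, +oo[%classic))%E /\
  (P (chain e i.+1 @^-1` `]y, +oo[%classic) <= (q e)%:E * P (chain e i @^-1` `](y - c * e)%R, +oo[%classic))%E.
Proof.
move=> e0 y0.
have ny : ~ (`]y, +oo[%classic : set R) 0 by rewrite /= in_itv/= andbT ltNge y0.
have [-> _] := reset_law _ _ _ _ _ _ _ _ _ _ (law e i e0) (c * e) `]y, +oo[%classic (measurable_itv _) ny.
have -> : [set x | `]y, +oo[%classic (x + c * e)] = `](y - c * e), +oo[%classic.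
  by apply/seteqP; split => x /=; rewrite !in_itv/= !andbT ltrBlDr.
have [_ mr _] := law e i e0.
have mD := mtail e i (y - c * e) e0.
have cst_int (r : R) : 0 <= r -> (\int[P]_(w in chain e i @^-1` `](y - c * e)%R, +oo[%classic) r%:E = r%:E * P (chain e i @^-1` `](y - c * e)%R, +oo[%classic))%E.
  by move=> r0; exact: integral_cst.
have eq0 : 0 <= eta e * q e by rewrite mulr_ge0 ?expR_ge0.
rewrite -!cst_int// ?expR_ge0//; split; apply: ge0_le_integral => //; try exact: measurable_funTS mr;
  move=> w _; rewrite lee_fin; first [exact: expR_ge0|exact: eq0|by case/andP: (rate_bounds e (chain e i w) i e0)].
Qed.

Lemma chain_ge0 e i w : 0 < e -> 0 <= U0 w -> 0 <= chain e i w.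
Proof.
move=> e0 u0; elim: i => //= i IH; rewrite /reset; case: ifP => // _.
by rewrite addr_ge0// mulr_ge0// ltW.
Qed.

Let tail_neg (e : R) i (y : R) : 0 < e -> y < 0 -> P (chain e i @^-1` `]y, +oo[%classic) = 1%E.
Proof.
move=> e0 y0; apply/eqP; rewrite eq_le (probability_le1 P (mtail e i y e0))/=.
rewrite -(exp_tail_pos _ _ gm) -(PRM_indep_law _ _ _ _ _ prm)//.
have mU : measurable_fun setT U0 by case: prm => _ [_ []].
rewrite le_measure ?inE//; [by rewrite -[X in measurable X]setTI; exact: mU|exact: mtail|].
by move=> w /=; rewrite !in_itv/= !andbT => /ltW u0; rewrite (lt_le_trans y0)// chain_ge0.
Qed.

(** The exponential tail is reproduced by a step: [q e] equals [expR (- (c * e / m))], which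
    compensates the displacement exactly because [c / m = 2 * B]. The lower bound loses a factor
    [eta e] per step, and a factor [q e] from the levels below one displacement. *)
Lemma chain_tail (e : R) i (y : R) : 0 < e -> 0 <= y ->
  ((eta e ^+ i * q e * expR (- (y / m)))%:E <= P (chain e i @^-1` `]y, +oo[%classic))%E /\
  (P (chain e i @^-1` `]y, +oo[%classic) <= (expR (- (y / m)))%:E)%E.
Proof.
move=> e0; have ce : 0 < c * e by exact: mulr_gt0.
have qE : q e = expR (- (c * e / m)) by rewrite /q -cm; congr expR; ring.
have q1 : q e <= 1 by rewrite -expR0 ler_expR oppr_le0 mulr_ge0 ?mulr_ge0 ?ltW.
have eta1 : eta e <= 1.
  by rewrite -expR0 ler_expR oppr_le0; repeat apply: mulr_ge0 => //; exact: ltW.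
have eta0 : 0 <= eta e by exact: expR_ge0.
have q0 : 0 <= q e by exact: expR_ge0.
have tail1 y' : 0 <= y' -> expR (- (y' / m)) <= 1.
  by move=> y0'; rewrite -expR0 ler_expR oppr_le0 divr_ge0// ltW.
elim: i y => [|i IH] y y0.
  rewrite expr0 mul1r /= (PRM_indep_law _ _ _ _ _ prm)// (gm y y0); split => //.
  by rewrite lee_fin ler_piMl// expR_ge0.
have [lo hi] := tail_step e i y e0 y0.
(* Below one displacement the previous level is negative and its tail is 1, so the recursion stops;
   this is where the factor [q e] of the lower bound is spent. *)
have [ye|ye] := leP (c * e) y; last first.
  have neg : y - c * e < 0 by rewrite subr_lt0.
  rewrite (tail_neg e i _ e0 neg) !mule1 in lo hi; split.
    apply: (le_trans _ lo); rewrite lee_fin exprS.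
    rewrite -[leRHS]mulr1 -!mulrA ler_wpM2l// mulrCA ler_wpM2l//.
    by apply: mulr_ile1; [exact: exprn_ge0|exact: expR_ge0|exact: exprn_ile1|exact: tail1].
  apply: (le_trans hi); rewrite lee_fin qE ler_expR lerN2 ler_pM2r ?invr_gt0//; exact: ltW.
have y1 : 0 <= y - c * e by rewrite subr_ge0.
have [lo' hi'] := IH _ y1.
have tE : q e * expR (- ((y - c * e) / m)) = expR (- (y / m)).
  by rewrite qE -expRD; congr expR; field; rewrite gt_eqF.
split.
  apply: (le_trans _ lo); apply: (@le_trans _ _ ((eta e * q e)%:E * (eta e ^+ i * q e * expR (- ((y - c * e) / m)))%:E)%E).
    rewrite -EFinM lee_fin -tE exprS le_eqVlt; apply/orP; left; apply/eqP; ring.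
  by rewrite lee_wpmul2l// lee_fin mulr_ge0.
apply: (le_trans hi); rewrite -tE EFinM lee_wpmul2l// lee_fin.
Qed.

(** The number of steps grows like the inverse of the step while the logarithm of [eta] is quadratic
    in the step, so the accumulated loss tends to 1. *)
Lemma chain_tail_cvg t y : 0 < t -> 0 <= y ->
  P (chain (t / n.+1%:R) n.+1 @^-1` `]y, +oo[%classic) @[n --> \oo] --> (expR (- (y / m)))%:E.
Proof.
move=> t0 y0.
have e0 n : 0 < t / n.+1%:R :> R by rewrite divr_gt0.
apply: (@squeeze_cvge _ _ _ _ (fun n => (eta (t / n.+1%:R) ^+ n.+1 * q (t / n.+1%:R) * expR (- (y / m)))%:E) _
   (fun=> (expR (- (y / m)))%:E)); last exact: cvg_cst.
  by apply: nearW => n; have [-> ->] := chain_tail _ n.+1 y (e0 n) y0.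
have tn : t / n.+1%:R @[n --> \oo] --> (0 : R).
  by rewrite -[X in _ --> X](mulr0 t); apply: cvgM; [exact: cvg_cst|exact: cvg_harmonic].
have ex (k : R) : expR (- (k * (t / n.+1%:R))) @[n --> \oo] --> (1 : R).
  rewrite [X in _ --> X](_ : 1 = expR (- (k * 0))); last by rewrite mulr0 oppr0 expR0.
  apply: (@cvg_comp _ _ _ (fun n => - (k * (t / n.+1%:R))) (@expR R) _ (nbhs (- (k * 0)))).
    by apply: cvgN; apply: cvgM; [exact: cvg_cst|exact: tn].
  exact: continuous_expR.
apply: cvg_EFin; first exact: nearW.
have H : (eta (t / n.+1%:R) ^+ n.+1 * q (t / n.+1%:R) * expR (- (y / m))) @[n --> \oo] --> 1 * 1 * expR (- (y / m)).
  apply: cvgM; last exact: cvg_cst.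
  apply: cvgM; last exact: (ex (2 * B)).
  rewrite (_ : (fun n => _) = (fun n => expR (- (2 * L * c * t * (t / n.+1%:R))))); first exact: ex.
  apply/funext => n; rewrite /eta -expRM_natl; congr expR.
  by rewrite -mulr_natl; field; rewrite gt_eqF.
by rewrite !mul1r in H.
Qed.

End exponential_chain.

(** * Comparison of the chain with the path *)

Section shrinking.
Context {R : realType} {d : measure_display} {X : measurableType d}.

Lemma counting_shrink (m : {measure set X -> \bar R}) (F : nat -> set X) (Z : set X) :
  (forall n, measurable (F n)) -> measurable Z -> {homo F : n k / (n <= k)%N >-> k `<=` n} -> \bigcap_n F n = Z ->
  (forall n, isnat (m (F n))) -> m Z = 0%E -> exists n, m (F n) = 0%E.
Proof.
move=> mF mZ hF FZ nF mZ0.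
have cv : m (F n) @[n --> \oo] --> m (\bigcap_n F n).
  apply: nonincreasing_cvg_mu => //; first by have [k ->] := nF 0%N; rewrite ltry.
    by rewrite FZ.
  by move=> n k nk; apply/subsetPset; exact: hF.
rewrite FZ mZ0 in cv.
have [_ [n _ hn]] := isnat_cvg _ _ nF (erefl : 0%E \is a fin_num) cv.
by exists n; exact: (hn n (leqnn n)).
Qed.

Lemma small_harmonic (x : R) : 0 < x -> exists n : nat, n.+1%:R^-1 < x.
Proof.
move=> x0; have /cvgrPdist_lt /(_ x x0) [n _ hn] := @cvg_harmonic R.
by exists n; have := hn n (leqnn n); rewrite /harmonic/= sub0r normrN gtr0_norm ?invr_gt0.
Qed.

End shrinking.

Section comparison.
Context {R : realType} {d : measure_display} {T : measurableType d}.
Variables (Np Nm : T -> {measure set (R * R) -> \bar R}) (U0 : T -> R) (phi : R -> R) (L c : R) (K : nat) (G : set T)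
  (w : T) (u : R -> R).
Hypotheses (Gw : G w) (cNp : forall M : nat, counting_on (Np w) (sqbox M%:R))
  (cNm : forall M : nat, counting_on (Nm w) (sqbox M%:R))
  (simpleN : forall M : nat, simple_upto Np Nm M%:R w).
Hypotheses (c0 : 0 < c) (L0 : 0 <= L) (phi0 : forall x, 0 <= phi x) (phiK : forall x, phi x <= K%:R)
  (phi_homo : {homo phi : x y / x <= y}) (phiL : forall x y, x <= y -> phi y <= phi x + L * (y - x)).
Hypotheses (u0 : u 0 = U0 w) (ll : forall t, 0 < t -> cvg (u @ t^'-)) (u_ge0 : forall t, 0 <= t -> 0 <= u t)
  (intp : forall t, 0 <= t -> (Np w).-integrable (strip 0 t) (jump u phi 1))
  (intm : forall t, 0 <= t -> (Nm w).-integrable (strip 0 t) (jump u phi (-1)))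
  (eqn : forall t, 0 <= t -> ((u t)%:E = (u 0)%:E - J (Np w) (Nm w) u phi (strip 0 t) + (c * t)%:E)%E).

Let ev := events (Np w) (Nm w) K.

Let evN (t : R) A : measurable A -> A `<=` `]0, t]%classic -> isnat (ev A).
Proof. exact: events_isnat. Qed.

Let linear (a b : R) : 0 <= a -> a <= b -> ev `]a, b]%classic = 0%E -> u b = u a + c * (b - a).
Proof.
move=> a0 ab e0; have b0 := le_trans a0 ab.
have := incr (Np w) (Nm w) u c phi intp intm eqn a b a0 ab.
rewrite /strip (J_null_events (Np w) (Nm w) phi K phiK u b _ b0 (intp b b0) (intm b b0))//.
  by rewrite sube0 -EFinD => -[].
by move=> x /=; rewrite !in_itv/= => /andP[/(le_lt_trans a0) -> ->].
Qed.

Let left_linear_on (a r : R) : 0 <= a -> a < r -> ev `]a, r[%classic = 0%E -> left_lim u r = u a + c * (r - a).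
Proof.
move=> a0 ar e0; apply: cvg_lim => //.
have c1 : (fun s => u a + c * (s - a)) @ r^'- --> u a + c * (r - a).
  apply: cvg_at_left_filter; apply: cvgD; first exact: cvg_cst.
  by apply: cvgM; [exact: cvg_cst|apply: cvgB; [exact: cvg_id|exact: cvg_cst]].
apply: cvg_trans c1; apply: near_eq_cvg.
near=> s; have sr : s < r by near: s; exact: nbhs_left_lt.
have as_ : a <= s by near: s; exact: nbhs_left_ge.
apply/esym/linear => //; apply/eqP; rewrite eq_le measure_ge0 andbT -e0 le_measure ?inE//.
by move=> x /=; rewrite !in_itv/= => /andP[-> /le_lt_trans]; apply.
Unshelve. all: by end_near. Qed.

Let left_gap (r : R) : 0 < r -> exists2 e, 0 < e & ev `](Num.max 0 (r - e)), r[%classic = 0%E.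
Proof.
move=> r0; pose F n := `]Num.max 0 (r - n.+1%:R^-1), r[%classic : set R.
have [n hn] : exists n, ev (F n) = 0%E.
  apply: (counting_shrink ev F set0).
  - by move=> n; rewrite /F.
  - exact: measurable0.
  - move=> n k nk x; rewrite /F/= !in_itv/= => /andP[h ->]; rewrite andbT; apply: le_lt_trans h.
    rewrite ge_max !le_max lexx/= lerD2l lerN2 lef_pV2 ?posrE ?ler_nat//.
    by rewrite ltnS nk orbT.
  - apply/seteqP; split => // x h.
    have := h 0%N I; rewrite /F/= in_itv/= => /andP[_ xr].
    have [n hn] : exists n, n.+1%:R^-1 < r - x by apply: small_harmonic; rewrite subr_gt0.
    have := h n I; rewrite /F/= in_itv/= gt_max => /andP[/andP[_ h2] _].
    by move: hn; rewrite ltrBrDr -ltrBrDl ltNge (ltW h2).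
  - move=> n; apply: (evN r); first by rewrite /F.
    by move=> x; rewrite /F/= !in_itv/= gt_max => /andP[/andP[-> _] /ltW ->].
  - exact: measure0.
by exists n.+1%:R^-1; [rewrite invr_gt0|exact: hn].
Qed.

(** A closed segment without points stays empty when slightly lengthened, since the lengthened
    segments shrink to it and carry integer counts. *)
Let margin (N : {measure set (R * R) -> \bar R}) (r v : R) : (forall M : nat, counting_on N (sqbox M%:R)) -> 0 < r ->
  N ([set r] `*` `[0%R, phi v]) = 0%E -> exists2 e, 0 < e & N ([set r] `*` `[0%R, phi v + e]) = 0%E.
Proof.
move=> cN r0 Z0; pose F n := [set r] `*` `[0, phi v + n.+1%:R^-1]%classic : set (R * R).
have mF n : measurable (F n) by exact: measurableX.
have [n hn] : exists n, N (F n) = 0%E.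
  apply: (counting_shrink N F _ mF) Z0; first exact: measurableX.
  - move=> n k nk -[p q]; rewrite /F/= !in_itv/= => -[-> /andP[-> qv]]; split => //.
    by rewrite (le_trans qv)// lerD2l lef_pV2 ?posrE ?ler_nat.
  - apply/seteqP; split => -[p q].
      move=> h; have := h 0%N I; rewrite /F/= in_itv/= => -[-> /andP[q0 _]]; split => //=.
      rewrite in_itv/= q0/= leNgt; apply/negP => qv.
      have [n hn] : exists n, n.+1%:R^-1 < q - phi v by apply: small_harmonic; rewrite subr_gt0.
      have := h n I; rewrite /F/= in_itv/= => -[_ /andP[_ h2]]; by move: hn; rewrite ltrBrDl ltNge h2.
    move=> [/= ->]; rewrite in_itv/= => /andP[q0 qv] n _; rewrite /F/=; split => //; rewrite in_itv/= q0/=.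
    by rewrite (le_trans qv)// lerDl invr_ge0.
  - move=> n; pose M := maxn K.+1 (Num.trunc r).+1.
    have rM : r <= M%:R by have /andP[_ /ltW h] := trunc_itv (ltW r0); rewrite (le_trans h)// ler_nat leq_maxr.
    apply: (cN M) => // -[p q]; rewrite /F/= in_itv/= => -[-> /andP[q0 qv]]; split; rewrite /= in_itv/= ?(ltW r0) ?q0//=.
    rewrite (le_trans qv)//; apply: (@le_trans _ _ K.+1%:R); last by rewrite ler_nat leq_maxl.
    by rewrite -[K.+1%:R]natr1 lerD// invf_le1// ler1n.
by exists n.+1%:R^-1; [rewrite invr_gt0|exact: hn].
Qed.

(** The step contains at most one event time [r], and if the path is not hit at [r] then no point
    lies within the Lipschitz margin above its rates. The overestimating chain then takes the same
    decision as the path. *)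
Definition tame (a e : R) : Prop := exists r : R,
  ev (`]a, a + e]%classic `\ r) = 0%E /\
  (0 < r -> hit_count (Np w) (Nm w) phi r (left_lim u r) = 0%E ->
    Np w ([set r] `*` `[0%R, phi (left_lim u r) + L * (2 * (c * e))]) = 0%E /\
    Nm w ([set r] `*` `[0%R, phi (- left_lim u r) + L * (2 * (c * e))]) = 0%E).

Let tame_near (t x : R) : 0 < t -> 0 <= x -> exists2 e0, 0 < e0 & forall a e, 0 <= a -> 0 < e -> e < e0 -> `|x - a| < e0 -> tame a e.
Proof.
move=> t0 x0.
have [e1 e10 h1] := events_gap (Np w) (Nm w) K cNp cNm x x0.
have [e2 e20 h2] : exists2 e, 0 < e & ev `](Num.max 0 (x - e)), x[%classic = 0%E.
  have [->|/eqP xn] := eqVneq x 0; last by apply: left_gap; rewrite lt_neqAle x0 andbT; apply/eqP => /esym.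
  exists 1 => //; rewrite (_ : `]_, _[%classic = set0) ?measure0//; apply/seteqP; split => z //=.
    by rewrite in_itv/= gt_max => /andP[/andP[z1 _] /(lt_trans z1)]; rewrite ltxx.
pose y := left_lim u x.
have [e3 e30 h3] : exists2 e, 0 < e & 0 < x -> hit_count (Np w) (Nm w) phi x y = 0%E ->
    Np w ([set x] `*` `[0%R, phi y + e]) = 0%E /\ Nm w ([set x] `*` `[0%R, phi (- y) + e]) = 0%E.
  have [/andP[xp /eqP hc]|no] := boolP ((0 < x) && (hit_count (Np w) (Nm w) phi x y == 0%E)); last first.
    by exists 1 => // xp hc; exfalso; move/negP: no; apply; rewrite xp hc eqxx.
  move: hc; rewrite /hit_count => /eqP; rewrite padde_eq0// => /andP[/eqP z1 /eqP z2].
  have [a a0 ha] := margin (Np w) x y cNp xp z1; have [b b0 hb] := margin (Nm w) x (- y) cNm xp z2.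
  exists (Num.min a b); first by rewrite lt_min a0.
  have mono (N : {measure set (R * R) -> \bar R}) (v e e' : R) : e <= e' -> N ([set x] `*` `[0%R, v + e']) = 0%E ->
      N ([set x] `*` `[0%R, v + e]) = 0%E.
    move=> ee z; apply/eqP; rewrite eq_le measure_ge0 andbT -z le_measure ?inE//; [exact: measurableX|exact: measurableX|].
    by move=> -[p q] [/= ->]; rewrite !in_itv/= => /andP[-> h]; split => //; rewrite (le_trans h)// lerD2l.
  by move=> _ _; split; [apply: mono ha|apply: mono hb]; rewrite ge_min lexx ?orbT.
have k0 : 0 < L * (2 * c) + 1 by rewrite ltr_wpDl// !mulr_ge0// ltW.
(* Halves leave room for both the offset of [a] from [x] and the step length; the added 1 keeps the
   denominator positive when [L] is 0. *)
pose e0 := Num.min (Num.min (e1 / 2) (e2 / 2)) (e3 / (L * (2 * c) + 1)).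
have e0E e : e < e0 -> [/\ e < e1 / 2, e < e2 / 2 & e < e3 / (L * (2 * c) + 1)] by rewrite !lt_min => /andP[/andP[]].
exists e0; first by rewrite !lt_min !divr_gt0.
move=> a e a0 ep /e0E[b1 b2 b3] /e0E[]; rewrite !ltr_norml => /andP[d1 d2] /andP[d3 d4] _.
exists x; split.
  have sub : `]a, a + e]%classic `\ x `<=` `](Num.max 0 (x - e2)), x[%classic `|` `]x, x + e1]%classic.
    move=> z [/=]; rewrite !in_itv/= => /andP[az za] zx; have [h|h|h] := ltgtP z x; last by [].
      by left; rewrite andbT gt_max (le_lt_trans a0 az)/=; lra.
    by right; rewrite /=; lra.
  have mD : measurable (`]a, a + e]%classic `\ x) by apply: measurableD.
  apply/negligibleP => //; apply: (negligibleS sub).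
  by apply: negligibleU; apply/negligibleP.
move=> xp hc; have [z1 z2] := h3 xp hc.
have le3 : L * (2 * (c * e)) <= e3.
  move: b3; rewrite ltr_pdivlMr// mulrDr mulr1 => b3.
  have -> : L * (2 * (c * e)) = e * (L * (2 * c)) by ring.
  lra.
have mono (N : {measure set (R * R) -> \bar R}) (v : R) : N ([set x] `*` `[0%R, v + e3]) = 0%E ->
    N ([set x] `*` `[0%R, v + L * (2 * (c * e))]) = 0%E.
  move=> z; apply/eqP; rewrite eq_le measure_ge0 andbT -z le_measure ?inE//; [exact: measurableX|exact: measurableX|].
  by move=> -[p q] [/= ->]; rewrite !in_itv/= => /andP[-> h]; split => //; rewrite (le_trans h)// lerD2l.
by split; exact: mono.
Qed.

(** Tameness near each time, made uniform by compactness of the segment. *)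
Lemma tame_eventually (t : R) : 0 < t -> \forall n \near \oo, forall a, 0 <= a <= t -> tame a (t / n.+1%:R).
Proof.
move=> t0; have /compact_near_coveringP nc := @segment_compact R 0 t.
have := nc nat \oo (fun n a => 0 <= a -> tame a (t / n.+1%:R)) _; rewrite /near_covering.
move=> /(_ _)[|n _ hn]; last first.
  exists n => // k nk a h; have /andP[a0 _] := h.
  have ai : `[0, t]%classic a by rewrite /= in_itv.
  exact: (hn k nk a ai a0).
move=> x /=; rewrite in_itv/= => /andP[x0 _].
have [e0 e00 he] := tame_near t x t0 x0.
have tn : t / n.+1%:R @[n --> \oo] --> (0 : R).
  by rewrite -[X in _ --> X](mulr0 t); apply: cvgM; [exact: cvg_cst|exact: cvg_harmonic].
have [n1 _ hn1] : \forall n \near \oo, t / n.+1%:R < e0 by exact: cvgr_lt tn _ e00.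
exists ([set a | `|x - a| < e0], [set n | (n1 <= n)%N]); first by split; [exact: nbhsx_ballx|exists n1].
move=> [a n] [/= xa nn] a0; apply: he => //; last exact: hn1.
by rewrite divr_gt0.
Qed.

Let V e i := chain Np Nm U0 phi c K G e i w.

Let section_cell (e v x : R) i (S : set (R * (R * R))) : v <= K%:R -> (forall p, S (x, p) <-> 0 <= p.2 <= v) ->
  xsection S x `&` (`]i%:R * e, i.+1%:R * e] `*` `[0%R, K%:R]) = `]i%:R * e, i.+1%:R * e]%classic `*` `[0, v]%classic.
Proof.
move=> vK hS; apply/seteqP; split => -[p q] /=.
  by move=> [/xsectionP /hS /= h [/= h1 _]]; split => //=; rewrite in_itv.
move=> [/= h1]; rewrite in_itv/= => h; split; first by apply/xsectionP/hS.
by split => //=; move: h; rewrite in_itv/= => /andP[-> /le_trans]; apply.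
Qed.

Let chainS e i : (V e i.+1 = V e i + c * e /\
    Np w (`]i%:R * e, i.+1%:R * e] `*` `[0%R, phi (V e i + 2 * (c * e))]) = 0%E /\
    Nm w (`]i%:R * e, i.+1%:R * e] `*` `[0%R, phi (- V e i)]) = 0%E) \/
  (V e i.+1 = 0 /\ ~ (Np w (`]i%:R * e, i.+1%:R * e] `*` `[0%R, phi (V e i + 2 * (c * e))]) = 0%E /\
    Nm w (`]i%:R * e, i.+1%:R * e] `*` `[0%R, phi (- V e i)]) = 0%E)).
Proof.
rewrite /V /= /reset; case: ifPn => h; [left|right]; split => //.
  move: h; rewrite inE => -[[_ /= h1] /= h2].
  by move: h1 h2; rewrite (section_cell e (phi (V e i + 2 * (c * e))))// (section_cell e (phi (- V e i))).
move=> [h1 h2]; move/negP: h; apply; rewrite inE; split; [split => //|] => /=.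
  by rewrite (section_cell e (phi (V e i + 2 * (c * e)))).
by rewrite (section_cell e (phi (- V e i))).
Qed.

Let null_sub (N : {measure set (R * R) -> \bar R}) (A B : set (R * R)) : measurable A -> measurable B -> A `<=` B -> N B = 0%E -> N A = 0%E.
Proof. by move=> mA mB AB z; apply/eqP; rewrite eq_le measure_ge0 andbT -z le_measure ?inE. Qed.

Let mX (A : set R) (v : R) : measurable A -> measurable (A `*` `[0%R, v] : set (R * R)).
Proof. by move=> mA; exact: measurableX. Qed.

Let ev_null (A : set R) : measurable A -> ev A = 0%E -> forall v, v <= K%:R ->
  Np w (A `*` `[0%R, v]) = 0%E /\ Nm w (A `*` `[0%R, v]) = 0%E.
Proof.
move=> mA; rewrite /ev eventsE => /eqP; rewrite padde_eq0// => /andP[/eqP z1 /eqP z2] v vK.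
have sub : A `*` `[0, v] `<=` A `*` `[0, (K%:R : R)].
  by move=> -[p q] [/= Ap]; rewrite !in_itv/= => /andP[-> /le_trans h]; split => //; exact: h.
by split; [apply: null_sub z1|apply: null_sub z2] => //; exact: mX.
Qed.

(** The invariant places the path between the chain and one displacement above it. Without an event
    both drift. An event missing the path misses the chain by the margin. An event hitting the path
    lies in the larger region of the chain, so both are reset, and the path regains at most [c * e]
    before the step ends. *)
Lemma chain_step e i : 0 < e -> tame (i%:R * e) e -> V e i <= u (i%:R * e) <= V e i + c * e -> 0 <= V e i ->
  V e i.+1 <= u (i.+1%:R * e) <= V e i.+1 + c * e.
Proof.
move=> e0 [r [out marg]] /andP[Vu uV] V0; set a := i%:R * e.
have a0 : 0 <= a by rewrite mulr_ge0// ltW.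
have bE : i.+1%:R * e = a + e by rewrite -natr1 mulrDl mul1r.
have ce : 0 < c * e by exact: mulr_gt0.
rewrite bE; set b := a + e; have ab : a <= b by rewrite lerDl ltW.
have step := chainS e i; rewrite bE -/a -/b in step.
have mC : measurable (`]a, b]%classic : set R) by [].
have VK : phi (V e i + 2 * (c * e)) <= K%:R by exact: phiK.
have [rin|rout] := pselect (`]a, b]%classic r); last first.
  have e0C : ev `]a, b]%classic = 0%E.
    rewrite -[RHS]out; congr (ev _); apply/seteqP; split => x; last by case.
    by move=> Cx; split => // xr; apply: rout; rewrite -xr.
  have [z1 _] := ev_null _ mC e0C _ VK; have [_ z2] := ev_null _ mC e0C _ (phiK (- V e i)).
  have ub := linear a b a0 ab e0C.
  have E : b - a = e by rewrite /b addrAC subrr add0r.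
  case: step => -[V1 nz]; last by exfalso; exact: nz.
  by rewrite V1 ub E; apply/andP; split; lra.
have /andP[ar rb] : a < r <= b by move: rin; rewrite /= in_itv.
have r0 : 0 < r by exact: le_lt_trans ar.
have mD : measurable (`]a, b]%classic `\ r) by apply: measurableD.
have eva : ev `]a, r[%classic = 0%E.
  apply/eqP; rewrite eq_le measure_ge0 andbT -out le_measure ?inE// => x /=; rewrite !in_itv/= => /andP[ax xr].
  by rewrite ax (le_trans (ltW xr) rb); split => // e1; rewrite e1 ltxx in xr.
have evb : ev `]r, b]%classic = 0%E.
  apply/eqP; rewrite eq_le measure_ge0 andbT -out le_measure ?inE// => x /=; rewrite !in_itv/= => /andP[rx xb].
  by rewrite (lt_trans ar rx) xb; split => // e1; rewrite e1 ltxx in rx.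
have yE := left_linear_on a r a0 ar eva.
have ubE := linear r b (ltW r0) rb evb.
have [k k1 [ur hk]] := jump_at (Np w) (Nm w) u c phi cNp cNm simpleN ll intp intm eqn r r0.
set y := left_lim u r in yE ur hk marg.
have car : 0 <= c * (r - a) by rewrite mulr_ge0 ?subr_ge0 ?(ltW c0) ?(ltW ar).
have cbr : 0 <= c * (b - r) by rewrite mulr_ge0 ?subr_ge0 ?(ltW c0).
have cab : c * (r - a) + c * (b - r) = c * e by rewrite /b; ring.
have Vy : V e i <= y by lra.
have yV : y <= V e i + 2 * (c * e) by lra.
have sub1 (v v' : R) : v <= v' -> ([set r] `*` `[0, v]%classic : set (R * R)) `<=` `]a, b]%classic `*` `[0, v']%classic.
  move=> vv -[p q] [/= ->]; rewrite !in_itv/= => /andP[q0 qv]; split; first by rewrite ar rb.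
  by rewrite q0 (le_trans qv).
case: k k1 ur hk => [|[|//]] _ ur hk.
  have [z1 z2] := marg r0 hk.
  rewrite subr0 mulr1 in ur.
  have cover (N : {measure set (R * R) -> \bar R}) (v v' : R) : v <= K%:R -> v <= v' -> N ((`]a, b]%classic `\ r) `*` `[0%R, v]) = 0%E ->
      N ([set r] `*` `[0%R, v']) = 0%E -> N (`]a, b] `*` `[0%R, v]) = 0%E.
    move=> vK vv n1 n2; apply/negligibleP; first exact: mX.
    apply: (@negligibleS _ _ _ _ ([set r] `*` `[0%R, v'] `|` (`]a, b]%classic `\ r) `*` `[0%R, v])).
      move=> -[p q] [/= Cp]; rewrite in_itv/= => /andP[q0 qv].
      have [->|/eqP pr] := eqVneq p r; [left|right]; rewrite /= in_itv/= q0; first by rewrite (le_trans qv).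
      by rewrite qv.
    by apply: negligibleU; apply/negligibleP => //; exact: mX.
  have p1 : phi (V e i + 2 * (c * e)) <= phi y + L * (2 * (c * e)).
    have h1 : V e i + 2 * (c * e) <= y + 2 * (c * e) by rewrite lerD2r.
    have h2 : y <= y + 2 * (c * e) by rewrite lerDl mulr_ge0// ltW.
    apply: (le_trans (phi_homo _ _ h1)); apply: (le_trans (phiL _ _ h2)).
    by rewrite addrAC subrr add0r.
  have p2 : phi (- V e i) <= phi (- y) + L * (2 * (c * e)).
    have h1 : - y <= - V e i by rewrite lerN2.
    apply: (le_trans (phiL _ _ h1)); rewrite lerD2l ler_wpM2l//; lra.
  case: step => -[V1 nz]; last first.
    exfalso; apply: nz; split.
      by apply: (cover (Np w) _ _ VK p1) => //; have [] := ev_null _ mD out _ VK.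
    by apply: (cover (Nm w) _ _ (phiK _) p2) => //; have [] := ev_null _ mD out _ (phiK (- V e i)).
  by rewrite V1 ubE ur; apply/andP; split; lra.
rewrite subrr mulr0 in ur.
case: step => -[V1 nz].
  exfalso; case: nz => n1 n2; move: hk.
  rewrite (null_sub _ _ _ (mX _ _ (measurable_set1 r)) (mX _ _ mC) (sub1 _ _ (phi_homo _ _ yV)) n1).
  have Vn : - y <= - V e i by rewrite lerN2.
  rewrite (null_sub _ _ _ (mX _ _ (measurable_set1 r)) (mX _ _ mC) (sub1 _ _ (phi_homo _ _ Vn)) n2).
  by rewrite adde0 => /esym/eqP; rewrite eqe oner_eq0.
by rewrite V1 ubE ur; apply/andP; split; lra.
Qed.

Lemma chain_close (t : R) : 0 < t -> 0 <= U0 w -> \forall n \near \oo,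
  V (t / n.+1%:R) n.+1 <= u t <= V (t / n.+1%:R) n.+1 + c * (t / n.+1%:R).
Proof.
move=> t0 U00; have := tame_eventually t t0; apply: filterS => n tm; set e := t / n.+1%:R.
have e0 : 0 < e by rewrite divr_gt0.
have ne : n.+1%:R * e = t by rewrite mulrC divfK.
suff H i : (i <= n.+1)%N -> V e i <= u (i%:R * e) <= V e i + c * e by rewrite -[X in u X]ne; exact: H.
elim: i => [_|i IH ni]; first by rewrite mul0r u0 lexx/= lerDl mulr_ge0// ltW.
apply: chain_step => //; last by apply: chain_ge0.
  apply: tm; rewrite mulr_ge0 ?(ltW e0)//= -ne ler_pM2r// ler_nat; exact: ltnW.
by apply: IH; exact: ltnW.
Qed.

End comparison.

(** * Invariance of the exponential law *)

Lemma leb_segment {R : realType} (t : R) : 0 <= t -> leb `[0, t]%classic = t%:E.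
Proof.
move=> t0; rewrite /leb lebesgue_measure_itv/= lte_fin; case: ltP => t0'; first by rewrite -EFinB subr0.
by congr _%:E; apply/eqP; rewrite eq_le t0' t0.
Qed.

Lemma leb_segment_oc {R : realType} (t : R) : 0 <= t -> lebR `]0, t]%classic = t%:E.
Proof.
move=> t0; rewrite [LHS]lebesgue_measure_itv/= lte_fin; case: ltP => t0'; first by rewrite -EFinB subr0.
by congr _%:E; apply/eqP; rewrite eq_le t0' t0.
Qed.

Section exponential_invariant.
Context {R : realType}.
Variables (phi : R -> R) (B L h m : R) (K : nat) (g : probability R R).
(** The speed at which a particle killed at rate [2 * B] travels the mean distance [m]. *)
Let c := 2 * B * m.
Hypotheses (m0 : 0 < m) (gm : exp_tail m g) (L0 : 0 <= L) (B0 : 0 < B).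
Hypotheses (mphi : measurable_fun setT phi) (phi0 : forall x, 0 <= phi x) (phiK : forall x, phi x <= K%:R)
  (phiB : forall x, phi x + phi (- x) = 2 * B) (phi_homo : {homo phi : x y / x <= y})
  (phiL : forall x y, x <= y -> phi y <= phi x + L * (y - x)).
Hypothesis drift_c : h * mean_drift phi g = c.

Let c0 : 0 < c. Proof. by rewrite !mulr_gt0. Qed.

Section with_points.
Context {d : measure_display} {T : measurableType d}.
Variables (P : probability T R) (Np Nm : T -> {measure set (R * R) -> \bar R}) (U0 : T -> R).
Hypothesis prm : PRM_indep P Np Nm U0 g.
Variable G0 : set T.
Hypotheses (mG0 : measurable G0) (PG0 : P G0 = 1%E) (hG0 : forall w, G0 w ->
  [/\ (forall M : nat, counting_on (Np w) (sqbox M%:R)),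
    (forall M : nat, counting_on (Nm w) (sqbox M%:R)) &
    (forall M : nat, simple_upto Np Nm M%:R w)]).

Let mU0 : measurable_fun setT U0. Proof. by case: prm => _ [_ []]. Qed.

Let G := G0 `&` U0 @^-1` `]0, +oo[.

Let mG : measurable G.
Proof. by apply: measurableI => //; rewrite -[X in measurable X]setTI; exact: mU0. Qed.

Let PG : P G = 1%E.
Proof.
rewrite /G setIC probability_setI1//; first by rewrite (PRM_indep_law _ _ _ _ _ prm)// (exp_tail_pos _ _ gm).
by rewrite -[X in measurable X]setTI; exact: mU0.
Qed.

Let path_of w : exists u : R -> R, G w -> [/\ u 0 = U0 w,
  (forall t, 0 <= t -> u @ t^'+ --> u t), (forall t, 0 < t -> cvg (u @ t^'-)) &
  [/\ (forall t, t < 0 -> u t = 0), (forall t, 0 <= t -> 0 <= u t),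
   (forall t, 0 <= t -> (Np w).-integrable (strip 0 t) (jump u phi 1) /\ (Nm w).-integrable (strip 0 t) (jump u phi (-1))) &
   (forall t, 0 <= t -> ((u t)%:E = (u 0)%:E - J (Np w) (Nm w) u phi (strip 0 t) + (c * t)%:E)%E)]].
Proof.
have [Gw|] := pselect (G w); last by exists id.
have [G0w U0w] := Gw; have [h1 h2 h3] := hG0 w G0w.
have u0 : 0 <= U0 w by move: U0w; rewrite /= in_itv/= andbT => /ltW.
have [u hu] := path_exists (Np w) (Nm w) c phi K (U0 w) h1 h2 h3 (ltW c0) u0 phiK mphi.
by exists u.
Qed.

Let up w := projT1 (cid (path_of w)).
Let upP w (Gw : G w) := projT2 (cid (path_of w)) Gw.

(** The zero path off the good event: [solves] asks for right continuity and left limits at every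
    sample point, not only almost surely. *)
Let U (t : R) (w : T) : R := if w \in G then up w t else 0.

Let UG w : G w -> (fun t => U t w) = up w.
Proof. by move=> Gw; apply/funext => t; rewrite /U mem_set. Qed.

Let UN w : ~ G w -> (fun t => U t w) = cst 0.
Proof. by move=> Gw; apply/funext => t; rewrite /U memNset. Qed.

Let V n t := chain Np Nm U0 phi c K G (t / n.+1%:R) n.+1.

Let hG w : G w -> (forall M : nat, counting_on (Np w) (sqbox M%:R)) /\ (forall M : nat, counting_on (Nm w) (sqbox M%:R)).
Proof. by move=> [/hG0[]]. Qed.

Let close t w : 0 < t -> G w -> \forall n \near \oo, V n t w <= U t w <= V n t w + c * (t / n.+1%:R).
Proof.
move=> t0 Gw; have [G0w U0w] := Gw; have [h1 h2 h3] := hG0 w G0w.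
have [e0 _ ll [_ ge intpm eqn]] := upP w Gw.
have u0 : 0 <= U0 w by move: U0w; rewrite /= in_itv/= andbT => /ltW.
rewrite /U mem_set//; apply: (chain_close Np Nm U0 phi L c K G w (up w)) => //.
- by move=> t' /intpm[].
- by move=> t' /intpm[].
Qed.

Let mV n t : 0 < t -> measurable_fun setT (V n t).
Proof.
move=> t0; have e0 : 0 < t / n.+1%:R by rewrite divr_gt0.
have := chain_indep P Np Nm U0 g phi c K G; move=> /(_ prm) => ci.
by case: (ci mG PG hG mphi (t / n.+1%:R) n.+1 e0).
Qed.

Let step_cvg (t : R) : c * (t / n.+1%:R) @[n --> \oo] --> (0 : R).
Proof.
rewrite -[X in _ --> X](mulr0 (c * t)); under eq_fun do rewrite mulrA.
by apply: cvgM; [exact: cvg_cst|exact: cvg_harmonic].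
Qed.

Let Vcvg t w : 0 < t -> G w -> V n t w @[n --> \oo] --> U t w.
Proof.
move=> t0 Gw; have cl := close t w t0 Gw.
have lim1 : (U t w - c * (t / n.+1%:R)) @[n --> \oo] --> U t w.
  by rewrite -[X in _ --> X]subr0; apply: cvgB; [exact: cvg_cst|exact: step_cvg].
have lim2 : (fun=> U t w) @ \oo --> U t w by exact: cvg_cst.
have sq : \forall n \near \oo, U t w - c * (t / n.+1%:R) <= V n t w <= U t w.
  by apply: filterS cl => n /andP[h1 h2]; apply/andP; split => //; rewrite lerBlDr.
exact: (squeeze_cvgr sq lim1 lim2).
Qed.

Let U00 w : U 0 w = U0 w * \1_G w.
Proof.
rewrite /U indicE; have [Gw|Gw] := pselect (G w); last by rewrite !memNset// mulr0.
by rewrite !mem_set// mulr1; have [e0 _ _ _] := upP w Gw; exact: e0.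
Qed.

Let mU t : measurable_fun setT (U t).
Proof.
have [t0|t0|<-] := ltgtP 0 t.
- apply: (measurable_fun_cvg (h := fun n w => V n t w * \1_G w)) => [n|w _].
    by apply: measurable_funM; [exact: mV|exact: measurable_indic].
  have [Gw|Gw] := pselect (G w).
    by rewrite indicE mem_set//; under eq_fun do rewrite mulr1; exact: Vcvg.
  by rewrite indicE memNset// /U memNset//; under eq_fun do rewrite mulr0; exact: cvg_cst.
- rewrite (_ : U t = cst 0); first exact: measurable_cst.
  apply/funext => w; rewrite /U; case: ifPn => // /set_mem Gw.
  by have [_ _ _ [neg _ _ _]] := upP w Gw; exact: neg.
- rewrite (_ : U 0 = fun w => U0 w * \1_G w); last by apply/funext => w; exact: U00.
  by apply: measurable_funM => //; exact: measurable_indic.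
Qed.

Let aeG : {ae P, forall w, G w}.
Proof.
exists (~` G); split; [exact: measurableC|by rewrite probability_setC// PG subee|by []].
Qed.

(** The chain converges to the path from below. If [U t w] exceeds [y] so does the chain eventually,
    and if it does not the chain does not either; the tail events therefore agree eventually, even
    when [U t w] equals [y]. *)
Let Utail t y : 0 <= t -> 0 <= y -> P (U t @^-1` `]y, +oo[) = (expR (- (y / m)))%:E.
Proof.
move=> t0 y0; have mpre (X : T -> R) : measurable_fun setT X -> measurable (X @^-1` `]y, +oo[).
  by move=> mX; rewrite -[X in measurable X]setTI; exact: mX.
move: t0; rewrite le_eqVlt => /orP[/eqP <-|t0].
  rewrite -(gm y y0) -(PRM_indep_law _ _ _ _ _ prm)// -(probability_setI1 P _ _ (mpre _ (mU 0)) mG PG).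
  rewrite -(probability_setI1 P _ _ (mpre _ mU0) mG PG); congr (P _); apply/seteqP.
  by split => w /= [h1 Gw]; split => //; move: h1; rewrite U00 indicE mem_set// mulr1.
have c1 : P (V n t @^-1` `]y, +oo[) @[n --> \oo] --> P (U t @^-1` `]y, +oo[).
  apply: cvg_measure_near => [n||]; [exact/mpre/mV|exact/mpre/mU|].
  apply: filterS aeG => w Gw.
  have [Uy|Uy] := ltP y (U t w).
    have ev : \forall n \near \oo, y < V n t w by exact: cvgr_gt (Vcvg t w t0 Gw) _ Uy.
    apply: filterS ev => n Vy; rewrite /= !in_itv/= !andbT; split => //.
  have := close t w t0 Gw; apply: filterS => n /andP[h1 _]; rewrite /= !in_itv/= !andbT; split.
    by rewrite ltNge (le_trans h1 Uy).
  by rewrite ltNge Uy.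
have cm : c / m = 2 * B by rewrite /c mulfK// gt_eqF.
have c2 := chain_tail_cvg P Np Nm U0 g phi B L c m K G prm mG PG hG m0 gm c0 cm L0 B0 mphi phi0 phiK phiB phi_homo phiL t y t0 y0.
by rewrite -(cvg_lim (@ereal_hausdorff R) c1) (cvg_lim (@ereal_hausdorff R) c2).
Qed.

Let U_ge0 t w : 0 <= t -> 0 <= U t w.
Proof.
by move=> t0; rewrite /U; case: ifPn => // /set_mem Gw; have [_ _ _ [_ ge _ _]] := upP w Gw; exact: ge.
Qed.

Let Ulaw t : 0 <= t -> forall A, measurable A -> P (U t @^-1` A) = g A.
Proof.
move=> t0; pose nu := measure_function_pushforward__canonical__measure_function_Measure P (mU t).
apply: (measure_tail_unique nu g) => [|b].
  by rewrite /nu/= /pushforward preimage_setT probability_setT ltry.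
rewrite /nu/= /pushforward; have [b0|b0] := leP 0 b; first by rewrite Utail// (gm b b0).
have -> : U t @^-1` `]b, +oo[%classic = setT.
  by apply/seteqP; split => // w _ /=; rewrite in_itv/= andbT (lt_le_trans b0)// U_ge0.
rewrite probability_setT; apply/esym/eqP; rewrite eq_le probability_le1//= -(exp_tail_pos _ _ gm) le_measure ?inE//.
by move=> x /=; rewrite !in_itv/= !andbT; exact: lt_trans.
Qed.

Let prmU : PRM_indep P Np Nm (U 0) g.
Proof.
have [mp [mm [_ law]]] := prm; split => //; split => //; split; first exact: mU.
move=> n k A a D b C hA dA hD dD mC; rewrite -(law n k A a D b C hA dA hD dD mC).
have mE : measurable (\bigcap_(i in `I_n) [set w | Np w (A i) = (a i)%:R%:E] `&` \bigcap_(i in `I_k) [set w | Nm w (D i) = (b i)%:R%:E]).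
  by apply: measurableI; apply: measurable_counts => // i ni; [case: (hA i ni)|case: (hD i ni)].
have mpre (X : T -> R) : measurable_fun setT X -> measurable (X @^-1` C).
  by move=> mX; rewrite -[X in measurable X]setTI; exact: mX.
rewrite -(probability_setI1 P _ _ (measurableI _ _ mE (mpre _ (mU 0))) mG PG).
rewrite -(probability_setI1 P _ _ (measurableI _ _ mE (mpre _ mU0)) mG PG); congr (P _); apply/seteqP.
by split => w /= [[h1 h2] Gw]; split => //; split => //; move: h2; rewrite U00 indicE mem_set// mulr1.
Qed.

Let mean_phi o s : 0 <= s -> (\int[P]_w (phi (o * U s w))%:E = \int[g]_x (phi (o * x))%:E)%E.
Proof.
move=> s0; have mo : measurable_fun setT (fun x : R => (phi (o * x))%:E).
  by apply/measurable_EFinP; apply: (measurableT_comp mphi); exact: measurable_funM.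
have po : {in [set: R], forall x, (0 <= (phi (o * x))%:E)%E} by move=> x _; rewrite lee_fin.
have := @ge0_integral_pushforward _ _ T R R _ (mU s) P setT _ measurableT mo po.
rewrite preimage_setT => <-; apply: eq_measure_integral => A mA _.
by rewrite /= /pushforward Ulaw.
Qed.

Let driftE s : 0 <= s -> drift P phi U s = mean_drift phi g.
Proof.
move=> s0; rewrite /drift !big_cons big_nil !mean_phi// /mean_drift addr0 mulN1r mul1r addrC.
congr (fine _ - fine _); apply: eq_integral => x _; first by rewrite mul1r.
by rewrite mulN1r.
Qed.

Let solU : solves P Np Nm U h phi.
Proof.
split; first exact: mU.
split.
  move=> w t t0.
  have tr (v : R -> R) : (fun s => U s w) = v -> v x @[x --> t^'+] --> v t -> (fun s => U s w) @ t^'+ --> U t w.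
    by move=> <-.
  have [Gw|Gw] := pselect (G w); last by apply: (tr _ (UN w Gw)); exact: cvg_cst.
  by apply: (tr _ (UG w Gw)); have [_ right_cont _ _] := upP w Gw; exact: right_cont.
split.
  move=> w t t0; have [Gw|Gw] := pselect (G w); last by rewrite (UN w Gw); exact: is_cvg_cst.
  by rewrite (UG w Gw); have [_ _ ll _] := upP w Gw; exact: ll.
split.
  move=> s o _ _; have fin : (P setT < +oo)%E by rewrite probability_setT ltry.
  apply: measurable_bounded_integrable => //.
    by apply: (measurableT_comp mphi); apply: measurable_funM => //; exact: mU.
  exists K%:R; split; first exact: num_real.
  by move=> M KM w _ /=; rewrite ger0_norm// (le_trans (phiK _))// ltW.
have intD t : 0 <= t -> (\int[leb]_(s in `[0%R, t]) (drift P phi U s)%:E = (mean_drift phi g * t)%:E)%E.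
  move=> t0; rewrite (eq_integral (cst (mean_drift phi g)%:E)); last first.
    by move=> s; rewrite inE/= in_itv/= => /andP[s0 _]; rewrite driftE.
  by rewrite integral_cst// [X in (_ * X)%E](leb_segment t t0) EFinM.
split.
  move=> t t0; apply: (eq_integrable _ (fun=> (mean_drift phi g)%:E)) => //.
    by move=> s; rewrite inE/= in_itv/= => /andP[s0 _]; rewrite driftE.
  apply: measurable_bounded_integrable => //.
    by rewrite [X in (X < _)%E](leb_segment t t0) ltry.
  exists `|mean_drift phi g|; split; first exact: num_real.
  by move=> M hM s _; exact: ltW.
apply: filterS aeG => w Gw t t0.
have [e0 _ _ [_ _ intpm eqn]] := upP w Gw; have [i1 i2] := intpm t t0.
have UE s : U s w = up w s by rewrite /U mem_set.
rewrite (UG w Gw) !UE; split.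
  move=> o [->|->]; rewrite /Nsel ?eqxx; first exact: i1.
  by rewrite (_ : (-1 == 1 :> R) = false)//; apply/eqP => h1; have := ltr01 (R := R); lra.
rewrite intD// -EFinM mulrA drift_c (eqn t t0) !big_cons big_nil adde0 /Nsel eqxx.
rewrite (_ : (-1 == 1 :> R) = false); last by apply/eqP => h1; have := ltr01 (R := R); lra.
by rewrite /J addeC [in LHS]addeC [(\int[Nm w]_(_ in _) _ + _)%E]addeC.
Qed.

Lemma exponential_invariant_of : is_invariant h phi g.
Proof. by exists d, T, P, Np, Nm, U; split; [exact: prmU|exact: solU|exact: Ulaw]. Qed.

End with_points.

Lemma exponential_invariant : is_invariant h phi g.
Proof.
have [mu muE] := @uniform_exists R; have prm := PRM_exists mu muE g.
have [G0 [mG0 PG0 hG0]] := PRM_ae _ _ _ _ _ prm.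
exact: (exponential_invariant_of _ _ _ _ prm G0 mG0 PG0 hG0).
Qed.

End exponential_invariant.

(** * The sigmoid case and its critical value *)

Section sigmoid_rate.
Context {R : realType}.
Variables (h : R) (phi f : R -> R) (B : R).
Hypotheses (h0 : 0 < h) (phi0 : forall x : R, 0 <= phi x) (mphi : measurable_fun setT phi).
Hypotheses (B0 : 0 < B) (phiE : forall x : R, phi x = f x + B).
Hypotheses (fodd : forall x : R, f (- x) = - f x) (f0 : f 0 = 0).
Hypotheses (df : forall x : R, derivable f x 1) (fB : forall x : R, f x <= B).
Hypotheses (f'pos : forall x : R, 0 < derive1 f x)
  (f'dec : forall x y : R, 0 <= x -> x < y -> derive1 f y < derive1 f x).

Let B2 : 0 < 2 * B. Proof. by rewrite mulr_gt0. Qed.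

Let phiN (x : R) : phi x + phi (- x) = 2 * B.
Proof. by rewrite !phiE fodd; ring. Qed.

Let hA : hypA phi.
Proof. by move=> r _; rewrite /Phi phiN. Qed.

(** [Psi] is linear here, so the integrand is a multiple of an exponential density. *)
Let hB : hypB phi.
Proof.
move=> lam lam0; pose m := (lam * (2 * B))^-1; have m0 : 0 < m by rewrite invr_gt0 mulr_gt0.
have psiE (s : R) : 0 <= s -> Psi phi s = (2 * B * s)%:E.
  move=> s0; rewrite /Psi (eq_integral (cst (2 * B)%:E)); last by move=> x _; rewrite /Phi phiN.
  by rewrite integral_cst// [X in (_ * X)%E](leb_segment s s0) EFinM.
have iE : {in `[0, +oo[%classic, forall s : R,
    expeR (- (lam%:E * Psi phi s)) = (m%:E * (exponential_pdf m^-1 s)%:E)%E}.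
  move=> s; rewrite inE/= in_itv/= andbT => s0.
  have -> : exponential_pdf m^-1 s = m^-1 * expR (- m^-1 * s) by exact: exponential_pdfE.
  rewrite psiE// -!EFinM -EFinN /=; congr _%:E; rewrite [RHS]mulrA mulfV ?gt_eqF// mul1r.
  by congr expR; rewrite /m invrK; ring.
apply: (@le_lt_trans _ _ (\int[leb]_(s in `[0%R, +oo[) (m%:E * (exponential_pdf m^-1 s)%:E))%E).
  by rewrite le_eqVlt; apply/orP; left; apply/eqP; apply: eq_integral => s ss; exact: iE.
rewrite ge0_integralZl//.
- rewrite -integral_itv_obnd_cbnd; last first.
    by apply/measurable_EFinP; apply: measurable_funTS; exact: measurable_exponential_pdf.
  by rewrite (exponential_pdf_tail m 0 m0 (lexx _)) -EFinM ltry.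
- by apply/measurable_EFinP; apply: measurable_funTS; exact: measurable_exponential_pdf.
- by move=> s _; rewrite lee_fin exponential_pdf_ge0// invr_ge0 ltW.
- by rewrite lee_fin ltW.
Qed.

(** The total rate is the constant [2 * B]. Shifting the positive half-line, which has full mass, by
    [b] takes time [b] divided by the speed, and the survival probability over that time is the
    tail. *)
Let law_pos (g : probability R R) : is_invariant h phi g -> 0 < mean_drift phi g ->
  exp_tail (h * mean_drift phi g / (2 * B)) g.
Proof.
move=> inv md b b0; have [_ _ _ shift] := invariant_facts h phi g phi0 mphi inv.
have [_ [g1 _]] := mean_drift_pos h phi h0 phi0 mphi g hB inv md.
have c0 : 0 < h * mean_drift phi g by rewrite mulr_gt0.
have bc : 0 <= b / (h * mean_drift phi g) by rewrite divr_ge0// ltW.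
have cond (x s : R) : `]0, +oo[%classic x -> 0 <= s -> s <= b / (h * mean_drift phi g) ->
    x + h * mean_drift phi g * s != 0.
  rewrite /= in_itv/= andbT => x0 s0 _; rewrite gt_eqF// ltr_pwDl// mulr_ge0// ltW//.
have := shift `]0, +oo[%classic _ bc (measurable_itv _) cond.
rewrite (_ : [set y | _] = `]b, +oo[%classic); last first.
  by apply/funext => y /=; rewrite !in_itv/= !andbT subr_gt0 mulrCA mulfV ?mulr1// gt_eqF.
move=> ->; rewrite (eq_integral (cst (expR (- (b / (h * mean_drift phi g / (2 * B)))))%:E)); last first.
  move=> x _; rewrite /rate (eq_integral (cst (2 * B)%:E)); last by move=> s _; rewrite /Phi phiN.
  rewrite integral_cst// [X in (_ * X)%E](leb_segment_oc _ bc) -EFinM -EFinN /=.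
  by congr (expR (- _))%:E; rewrite invf_div; ring.
rewrite integral_cst//.
by rewrite [X in (_ * X)%E]g1 mule1.
Qed.

(** The constant [B] cancels in [phi x - phi (- x)], and oddness leaves [2 * f x]. *)
Let mean_drift_response (m : R) (g nu : probability R R) : 0 < m -> exp_tail m g -> exp_tail 1 nu ->
  mean_drift phi g = 2 * response_mean f nu m.
Proof.
move=> m0 gm nu1.
have mfm : measurable_fun setT (fun y : R => f (m * y)).
  by apply: (measurableT_comp (measurable_response f df)); exact: measurable_funM.
have mpm (o : R) : measurable_fun setT (fun y : R => phi (o * y)).
  by apply: (measurableT_comp mphi); exact: measurable_funM.
have fin : (nu setT < +oo)%E by rewrite probability_setT ltry.
have iB (F : R -> R) : measurable_fun setT F -> (forall x, `|F x| <= 2 * B) -> nu.-integrable setT (EFin \o F).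
  move=> mF bF; apply: measurable_bounded_integrable => //.
  exists (2 * B); split; first exact: num_real.
  by move=> M hM w _ /=; rewrite (le_trans (bF w))// ltW.
have phi_le (x : R) : `|phi x| <= 2 * B.
  by rewrite ger0_norm// phiE; have := fB x; lra.
have if_ : nu.-integrable setT (EFin \o (fun y : R => f (m * y))).
  have B_le : B <= 2 * B by rewrite mulr_natl mulr2n lerDl ltW.
  by apply: iB => // x; exact: (le_trans (response_bound f B fodd fB _) B_le).
rewrite /mean_drift (exp_tail_integral m g nu (fun x => (phi x)%:E) m0 gm nu1)//; last first.
  exact/measurable_EFinP.
have mphiN : measurable_fun setT (fun x : R => (phi (- x))%:E).
  by apply/measurable_EFinP; apply: (measurableT_comp mphi); exact: oppr_measurable.
have phiN0 (x : R) : (0 <= (phi (- x))%:E)%E by rewrite lee_fin.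
rewrite (exp_tail_integral m g nu (fun x => (phi (- x))%:E) m0 gm nu1 mphiN phiN0).
have mN : measurable_fun setT (fun y : R => phi (- (m * y))).
  by under eq_fun do rewrite -mulNr; exact: mpm.
rewrite -[LHS](RintegralB measurableT (iB _ (mpm m) (fun x => phi_le _)) (iB _ mN (fun x => phi_le _))).
rewrite /response_mean -(RintegralZl 2 measurableT if_); apply: eq_Rintegral => y _.
by rewrite !phiE fodd; ring.
Qed.

(** The mean [m] is the speed over [2 * B], and the speed is [h] times the drift
    [2 * response_mean f nu m]; eliminating the drift leaves an equation for [m] alone. *)
Let drift_fixed (g nu : probability R R) : exp_tail 1 nu -> is_invariant h phi g -> 0 < mean_drift phi g ->
  exists2 m : R, 0 < m & exp_tail m g /\ response_mean f nu m = B / h * m.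
Proof.
move=> nu1 inv md; have m0 : 0 < h * mean_drift phi g / (2 * B) by rewrite divr_gt0// mulr_gt0.
have gm := law_pos g inv md; exists (h * mean_drift phi g / (2 * B)) => //; split => //.
have := mean_drift_response _ g nu m0 gm nu1; set rm := response_mean _ _ _ => E.
by rewrite E; field; rewrite !gt_eqF.
Qed.

(** A positive solution [m] satisfies [B / h * m = response_mean f nu m < derive1 f 0 * m], the
    strict inequality coming from concavity. *)
Lemma subcritical_drift (g : probability R R) : is_invariant h phi g -> 0 < mean_drift phi g ->
  B / derive1 f 0 < h.
Proof.
have [nu nu1] := exp_tail_exists (1 : R) ltr01.
move=> inv md; have [m m0 [gm E]] := drift_fixed g nu nu1 inv md.
have := response_mean_lt f B fodd f0 df fB f'dec nu nu1 m m0.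
by rewrite E ltr_pM2r// ltr_pdivrMr// ltr_pdivrMr// mulrC.
Qed.

Lemma subcritical_unique : h <= B / derive1 f 0 ->
  forall g : probability R R, is_invariant h phi g -> eqm g delta0.
Proof.
move=> hc g inv; have [md|md|md] := ltgtP (mean_drift phi g) 0.
- have [g' gE] := reflect_probability g.
  have inv' := reflected_invariant h phi g g' gE inv.
  have md' : 0 < mean_drift phi g' by rewrite (mean_drift_reflect phi phi0 mphi g g' gE) oppr_gt0.
  by have := lt_le_trans (subcritical_drift g' inv' md') hc; rewrite ltxx.
- by have := lt_le_trans (subcritical_drift g inv md) hc; rewrite ltxx.
- exact: (mean_drift0 h phi phi0 mphi g hA inv md).
Qed.

(** The positive law is exponential with mean the fixed point of the response; its speed
    [h * mean_drift phi gp] then equals [2 * B * m], as the construction of the path requires. The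
    negative law is its reflection. *)
Lemma supercritical_invariant : B / derive1 f 0 < h ->
  exists gp gm : probability R R,
    [/\ is_invariant h phi gp /\ ~ eqm gp delta0 /\ supp_pos gp,
        is_invariant h phi gm /\ ~ eqm gm delta0 /\ supp_neg gm &
        forall g : probability R R, is_invariant h phi g ->
          eqm g delta0 \/ eqm g gp \/ eqm g gm].
Proof.
move=> hc; have [nu nu1] := exp_tail_exists (1 : R) ltr01.
have k0 : 0 < B / h by rewrite divr_gt0.
have k1 : B / h < derive1 f 0 by move: hc; rewrite !ltr_pdivrMr// mulrC.
have [m m0 mE] := response_fixpoint f B fodd f0 df fB f'pos f'dec nu nu1 _ k0 k1.
have [gp gpm] := exp_tail_exists m m0.
have dE := mean_drift_response m gp nu m0 gpm nu1.
have dp : 0 < mean_drift phi gp by rewrite dE mE mulr_gt0// mulr_gt0.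
have invp : is_invariant h phi gp.
  have f_homo (x y : R) : x <= y -> f x <= f y.
    rewrite le_eqVlt => /orP[/eqP ->//|xy].
    have [||z _ E] := @MVT R f (derive1 f) x y xy.
    - by move=> z _; rewrite derive1E; exact/derivableP.
    - by apply: derivable_within_continuous => z _; exact: df.
    by rewrite -subr_ge0 E mulr_ge0// ?subr_ge0 ltW.
  apply: (exponential_invariant phi B (derive1 f 0) h m (Num.bound (2 * B)) gp) => //.
  - exact: ltW.
  - move=> x; apply/ltW; apply: (le_lt_trans _ (archi_boundP (ltW B2))).
    by rewrite phiE; have := fB x; lra.
  - by move=> x y xy; rewrite !phiE lerD2r f_homo.
  - move=> x y xy; rewrite !phiE.
    have := response_lip f fodd f0 df f'pos f'dec y x.
    rewrite [`|y - x|]ger0_norm ?subr_ge0// => /(le_trans (ler_norm _)).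
    by move=> H; rewrite addrAC lerD2r -lerBlDl.
  - by rewrite dE mE; field; rewrite gt_eqF.
have [gm gmE] := reflect_probability gp.
have invm := reflected_invariant h phi gp gm gmE invp.
have [supp _] := mean_drift_pos h phi h0 phi0 mphi gp hB invp dp.
have pre1 : [eta -%R] @^-1` `]-oo, (0 : R)[%classic = `]0, +oo[%classic.
  by apply/funext => y /=; rewrite !in_itv/= andbT oppr_lt0.
have pre2 : [eta -%R] @^-1` `](0 : R), +oo[%classic = `]-oo, 0[%classic.
  by apply/funext => y /=; rewrite !in_itv/= andbT oppr_gt0.
have one := exp_tail_pos _ _ gpm.
have d0 (A : set R) : ~ A 0 -> delta0 A = 0%E by move=> A0; rewrite /delta0 diracE memNset.
exists gp, gm; split.
- split => //; split => // /(_ `]0, +oo[%classic (measurable_itv _)).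
  by rewrite one d0; [move=> /eqP; rewrite eqe oner_eq0|rewrite /= in_itv/= ltxx].
- split => //; split; last by rewrite /supp_neg gmE pre2.
  move=> /(_ `]-oo, 0[%classic (measurable_itv _)).
  by rewrite gmE pre1 one d0; [move=> /eqP; rewrite eqe oner_eq0|rewrite /= in_itv/= ltxx].
(* Two different fixed points would have the same ratio [response_mean m / m], which is strictly
   decreasing in [m]. *)
have uniq_pos (g : probability R R) : is_invariant h phi g -> 0 < mean_drift phi g -> eqm g gp.
  move=> inv md; have [m' m'0 [gm' E']] := drift_fixed g nu nu1 inv md.
  have ratio := response_mean_ratio f B fodd f0 df fB f'dec nu nu1.
  have [lt|lt|eqmm] := ltgtP m m'.
  - by have := ratio m m' m0 lt; rewrite mE E' mulrCA [m' * _]mulrCA [m' * m]mulrC ltxx.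
  - by have := ratio m' m m'0 lt; rewrite mE E' mulrCA [m * _]mulrCA [m' * m]mulrC ltxx.
  - by move: gm'; rewrite -eqmm => gm' A mA; exact: (exp_tail_unique m g gp gm' gpm A mA).
move=> g inv; have [md|md|md] := ltgtP (mean_drift phi g) 0.
- have [g' gE] := reflect_probability g.
  have inv' := reflected_invariant h phi g g' gE inv.
  have md' : 0 < mean_drift phi g' by rewrite (mean_drift_reflect phi phi0 mphi g g' gE) oppr_gt0.
  right; right => A mA; rewrite gmE.
  have mNA : measurable ([eta -%R] @^-1` A : set R).
    by rewrite -[X in measurable X]setTI; exact: (@oppr_measurable R setT measurableT A mA).
  rewrite -(uniq_pos g' inv' md' _ mNA) gE; congr (g _).
  by apply/funext => y /=; rewrite opprK.
- by right; left; exact: uniq_pos.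
- by left; exact: (mean_drift0 h phi phi0 mphi g hA inv md).
Qed.

End sigmoid_rate.

Theorem theorem4 (R : realType) (h : R) (phi : R -> R) :
  0 < h -> (forall x, 0 <= phi x) -> measurable_fun setT phi ->
  (* 1. *)
  (hypA phi -> is_invariant h phi delta0) /\
  (* 2. *)
  (hypA phi -> hypB phi -> forall g : probability R R,
     is_invariant h phi g -> ~ eqm g delta0 -> supp_pos g \/ supp_neg g) /\
  (* 3. *)
  (hypA phi -> hypB phi -> forall g : probability R R,
     is_invariant h phi g -> ~ eqm g delta0 -> supp_pos g ->
     exists gam : R, [/\ 0 < gam,
       forall A, measurable A ->
         g A = (\int[leb]_(x in A `&` `[0%R, +oo[) ggam h phi gam x)%E,
       (\int[leb]_(x in `[0%R, +oo[) ((phi x - phi (- x))%:E * ggam h phi gam x))%E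
         = gam%:E &
       (\int[leb]_(x in `[0%R, +oo[) ggam h phi gam x)%E = 1%E]) /\
  (* 4. *)
  (hypA phi -> hypB phi -> forall (gd : R -> R) (g gt : probability R R),
     (forall A, measurable A -> g A = (\int[leb]_(x in A) (gd x)%:E)%E) ->
     (forall A, measurable A -> gt A = (\int[leb]_(x in A) (gd (- x))%:E)%E) ->
     ((is_invariant h phi g /\ supp_pos g) <-> (is_invariant h phi gt /\ supp_neg gt))) /\
  (* 5. *)
  (forall (f : R -> R) (B : R),
     0 < B -> (forall x, phi x = f x + B) ->
     (forall x, f (- x) = - f x) -> f 0 = 0 ->
     (forall x, derivable f x 1) -> continuous (derive1 f) ->
     (forall x, f x <= B) -> (forall x, 0 < derive1 f x) ->
     (forall x y, 0 <= x -> x < y -> derive1 f y < derive1 f x) ->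
     (h <= B / derive1 f 0 ->
        is_invariant h phi delta0 /\
        forall g : probability R R, is_invariant h phi g -> eqm g delta0) /\
     (B / derive1 f 0 < h ->
        is_invariant h phi delta0 /\
        exists gp gm : probability R R,
          [/\ is_invariant h phi gp /\ ~ eqm gp delta0 /\ supp_pos gp,
              is_invariant h phi gm /\ ~ eqm gm delta0 /\ supp_neg gm &
              forall g : probability R R, is_invariant h phi g ->
                eqm g delta0 \/ eqm g gp \/ eqm g gm])).
Proof.
move=> h0 phi0 mphi; split; first by move=> _; exact: dirac0_invariant.
split; first by move=> hA hB g; exact: (invariant_support h phi h0 phi0 mphi hA hB g).
split; first by move=> hA hB g; exact: (invariant_density h phi h0 phi0 mphi hA hB g).
split; first by move=> _ _ gd g gt; exact: (reflect_density_invariant h phi gd g gt).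
move=> f B B0 phiE fodd f0 df _ fB f'pos f'dec; split => hc; split; try exact: dirac0_invariant.
  exact: (subcritical_unique h phi f B).
exact: (supercritical_invariant h phi f B).
Qed.
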